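(* Let $0<\theta<\pi$ and $\Lambda=\{re^{i\varphi}: r\ge 0,\ \theta\le\varphi\le 2\pi-\theta\}$. Let $m\ge 0$, $0\le\delta<\rho\le 1$, and let $a\in S^m_{\rho,\delta}$ (possibly matrix-valued) be $\Lambda$-hypoelliptic (see context). Let $E$ be a Banach space of tempered distributions on $\mathbb{R}^n$ which contains the Schwartz space $\mathcal{S}$ as a dense subspace and for which the mapping $\operatorname{op}:S^0_{\rho,\delta}\to\mathcal{L}(E)$ is (well-defined and) continuous. Let $A$ be the closed extension in $E$ of $\operatorname{op}a:\mathcal{S}\to\mathcal{S}$, and assume that (1) $\Lambda$ is contained in the resolvent set of $A$; (2) $\|\langle\lambda\rangle(A-\lambda)^{-1}\|_{\mathcal{L}(E)}$ is uniformly bounded in $\lambda\in\Lambda$. For $f\in H$ let $$f(A)=\frac{i}{2\pi}\int_{\partial\Lambda}f(\lambda)(A-\lambda)^{-1}\,d\lambda\in\mathcal{L}(E).$$ Then there is a constant $M$, independent of $f$, such that $$\|f(A)\|_{\mathcal{L}(E)}\le M\,\|f\|_\infty\qquad\text{for all }f\in H.$$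
   Context: Notation: $\langle\xi\rangle=(1+|\xi|^2)^{1/2}$, and likewise $\langle\lambda\rangle=(1+|\lambda|^2)^{1/2}$ for $\lambda\in\mathbb{C}$. $\mathcal{L}(E)$ is the space of bounded linear operators on $E$. Symbol classes: for $0\le\delta\le\rho\le1$, $\delta<1$, $S^m_{\rho,\delta}$ is the Fréchet space of smooth (possibly matrix-valued) functions $a$ on $\mathbb{R}^n\times\mathbb{R}^n$ for which all seminorms $q_{\alpha,\beta}(a)=\sup_{x,\xi}|D^\alpha_\xi D^\beta_x a(x,\xi)|\,\langle\xi\rangle^{-m+\rho|\alpha|-\delta|\beta|}$, $\alpha,\beta\in\mathbb{N}_0^n$, are finite. The operator $\operatorname{op} a$ is the (left-quantized) pseudodifferential operator on $\mathbb{R}^n$ with symbol $a$, acting on $\mathcal{S}$ and on tempered distributions. If $a$ is matrix-valued, $\mathcal{S}$ and $E$ consist of correspondingly vector-valued functions and distributions. $\Lambda$-hypoellipticity of $a\in S^m_{\rho,\delta}$: there exist constants $c,C>0$ such that for all $x,\xi\in\mathbb{R}^n$ with $|\xi|\ge C$ the spectrum of $a(x,\xi)$ lies outside $\Lambda\cup\{|\lambda|\le c\}$ and, for all multi-indices $\alpha,\beta$, there is a constant $c_{\alpha\beta}$ with $$|\partial^\alpha_\xi\partial^\beta_x a(x,\xi)|\,|(a(x,\xi)-\lambda)^{-1}|\le c_{\alpha\beta}\langle\xi\rangle^{-\rho|\alpha|+\delta|\beta|}\qquad\text{for all }\lambda\in\Lambda,\ x\in\mathbb{R}^n,\ |\xi|\ge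 C.$$ The closed extension $A$: the operator $\operatorname{op}a$, regarded as an unbounded operator in $E$ with domain $\mathcal{S}$, is closable, and $A$ denotes its closure. Function spaces: $H_\infty$ is the space of bounded holomorphic functions $f:\mathbb{C}\setminus\Lambda\to\mathbb{C}$ with the supremum norm $\|f\|_\infty$; $H$ is the subspace of those $f$ for which there are $c,d>0$ (depending on $f$) with $|f(z)|\le c(|z|^d+|z|^{-d})^{-1}$. Each $f\in H_\infty$ has non-tangential boundary values on $\partial\Lambda$ in $L^\infty$, which are used in the integral. The contour $\partial\Lambda$ runs from $\infty e^{i\theta}$ to $0$ and then to $\infty e^{-i\theta}$. The integral defining $f(A)$ converges in $\mathcal{L}(E)$. *)

(* Defs.v *)
From HB Require Import structures.
From mathcomp Require Import all_boot all_order all_algebra.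
From mathcomp Require Import complex.
From mathcomp Require Import all_classical all_reals all_analysis.
Set Implicit Arguments.
Unset Strict Implicit.
Unset Printing Implicit Defensive.
Import Order.TTheory GRing.Theory Num.Theory.
Import numFieldNormedType.Exports.
Local Open Scope classical_set_scope.
Local Open Scope complex_scope.
Local Open Scope ring_scope.

(* The numFieldType R[i] as a normed space over itself; the library declares
   this instance only for abstract numeric fields and for K^o. *)
HB.instance Definition _ (R : realType) := NormedModule.copy R[i] R[i]^o.

(* The norm of a complex normed space is valued in R[i] in the library;
   [rnorm] is the same norm valued in R. On matrices it is the maximum of the
   moduli of the entries. *)
Definition rnorm (R : realType) (V : normedModType R[i]) (v : V) : R :=
  complex.Re `|v|.

Definition expi (R : realType) (t : R) : R[i] := cos t +i* sin t.

Definition japC (R : realType) (l : R[i]) : R := Num.sqrt (1 + rnorm l ^+ 2).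

Definition sector (R : realType) (theta : R) : set R[i] :=
  [set z | exists r phi : R,
    [/\ 0 <= r, theta <= phi <= 2 * pi - theta & z = r%:C * expi phi]].

Section euclidean.
Variables (R : realType) (n : nat).
Implicit Types x xi : 'rV[R]_n.

Definition dot x xi : R := \sum_i x 0 i * xi 0 i.

(* The library norm on row vectors is the maximum norm. *)
Definition enorm x : R := Num.sqrt (dot x x).

Definition jap x : R := Num.sqrt (1 + enorm x ^+ 2).

Definition multi_index := {ffun 'I_n -> nat}.

Definition mabs (alpha : multi_index) : nat := (\sum_i alpha i)%N.

End euclidean.

(* R[i] is not a normed space over R in the library, so functions of real
   variables with complex matrix values are differentiated entrywise through
   their real and imaginary parts. *)
Section smooth.
Variables (R : realType) (V : normedModType R) (p q : nat).
Implicit Types F : V -> 'M[R[i]]_(p, q).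

Definition reE F i j (x : V) : R := complex.Re (F x i j).
Definition imE F i j (x : V) : R := complex.Im (F x i j).

Definition derivableC F x v : Prop :=
  forall i j, derivable (reE F i j) x v /\ derivable (imE F i j) x v.

Definition derC (v : V) F : V -> 'M[R[i]]_(p, q) :=
  fun x => \matrix_(i, j) ('D_v (reE F i j) x +i* 'D_v (imE F i j) x).

Definition smooth F : Prop := forall vs : seq V,
  continuous (foldr derC F vs) /\
  forall x v, derivableC (foldr derC F vs) x v.

Definition pderiv n (e : 'I_n -> V) (alpha : multi_index n) F :
    V -> 'M[R[i]]_(p, q) :=
  foldr (fun i G => iter (alpha i) (derC (e i)) G) F (enum 'I_n).

End smooth.

Section integration.
Variable R : realType.
Local Notation mu := (@lebesgue_measure R).

Definition cintegral (g : R -> R[i]) : R[i] :=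
  (\int[mu]_t complex.Re (g t)) +i* (\int[mu]_t complex.Im (g t)).

(* Iterated Lebesgue integral. It is only applied to continuous integrands that
   decrease rapidly, for which it is the Lebesgue integral by Fubini. *)
Fixpoint integralRn (n : nat) : ('rV[R]_n -> R[i]) -> R[i] :=
  match n with
  | 0 => fun g => g 0
  | n'.+1 => fun g => cintegral (fun t =>
      integralRn (fun y : 'rV[R]_n' => g (row_mx (t%:M : 'rV[R]_1) y)))
  end.

Definition integralMx n p q (F : 'rV[R]_n -> 'M[R[i]]_(p, q)) :
  'M[R[i]]_(p, q) := \matrix_(i, j) integralRn (fun x => F x i j).

End integration.

Section pseudodifferential.
Variables (R : realType) (n k : nat).

Definition vfun := 'rV[R]_n -> 'cV[R[i]]_k.
(* The first component of the argument is x, the second one is xi. *)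
Definition symbol := 'rV[R]_n * 'rV[R]_n -> 'M[R[i]]_k.

Implicit Types (phi psi : vfun) (a b : symbol) (alpha beta : multi_index n).

Definition dirx (i : 'I_n) : 'rV[R]_n * 'rV[R]_n := (delta_mx 0 i, 0).
Definition dirxi (i : 'I_n) : 'rV[R]_n * 'rV[R]_n := (0, delta_mx 0 i).

Definition dsym alpha beta a : symbol :=
  pderiv dirxi alpha (pderiv dirx beta a).

Definition symbol_seminorm (m rho delta : R) alpha beta a : \bar R :=
  ereal_sup [set (rnorm (dsym alpha beta a z) *
    jap z.2 `^ (- m + rho * (mabs alpha)%:R - delta * (mabs beta)%:R))%:E
    | z in [set: 'rV[R]_n * 'rV[R]_n]].

Definition symbol_class (m rho delta : R) : set symbol :=
  [set a | smooth a /\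
    forall alpha beta, (symbol_seminorm m rho delta alpha beta a < +oo)%E].

Definition hypoelliptic (Lambda : set R[i]) (rho delta : R) a : Prop :=
  exists c C : R, [/\ 0 < c, 0 < C,
    forall x xi, C <= enorm xi -> forall l, eigenvalue (a (x, xi)) l ->
      ~ Lambda l /\ c < rnorm l
  & forall alpha beta, exists cab : R,
      forall l x xi, Lambda l -> C <= enorm xi ->
      rnorm (dsym alpha beta a (x, xi)) * rnorm (invmx (a (x, xi) - l%:M))
      <= cab * jap xi `^ (- rho * (mabs alpha)%:R + delta * (mabs beta)%:R)].

Definition schwartz_seminorm (N : nat) alpha phi : \bar R :=
  ereal_sup [set (jap x ^+ N * rnorm
    (pderiv (fun i => delta_mx 0 i) alpha phi x))%:E | x in [set: 'rV[R]_n]].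

Definition schwartz : set vfun :=
  [set phi | smooth phi /\
    forall N alpha, (schwartz_seminorm N alpha phi < +oo)%E].

Definition fourier phi : vfun :=
  fun xi => integralMx (fun y => expi (- dot y xi) *: phi y).

Definition op a phi : vfun := fun x =>
  ((2 * pi) ^- n)%:C *:
  integralMx (fun xi => expi (dot x xi) *: (a (x, xi) *m fourier phi xi)).

(* The transpose of [op a] for the pairing [pairing]. *)
Definition opT a phi : vfun := fun y =>
  ((2 * pi) ^- n)%:C *: integralMx (fun xi => expi (- dot y xi) *:
    integralMx (fun x => expi (dot x xi) *: ((a (x, xi))^T *m phi x))).

Definition pairing phi psi : R[i] :=
  integralRn (fun x => \sum_j phi x j 0 * psi x j 0).

(* Distributions are total functions of which only the values on Schwartz
   functions matter. *)
Definition distr := vfun -> R[i].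

Definition tempered (u : distr) : Prop :=
  (forall c phi psi, schwartz phi -> schwartz psi ->
    u (fun x => c *: phi x + psi x) = c * u phi + u psi) /\
  (forall phi, schwartz phi -> forall e : R, 0 < e ->
    exists N (d : R), 0 < d /\ forall psi, schwartz psi ->
      (forall alpha, (mabs alpha <= N)%N ->
        (schwartz_seminorm N alpha (fun x => psi x - phi x)%R
          <= d%:E)%E) ->
      rnorm (u psi - u phi) <= e).

Section spaces.
Variable E : normedModType R[i].
Implicit Types T : E -> E.

Definition bounded_op T : Prop :=
  linear T /\ exists K : R, forall u, rnorm (T u) <= K * rnorm u.

Definition opnorm T : R := sup [set rnorm (T u) | u in [set u | rnorm u <= 1]].

Variable iota : E -> distr.

(* [iota] identifies E with a vector space of tempered distributions. *)
Definition tempered_embedding : Prop :=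
  [/\ forall u, tempered (iota u),
      forall c u v phi, schwartz phi ->
        iota (c *: u + v) phi = c * iota u phi + iota v phi
    & forall u v, (forall phi, schwartz phi -> iota u phi = iota v phi) ->
        u = v].

Definition represents (u : E) phi : Prop :=
  forall psi, schwartz psi -> iota u psi = pairing phi psi.

Definition contains_schwartz_densely : Prop :=
  (forall phi, schwartz phi -> exists u, represents u phi) /\
  dense [set u | exists2 phi, schwartz phi & represents u phi].

(* T is the restriction to E of [op a] acting on tempered distributions. *)
Definition op_on a T : Prop :=
  bounded_op T /\
  forall u phi, schwartz phi -> iota (T u) phi = iota u (opT a phi).

(* Continuity refers to the topology defined by the seminorms of
   S^0_(rho,delta) and to the operator norm. *)
Definition op_continuous (rho delta : R) : Prop :=
  (forall a, symbol_class 0 rho delta a -> exists T, op_on a T) /\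
  (forall a, symbol_class 0 rho delta a -> forall e : R, 0 < e ->
    exists N (d : R), 0 < d /\ forall b, symbol_class 0 rho delta b ->
      (forall alpha beta, (mabs alpha + mabs beta <= N)%N ->
        (symbol_seminorm 0 rho delta alpha beta (fun z => b z - a z)%R
          <= d%:E)%E) ->
      forall Ta Tb, op_on a Ta -> op_on b Tb ->
        opnorm (fun u => Tb u - Ta u) <= e).

(* The unbounded operator [A] with domain [D] is the closure of [op a] with
   domain the Schwartz space. *)
Definition closed_extension a (D : set E) (A : E -> E) : Prop :=
  [set w : E * E | D w.1 /\ w.2 = A w.1] =
  closure [set w : E * E | exists2 phi, schwartz phi &
    represents w.1 phi /\ represents w.2 (op a phi)].

End spaces.
End pseudodifferential.

Section functional_calculus.
Variables (R : realType) (E : normedModType R[i]).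
Local Notation mu := (@lebesgue_measure R).
Implicit Types (D : set E) (A T : E -> E) (l : R[i]) (f fb : R[i] -> R[i]).

Definition is_resolvent D A l T : Prop :=
  [/\ bounded_op T,
      forall v, D (T v) /\ A (T v) - l *: T v = v
    & forall u, D u -> T (A u - l *: u) = u].

Definition resolvent_set D A : set R[i] :=
  [set l | exists T, is_resolvent D A l T].

Definition resolvent D A l : E -> E := xget (fun=> 0) (is_resolvent D A l).

(* Bochner integral, over a set of real numbers, of functions with values in
   the bounded operators on E. The list [s] stands for the simple function
   which is the sum of the 1_B T, with (B, T) in [s]. *)
Definition simple_op (s : seq (set R * (E -> E))) : Prop :=
  forall i, (i < size s)%N -> let BT := nth (set0, fun=> 0) s i in
  [/\ measurable BT.1, (mu BT.1 < +oo)%E & bounded_op BT.2].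

Definition simple_val (s : seq (set R * (E -> E))) (t : R) : E -> E :=
  fun u => \sum_(BT <- s) (\1_(BT.1) t)%:C *: BT.2 u.

Definition simple_integral (X : set R) (s : seq (set R * (E -> E))) : E -> E :=
  fun u => \sum_(BT <- s) (fine (mu (BT.1 `&` X)))%:C *: BT.2 u.

Definition is_bochner_integral (X : set R) (h : R -> E -> E) (I : E -> E) :
    Prop :=
  [/\ bounded_op I, forall t, X t -> bounded_op (h t)
    & exists s : nat -> seq (set R * (E -> E)),
      let err j t := opnorm (fun u => h t u - simple_val (s j) t u) in
      [/\ forall j, simple_op (s j),
          forall j, measurable_fun X (err j),
          (\int[mu]_(t in X) (err j t)%:E)%E @[j --> \oo] --> 0%E
        & opnorm (fun u => I u - simple_integral X (s j) u) @[j --> \oo]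
            --> (0 : R)]].

Definition halfline : set R := `]0, +oo[.

Variable theta : R.
Local Notation Lambda := (sector theta).

Definition holomorphic_off f : Prop := forall z, ~ Lambda z -> derivable f z 1.

Definition supnorm f : R := sup [set rnorm (f z) | z in ~` Lambda].

Definition Hinfty : set (R[i] -> R[i]) :=
  [set f | holomorphic_off f /\
    exists K : R, forall z, ~ Lambda z -> rnorm (f z) <= K].

Definition Hdecay : set (R[i] -> R[i]) :=
  [set f | Hinfty f /\ exists c d : R, [/\ 0 < c, 0 < d &
    forall z, ~ Lambda z ->
      rnorm (f z) <= c * (rnorm z `^ d + rnorm z `^ (- d))^-1]].

(* The point of the boundary of Lambda with modulus r and argument s, where
   s is theta or - theta. *)
Definition ray (s r : R) : R[i] := r%:C * expi s.

(* Non-tangential approach region: |z - z0| is at most kappa times the distance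
   of z to Lambda. *)
Definition stolz (kappa : R) (z0 : R[i]) : set R[i] :=
  [set z | ~ Lambda z /\
    forall w, Lambda w -> rnorm (z - z0) <= kappa * rnorm (z - w)].

Definition boundary_values f fb : Prop :=
  forall s, s = theta \/ s = - theta ->
  [/\ measurable_fun halfline (fun r => complex.Re (fb (ray s r))),
      measurable_fun halfline (fun r => complex.Im (fb (ray s r)))
    & {ae mu, forall r, 0 < r -> forall kappa,
        f @ within (stolz kappa (ray s r)) (nbhs (ray s r))
          --> fb (ray s r)}].

Definition is_ray_integral D A fb (s : R) : (E -> E) -> Prop :=
  is_bochner_integral halfline
    (fun r u => (fb (ray s r) * expi s) *: resolvent D A (ray s r) u).

(* T = (i / 2 pi) times the integral of fb(l) (A - l)^-1 over the boundary of
   Lambda, which is run along the ray of argument theta towards 0 and then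
   along the ray of argument - theta away from 0. *)
Definition is_functional_calculus D A fb T : Prop :=
  exists Ip Im : E -> E,
    [/\ is_ray_integral D A fb theta Ip, is_ray_integral D A fb (- theta) Im
      & T = fun u => ('i / (2 * pi)%:C) *: (Im u - Ip u)].

End functional_calculus.

(* Main.v *)
(* Let [b = (a - l)^-1] for large [l] on the contour. Then [op b] differs from the
   resolvent of [A] by [op r] composed with the resolvent, where [r] is of size
   [|l|^-e] in S^0: this part of the contour integral converges absolutely with
   [|f| <= ||f||_oo], and the bounded part of the contour is harmless. What remains
   is [op] of the integral of [f b], a symbol to be bounded in S^0 by [||f||_oo].
   Its derivatives decay fast enough along both rays; for the symbol itself one
   compares [b] with [-1/l], and the leftover integral of [f(l)/l] over both rays is
   bounded by Cauchy's theorem, in the form of a primitive of [f(z)/z] in polar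
   coordinates. The integrals are treated through Riemann sums whose values are
   increments of that primitive, so that sums over both rays telescope and only
   finite combinations of operators are ever quantized. *)
Require Import Defs.
From mathcomp Require Import all_boot all_order all_algebra.
From mathcomp Require Import complex ring lra.
From mathcomp Require Import all_classical all_reals all_analysis measurable_realfun.
Set Implicit Arguments.
Unset Strict Implicit.
Unset Printing Implicit Defensive.
Import Order.TTheory GRing.Theory Num.Theory.
Import numFieldNormedType.Exports.
Local Open Scope classical_set_scope.
Local Open Scope complex_scope.
Local Open Scope ring_scope.

(** [f] has boundary values only almost everywhere, so it is sampled on rays turned slightly away
    from [Lambda], while resolvents and symbols stay on the contour itself; the radial step is the
    sine of the turning angle, which keeps the samples belonging to a boundary point in one Stolz
    region. The quantization enters through continuity of [op] on order 0, that is, through a bound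
    by finitely many seminorms, so symbol estimates must be uniform in [l], in the step and in the
    number of nodes. Order 0 is borderline: at a point with [q = 1 + |a|] a node of modulus [t]
    contributes about [1 / (q + t)], and such a sum grows logarithmically. A derivative adds a
    further factor of the inverse and leaves [q / (q + t)^2], whose integral is 1 for every [q]; the
    symbol itself has to be cut at [t = q]. The decay exponent of the remainder is
    [(rho - delta) / (m + 1)]: one derivative in [xi] gains [rho - delta] powers of the bracket of
    [xi], and the order [m] of [a] fixes their exchange rate against powers of [|l|]. *)

Local Notation iRn := integralRn.
Local Notation cint := cintegral.
Local Notation Re := complex.Re.
Local Notation Im := complex.Im.

(* [letr h] bounds the left-hand side of a large inequality by means of [h]. *)
Tactic Notation "letr" uconstr(h) := refine (le_trans h _).
Ltac monol := rewrite ler_wpM2l //.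
Ltac monor := rewrite ler_wpM2r //.
Tactic Notation "ext" ident(x) := apply/funext => x.
Tactic Notation "iext" ident(x) := congr iRn; ext x.
Tactic Notation "cext" ident(x) := congr cint; ext x.

(** On nodes [i h] the measure [dt / t] gives cell [i] about the mass [1 / i], so this is the
    discrete form of the integral of [f(l) / l] along one ray minus that along the other. *)
Notation dsum v i0 i1 :=
 (\sum_(i0 <= i < i1) (v true i - v false i) / (i%:R)%:C).
(** The factor 2 is the price of a mean value inequality applied to real and imaginary parts
    separately. *)
Notation vbd v B i0 N := (forall b i, (i0 <= i < N)%N -> rnorm (v b i) <= 2 * B).

Lemma eq_ler (R : realType) (x y : R) : x = y -> x <= y.
by move=> ->. Qed.

(** * Real-valued norms in complex normed spaces *)

Section rnorm.
Variable R : realType.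
Implicit Types (V W : normedModType R[i]) (z : R[i]).

Lemma rnE V (v : V) : `|v| = (rnorm v)%:C.
by rewrite /rnorm RRe_real // ger0_real. Qed.

Lemma rn_ge0 V (v : V) : 0 <= rnorm v.
by rewrite -ler0c -rnE normr_ge0. Qed.

Lemma ler_rnM V W (v : V) (w : W) (a b : R) : rnorm v <= a -> rnorm w <= b -> rnorm v * rnorm w <= a * b.
by apply: ler_pM; exact: rn_ge0. Qed.

Lemma coef_ge0 V (v : V) (a b : R) : rnorm v <= a * b -> 0 < b -> 0 <= a.
by move=> h b0; rewrite -(pmulr_lge0 _ b0); exact: le_trans (rn_ge0 _) h. Qed.

Lemma rn0 V : rnorm (0 : V) = 0.
by apply: complexI; rewrite -rnE normr0. Qed.

Lemma rn_eq0 V (v : V) : (rnorm v == 0) = (v == 0).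
by rewrite -(normr_eq0 v) rnE (inj_eq (@complexI _)). Qed.

Lemma rnN V (v : V) : rnorm (- v) = rnorm v.
by rewrite /rnorm normrN. Qed.

Lemma rnB V (v w : V) : rnorm (v - w) = rnorm (w - v).
by rewrite /rnorm distrC. Qed.

Lemma rnD V (v w : V) : rnorm (v + w) <= rnorm v + rnorm w.
by rewrite -lecR raddfD /= -!rnE ler_normD. Qed.

Lemma rn_sum V (I : Type) (s : seq I) (P : pred I) (F : I -> V) :
 rnorm (\sum_(i <- s | P i) F i) <= \sum_(i <- s | P i) rnorm (F i).
elim/big_ind2: _ => [|x a y b xa yb|//]; first by rewrite rn0.
exact: le_trans (rnD _ _) (lerD xa yb).
Qed.

Lemma rnZ V z (v : V) : rnorm (z *: v) = rnorm z * rnorm v.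
by apply: complexI; rewrite rmorphM /= -!rnE normrZ. Qed.

Lemma rnM z z' : rnorm (z * z') = rnorm z * rnorm z'.
exact: rnZ. Qed.

Lemma rn1 : rnorm (1 : R[i]) = 1.
by apply: complexI; rewrite -rnE normr1. Qed.

Lemma rnr (r : R) : rnorm r%:C = `|r|.
by rewrite /rnorm normc_def /= expr0n /= addr0 sqrtr_sqr.
Qed.

Lemma rni : rnorm ('i : R[i]) = 1.
by rewrite /rnorm normc_def /= expr0n add0r expr1n sqrtr1. Qed.

Lemma rn_sqr z : rnorm z ^+ 2 = Re z ^+ 2 + Im z ^+ 2.
by rewrite /rnorm normc_def /= sqr_sqrtr // addr_ge0 // sqr_ge0. Qed.

Lemma nRe z : `|Re z| <= rnorm z.
rewrite -(@ler_pXn2r _ 2) ?nnegrE ?rn_ge0 // rn_sqr real_normK ?num_real //.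
by rewrite lerDl sqr_ge0.
Qed.

Lemma nIm z : `|Im z| <= rnorm z.
rewrite -(@ler_pXn2r _ 2) ?nnegrE ?rn_ge0 // rn_sqr real_normK ?num_real //.
by rewrite lerDr sqr_ge0.
Qed.

Lemma rn_le z : rnorm z <= `|Re z| + `|Im z|.
rewrite -(@ler_pXn2r _ 2) ?nnegrE ?rn_ge0 ?addr_ge0 // rn_sqr sqrrD.
by rewrite !real_normK ?num_real // addrAC lerDl mulrn_wge0 // mulr_ge0.
Qed.

Lemma rnV z : rnorm z^-1 = (rnorm z)^-1.
by apply: complexI; rewrite fmorphV /= -!rnE normfV. Qed.

Lemma rnX z k : rnorm (z ^+ k) = rnorm z ^+ k.
by elim: k => [|k IH]; rewrite ?expr0 ?rn1 // !exprS rnM IH. Qed.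

Lemma rne (t : R) : rnorm (expi t) = 1.
rewrite /rnorm normc_def /=; rewrite cos2Dsin2; exact: sqrtr1.
Qed.

Lemma expiD (s t : R) : expi (s + t) = expi s * expi t :> R[i].
rewrite /expi cosD sinD; apply/eqP; rewrite eq_complex /=.
by apply/andP; split; apply/eqP; ring.
Qed.

Lemma expi0 : expi 0 = 1 :> R[i].
by rewrite /expi cos0 sin0. Qed.

(** Tolerances in a complex normed space are positive elements of [R[i]], hence real; this passes to
    tolerances in [R]. *)
Lemma cvg_rnP (T : Type) (F : set_system T) (FF : Filter F) V
  (f : T -> V) (l : V) :
 f @ F --> l <-> forall e : R, 0 < e -> \forall x \near F, rnorm (l - f x) < e.
split=> [/cvgrPdist_lt h e e0|h].
 have := h e%:C; rewrite ltcR => /(_ e0); apply: filterS => x.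
 by rewrite rnE ltcR.
apply/cvgrPdist_lt => e e0.
have er : e = (Re e)%:C by rewrite RRe_real // gtr0_real.
move: (e0); rewrite er ltcR => /h; apply: filterS => x.
by rewrite rnE ltcR.
Qed.

Lemma cvg_ReIm (T : Type) (F : set_system T) (FF : Filter F)
  (f : T -> R[i]) (l : R[i]) :
 f @ F --> l <-> (fun x => Re (f x)) @ F --> Re l /\
  (fun x => Im (f x)) @ F --> Im l.
split=> [/cvg_rnP h|[/cvgrPdist_lt h1 /cvgrPdist_lt h2]].
 by split; apply/cvgrPdist_lt => e /h; apply: filterS => x;
  apply: le_lt_trans; rewrite -raddfB /=; [exact: nRe|exact: nIm].
apply/cvg_rnP => e e0.
have e20 : 0 < e / 2 by rewrite divr_gt0.
have A := h1 _ e20; have B := h2 _ e20.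
near=> x; apply: le_lt_trans (rn_le _) _; rewrite !raddfB /= [ltRHS]splitr.
by apply: ltrD; near: x.
Unshelve. all: by end_near. Qed.

End rnorm.
#[local] Hint Extern 0 (is_true (@Order.le _ _ _ (@rnorm _ _ _))) => exact: rn_ge0 : core.
#[local] Hint Extern 0 (is_true (@Order.le _ _ _ (@GRing.exp _ _ _))) => first [exact: sqr_ge0 | exact: exprn_ge0] : core.
#[local] Hint Extern 0 (is_true (@Order.le _ _ _ (@powR _ _ _))) => exact: powR_ge0 : core.

(** * Continuity of complex-valued functions *)

Section complex_continuity.
Variables (R : realType) (T : topologicalType).
Implicit Types f g : T -> R[i].

Lemma ccontP f : continuous f <-> continuous (fun x => Re (f x)) /\
 continuous (fun x => Im (f x)).
split=> [h|[h1 h2] x].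
 by split=> x; have /cvg_ReIm[] := h x.
by apply/cvg_ReIm; split; [exact: h1|exact: h2].
Qed.

Lemma cts_expi (f : T -> R) : continuous f -> continuous (fun x => expi (f x)).
move=> h; apply/ccontP; split => x /=.
 by apply: continuous_comp; [exact: h|exact: continuous_cos].
by apply: continuous_comp; [exact: h|exact: continuous_sin].
Qed.

Lemma ctsC (f : T -> R) : continuous f -> continuous (fun x => (f x)%:C).
by move=> h; apply/ccontP; split => x /=; [exact: h|exact: cvg_cst]. Qed.

Lemma ccontD f g : continuous f -> continuous g -> continuous (fun x => f x + g x).
by move=> cf cg x; apply: cvgD; [exact: cf|exact: cg]. Qed.

Lemma ccontM f g : continuous f -> continuous g -> continuous (fun x => f x * g x).
by move=> cf cg x; apply: cvgM; [exact: cf|exact: cg]. Qed.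

End complex_continuity.

(** * Dominated convergence and integrals depending on a parameter *)

Section dominated.
Context (R : realType) d (Y : measurableType d) (mu : {measure set Y -> \bar R}).
Variables (B : set Y) (mB : measurable B).

Lemma dom_itble (f G : Y -> R) : measurable_fun B f ->
 mu.-integrable B (EFin \o G) -> (forall y, B y -> `|f y| <= G y) ->
 mu.-integrable B (EFin \o f).
move=> mf iG fG; apply: le_integrable iG => //; first exact/measurable_EFinP.
move=> y By /=; rewrite lee_fin; letr (fG _ By); exact: ler_norm.
Qed.

Lemma dom_Rint_ae (f_ : nat -> Y -> R) (f G : Y -> R) :
 (forall n, measurable_fun B (f_ n)) -> measurable_fun B f ->
 {ae mu, forall y, B y -> f_ n y @[n --> \oo] --> f y} ->
 mu.-integrable B (EFin \o G) ->
 {ae mu, forall y n, B y -> `|f_ n y| <= G y} ->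
 \int[mu]_(y in B) f_ n y @[n --> \oo] --> \int[mu]_(y in B) f y.
move=> mf_ mf f_f iG fG.
have [|||||i _ h] := @dominated_convergence _ _ _ mu B mB
 (fun n => EFin \o f_ n) (EFin \o f) (EFin \o G).
- by move=> n; exact/measurable_EFinP.
- exact/measurable_EFinP.
- by apply: filterS f_f => y h By; apply: cvg_EFin; [exact: nearW|exact: h].
- exact: iG.
- by apply: filterS fG => y h n By /=; rewrite lee_fin; exact: h.
rewrite /Rintegral; apply: fine_cvg.
by rewrite fineK //; exact: integrable_fin_num.
Qed.

Lemma dom_Rint (f_ : nat -> Y -> R) (f G : Y -> R) :
 (forall n, measurable_fun B (f_ n)) -> measurable_fun B f ->
 (forall y, B y -> f_ n y @[n --> \oo] --> f y) ->
 mu.-integrable B (EFin \o G) ->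
 (forall n y, B y -> `|f_ n y| <= G y) ->
 \int[mu]_(y in B) f_ n y @[n --> \oo] --> \int[mu]_(y in B) f y.
move=> mf_ mf f_f iG fG; apply: (dom_Rint_ae mf_ mf _ iG).
 exact: aeW.
by apply: aeW => y n; exact: fG.
Qed.

(** Dominated convergence speaks of sequences. Points of [P] have a countable base of balls, so a
    limit that fails is already refuted by a sequence; [Q] is the neighbourhood on which domination
    is known. *)
Lemma cvg_seq_nbhs (P : pseudoMetricType R) (g : P -> R) (p : P) (l : R)
  (Q : set P) : (\forall q \near p, Q q) ->
 (forall q_ : nat -> P, (forall n, Q (q_ n)) -> q_ n @[n --> \oo] --> p ->
  g (q_ n) @[n --> \oo] --> l) ->
 g @ p --> l.
move=> Qp H; apply/cvgrPdist_lt => e e0; apply: contrapT => ne.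
have [q_ hq] : {q_ : nat -> P & forall n,
  [/\ ball p n.+1%:R^-1 (q_ n), Q (q_ n) & e <= `|l - g (q_ n)|]}.
 apply: (@boolp.choice _ _ (fun n q => [/\ ball p n.+1%:R^-1 q, Q q & e <= `|l - g q|])) => n.
 apply: contrapT => nq; apply: ne.
 have : \forall q \near p, ball p n.+1%:R^-1 q by apply: nbhsx_ballx.
 move: Qp; apply: filterS2 => q Qq bq; rewrite ltNge; apply/negP => h.
 by apply: nq; exists q.
have qp : q_ n @[n --> \oo] --> p.
 apply/cvg_ballP => r r0.
 have := near_infty_natSinv_lt (PosNum r0); apply: filterS => n /= nr.
 have [b _ _] := hq n; apply: le_ball b; exact: ltW.
have /cvgrPdist_lt/(_ _ e0)[N _ hN] := H q_ (fun n => let: And3 _ h _ := hq n in h) qp.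
have [_ _] := hq N; rewrite leNgt => /negP; apply; exact: hN (leqnn N).
Qed.

Lemma cvg_param_int (P : pseudoMetricType R) (F : P -> Y -> R) (p : P)
  (G : Y -> R) :
 (forall q, measurable_fun B (F q)) ->
 (forall y, B y -> F ^~ y @ p --> F p y) ->
 mu.-integrable B (EFin \o G) ->
 (\forall q \near p, forall y, B y -> `|F q y| <= G y) ->
 \int[mu]_(y in B) F q y @[q --> p] --> \int[mu]_(y in B) F p y.
move=> mF cF iG FG; apply: (cvg_seq_nbhs FG) => q_ Qq qp.
apply: (@dom_Rint _ _ G) => //.
by move=> y By; apply: cvg_comp qp (cF y By).
Qed.

End dominated.

(** A directional derivative on [V] is an ordinary derivative along a line, where the chain rule,
    the mean value theorem and differentiation under the integral are available. *)
Lemma der_line (R : realType) (V W : normedModType R) (f : V -> W) (x v : V) (df : W) (t : R) :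
 is_derive (x + t *: v) v f df <-> is_derive t 1 (fun s => f (x + s *: v)) df.
have E (h : R) : f (h *: v + (x + t *: v)) = f (x + (h *: 1 + t) *: v).
 by congr f; rewrite addrCA -scalerDl /= /GRing.scale /= mulr1.
have E' : (fun h : R => h^-1 *: (f (h *: v + (x + t *: v)) - f (x + t *: v))) =
  (fun h : R => h^-1 *: (f (x + (h *: 1 + t) *: v) - f (x + t *: v))).
 by ext h; rewrite E.
by split=> -[d1 d2]; split; move: d1 d2; rewrite /derivable /derive /= E'.
Qed.

Section param_derivative.
Context (R : realType) d (Y : measurableType d) (mu : {measure set Y -> \bar R}).
Variables (B : set Y) (mB : measurable B) (V : normedModType R).

(** Only the line through [p] in direction [v] matters: the hypothesis near [p] becomes one on an
    interval []-e, e[] of parameters. *)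
Lemma der_param_int (F dF : V -> Y -> R) (p v : V) (G : Y -> R) :
 (forall q, mu.-integrable B (EFin \o F q)) ->
 mu.-integrable B (EFin \o G) ->
 (\forall q \near p, forall y, B y -> is_derive q v (F ^~ y) (dF q y) /\ `|dF q y| <= G y) ->
 is_derive p v (fun q => \int[mu]_(y in B) F q y) (\int[mu]_(y in B) dF p y).
move=> iF iG nF.
have nF0 : \forall s \near (0 : R), forall y, B y ->
  is_derive (p + s *: v) v (F ^~ y) (dF (p + s *: v) y) /\ `|dF (p + s *: v) y| <= G y.
 have cl : (fun s : R => p + s *: v) @ (0 : R) --> p.
  rewrite -[X in _ --> X]addr0 -[X in _ --> _ + X](scale0r v).
  by apply: cvgD; [exact: cvg_cst|apply: cvgZr_tmp; exact: cvg_id].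
 exact: cl nF.
have [e /= e0 he] := nF0.
pose f s y := F (p + s *: v) y.
have hI s : `]- e, e[%classic s -> forall y, B y ->
  is_derive (p + s *: v) v (F ^~ y) (dF (p + s *: v) y) /\ `|dF (p + s *: v) y| <= G y.
 rewrite /= in_itv /= => se; apply: he => /=.
 by rewrite sub0r normrN ltr_norml.
have df s y : `]- e, e[%classic s -> B y -> is_derive s 1 (f ^~ y) (dF (p + s *: v) y).
 move=> se By; exact: (der_line _ _ _ _ _).1 (hI _ se _ By).1.
have I0 : `]- e, e[%classic (0 : R) by rewrite /= in_itv /= oppr_lt0 e0.
have G0 (y : Y) : 0 <= `|G y| by [].
have iG' : mu.-integrable B (EFin \o (fun y => `|G y|)).
 exact: integrable_norm iG.
have dd x y : `]- e, e[%classic x -> B y -> derivable (f^~ y) x 1.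
 by move=> xI By; have [] := df _ _ xI By.
have bb x y : `]- e, e[%classic x -> B y -> `|partial1of2 f x y| <= `|G y|.
 move=> xI By; rewrite partial1of2E; have [_ ->] := df _ _ xI By.
 by have [_ /le_trans] := hI _ xI _ By; apply; exact: ler_norm.
have h := @cvg_differentiation_under_integral R _ Y mu f B mB 0 (- e) e I0
 (fun s _ => iF (p + s *: v)) dd (fun y => `|G y|) G0 iG' bb.
have EE : (fun h : R => h^-1 *: (\int[mu]_(y in B) f (h + 0) y - \int[mu]_(y in B) f 0 y)) =
 (fun h : R => h^-1 *: (\int[mu]_(y in B) F (h *: v + p) y - \int[mu]_(y in B) F p y)).
 ext s; rewrite /f addr0 /=; congr (_ *: (_ - _)).
  by apply: eq_Rintegral => y _; rewrite addrC.
 by apply: eq_Rintegral => y _; rewrite scale0r addr0.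
have EL : \int[mu]_(y in B) partial1of2 f 0 y = \int[mu]_(y in B) dF p y.
 apply: eq_Rintegral => y /set_mem By; rewrite partial1of2E.
 by have [_ ->] := df _ _ I0 By; rewrite scale0r addr0.
rewrite EE EL in h; split; last exact: cvg_lim h.
by apply/cvg_ex; exists (\int[mu]_(y in B) dF p y).
Qed.

End param_derivative.

Lemma cts_comp2 (T A B W : topologicalType) (F : A -> B -> W)
  (f : T -> A) (g : T -> B) : continuous (fun z : A * B => F z.1 z.2) ->
 continuous f -> continuous g -> continuous (fun t => F (f t) (g t)).
move=> cF cf cg t.
apply: (@continuous_comp _ _ _ (fun t => (f t, g t)) (fun z => F z.1 z.2) t).
 have h := @cvg_pair _ _ _ (nbhs t) (nbhs (f t)) (nbhs (g t)) _ _ _ f g (cf t) (cg t).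
 exact: h.
exact: cF.
Qed.

Lemma ctsc (T A W : topologicalType) (F : A -> W) (f : T -> A) :
 continuous F -> continuous f -> continuous (fun t => F (f t)).
by move=> cF cf t; apply: continuous_comp; [exact: cf|exact: cF]. Qed.

Section continuous_arith.
Variables (R : realType) (T : topologicalType).
Implicit Types f g : T -> R.

Lemma cts_add f g : continuous f -> continuous g -> continuous (fun t => f t + g t).
by move=> cf cg t; apply: cvgD; [exact: cf|exact: cg]. Qed.

Lemma cts_sub f g : continuous f -> continuous g -> continuous (fun t => f t - g t).
by move=> cf cg t; apply: cvgB; [exact: cf|exact: cg]. Qed.

Lemma cts_mul f g : continuous f -> continuous g -> continuous (fun t => f t * g t).
by move=> cf cg t; apply: cvgM; [exact: cf|exact: cg]. Qed.

Lemma cts_cst (W : topologicalType) (c : W) : continuous (fun _ : T => c).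
by move=> t; exact: cvg_cst. Qed.

End continuous_arith.

(** * Lebesgue integrals on the line dominated by [1 / (1 + t^2)] *)

Section line.
Variable R : realType.
Notation mu := (@lebesgue_measure R).

(** The standard majorant of the absolutely convergent integrals below: integrable, comparable to
    its translates, and controlling its own derivatives. *)
Definition wt1 (t : R) : R := (1 + t ^+ 2)^-1.

Lemma wt1_gt0 t : 0 < wt1 t.
by rewrite invr_gt0 ltr_wpDr // sqr_ge0. Qed.

Lemma wt1_ge0 t : 0 <= wt1 t. Proof. exact/ltW/wt1_gt0. Qed.

Lemma wt1_le1 t : wt1 t <= 1.
by rewrite invf_le1 ?ltr_wpDr // lerDl sqr_ge0. Qed.

Lemma cts_wt1 : continuous wt1.
exact: continuous_oneDsqrV. Qed.

Lemma int_wt1 : (\int[mu]_t (wt1 t)%:E = pi%:E)%E.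
rewrite ge0_symfun_integralT; [|exact: wt1_ge0|exact: cts_wt1|].
 rewrite -set_itvcy integral0y_oneDsqr -EFinM; congr EFin.
 by rewrite mulrC divfK.
by move=> t; rewrite /wt1 /= sqrrN.
Qed.

Lemma itble_wt1 : mu.-integrable setT (EFin \o wt1).
apply/integrableP; split.
 apply/measurable_EFinP.
 apply: continuous_measurable_fun.
 exact: cts_wt1.
under eq_integral do rewrite /= ger0_norm ?wt1_ge0 //.
by rewrite int_wt1 ltry.
Qed.

Lemma Rint_wt1 : \int[mu]_t wt1 t = pi.
by rewrite /Rintegral int_wt1. Qed.

Lemma itble_wt1Z K : mu.-integrable setT (EFin \o (fun t => K * wt1 t)).
have -> : EFin \o (fun t => K * wt1 t) = (fun t => K%:E * (EFin \o wt1) t)%E by [].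
by apply: integrableZl => //; exact: itble_wt1.
Qed.

Lemma itbl (f : R -> R) K : continuous f ->
 (forall t, `|f t| <= K * wt1 t) -> mu.-integrable setT (EFin \o f).
move=> cf fK; apply: (@dom_itble R _ _ mu setT measurableT f (fun t => K * wt1 t)) => //.
- exact: continuous_measurable_fun.
- exact: itble_wt1Z.
Qed.

Lemma Rint_dom (f : R -> R) K : continuous f ->
 (forall t, `|f t| <= K * wt1 t) -> `|\int[mu]_t f t| <= K * pi.
move=> cf fK; letr (le_normr_Rintegral _ _) => //.
 exact: itbl fK.
rewrite -Rint_wt1 -RintegralZl //; last exact: itble_wt1.
apply: le_Rintegral => //; last exact: itble_wt1Z.
apply: integrable_norm; exact: itbl fK.
Qed.

Lemma Integral_shift (g : R -> R) (c : R) : continuous g -> (forall t, 0 <= g t) ->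
  (\int[mu]_t (g (t + c))%:E = \int[mu]_t (g t)%:E)%E.
move=> cg g0; have dS : derive1 (fun t : R => t + c) = cst 1.
  ext t; rewrite derive1E (_ : (fun t => t + c) = id + cst c) //.
  by rewrite deriveD // derive_id derive_cst addr0.
 rewrite [RHS](@increasing_ge0_integration_by_substitutionT R (fun t => t + c)) //.
 - by rewrite dS; apply: eq_integral => t _ /=; rewrite fctE /= mulr1.
 - by move=> x y; rewrite ltrD2r.
 - by rewrite dS; exact: cst_continuous.
 - by rewrite dS; exact: is_cvg_cst.
 - by rewrite dS; exact: is_cvg_cst.
 - exact: cvg_addrr_Ny.
 - exact: cvg_addrr.
Qed.

(** Substitution is applied to nonnegative integrands. Adding [K * wt1], which dominates [|f|],
    makes the integrand nonnegative, and the added integral is cancelled afterwards. *)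
Lemma Rint_shift (f : R -> R) (c : R) K : continuous f ->
 (forall t, `|f t| <= K * wt1 t) ->
 \int[mu]_t f (t + c) = \int[mu]_t f t.
move=> cf fK.
have cS (g : R -> R) : continuous g -> continuous (fun t => g (t + c)).
 by move=> cg; apply: (ctsc cg); apply: cts_add; [move=> t; exact: cvg_id|exact: cts_cst].
pose h t := f t + K * wt1 t.
have ck : continuous (fun t => K * wt1 t).
 by move=> t; apply: cvgM; [exact: cvg_cst|exact: cts_wt1].
have ch : continuous h by move=> t; apply: cvgD; [exact: cf|exact: ck].
have K0 : 0 <= K by have := le_trans (normr_ge0 _) (fK 0); rewrite pmulr_lge0 // wt1_gt0.
have h0 t : 0 <= h t.
 by rewrite /h -lerBlDr sub0r; have := fK t; rewrite ler_norml => /andP[].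
have k0 t : 0 <= K * wt1 t by rewrite mulr_ge0 ?wt1_ge0.
have i1 := itbl cf fK.
have i2 : mu.-integrable setT (EFin \o (fun t => K * wt1 t)) by exact: itble_wt1Z.
have i2' : mu.-integrable setT (EFin \o (fun t => K * wt1 (t + c))).
 apply/integrableP; split.
  by apply/measurable_EFinP; apply: continuous_measurable_fun; apply: (cS (fun t => K * wt1 t)).
 under eq_integral do rewrite /= ger0_norm //.
 rewrite (Integral_shift c ck k0); have /integrableP[_] := i2.
 by under eq_integral do rewrite /= ger0_norm //.
have i1' : mu.-integrable setT (EFin \o (fun t => f (t + c))).
 apply: (@dom_itble R _ _ mu setT measurableT _ (fun t => K * wt1 (t + c))) => //.
 by apply: continuous_measurable_fun; exact: cS.
have E := Integral_shift c ch h0; have Ew := Integral_shift c ck k0.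
have : \int[mu]_t (f (t + c) + K * wt1 (t + c)) = \int[mu]_t (f t + K * wt1 t).
 by rewrite /Rintegral E.
rewrite RintegralD // RintegralD //.
have -> : \int[mu]_t (K * wt1 (t + c)) = \int[mu]_t (K * wt1 t) by rewrite /Rintegral Ew.
exact: addIr.
Qed.

Lemma wt1_shift (s t : R) : `|s| <= 1 -> wt1 (t + s) <= 3 * wt1 t.
move=> s1; have s2 : s ^+ 2 <= 1 by rewrite -real_normK ?num_real // exprn_ile1.
rewrite /wt1 ler_pdivlMr ?ltr_wpDr //.
rewrite ler_pdivrMl ?ltr_wpDr //.
have := sqr_ge0 (2 * t + 3 * s); nra.
Qed.

(** The integral of [f (t + q)] is constant in [q]; differentiating under the integral at [q = 0]
    gives the integral of [df]. *)
Lemma Rint_der (f df : R -> R) K : continuous df ->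
 (forall t : R, is_derive t 1 f (df t)) ->
 (forall t, `|f t| <= K * wt1 t) ->
 (forall t, `|df t| <= K * wt1 t) ->
 \int[mu]_t df t = 0.
move=> cdf fdf fK dfK.
have cf : continuous f.
 move=> t; apply: differentiable_continuous; apply/derivable1_diffP.
 by have [] := fdf t.
have cS (g : R -> R) (c : R) : continuous g -> continuous (fun t : R => g (t + c)).
 by move=> cg; apply: (ctsc cg); apply: cts_add; [move=> t; exact: cvg_id|exact: cts_cst].
have K0 : 0 <= K by have := le_trans (normr_ge0 _) (fK 0); rewrite pmulr_lge0 // wt1_gt0.
have sK (g : R -> R) q t : `|q| <= 1 -> (forall t, `|g t| <= K * wt1 t) -> `|g (t + q)| <= K * 3 * wt1 t.
 move=> q1 gK; letr (gK _); rewrite -mulrA ler_wpM2l //.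
 exact: wt1_shift.
have dI : is_derive (0 : R) (1 : R) (fun q : R => \int[mu]_t f (t + q)) (\int[mu]_t df (t + 0)).
 apply: (@der_param_int R _ _ mu setT measurableT R (fun q t => f (t + q))
  (fun q t => df (t + q)) 0 1 (fun t => K * 3 * wt1 t)).
 - move=> q; apply: (@dom_itble R _ _ mu setT measurableT _ (fun t => K * wt1 (t + q))).
  + by apply: continuous_measurable_fun; exact: cS.
  + apply/integrableP; split.
  apply/measurable_EFinP; apply: continuous_measurable_fun.
  apply: (cS (fun t => K * wt1 t)).
  by apply: cts_mul; [exact: cts_cst|exact: cts_wt1].
  under eq_integral do rewrite /= ger0_norm ?mulr_ge0 ?wt1_ge0 //.
  rewrite (Integral_shift q (g := fun t => K * wt1 t)).
  - have /integrableP[_] := itble_wt1Z K.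
  by under eq_integral do rewrite /= ger0_norm ?mulr_ge0 ?wt1_ge0 //.
  - by move=> t; apply: cvgM; [exact: cvg_cst|exact: cts_wt1].
  - by move=> t; rewrite mulr_ge0 ?wt1_ge0.
  + by move=> t _; exact: fK.
 - exact: itble_wt1Z.
 - have n1 : \forall q \near (0 : R), `|q| <= 1.
  by exists 1 => //= q /=; rewrite sub0r normrN; exact: ltW.
  apply: filterS n1 => q q1 t _; split.
  have := (der_line f t 1 (df (t + q)) q).1.
  have -> : t + q *: 1 = t + q by rewrite /GRing.scale /= mulr1.
  have -> : (fun s => f (t + s *: 1)) = (fun s => f (t + s)).
  by ext s; rewrite /GRing.scale /= mulr1.
  by apply; exact: fdf.
  exact: sK.
have Ec : (fun q : R => \int[mu]_t f (t + q)) = cst (\int[mu]_t f t).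
 by ext q; exact: (Rint_shift _ cf fK).
rewrite Ec in dI; have [_] := dI; rewrite derive_cst.
by under eq_Rintegral do rewrite addr0.
Qed.

(** Rounding the first variable down to a multiple of [1 / (j + 1)] turns preimages into countable
    unions of measurable rectangles; the rounded functions converge pointwise by continuity. This
    gives measurability for the product of the two Borel algebras, as Fubini requires. *)
Lemma cts_mble_fun2 (F : R -> R -> R) :
 continuous (fun z : R * R => F z.1 z.2) ->
 measurable_fun setT (fun z : measurableTypeR R * measurableTypeR R => F z.1 z.2).
move=> cF.
pose a (j : nat) (t : R) : R := (Num.floor (j.+1%:R * t))%:~R / j.+1%:R.
have aE j t : `|t - a j t| <= j.+1%:R^-1.
 have j0 : (0 : R) < j.+1%:R by [].
 rewrite -(ler_pM2r j0) mulVf ?gt_eqF // -[X in _ * X]ger0_norm ?ltW // -normrM mulrBl.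
 rewrite /a divfK ?gt_eqF // [t * _]mulrC.
 have /andP[h1 h2] := floor_itv (j.+1%:R * t).
 by rewrite ger0_norm ?subr_ge0 //; move: h2; rewrite intrD; lra.
have ca t : a j t @[j --> \oo] --> t.
 apply/cvgrPdist_le => e e0.
 have := near_infty_natSinv_lt (PosNum e0); apply: filterS => j /= je.
 exact: le_trans (aE j t) (ltW je).
apply: (measurable_fun_cvg (h := fun j (z : measurableTypeR R * measurableTypeR R) => F (a j z.1) z.2)) => //.
- move=> j _ B mB; rewrite setTI.
 have -> : (fun z : measurableTypeR R * measurableTypeR R => F (a j z.1) z.2) @^-1` B =
  \bigcup_(k in [set: int]) ([set t | Num.floor (j.+1%:R * t) = k] `*`
  [set t | B (F (k%:~R / j.+1%:R) t)]).
  apply/seteqP; split => -[x y] /=.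
  by move=> Bxy; exists (Num.floor (j.+1%:R * x)).
  by move=> [k _ [/= kx]]; rewrite /a kx.
 apply: countable_bigcupT_measurable => // k.
 apply: measurableX.
  have -> : [set t : R | Num.floor (j.+1%:R * t) = k] =
  `[k%:~R / j.+1%:R, (k + 1)%:~R / j.+1%:R[%classic.
  have j0 : (0 : R) < j.+1%:R by [].
  apply/seteqP; split => t /=; rewrite in_itv /= ler_pdivrMr // ltr_pdivlMr // [t * _]mulrC.
  by move=> <-; rewrite floor_itv.
  by move=> h; exact: floor_def.
  exact: measurable_itv.
 have ck : continuous (F (k%:~R / j.+1%:R)).
  by apply: (cts_comp2 cF); [exact: cts_cst|move=> t; exact: cvg_id].
 have := continuous_measurable_fun ck measurableT mB.
 by rewrite setTI.
- move=> [x y] _ /=.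
 have c1 : continuous (F ^~ y).
  by apply: (cts_comp2 cF); [move=> t; exact: cvg_id|exact: cts_cst].
 by apply: (@cvg_comp _ _ _ (fun j => a j x) (F ^~ y) _ (nbhs x)); [exact: ca|exact: c1].
Qed.

Lemma Rint_swap (F : R -> R -> R) K :
 continuous (fun z : R * R => F z.1 z.2) ->
 (forall s t, `|F s t| <= K * wt1 s * wt1 t) ->
 \int[mu]_s \int[mu]_t F s t = \int[mu]_t \int[mu]_s F s t.
move=> cF FK; have mF := cts_mble_fun2 cF.
have c1 s : continuous (F s).
 by apply: (cts_comp2 cF); [exact: cts_cst|move=> t; exact: cvg_id].
have c2 t : continuous (F ^~ t).
 by apply: (cts_comp2 cF); [move=> s; exact: cvg_id|exact: cts_cst].
have i1 s : mu.-integrable setT (EFin \o F s) by exact: itbl (FK s).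
have i2 t : mu.-integrable setT (EFin \o F ^~ t).
 apply: (@itbl _ (K * wt1 t)) => // s.
 by rewrite mulrAC; exact: FK.
have K0 : 0 <= K.
 by have := le_trans (normr_ge0 _) (FK 0 0); rewrite -mulrA pmulr_lge0 // mulr_gt0 // wt1_gt0.
have cn s : continuous (fun t => `|F s t|).
 by apply: (ctsc (@norm_continuous _ R)); exact: c1.
have nK s t : `|(`|F s t|)| <= K * wt1 s * wt1 t by rewrite normr_id.
have iF : (mu \x mu)%E.-integrable setT (fun z => (F z.1 z.2)%:E).
 apply/integrable12ltyP; first exact/measurable_EFinP.
 apply: (@le_lt_trans _ _ (\int[mu]_s ((K * pi) * wt1 s)%:E)%E); last first.
  have /integrableP[_] := itble_wt1Z (K * pi).
  under eq_integral do rewrite /= ger0_norm ?mulr_ge0 ?wt1_ge0 ?pi_ge0 //.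
  by [].
 apply: ge0_le_integral => //.
 - by move=> s _; apply: integral_ge0.
 - rewrite (_ : (fun x => _) = EFin \o (fun s => \int[mu]_t `|F s t|)); last first.
  apply/funext => s /=; rewrite /Rintegral fineK //.
  exact: integrable_fin_num (itbl (cn s) (nK s)).
  apply/measurable_EFinP; apply: continuous_measurable_fun => s.
  apply: (@cvg_param_int R _ _ mu setT measurableT R (fun s t => `|F s t|) s (fun t => K * wt1 t)).
  + by move=> q; apply: continuous_measurable_fun; exact: cn.
  + by move=> t _; apply: (ctsc (@norm_continuous _ R)); exact: c2.
  + exact: itble_wt1Z.
  + exists 1 => //= q _ t _; letr (nK q t); rewrite mulrAC.
  by rewrite ler_piMr ?wt1_le1 ?mulr_ge0 ?wt1_ge0.
 - by apply/measurable_EFinP; apply: continuous_measurable_fun; apply: cts_mul; [exact: cts_cst|exact: cts_wt1].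
 - move=> s _.
  have := Rint_dom (cn s) (nK s).
  rewrite ger0_norm ?Rintegral_ge0 // => h.
  rewrite (_ : \int[_]_y _ = (\int[mu]_t `|F s t|)%:E)%E.
  by rewrite lee_fin mulrAC.
  by rewrite /Rintegral fineK //; exact: integrable_fin_num (itbl (cn s) (nK s)).
have := Fubini iF => /= E.
have E1 s : (\int[mu]_t (F s t)%:E = (\int[mu]_t F s t)%:E)%E.
 by rewrite /Rintegral fineK //; exact: integrable_fin_num (i1 s).
have E2 t : (\int[mu]_s (F s t)%:E = (\int[mu]_s F s t)%:E)%E.
 by rewrite /Rintegral fineK //; exact: integrable_fin_num (i2 t).
move: E; under eq_integral do rewrite E1; under [X in _ = X -> _]eq_integral do rewrite E2.
by rewrite {1 3}/Rintegral => ->.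
Qed.

End line.

(** * Continuity in matrix spaces and the product weight on [R^n] *)

Lemma cts_mxP (K : numFieldType) (T : topologicalType) m n (f : T -> 'M[K]_(m, n)) :
 continuous f <-> forall i j, continuous (fun t => f t i j).
split=> [cf i j|h t].
 by apply: (ctsc (@coord_continuous K m n i j) cf).
apply/cvg_ballP => e e0.
have : \forall s \near t, forall ij : 'I_m * 'I_n, ball (f t ij.1 ij.2) e (f s ij.1 ij.2).
 apply: filter_forall => -[i j]; have /cvg_ballP := h i j t; exact.
by apply: filterS => s H; split=> // i j; exact: (H (i, j)).
Qed.

Lemma cts_row_mx (R : realType) (T : topologicalType) n (f : T -> R) (g : T -> 'rV[R]_n) :
 continuous f -> continuous g -> continuous (fun t => row_mx (f t)%:M (g t) : 'rV[R]_(1 + n)).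
move=> cf /cts_mxP cg; apply/cts_mxP => i j.
case: (split_ordP j) => k ->.
 under eq_fun do rewrite row_mxEl mxE ord1 (ord1 k) eqxx mulr1n.
 exact: cf.
by under eq_fun do rewrite row_mxEr; exact: cg.
Qed.

Lemma near_all (T : topologicalType) (x : T) (Q : T -> Prop) :
 (forall y, Q y) -> \forall y \near x, Q y.
by move=> h; apply: filterS filterT => y _. Qed.

Section wt.
Variable R : realType.

Definition wt n (x : 'rV[R]_n) : R := \prod_i wt1 (x 0 i).

Lemma wt_gt0 n (x : 'rV[R]_n) : 0 < wt x.
by apply: prodr_gt0 => i _; exact: wt1_gt0. Qed.

Lemma wt_ge0 n (x : 'rV[R]_n) : 0 <= wt x. Proof. exact/ltW/wt_gt0. Qed.

Lemma wt_le1 n (x : 'rV[R]_n) : wt x <= 1.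
by apply: prodr_ile1 => i _; rewrite wt1_ge0 wt1_le1. Qed.

Lemma wt_row_mx n (t : R) (y : 'rV[R]_n) :
 wt (row_mx t%:M y : 'rV[R]_(1 + n)) = wt1 t * wt y.
rewrite /wt big_split_ord big_ord1 row_mxEl mxE eqxx mulr1n; congr (_ * _).
by apply: eq_bigr => i _; rewrite row_mxEr.
Qed.

Lemma cts_wt n : continuous (@wt n).
rewrite /wt; elim: (index_enum _) => [|i s IH].
 by under eq_fun do rewrite big_nil; exact: cts_cst.
under eq_fun do rewrite big_cons; apply: cts_mul => //.
by apply: (ctsc (@cts_wt1 R)); exact: coord_continuous.
Qed.

End wt.

#[local] Hint Extern 0 (is_true (@Order.le _ _ _ (@wt1 _ _))) => exact: wt1_ge0 : core.
#[local] Hint Extern 0 (is_true (@Order.le _ _ _ (@wt _ _ _))) => exact: wt_ge0 : core.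

Lemma cts_dot (R : realType) (T : topologicalType) n (f g : T -> 'rV[R]_n) :
 continuous f -> continuous g -> continuous (fun t => dot (f t) (g t)).
move=> /cts_mxP cf /cts_mxP cg; rewrite /dot; elim: (index_enum _) => [|i s IH].
 by under eq_fun do rewrite big_nil; exact: cts_cst.
by under eq_fun do rewrite big_cons; apply: cts_add => //; exact: cts_mul.
Qed.

Lemma cts_pair (T A B : topologicalType) (f : T -> A) (g : T -> B) :
 continuous f -> continuous g -> continuous (fun t => (f t, g t)).
move=> cf cg t.
have h := @cvg_pair _ _ _ (nbhs t) (nbhs (f t)) (nbhs (g t)) _ _ _ f g (cf t) (cg t).
exact: h.
Qed.

Lemma cts_addv (R : realType) (T : topologicalType) (U : normedModType R) (f g : T -> U) :
 continuous f -> continuous g -> continuous (fun t => f t + g t).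
by move=> cf cg t; exact: (@cvgD _ U _ _ _ f g _ _ (cf t) (cg t)). Qed.

Ltac cts := first
 [ exact: cts_cst | by move=> ?; exact: cvg_id | by move=> ?; exact: cvg_fst
 | by move=> ?; exact: cvg_snd
 | apply: cts_expi; cts | apply: ccontM; cts | apply: cts_mul; cts | apply: ctsC; cts
 | apply: cts_dot; cts | apply: cts_row_mx; cts | apply: cts_pair; cts | apply: cts_addv; cts
 | exact: cts_wt | exact: cts_wt1 | exact: opp_continuous | assumption ].

(** * Complex-valued integrals, on the line and iterated over [R^n] *)

Section complex_derivative.
Variables (R : realType) (V : normedModType R).
Implicit Types (f g : V -> R[i]) (x v : V).

Definition cder v f x (l : R[i]) : Prop :=
 is_derive x v (fun y => Re (f y)) (Re l) /\
 is_derive x v (fun y => Im (f y)) (Im l).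

End complex_derivative.

Section cint.
Variable R : realType.
Notation mu := (@lebesgue_measure R).
Notation C := R[i].

Definition ccont (A B : topologicalType) (F : A -> B -> C) :=
 continuous (fun z : A * B => F z.1 z.2).

Lemma ccontRe (A B : topologicalType) (F : A -> B -> C) : ccont F ->
 continuous (fun z : A * B => Re (F z.1 z.2)).
by move=> /ccontP[]. Qed.

Lemma ccontIm (A B : topologicalType) (F : A -> B -> C) : ccont F ->
 continuous (fun z : A * B => Im (F z.1 z.2)).
by move=> /ccontP[]. Qed.

Lemma cint_bd (f : R -> C) K : continuous f ->
 (forall t, rnorm (f t) <= K * wt1 t) -> rnorm (cint f) <= K * (2 * pi).
move=> /ccontP[c1 c2] fK; letr (rn_le _) => /=.
rewrite mulrCA mulr2n mulrDl mul1r; apply: lerD.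
 by apply: Rint_dom c1 _ => t; apply: le_trans (fK t); exact: nRe.
by apply: Rint_dom c2 _ => t; apply: le_trans (fK t); exact: nIm.
Qed.

Lemma cintD (f g : R -> C) K : continuous f -> continuous g ->
 (forall t, rnorm (f t) <= K * wt1 t) -> (forall t, rnorm (g t) <= K * wt1 t) ->
 cint (fun t => f t + g t) = cint f + cint g.
move=> /ccontP[c1 c2] /ccontP[d1 d2] fK gK; rewrite /cint.
have i1 := itbl c1 (fun t => le_trans (nRe _) (fK t)).
have i2 := itbl c2 (fun t => le_trans (nIm _) (fK t)).
have j1 := itbl d1 (fun t => le_trans (nRe _) (gK t)).
have j2 := itbl d2 (fun t => le_trans (nIm _) (gK t)).
rewrite -[RHS]/(Complex _ _) -!RintegralD //; congr (_ +i* _);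
 by apply: eq_Rintegral => t _; rewrite raddfD.
Qed.

Lemma cintZ (f : R -> C) (c : C) K : continuous f ->
 (forall t, rnorm (f t) <= K * wt1 t) ->
 cint (fun t => c * f t) = c * cint f.
move=> /ccontP[c1 c2] fK; rewrite /cint.
have i1 := itbl c1 (fun t => le_trans (nRe _) (fK t)).
have i2 := itbl c2 (fun t => le_trans (nIm _) (fK t)).
have iZ (g : R -> R) k : mu.-integrable setT (EFin \o g) -> mu.-integrable setT (EFin \o (fun t => k * g t)).
 by move=> ig; apply: (@integrableZl _ _ _ mu _ measurableT k _ ig).
case: c => a b /=; rewrite -[RHS]/(Complex _ _) -!RintegralZl // -RintegralB //; try exact: iZ.
rewrite -RintegralD //; try exact: iZ.
by congr (_ +i* _); apply: eq_Rintegral => t _; case: (f t).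
Qed.

Lemma cint_cts (P : pseudoMetricType R) (F : P -> R -> C) :
 ccont F ->
 (forall p : P, exists K, \forall q \near p, forall t, rnorm (F q t) <= K * wt1 t) ->
 continuous (fun p => cint (F p)).
move=> cF nF.
have cl (A : P -> R -> R) : continuous (fun z : P * R => A z.1 z.2) ->
 (forall p t, `|A p t| <= rnorm (F p t)) -> continuous (fun p => \int[mu]_t A p t).
 move=> cA AF p; have [K hK] := nF p.
 apply: (@cvg_param_int R _ _ mu setT measurableT P A p (fun t => K * wt1 t)).
 - move=> q; apply: continuous_measurable_fun.
  by apply: (cts_comp2 cA); cts.
 - move=> t _; have : continuous (A ^~ t); last exact.
  by apply: (cts_comp2 cA); cts.
 - exact: itble_wt1Z.
 - by apply: filterS hK => q h t _; exact: le_trans (AF _ _) (h t).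
apply/ccontP; split=> /=; apply: cl => [|p t].
- exact: ccontRe.
- exact: nRe.
- exact: ccontIm.
- exact: nIm.
Qed.

Lemma cder_cint (V : normedModType R) (F dF : V -> R -> C) (p v : V) K :
 (forall q, continuous (F q)) -> (forall q, exists K, forall t, rnorm (F q t) <= K * wt1 t) ->
 (forall q t, cder v (F ^~ t) q (dF q t)) ->
 (\forall q \near p, forall t, rnorm (dF q t) <= K * wt1 t) ->
 cder v (fun q => cint (F q)) p (cint (dF p)).
move=> cF bF hd nd; split=> /=.
 apply: (@der_param_int R _ _ mu setT measurableT V (fun q t => Re (F q t))
  (fun q t => Re (dF q t)) p v (fun t => K * wt1 t)).
 - move=> q; have [K' hK] := bF q; have /ccontP[c1 _] := cF q.
  by apply: (itbl c1) => t; apply: le_trans (hK t); exact: nRe.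
 - exact: itble_wt1Z.
 - apply: filterS nd => q h t _; split; first by have [] := hd q t.
  by apply: le_trans (h t); exact: nRe.
apply: (@der_param_int R _ _ mu setT measurableT V (fun q t => Im (F q t))
 (fun q t => Im (dF q t)) p v (fun t => K * wt1 t)).
- move=> q; have [K' hK] := bF q; have /ccontP[_ c1] := cF q.
 by apply: (itbl c1) => t; apply: le_trans (hK t); exact: nIm.
- exact: itble_wt1Z.
- apply: filterS nd => q h t _; split; first by have [] := hd q t.
 by apply: le_trans (h t); exact: nIm.
Qed.

Lemma cint_swap (F : R -> R -> C) K : ccont F ->
 (forall s t, rnorm (F s t) <= K * wt1 s * wt1 t) ->
 cint (fun s => cint (F s)) = cint (fun t => cint (F ^~ t)).
move=> cF FK; rewrite /cint; congr (_ +i* _) => /=.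
 by apply: Rint_swap (ccontRe cF) _ => s t; apply: le_trans (FK s t); exact: nRe.
by apply: Rint_swap (ccontIm cF) _ => s t; apply: le_trans (FK s t); exact: nIm.
Qed.

Lemma cint_shift (f : R -> C) (c : R) K : continuous f ->
 (forall t, rnorm (f t) <= K * wt1 t) ->
 cint (fun t => f (t + c)) = cint f.
move=> /ccontP[c1 c2] fK; rewrite /cint; congr (_ +i* _).
 by apply: (Rint_shift c c1) => t; apply: le_trans (fK t); exact: nRe.
by apply: (Rint_shift c c2) => t; apply: le_trans (fK t); exact: nIm.
Qed.

Section iRn.
Implicit Types P : pseudoMetricType R.

(** Domination uniform near each parameter value, the form needed to pass continuity and derivatives
    through the integral. *)
Definition ldom P n (F : P -> 'rV[R]_n -> C) :=
 forall p : P, exists K, \forall q \near p, forall x, rnorm (F q x) <= K * wt x.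

Lemma wt0 (x : 'rV[R]_0) : wt x = 1.
by rewrite /wt big_ord0. Qed.

Lemma ccomp (A B T : topologicalType) (F : A -> B -> C) (f : T -> A) (g : T -> B) :
 ccont F -> continuous f -> continuous g -> continuous (fun t => F (f t) (g t)).
exact: cts_comp2. Qed.

Lemma ccont_inner P n (F : P -> 'rV[R]_n.+1 -> C) : ccont F ->
 ccont (fun (z : P * R) (y : 'rV[R]_n) => F z.1 (row_mx z.2%:M y : 'rV_(1 + n))).
move=> cF; apply: (ccomp cF).
 by move=> z; apply: continuous_comp; exact: cvg_fst.
apply: cts_row_mx; last cts.
by move=> z; apply: continuous_comp; [exact: cvg_fst|exact: cvg_snd].
Qed.

(** Continuity and the bound are proved together: in dimension [n + 1] the outer integral can be
    estimated only once the inner one is continuous in the first coordinate. The parameter space is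
    quantified inside the induction because that coordinate joins it. *)
Lemma iRn_base n :
 (forall P (F : P -> 'rV[R]_n -> C), ccont F -> ldom F ->
  continuous (fun p => iRn (F p))) /\
 (forall (f : 'rV[R]_n -> C) K, continuous f -> (forall x, rnorm (f x) <= K * wt x) ->
  rnorm (iRn f) <= K * (2 * pi) ^+ n).
elim: n => [|n [IHc IHb]]; split.
- move=> P F cF _ /=.
 by apply: (ccomp cF); cts.
- by move=> f K _ fK /=; have := fK 0; rewrite wt0 expr0.
- move=> P F cF dF /=; apply: cint_cts.
  apply: (IHc (P * R)%type (fun z y => F z.1 (row_mx z.2%:M y : 'rV_(1 + n)))).
  exact: ccont_inner.
  move=> [p t]; have [K hK] := dF p; exists K.
  have : \forall q \near (p, t), forall x, rnorm (F q.1 x) <= K * wt x.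
  exact: (@cvg_fst _ _ (nbhs p) (nbhs t) _ _ hK).
  apply: filterS => q h y; letr (h _); rewrite wt_row_mx.
  have K0 : 0 <= K := coef_ge0 (h 0) (wt_gt0 _).
  by monol; rewrite ler_piMl ?wt1_le1.
 move=> p; have [K hK] := dF p; exists (K * (2 * pi) ^+ n).
 apply: filterS hK => q h t; rewrite mulrAC; apply: IHb.
  apply: (ccomp cF); cts.
 by move=> y; rewrite -mulrA -wt_row_mx.
- move=> f K cf fK /=; rewrite exprS mulrCA mulrC.
 apply: cint_bd.
  apply: (IHc R (fun t y => f (row_mx t%:M y : 'rV_(1 + n)))).
  apply: (ctsc cf); apply: cts_row_mx; move=> z; [exact: cvg_fst|exact: cvg_snd].
  move=> t; exists K; apply: near_all => q y; letr (fK _); rewrite wt_row_mx.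
  have K0 : 0 <= K := coef_ge0 (fK 0) (wt_gt0 _).
  by monol; rewrite ler_piMl ?wt1_le1.
 move=> t; rewrite mulrAC; apply: IHb.
  by apply: (ctsc cf); cts.
 by move=> y; rewrite -mulrA -wt_row_mx.
Qed.

Lemma iRn_cts P n (F : P -> 'rV[R]_n -> C) : ccont F -> ldom F ->
 continuous (fun p => iRn (F p)).
exact: (iRn_base n).1. Qed.

Lemma iRn_bd n (f : 'rV[R]_n -> C) K : continuous f ->
 (forall x, rnorm (f x) <= K * wt x) ->
 rnorm (iRn f) <= K * (2 * pi) ^+ n.
exact: (iRn_base n).2. Qed.

Section slices.
Variables (n : nat) (f : 'rV[R]_n.+1 -> C) (K : R).
Hypotheses (cf : continuous f) (fK : forall x, rnorm (f x) <= K * wt x).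

Lemma slice_dom t y : rnorm (f (row_mx t%:M y : 'rV_(1 + n))) <= K * wt1 t * wt y.
by rewrite -mulrA -wt_row_mx. Qed.

Lemma slice_cts t : continuous (fun y => f (row_mx t%:M y : 'rV_(1 + n))).
by apply: (ctsc cf); cts.
Qed.

Lemma slice_ccont : ccont (fun (t : R) y => f (row_mx t%:M y : 'rV_(1 + n))).
by apply: (ctsc cf); apply: cts_row_mx; move=> z; [exact: cvg_fst|exact: cvg_snd].
Qed.

Lemma slice_K0 : 0 <= K.
exact: coef_ge0 (fK 0) (wt_gt0 _). Qed.

Lemma slice_int_cts : continuous (fun t : R => iRn (fun y => f (row_mx t%:M y : 'rV_(1 + n)))).
apply: iRn_cts; first exact: slice_ccont.
move=> t; exists K; apply: near_all => q y; letr (slice_dom _ _).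
by rewrite -mulrA ler_wpM2l ?slice_K0 // ler_piMl ?wt1_le1.
Qed.

Lemma slice_id t :
 rnorm (iRn (fun y => f (row_mx t%:M y : 'rV_(1 + n)))) <= K * (2 * pi) ^+ n * wt1 t.
rewrite mulrAC; apply: iRn_bd; first exact: slice_cts.
exact: slice_dom.
Qed.
End slices.

Lemma iRnD n (f g : 'rV[R]_n -> C) K : continuous f -> continuous g ->
 (forall x, rnorm (f x) <= K * wt x) -> (forall x, rnorm (g x) <= K * wt x) ->
 iRn (fun x => f x + g x) = iRn f + iRn g.
elim: n f g K => [//|n IH] f g K cf cg fK gK /=.
rewrite -(cintD (slice_int_cts cf fK) (slice_int_cts cg gK)
 (slice_id cf fK) (slice_id cg gK)).
cext t; apply: (IH _ _ (K * wt1 t));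
 by [exact: slice_cts|exact: slice_dom].
Qed.

Lemma iRnZ n (f : 'rV[R]_n -> C) c K : continuous f ->
 (forall x, rnorm (f x) <= K * wt x) ->
 iRn (fun x => c * f x) = c * iRn f.
elim: n f K => [//|n IH] f K cf fK /=.
rewrite -(cintZ c (slice_int_cts cf fK) (slice_id cf fK)).
cext t; apply: (IH _ (K * wt1 t));
 by [exact: slice_cts|exact: slice_dom].
Qed.

Lemma iRn_shift n (f : 'rV[R]_n -> C) c K : continuous f ->
 (forall x, rnorm (f x) <= K * wt x) ->
 iRn (fun x => f (x + c)) = iRn f.
elim: n f c K => [|n IH] f c K cf fK /=; first by rewrite [c]thinmx0 addr0.
rewrite -(cint_shift ((c : 'rV_(1 + n)) 0 (lshift n 0)) (slice_int_cts cf fK) (slice_id cf fK)).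
cext t; set t' := t + _.
rewrite -(IH _ (rsubmx (c : 'rV_(1 + n))) (K * wt1 t') (@slice_cts _ _ cf t') (slice_dom fK t')).
iext y; congr f.
have E : row_mx t%:M y + (c : 'rV_(1 + n)) = row_mx t'%:M (y + rsubmx (c : 'rV_(1 + n))).
 apply/rowP => j; rewrite [in LHS]mxE; case: (split_ordP j) => k ->.
  by rewrite !row_mxEl !mxE (ord1 k) eqxx !mulr1n.
 by rewrite !row_mxEr !mxE.
exact: E.
Qed.

Lemma cder_iRn (V : normedModType R) n (F dF : V -> 'rV[R]_n -> C) (p v : V) :
 ccont F -> ccont dF -> ldom F -> ldom dF ->
 (forall q x, cder v (F ^~ x) q (dF q x)) ->
 cder v (fun q => iRn (F q)) p (iRn (dF p)).
elim: n F dF p => [|n IH] F dF p cF cdF lF ldF hd /=; first exact: hd.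
have cs (G : V -> 'rV[R]_n.+1 -> C) q : ccont G -> continuous (G q).
 by move=> cG; apply: (ccomp cG); cts.
have lb (G : V -> 'rV[R]_n.+1 -> C) q : ldom G -> exists K, forall x, rnorm (G q x) <= K * wt x.
 by move=> /(_ q)[K /nbhs_singleton hK]; exists K.
have [K hK] := ldF p.
have ccs (G : V -> 'rV[R]_n.+1 -> C) t : ccont G ->
  ccont (fun q y => G q (row_mx t%:M y : 'rV_(1 + n))).
 move=> cG; apply: (ccomp cG); cts.
have lcs (G : V -> 'rV[R]_n.+1 -> C) t : ldom G -> ldom (fun q y => G q (row_mx t%:M y : 'rV_(1 + n))).
 move=> lG q; have [K' hK'] := lG q; exists (K' * wt1 t).
 by apply: filterS hK' => q' h y; exact: slice_dom.
have := @cder_cint V (fun q t => iRn (fun y => F q (row_mx t%:M y : 'rV_(1 + n))))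
 (fun q t => iRn (fun y => dF q (row_mx t%:M y : 'rV_(1 + n)))) p v (K * (2 * pi) ^+ n).
apply.
- move=> q; have [K' hK'] := lb F q lF; exact: slice_int_cts (cs _ q cF) hK'.
- move=> q; have [K' hK'] := lb F q lF; exists (K' * (2 * pi) ^+ n) => t.
 exact: slice_id (cs _ q cF) hK' t.
- by move=> q t; apply: (IH (fun q y => F q (row_mx t%:M y : 'rV_(1 + n))) (fun q y => dF q (row_mx t%:M y : 'rV_(1 + n)))); [exact: ccs|exact: ccs|exact: lcs|exact: lcs|move=> q' y; exact: hd].
- apply: filterS hK => q h t; exact: slice_id (cs _ q cdF) h t.
Qed.

Lemma cint_iRn_swap n (F : R -> 'rV[R]_n -> C) K : ccont F ->
 (forall t x, rnorm (F t x) <= K * wt1 t * wt x) ->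
 cint (fun t => iRn (F t)) = iRn (fun x => cint (F ^~ x)).
elim: n F K => [//|n IH] F K cF FK /=.
have cs t : continuous (F t).
 by apply: (ccomp cF); cts.
have K0 : 0 <= K.
 by have := le_trans (rn_ge0 _) (FK 0 0); rewrite -mulrA pmulr_lge0 // mulr_gt0 ?wt1_gt0 ?wt_gt0.
rewrite (@cint_swap (fun t s => iRn (fun y => F t (row_mx s%:M y : 'rV_(1 + n)))) (K * (2 * pi) ^+ n)).
- cext s; rewrite (IH _ (K * wt1 s)) //.
  apply: (ccomp cF); cts.
 by move=> t y; letr (slice_dom (FK t) s y); rewrite [K * wt1 s * _]mulrAC.
- apply: (@iRn_cts (R * R)%type n (fun z y => F z.1 (row_mx z.2%:M y : 'rV_(1 + n)))).
  exact: ccont_inner.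
 move=> [t s]; exists K; apply: near_all => -[t' s'] y /=; letr (slice_dom (FK t') s' y).
 rewrite -!mulrA ler_wpM2l // mulrA ler_piMl // mulr_ile1 ?wt1_le1 //.
- move=> s t; letr (slice_id (cs s) (FK s) t).
 by rewrite [K * wt1 s * _]mulrAC.
Qed.

Lemma iRn_swap n m (F : 'rV[R]_n -> 'rV[R]_m -> C) K : ccont F ->
 (forall x y, rnorm (F x y) <= K * wt x * wt y) ->
 iRn (fun x => iRn (F x)) = iRn (fun y => iRn (F ^~ y)).
elim: n F K => [//|n IH] F K cF FK /=.
have K0 : 0 <= K.
 by have := le_trans (rn_ge0 _) (FK 0 0); rewrite -mulrA pmulr_lge0 // mulr_gt0 ?wt_gt0.
have cs y : continuous (F ^~ y).
 by apply: (ccomp cF); cts.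
have FK' y x : rnorm (F x y) <= K * wt y * wt x by rewrite mulrAC.
rewrite -(@cint_iRn_swap _ _ (K * (2 * pi) ^+ n)).
- cext t; apply: (IH _ (K * wt1 t)).
  apply: (ccomp cF); cts.
 by move=> x y; rewrite -[K * _ * _]mulrA -wt_row_mx.
- apply: (@iRn_cts (R * 'rV[R]_m)%type n (fun z x => F (row_mx z.1%:M x : 'rV_(1 + n)) z.2)).
  apply: (ccomp cF); last by move=> z; apply: continuous_comp; [exact: cvg_fst|exact: cvg_snd].
  apply: cts_row_mx; last cts.
  by move=> z; apply: continuous_comp; exact: cvg_fst.
 move=> [t y]; exists K; apply: near_all => -[t' y'] x /=; letr (slice_dom (FK' y') t' x).
 rewrite -!mulrA ler_wpM2l // mulrA ler_piMl // mulr_ile1 ?wt1_le1 ?wt_le1 //.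
- move=> t y; letr (slice_id (cs y) (FK' y) t).
 by rewrite -!mulrA (mulrC (wt y)) !mulrA.
Qed.

Lemma wt1_translate (t s : R) : wt1 (t + s) <= 2 * (1 + s ^+ 2) * wt1 t.
rewrite /wt1 ler_pdivlMr ?ltr_wpDr //.
rewrite ler_pdivrMl ?ltr_wpDr //.
have := sqr_ge0 (s * (t + s)); have := sqr_ge0 (t + 2 * s); nra.
Qed.

Lemma wt_translate n (x : 'rV[R]_n) (i : 'I_n) (s : R) :
 wt (x + s *: delta_mx 0 i) <= 2 * (1 + s ^+ 2) * wt x.
rewrite /wt (bigD1 i) //= [X in _ <= _ * X](bigD1 i) //= mulrA.
apply: ler_pM; [by []|by apply: prodr_ge0 => j _; by []| |].
 by rewrite !mxE !eqxx mulr1; exact: wt1_translate.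
apply: ler_prod => j ji; rewrite wt1_ge0 !mxE eqxx (negbTE ji) mulr0 addr0.
exact: lexx.
Qed.

Lemma cder_line (V : normedModType R) (f : V -> C) (x v : V) (l : C) (t : R) :
 cder v f (x + t *: v) l <-> cder (1 : R) (fun s => f (x + s *: v)) t l.
by split=> -[h1 h2]; split; apply/(der_line (fun y => _ (f y))).
Qed.

(** Same mechanism as on the line: the integral of a translate along the [i]-th basis vector does
    not depend on the shift, and its derivative at shift 0 is the integral of [df]. *)
Lemma iRn_der n (f df : 'rV[R]_n -> C) (i : 'I_n) K :
 continuous f -> continuous df ->
 (forall x, cder (delta_mx 0 i) f x (df x)) ->
 (forall x, rnorm (f x) <= K * wt x) ->
 (forall x, rnorm (df x) <= K * wt x) ->
 iRn df = 0.
move=> cf cdf hd fK dfK; have K0 : 0 <= K := coef_ge0 (fK 0) (wt_gt0 _).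
pose e : 'rV[R]_n := delta_mx 0 i.
have cS (g : 'rV[R]_n -> C) : continuous g -> ccont (fun (s : R) (x : 'rV[R]_n) => g (x + s *: e)).
 move=> cg; apply: (ctsc cg) => z; apply: cvgD; first exact: cvg_snd.
 by apply: cvgZr_tmp; exact: cvg_fst.
have dS (g : 'rV[R]_n -> C) : (forall x, rnorm (g x) <= K * wt x) ->
  ldom (fun (s : R) (x : 'rV[R]_n) => g (x + s *: e)).
 move=> gK s.
 (* From [(s - q)^2 <= 1] follows [q^2 <= 2 s^2 + 2], which bounds the factor [1 + q^2] of
    [wt_translate]. *)
 exists (K * (2 * (3 + 2 * s ^+ 2))); exists 1 => //= q /= qs x.
 letr (gK _); rewrite -mulrA ler_wpM2l //.
 letr (wt_translate _ _ _); monor; monol.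
 have : (s - q) ^+ 2 <= 1 by rewrite -real_normK ?num_real // exprn_ile1 // ltW.
 have := sqr_ge0 (2 * s - q); nra.
have := @cder_iRn R n (fun (s : R) (x : 'rV[R]_n) => f (x + s *: e)) (fun (s : R) (x : 'rV[R]_n) => df (x + s *: e)) 0 1
 (cS _ cf) (cS _ cdf) (dS _ fK) (dS _ dfK).
have -> : (fun q => iRn (fun x => f (x + q *: e))) = cst (iRn f).
 by ext q; exact: (iRn_shift _ cf fK).
have -> : iRn (fun x => df (x + 0 *: e)) = iRn df.
 by iext x; rewrite scale0r addr0.
have hd' q x : cder (1 : R) (fun s => f (x + s *: e)) q (df (x + q *: e)).
 by apply/cder_line; exact: hd.
move=> /(_ hd')[[_ h1] [_ h2]]; rewrite !derive_cst in h1 h2.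
by apply/eqP; rewrite eq_complex -h1 -h2 /= !eqxx.
Qed.

End iRn.

End cint.

(** * Symmetry of second derivatives *)

Section schwarz.
Variables (R : realType) (V : normedModType R).

Lemma dble_cts_line (g : V -> R) (x u : V) :
 (forall y, derivable g y u) -> continuous (fun s : R => g (x + s *: u)).
move=> dg s; apply: differentiable_continuous; apply/derivable1_diffP.
by have [] := (der_line _ _ _ _ _).1 (derivableP (dg (x + s *: u))).
Qed.

(** Two applications of the mean value theorem: along [u] to a difference in direction [v], then
    along [v] to the derivative so obtained. *)
Lemma second_difference (g : V -> R) (x u v : V) (h : R) : 0 < h ->
 (forall y, derivable g y u) -> (forall y, derivable ('D_u g) y v) ->
 exists s t : R, [/\ 0 < s < h, 0 < t < h &
  g (x + h *: u + h *: v) - g (x + h *: u) - g (x + h *: v) + g x =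
  'D_v ('D_u g) (x + s *: u + t *: v) * h ^+ 2].
move=> h0 dg ddg.
pose F (s : R) := g (x + h *: v + s *: u) - g (x + s *: u).
pose dF (s : R) := 'D_u g (x + h *: v + s *: u) - 'D_u g (x + s *: u).
have FdF (s : R) : is_derive s (1 : R) F (dF s).
 have h1 := (der_line g (x + h *: v) u _ s).1 (derivableP (dg _)).
 have h2 := (der_line g x u _ s).1 (derivableP (dg _)).
 exact: is_deriveB h1 h2.
have cF : {within `[0, h], continuous F}.
 by apply: continuous_subspaceT; apply: cts_sub; exact: dble_cts_line.
have [s sh Es] := MVT h0 (fun s _ => FdF s) cF.
pose G (t : R) := 'D_u g (x + s *: u + t *: v).
have GdG (t : R) : is_derive t (1 : R) G ('D_v ('D_u g) (x + s *: u + t *: v)).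
 exact: (der_line ('D_u g) (x + s *: u) v _ t).1 (derivableP (ddg _)).
have cG : {within `[0, h], continuous G}.
 by apply: continuous_subspaceT; exact: (@dble_cts_line ('D_u g) (x + s *: u) v ddg).
have [t th Et] := MVT h0 (fun t _ => GdG t) cG.
exists s, t; split; [by move: sh; rewrite in_itv|by move: th; rewrite in_itv|].
move: Es Et; rewrite /F /G /dF !scale0r !addr0 !subr0.
rewrite (addrAC x (h *: v) (h *: u)) (addrAC x (h *: v) (s *: u)) => Es Et.
have -> : g (x + h *: u + h *: v) - g (x + h *: u) - g (x + h *: v) + g x =
 g (x + h *: u + h *: v) - g (x + h *: u) - (g (x + h *: v) - g x) by rewrite opprB addrA addrAC.
by rewrite Es Et expr2 mulrA.
Qed.

(** The second difference with step [h] is symmetric in [u] and [v], so by [second_difference] the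
    two mixed derivatives take a common value, each at some point near [x]. Continuity of both at
    [x] lets the points shrink to [x]. *)
Lemma der_comm (g : V -> R) (x u v : V) :
 (forall y, derivable g y u) -> (forall y, derivable g y v) ->
 (forall y, derivable ('D_u g) y v) -> (forall y, derivable ('D_v g) y u) ->
 continuous ('D_v ('D_u g)) -> continuous ('D_u ('D_v g)) ->
 'D_v ('D_u g) x = 'D_u ('D_v g) x.
move=> du dv duv dvu cuv cvu; apply/eqP; rewrite -subr_eq0 -normr_le0.
apply/ler_addgt0Pr => e e0; rewrite add0r.
have e2 : 0 < e / 2 by rewrite divr_gt0.
have near2 (G : V -> R) (a b : V) : {for x, continuous G} -> exists2 d : R, 0 < d &
  forall s t : R, `|s| < d -> `|t| < d -> `|G x - G (x + s *: a + t *: b)| < e / 2.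
 move=> cG.
 have cl : (fun z : R * R => x + z.1 *: a + z.2 *: b) @ ((0 : R), (0 : R)) --> x.
  rewrite -[X in _ --> X]addr0 -[X in _ --> _ + X](scale0r b).
  rewrite -[X in _ --> X + _]addr0 -[X in _ --> _ + X + _](scale0r a).
  apply: cvgD; last by apply: cvgZr_tmp; exact: cvg_snd.
  by apply: cvgD; [exact: cvg_cst|apply: cvgZr_tmp; exact: cvg_fst].
 have cG' := @cvg_comp _ _ _ (fun z : R * R => x + z.1 *: a + z.2 *: b) G _ _ _ cl cG.
 have /cvgrPdist_lt/(_ _ e2) := cG'.
 move=> [[A B] [/= [d1 /= d10 h1] [d2 /= d20 h2]] AB].
 exists (Num.min d1 d2); first by rewrite lt_min d10.
 move=> s t; rewrite !lt_min => /andP[s1 _] /andP[_ t2].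
 by apply: (AB (s, t)); split => /=; [apply: h1|apply: h2]; rewrite /= sub0r normrN.
have [d1 d10 h1] := near2 _ u v (cuv x).
have [d2 d20 h2] := near2 _ v u (cvu x).
pose h := Num.min d1 d2 / 2.
have hm : h < Num.min d1 d2 by rewrite /h ltr_pdivrMr // ltr_pMr ?ltr1n // lt_min d10.
have [hd1 hd2] : h < d1 /\ h < d2 by move: hm; rewrite lt_min => /andP[].
have h0 : 0 < h by rewrite divr_gt0 // lt_min d10.
clearbody h; have lt_d (r d : R) : 0 < r < h -> h < d -> `|r| < d.
 by case/andP => r0 rh hd; rewrite gtr0_norm // (lt_trans rh).
have [s [t [sh th Est]]] := second_difference x h0 du duv.
have [s' [t' [sh' th' Est']]] := second_difference x h0 dv dvu.
have EE : 'D_v ('D_u g) (x + s *: u + t *: v) = 'D_u ('D_v g) (x + s' *: v + t' *: u).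
 apply: (mulIf (_ : h ^+ 2 != 0)); first by rewrite expf_neq0 // gt_eqF.
 have swap4 (a b c d : R) : a - b - c + d = a - c - b + d by rewrite (addrAC a).
 apply: etrans (esym Est) _; apply: etrans Est'; rewrite (addrAC x (h *: u)); exact: swap4.
have k1 := h1 s t (lt_d _ _ sh hd1) (lt_d _ _ th hd1).
have k2 := h2 s' t' (lt_d _ _ sh' hd2) (lt_d _ _ th' hd2).
rewrite -EE distrC in k2; rewrite [e]splitr.
letr (ler_distD ('D_v ('D_u g) (x + s *: u + t *: v)) _ _).
exact: lerD (ltW k1) (ltW k2).
Qed.

End schwarz.

(** * Smooth complex-valued functions and their iterated directional derivatives *)

Lemma cReM (R : realType) (a b : R[i]) :
 Re (a * b) = Re a * Re b - Im a * Im b.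
by case: a b => ? ? []. Qed.

Lemma cImM (R : realType) (a b : R[i]) :
 Im (a * b) = Re a * Im b + Im a * Re b.
by case: a b => ? ? []. Qed.

Section csm.
Variables (R : realType) (V : normedModType R).
Notation C := R[i].
Implicit Types (f g : V -> C) (x v : V) (vs : seq V).

Definition cD v f : V -> C := fun x =>
 'D_v (fun y => Re (f y)) x +i* 'D_v (fun y => Im (f y)) x.

Definition cDs vs f : V -> C := foldr cD f vs.

Definition cdble f x v : Prop :=
 derivable (fun y => Re (f y)) x v /\ derivable (fun y => Im (f y)) x v.

(** A one-constructor type and not a bare conjunction, so that conversion does not expand it into
    iterated derivatives. *)
Variant csm f : Prop := CSmooth of forall vs,
 continuous (cDs vs f) /\ forall x v, cdble (cDs vs f) x v.

Lemma csmE f : csm f <-> forall vs,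
 continuous (cDs vs f) /\ forall x v, cdble (cDs vs f) x v.
by split=> [[]|/CSmooth]. Qed.

Lemma cder_val v f x l : cder v f x l -> cD v f x = l.
by case: l => a b [[_ h1] [_ h2]]; rewrite /cD h1 h2. Qed.

Lemma cdbleP f x v : cdble f x v -> cder v f x (cD v f x).
by move=> [h1 h2]; split; apply: derivableP. Qed.

Lemma cder_cdble f x v l : cder v f x l -> cdble f x v.
by move=> [[h1 _] [h2 _]]; split. Qed.

Lemma cDs_cat vs1 vs2 f : cDs (vs1 ++ vs2) f = cDs vs1 (cDs vs2 f).
exact: foldr_cat. Qed.

Lemma csmc f : csm f -> continuous f.
by move=> [/(_ [::])[]]. Qed.

Lemma csm_cder f v x : csm f -> cder v f x (cD v f x).
by move=> [/(_ [::])[_ h]]; exact: cdbleP. Qed.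

Lemma csm_cDs f vs : csm f -> csm (cDs vs f).
by move=> [sf]; constructor => vs'; rewrite -cDs_cat; exact: sf. Qed.

Lemma csm_cD f v : csm f -> csm (cD v f).
exact: (@csm_cDs f [:: v]). Qed.

(** Smoothness concerns all iterated derivatives at once. It suffices to place [f] in a class of
    continuous functions that contains the directional derivatives of its members; induction on the
    word of directions does the rest. The closure properties below are obtained by choosing the
    class. *)
Lemma csm_coind (Q : (V -> C) -> Prop) :
 (forall f, Q f -> continuous f) ->
 (forall f v, Q f -> exists2 g, Q g & forall x, cder v f x (g x)) ->
 forall f, Q f -> csm f.
move=> Qc Qd f Qf; constructor=> vs.
have Qvs : Q (cDs vs f).
 elim: vs => [//|v vs IH]; have [g Qg hg] := Qd _ v IH.
 suff -> : cDs (v :: vs) f = g by [].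
 by ext x; exact: cder_val.
split; first exact: Qc.
by move=> x v; have [g _ hg] := Qd _ v Qvs; exact: cder_cdble (hg x).
Qed.

Lemma cderD f g x v l k : cder v f x l -> cder v g x k ->
 cder v (fun y => f y + g y) x (l + k).
move=> [h1 h2] [k1 k2]; split; rewrite raddfD.
 rewrite (_ : (fun y => _) = (fun y => Re (f y)) + (fun y => Re (g y))); last first.
  by ext y; rewrite raddfD.
 exact: is_deriveD.
rewrite (_ : (fun y => _) = (fun y => Im (f y)) + (fun y => Im (g y))); last first.
 by ext y; rewrite raddfD.
exact: is_deriveD.
Qed.

Lemma cderM f g x v l k : cder v f x l -> cder v g x k ->
 cder v (fun y => f y * g y) x (l * g x + f x * k).
move=> [h1 h2] [k1 k2]; split.
 rewrite (_ : (fun y => _) = (fun y => Re (f y)) * (fun y => Re (g y))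
  - (fun y => Im (f y)) * (fun y => Im (g y))); last first.
  by ext y; rewrite cReM.
 have -> : Re (l * g x + f x * k) =
  Re (f x) *: Re k + Re (g x) *: Re l
  - (Im (f x) *: Im k + Im (g x) *: Im l).
  by rewrite raddfD /= !cReM /GRing.scale /=; ring.
 by apply: is_deriveB; exact: is_deriveM.
rewrite (_ : (fun y => _) = (fun y => Re (f y)) * (fun y => Im (g y))
 + (fun y => Im (f y)) * (fun y => Re (g y))); last first.
 by ext y; rewrite cImM.
have -> : Im (l * g x + f x * k) =
 Re (f x) *: Im k + Im (g x) *: Re l
 + (Im (f x) *: Re k + Re (g x) *: Im l).
 by rewrite raddfD /= !cImM /GRing.scale /=; ring.
by apply: is_deriveD; exact: is_deriveM.
Qed.

Lemma cder_cst (c : C) x v : cder v (fun _ => c) x 0.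
by split; exact: is_derive_cst. Qed.

Lemma cderZ f x v l (c : C) : cder v f x l -> cder v (fun y => c * f y) x (c * l).
move=> h; have := cderM (cder_cst c x v) h.
by rewrite mul0r add0r.
Qed.

Lemma cder_eq f x v l k : cder v f x l -> l = k -> cder v f x k.
by move=> h <-. Qed.

Lemma cder_real (h : V -> R) x v l : is_derive x v h l -> cder v (fun y => (h y)%:C) x l%:C.
by move=> hl; split=> //=; exact: is_derive_cst. Qed.

Lemma cDsc v vs f : cDs (v :: vs) f = cD v (cDs vs f). Proof. by []. Qed.

Lemma cDsn f : cDs [::] f = f. Proof. by []. Qed.

Lemma csm_dble_Re f x v : csm f -> derivable (fun y => Re (f y)) x v.
by move=> [h]; have [_ h1] := h [::]; have [] := h1 x v. Qed.

Lemma csm_dble_Im f x v : csm f -> derivable (fun y => Im (f y)) x v.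
by move=> [h]; have [_ h1] := h [::]; have [] := h1 x v. Qed.

Lemma cD_Re v f : (fun y => Re (cD v f y)) = 'D_v (fun y => Re (f y)).
by []. Qed.

Lemma cD_Im v f : (fun y => Im (cD v f y)) = 'D_v (fun y => Im (f y)).
by []. Qed.

Opaque cD cDs cder.

(** A class for the coinduction: derivatives of a product are sums of products, so sums and products
    must be closed off together. *)
Inductive sm_alg : (V -> C) -> Prop :=
| smooth_algebra_csmooth f : csm f -> sm_alg f
| smooth_algebra_cst c : sm_alg (fun _ => c)
| smooth_algebraD f g : sm_alg f -> sm_alg g -> sm_alg (fun x => f x + g x)
| smooth_algebraM f g : sm_alg f -> sm_alg g -> sm_alg (fun x => f x * g x).

Lemma sm_algP f : sm_alg f -> csm f.
apply: csm_coind => {f} [f|f v].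
 elim=> {f} [f sf|c|f g _ cf _ cg|f g _ cf _ cg]; [exact: csmc|cts| |].
  exact: (ccontD cf cg).
 exact: (ccontM cf cg).
elim=> {f} [f sf|c|f g _ [f' af hf] _ [g' ag hg]|f g Af [f' af hf] Ag [g' ag hg]].
- exists (cD v f); first exact/smooth_algebra_csmooth/csm_cD.
 by move=> x; exact: csm_cder.
- by exists (fun _ => 0); [exact: smooth_algebra_cst|move=> x; exact: cder_cst].
- exists (fun x => f' x + g' x); first exact: smooth_algebraD.
 by move=> x; exact: cderD.
- exists (fun x => f' x * g x + f x * g' x).
  by apply: smooth_algebraD; exact: smooth_algebraM.
 by move=> x; exact: cderM.
Qed.

Lemma csm_cst (c : C) : csm (fun _ => c).
exact/sm_algP/smooth_algebra_cst. Qed.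

Lemma csmD f g : csm f -> csm g -> csm (fun x => f x + g x).
by move=> sf sg; apply/sm_algP/smooth_algebraD; exact: smooth_algebra_csmooth. Qed.

Lemma csmM f g : csm f -> csm g -> csm (fun x => f x * g x).
by move=> sf sg; apply/sm_algP/smooth_algebraM; exact: smooth_algebra_csmooth. Qed.

Lemma csmZ c f : csm f -> csm (fun x => c * f x).
by move=> sf; apply: csmM => //; exact: csm_cst. Qed.

Lemma csm_sum (I : Type) (s : seq I) (F : I -> V -> C) :
 (forall i, csm (F i)) -> csm (fun x => \sum_(i <- s) F i x).
move=> sF; elim: s => [|i s IH].
 by under eq_fun do rewrite big_nil; exact: csm_cst.
by under eq_fun do rewrite big_cons; exact: csmD.
Qed.

Lemma cD_D f g v : csm f -> csm g -> cD v (fun x => f x + g x) = fun x => cD v f x + cD v g x.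
by move=> sf sg; ext x; apply: cder_val; apply: cderD; exact: csm_cder.
Qed.

Lemma cD_M f g v : csm f -> csm g ->
 cD v (fun x => f x * g x) = fun x => cD v f x * g x + f x * cD v g x.
by move=> sf sg; ext x; apply: cder_val; apply: cderM; exact: csm_cder.
Qed.

Lemma cD_Z c f v : csm f -> cD v (fun x => c * f x) = fun x => c * cD v f x.
by move=> sf; ext x; apply: cder_val; apply: cderZ; exact: csm_cder.
Qed.

Lemma cD_cst c v : cD v (fun _ => c) = fun _ => 0.
by ext x; apply: cder_val; exact: cder_cst. Qed.

Lemma cDs_D f g vs : csm f -> csm g ->
 cDs vs (fun x => f x + g x) = fun x => cDs vs f x + cDs vs g x.
move=> sf sg; elim: vs => [|v vs IH]; first by rewrite !cDsn.
by rewrite !cDsc IH cD_D //; exact: csm_cDs.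
Qed.

Lemma cDs_Z c f vs : csm f -> cDs vs (fun x => c * f x) = fun x => c * cDs vs f x.
move=> sf; elim: vs => [|v vs IH]; first by rewrite !cDsn.
by rewrite !cDsc IH cD_Z //; exact: csm_cDs.
Qed.

Lemma cDs_cst c v vs : cDs (v :: vs) (fun _ => c) = fun _ => 0.
elim: vs v => [|w vs IH] v; first by rewrite cDsc cDsn cD_cst.
by rewrite cDsc IH cD_cst.
Qed.

Lemma cDs_sum (I : Type) (s : seq I) (F : I -> V -> C) vs :
 (forall i, csm (F i)) ->
 cDs vs (fun x => \sum_(i <- s) F i x) = fun x => \sum_(i <- s) cDs vs (F i) x.
move=> sF; elim: s => [|i s IH].
 have -> : (fun x => \sum_(i <- [::]) F i x) = (fun _ => 0).
  by ext x; rewrite big_nil.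
 ext x; rewrite big_nil; case: vs => [|v vs]; first by rewrite cDsn.
 by rewrite cDs_cst.
have -> : (fun x => \sum_(j <- i :: s) F j x) = (fun x => F i x + \sum_(j <- s) F j x).
 by ext x; rewrite big_cons.
rewrite cDs_D //; last exact: csm_sum.
by ext x; rewrite IH big_cons.
Qed.

(** All distributions of the letters of a word over two words, order preserved, with multiplicity:
    the index set of the Leibniz rule. *)
Fixpoint spl (T : Type) (s : seq T) : seq (seq T * seq T) :=
 if s is x :: s' then
  [seq (x :: p.1, p.2) | p <- spl s'] ++ [seq (p.1, x :: p.2) | p <- spl s']
 else [:: ([::], [::])].

Lemma cDs_M f g vs : csm f -> csm g ->
 cDs vs (fun x => f x * g x) =
 fun x => \sum_(p <- spl vs) cDs p.1 f x * cDs p.2 g x.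
move=> sf sg; elim: vs => [|v vs IH].
 by ext x; rewrite big_seq1 !cDsn.
have sfg (p : seq V * seq V) : csm (fun x => cDs p.1 f x * cDs p.2 g x).
 by apply: csmM; exact: csm_cDs.
have E := cDs_sum (spl vs) [:: v] sfg.
rewrite cDsc IH -[cD v _]cDsn -[cDs [::] (cD v _)]/(cDs [:: v] _) E.
ext x; rewrite [spl (v :: vs)]/= big_cat !big_map /= -big_split; apply: eq_bigr => p _ /=.
by rewrite !cDsc cDsn cD_M //; exact: csm_cDs.
Qed.

Lemma cD_comm f u v : csm f -> cD u (cD v f) = cD v (cD u f).
move=> sf; ext x.
have d w : csm (cD w f) by exact: csm_cD.
have dd w w' : csm (cD w (cD w' f)) by do 2!apply: csm_cD.
have r w y : derivable (fun y => Re (f y)) y w by exact: csm_dble_Re.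
have i w y : derivable (fun y => Im (f y)) y w by exact: csm_dble_Im.
have r2 w w' y : derivable ('D_w' (fun y => Re (f y))) y w.
 by rewrite -cD_Re; exact: csm_dble_Re.
have i2 w w' y : derivable ('D_w' (fun y => Im (f y))) y w.
 by rewrite -cD_Im; exact: csm_dble_Im.
have rc w w' : continuous ('D_w ('D_w' (fun y => Re (f y)))).
 by rewrite -!cD_Re; exact: ((ccontP _).1 (csmc (dd w w'))).1.
have ic w w' : continuous ('D_w ('D_w' (fun y => Im (f y)))).
 by rewrite -!cD_Im; exact: ((ccontP _).1 (csmc (dd w w'))).2.
have e1 := der_comm x (r v) (r u) (r2 u v) (r2 v u) (rc u v) (rc v u).
have e2 := der_comm x (i v) (i u) (i2 u v) (i2 v u) (ic u v) (ic v u).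
have E1 : Re (cD u (cD v f) x) = Re (cD v (cD u f) x).
 by move: e1; rewrite -!cD_Re.
have E2 : Im (cD u (cD v f) x) = Im (cD v (cD u f) x).
 by move: e2; rewrite -!cD_Im.
move: E1 E2; case: (cD u _ x) => ? ?; case: (cD v _ x) => ? ? /= -> ->.
by [].
Qed.

Lemma cDs_cD_comm f v vs : csm f -> cD v (cDs vs f) = cDs vs (cD v f).
move=> sf; elim: vs => [|w vs IH]; first by rewrite !cDsn.
by rewrite !cDsc cD_comm ?IH //; exact: csm_cDs.
Qed.

Lemma cDs_comm f vs ws : csm f -> cDs vs (cDs ws f) = cDs ws (cDs vs f).
move=> sf; elim: vs => [|w vs IH]; first by rewrite !cDsn.
by rewrite !cDsc IH cDs_cD_comm //; exact: csm_cDs.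
Qed.

Lemma cDs_perm (W : eqType) (e : W -> V) f (s t : seq W) : csm f -> perm_eq s t ->
 cDs (map e s) f = cDs (map e t) f.
move=> sf st; have P := @catCA_perm_ind _ (fun u => cDs (map e s) f = cDs (map e u) f).
apply: (P _ s t st) => // s1 s2 s3 ->.
by rewrite !map_cat !cDs_cat cDs_comm //; exact: csm_cDs.
Qed.

End csm.

(** * Chain rules and affine substitutions *)

Section chain.
Variable R : realType.
Notation C := R[i].

Lemma cderE (V : normedModType R) (f : V -> C) (x v : V) l :
 cder v f x l <-> is_derive x v (fun y => Re (f y)) (Re l) /\
  is_derive x v (fun y => Im (f y)) (Im l).
by []. Qed.

Lemma cder_comp (U V : normedModType R) (f : V -> C) (h : U -> V) (y w : U) (v : V) l :
 (forall t : R, h (y + t *: w) = h y + t *: v) ->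
 cder v f (h y) l -> cder w (fun x => f (h x)) y l.
move=> hE hf; have := (cder_line (fun x => f (h x)) y w l 0).2.
rewrite scale0r addr0; apply.
rewrite (_ : (fun s => _) = fun s => f (h y + s *: v)); last by ext s; rewrite hE.
by apply/(cder_line f); rewrite scale0r addr0.
Qed.

(** [L] is the linear part of the affine map [h]: the derivative of the composite along [w] is the
    composite of the derivative along [L w], which keeps the class of composites stable. *)
Lemma csm_aff (U V : normedModType R) (f : V -> C) (h : U -> V) (L : U -> V) :
 continuous h -> (forall y w (t : R), h (y + t *: w) = h y + t *: L w) ->
 csm f -> csm (fun x => f (h x)) /\
 forall ws, cDs ws (fun x => f (h x)) = fun x => cDs (map L ws) f (h x).
move=> ch hE sf.
have D (g : V -> C) w : csm g -> forall x, cder w (fun x => g (h x)) x (cD (L w) g (h x)).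
 by move=> sg x; apply: (cder_comp (hE x w)); exact: csm_cder.
split.
 apply: (csm_coind (Q := fun F => exists2 g, csm g & F = fun x => g (h x))); last by exists f.
  by move=> _ [g sg ->]; apply: (ctsc (csmc sg) ch).
 move=> _ w [g sg ->]; exists (fun x => cD (L w) g (h x)); last exact: D.
 by exists (cD (L w) g) => //; exact: csm_cD.
elim=> [|w ws IH]; first by rewrite [map _ _]/= !cDsn.
rewrite cDsc IH [map _ (_ :: _)]/= cDsc; ext x; apply: cder_val.
by apply: D; exact: csm_cDs.
Qed.

Lemma der_chain (phi g : R -> R) (t : R) a b :
 is_derive (g t) 1 phi a -> is_derive t 1 g b -> is_derive t 1 (fun s => phi (g s)) (b * a).
by move=> h1 h2; have h := @is_derive1_comp _ phi g t _ _ h1 h2; apply: is_derive_eq h _; rewrite mulrC. Qed.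

Lemma cder_expi (V : normedModType R) (h : V -> R) (x v : V) (l : R) :
 is_derive x v h l -> cder v (fun y => expi (h y)) x ('i * l%:C * expi (h x)).
move=> hl.
have hl0 : is_derive 0 (1 : R) (fun s => h (x + s *: v)) l.
 by apply/(der_line h); rewrite scale0r addr0.
have := (cder_line (fun y => expi (h y)) x v ('i * l%:C * expi (h x)) 0).2.
rewrite scale0r addr0; apply; apply/cderE; split.
 have h1 := der_chain (is_derive_cos _) hl0.
 by apply: is_derive_eq h1 _; rewrite scale0r addr0 /=; ring.
have h2 := der_chain (is_derive_sin _) hl0.
by apply: is_derive_eq h2 _; rewrite scale0r addr0 /=; ring.
Qed.

Lemma der_affine (V : normedModType R) (h : V -> R) (x v : V) (l : R) :
 (forall t : R, h (x + t *: v) = h x + t * l) -> is_derive x v h l.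
move=> hE; have := (der_line h x v l 0).2; rewrite scale0r addr0; apply.
rewrite (_ : (fun s => _) = cst (h x) + l \*: id); last first.
 by ext s; rewrite hE /= mulrC.
have E : 0 + l *: (1 : R) = l by rewrite add0r /GRing.scale /= mulr1.
have H : is_derive (0 : R) (1 : R) (cst (h x) + l \*: id) (0 + l *: (1 : R)) by apply: is_deriveD.
by rewrite E in H.
Qed.

Lemma dotDl n (x y z : 'rV[R]_n) : dot (x + y) z = dot x z + dot y z.
by rewrite /dot -big_split; apply: eq_bigr => i _; rewrite mxE mulrDl. Qed.

Lemma dotZl n t (x z : 'rV[R]_n) : dot (t *: x) z = t * dot x z.
by rewrite /dot mulr_sumr; apply: eq_bigr => i _; rewrite mxE mulrA. Qed.

Lemma dotC n (x y : 'rV[R]_n) : dot x y = dot y x.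
by apply: eq_bigr => i _; rewrite mulrC. Qed.

Lemma dot_delta n (i : 'I_n) (x : 'rV[R]_n) : dot (delta_mx 0 i) x = x 0 i.
rewrite /dot (bigD1 i) //= big1 ?addr0 ?mxE ?eqxx ?mul1r // => j ji.
by rewrite mxE eqxx (negbTE ji) mul0r.
Qed.

Lemma cder_expi_dot n (sg : R) (z y v : 'rV[R]_n) :
 cder v (fun y => expi (sg * dot y z)) y ('i * (sg * dot v z)%:C * expi (sg * dot y z)).
apply: cder_expi; apply: der_affine => t.
by rewrite dotDl dotZl; ring.
Qed.

Lemma dot_row_mx n (t s : R) (y z : 'rV[R]_n) :
 dot (row_mx t%:M y : 'rV_(1 + n)) (row_mx s%:M z : 'rV_(1 + n)) = t * s + dot y z.
rewrite /dot big_split_ord big_ord1 !row_mxEl !mxE eqxx !mulr1n; congr (_ + _).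
by apply: eq_bigr => i _; rewrite !row_mxEr.
Qed.

End chain.

(** * Derivatives of the product weight *)

Section weight_derivatives.
Variables (R : realType) (n : nat).
Notation C := R[i].
Notation rV := 'rV[R]_n.

(** The bounded functions generated by [1 / (1 + x_j^2)] and [x_j / (1 + x_j^2)]. Their derivatives
    stay in the algebra, and every derivative of [wt] is [wt] times a member, hence dominated by
    [wt]. *)
Inductive wt_alg : (rV -> C) -> Prop :=
| weight_algebra_cst c : wt_alg (fun _ => c)
| weight_algebra_den j : wt_alg (fun x => (wt1 (x 0 j))%:C)
| weight_algebra_num j : wt_alg (fun x => (x 0 j * wt1 (x 0 j))%:C)
| weight_algebraD f g : wt_alg f -> wt_alg g -> wt_alg (fun x => f x + g x)
| weight_algebraM f g : wt_alg f -> wt_alg g -> wt_alg (fun x => f x * g x).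

Lemma der_coord (x v : rV) j : is_derive x v (fun y => y 0 j) (v 0 j).
by apply: der_affine => t; rewrite !mxE. Qed.

Lemma der_coordc (phi dphi : R -> R) (x v : rV) j :
 (forall t : R, is_derive t 1 phi (dphi t)) ->
 is_derive x v (fun y => phi (y 0 j)) (v 0 j * dphi (x 0 j)).
move=> h; have := (der_line (fun y : rV => phi (y 0 j)) x v (v 0 j * dphi (x 0 j)) 0).2.
rewrite scale0r addr0; apply.
have h0 : is_derive 0 (1 : R) (fun s => (x + s *: v) 0 j) (v 0 j).
 by apply/(der_line (fun y : rV => y 0 j)); rewrite scale0r addr0; exact: der_coord.
have hx : is_derive ((x + 0 *: v) 0 j) 1 phi (dphi (x 0 j)) by rewrite scale0r addr0.
exact: (der_chain hx h0).
Qed.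

Lemma der_wt1 (t : R) : is_derive t 1 (@wt1 R) (- (2 * (t * wt1 t) * wt1 t)).
have hd : is_derive t (1 : R) (fun s : R => 1 + s ^+ 2) (2 * t).
 have h := @is_deriveD R R R (cst 1) (fun s => s ^+ 2) t 1 0 (2 * t).
 rewrite add0r in h; apply: h.
 have E : (fun s : R => s ^+ 2) = id ^+ 2 by ext s; rewrite !expr2.
 rewrite E; apply: is_derive_eq.
 by rewrite /GRing.scale /= expr1 mulr1.
have n0 : 1 + t ^+ 2 != 0 by rewrite gt_eqF // ltr_wpDr // sqr_ge0.
have h : is_derive t (1 : R) (fun s : R => (1 + s ^+ 2)^-1) (- (1 + t ^+ 2) ^- 2 *: (2 * t)).
 by have [d1 <-] := hd; split; [exact: (@derivableV _ _ (fun s : R => 1 + s ^+ 2))|exact: (@deriveV _ _ (fun s : R => 1 + s ^+ 2))].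
apply: is_derive_eq h _.
by rewrite /wt1 /GRing.scale /=; field.
Qed.

Lemma der_twt1 (t : R) :
 is_derive t 1 (fun t => t * wt1 t) (wt1 t - 2 * (t * wt1 t) ^+ 2).
have h := is_deriveM (is_derive_id t (1 : R)) (der_wt1 t).
by apply: is_derive_eq h _; rewrite /GRing.scale /=; ring.
Qed.

Lemma normr_twt1 (t : R) : `|t * wt1 t| <= 1.
have w0 : 0 < 1 + t ^+ 2 by rewrite ltr_wpDr // sqr_ge0.
rewrite normrM (ger0_norm (wt1_ge0 t)) /wt1 ler_pdivrMr // mul1r.
have := sqr_ge0 (`|t| - 1); rewrite -(real_normK (num_real t)); nra.
Qed.

Lemma wt_alg_cts f : wt_alg f -> continuous f.
have c1 j : continuous (fun x : rV => x 0 j) by exact: coord_continuous.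
have c2 j : continuous (fun x : rV => wt1 (x 0 j)) by apply: (ctsc (@cts_wt1 R)).
elim=> {f} [c|j|j|f g _ cf _ cg|f g _ cf _ cg].
- cts.
- exact: ctsC.
- by apply: ctsC; exact: cts_mul.
- exact: (ccontD cf cg).
- exact: (ccontM cf cg).
Qed.

Lemma wt_alg_bdd f : wt_alg f -> exists K, forall x, rnorm (f x) <= K.
elim=> {f} [c|j|j|f g _ [K1 h1] _ [K2 h2]|f g _ [K1 h1] _ [K2 h2]].
- by exists (rnorm c).
- by exists 1 => x; rewrite rnr ger0_norm ?wt1_ge0 ?wt1_le1.
- by exists 1 => x; rewrite rnr normr_twt1.
- by exists (K1 + K2) => x; letr (rnD _ _); exact: lerD.
- by exists (K1 * K2) => x; rewrite rnM; apply: ler_pM => //.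
Qed.

Lemma wt_alg_der f v : wt_alg f ->
 exists2 g, wt_alg g & forall x, cder v f x (g x).
elim=> {f} [c|j|j|f g Af [f' af hf] Ag [g' ag hg]|f g Af [f' af hf] Ag [g' ag hg]].
- by exists (fun _ => 0); [exact: weight_algebra_cst|move=> x; exact: cder_cst].
- exists (fun x => (- (2 * v 0 j))%:C * ((x 0 j * wt1 (x 0 j))%:C * (wt1 (x 0 j))%:C)).
  apply: weight_algebraM; first exact: weight_algebra_cst.
  by apply: weight_algebraM; [exact: weight_algebra_num|exact: weight_algebra_den].
 move=> x; rewrite -!rmorphM /=; apply: cder_real.
 apply: is_derive_eq (der_coordc x v j der_wt1) _; ring.
- exists (fun x => (v 0 j)%:C * ((wt1 (x 0 j))%:C + (-2)%:C * ((x 0 j * wt1 (x 0 j))%:C * (x 0 j * wt1 (x 0 j))%:C))).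
  apply: weight_algebraM; first exact: weight_algebra_cst.
  apply: weight_algebraD; first exact: weight_algebra_den.
  apply: weight_algebraM; first exact: weight_algebra_cst.
  by apply: weight_algebraM; exact: weight_algebra_num.
 move=> x; rewrite -!rmorphM -rmorphD -rmorphM /=; apply: cder_real.
 apply: is_derive_eq (der_coordc x v j der_twt1) _; ring.
- exists (fun x => f' x + g' x); first exact: weight_algebraD.
 by move=> x; exact: cderD.
- exists (fun x => f' x * g x + f x * g' x).
  by apply: weight_algebraD; exact: weight_algebraM.
 by move=> x; exact: cderM.
Qed.

Lemma wt_der v : exists2 g, wt_alg g &
 forall x : rV, cder v (fun x => (wt x)%:C) x ((wt x)%:C * g x).
rewrite /wt; elim: (index_enum _) => [|j s [g ag hg]].
 exists (fun _ => 0); first exact: weight_algebra_cst.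
 move=> x; rewrite mulr0.
 rewrite (_ : (fun y => _) = fun _ => 1); last by ext y; rewrite big_nil.
 exact: cder_cst.
exists (fun x : rV => (- (2 * v 0 j))%:C * (x 0 j * wt1 (x 0 j))%:C + g x).
 apply: weight_algebraD => //; apply: weight_algebraM; [exact: weight_algebra_cst|exact: weight_algebra_num].
move=> x; rewrite (_ : (fun y => _) = fun y : rV => (wt1 (y 0 j))%:C * (\prod_(i <- s) wt1 (y 0 i))%:C); last first.
 by ext y; rewrite big_cons rmorphM.
have h1 := cder_real (der_coordc x v j der_wt1).
apply: (cder_eq (cderM h1 (hg x))).
rewrite big_cons !rmorphM !rmorphN /= !rmorphM /=; ring.
Qed.

Lemma wt_sm : csm (fun x : rV => (wt x)%:C) /\
 forall vs, exists K, forall x, rnorm (cDs vs (fun x : rV => (wt x)%:C) x) <= K * wt x.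
pose Q (F : rV -> C) := exists2 f, wt_alg f & F = fun x => (wt x)%:C * f x.
have Q1 : Q (fun x => (wt x)%:C).
 exists (fun _ => 1); first exact: weight_algebra_cst.
 by ext x; rewrite mulr1.
have Qc F : Q F -> continuous F.
 move=> [f af ->]; apply: ccontM; last exact: wt_alg_cts.
 by apply: ctsC; exact: cts_wt.
have Qd F v : Q F -> exists2 G, Q G & forall x, cder v F x (G x).
 move=> [f af ->]; have [f' af' hf'] := wt_alg_der v af.
 have [g ag hg] := wt_der v.
 exists (fun x => (wt x)%:C * (g x * f x + f' x)).
  exists (fun x => g x * f x + f' x) => //.
  by apply: weight_algebraD => //; exact: weight_algebraM.
 move=> x; apply: (cder_eq (cderM (hg x) (hf' x))); ring.
split; first exact: csm_coind Qc Qd _ Q1.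
move=> vs; suff [f af ->] : Q (cDs vs (fun x => (wt x)%:C)).
 have [K hK] := wt_alg_bdd af; exists K => x.
 by rewrite rnM rnr ger0_norm // mulrC ler_wpM2r.
elim: vs => [|v vs IH]; first by rewrite cDsn.
have [G QG hG] := Qd _ v IH; rewrite cDsc.
by have -> : cD v (cDs vs (fun x => (wt x)%:C)) = G by ext x; exact: cder_val.
Qed.

End weight_derivatives.

(** * The Gaussian and Fourier inversion in one dimension *)

Section gaussian.
Variable R : realType.
Notation C := R[i].
Notation mu := (@lebesgue_measure R).

(** [exp(-t^2)] is the inverse square of [exp(t^2 / 2)], which is at least [1 + t^2 / 2]. *)
Lemma gauss_wt1 (t : R) : gauss_fun t <= 2 * wt1 t /\ `|t| * gauss_fun t <= 2 * wt1 t.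
have e1 : gauss_fun t <= ((1 + t ^+ 2 / 2) ^+ 2)^-1.
 have -> : gauss_fun t = (expR (t ^+ 2 / 2) ^+ 2)^-1.
  by rewrite /gauss_fun expRN -expRM_natl; congr ((expR _)^-1); field.
 have q0 : 0 < 1 + t ^+ 2 / 2 by rewrite ltr_wpDr // divr_ge0 // sqr_ge0.
 rewrite lef_pV2 ?posrE ?exprn_gt0 ?expR_gt0 // ler_pXn2r ?nnegrE ?expR_ge0 ?(ltW q0) //.
 by have := expR_ge1Dx (t ^+ 2 / 2).
have p : 0 < 1 + t ^+ 2 by rewrite ltr_wpDr // sqr_ge0.
have q : 0 < (1 + t ^+ 2 / 2) ^+ 2 by rewrite exprn_gt0 // ltr_wpDr // divr_ge0 // sqr_ge0.
have t2 : `|t| ^+ 2 = t ^+ 2 by rewrite real_normK ?num_real.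
split; first (letr e1; rewrite /wt1 ler_pdivlMr // ler_pdivrMl //; have := sqr_ge0 (t ^+ 2); nra).
letr (ler_wpM2l (normr_ge0 t) e1).
rewrite /wt1 ler_pdivlMr // mulrAC ler_pdivrMr //.
have a0 := normr_ge0 t; have := sqr_ge0 (`|t| - 1); rewrite -t2; nra.
Qed.

Lemma cint_der (f df : R -> C) K : continuous df ->
 (forall t, cder (1 : R) f t (df t)) ->
 (forall t, rnorm (f t) <= K * wt1 t) -> (forall t, rnorm (df t) <= K * wt1 t) ->
 cint df = 0.
move=> /ccontP[c1 c2] fdf fK dfK; rewrite /cint.
have e1 : \int[mu]_t Re (df t) = 0.
 apply: (@Rint_der R (fun t => Re (f t)) (fun t => Re (df t)) K c1).
 - by move=> t; have /cderE[] := fdf t.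
 - by move=> t; apply: le_trans (nRe _) (fK t).
 - by move=> t; apply: le_trans (nRe _) (dfK t).
have e2 : \int[mu]_t Im (df t) = 0.
 apply: (@Rint_der R (fun t => Im (f t)) (fun t => Im (df t)) K c2).
 - by move=> t; have /cderE[] := fdf t.
 - by move=> t; apply: le_trans (nIm _) (fK t).
 - by move=> t; apply: le_trans (nIm _) (dfK t).
by rewrite e1 e2.
Qed.

Lemma Integral_scale (g : R -> R) (e : R) : 0 < e -> continuous g -> (forall t, 0 <= g t) ->
 (\int[mu]_t (g t)%:E = \int[mu]_t (e * g (e * t))%:E)%E.
move=> e0 cg g0.
have dS (t : R) : is_derive t (1 : R) (fun t => e * t) e.
 by apply: der_affine => s; rewrite /GRing.scale /= mulr1; ring.
have dE : derive1 (fun t : R => e * t) = cst e.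
 by ext t; rewrite derive1E; have [_ ->] := dS t.
rewrite [LHS](@increasing_ge0_integration_by_substitutionT R (fun t => e * t)) //.
- by rewrite dE; apply: eq_integral => t _ /=; rewrite fctE /= mulrC.
- by move=> x y; rewrite ltr_pM2l.
- by rewrite dE; exact: cst_continuous.
- by rewrite dE; exact: is_cvg_cst.
- by rewrite dE; exact: is_cvg_cst.
- by apply/gt0_cvgMrNy => //; exact: cvg_id.
- by apply/gt0_cvgMry => //; exact: cvg_id.
Qed.

(** As for translations, [K * wt1] is added to reach a nonnegative integrand. *)
Lemma Rint_scale (f : R -> R) (e K : R) : 0 < e -> continuous f ->
 (forall t, `|f t| <= K * wt1 t) ->
 \int[mu]_t f (e * t) = e^-1 * \int[mu]_t f t.
move=> e0 cf fK.
have K0 : 0 <= K by have := le_trans (normr_ge0 _) (fK 0); rewrite pmulr_lge0 // wt1_gt0.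
have cS (g : R -> R) : continuous g -> continuous (fun t => g (e * t)).
 by move=> cg; apply: (ctsc cg); cts.
have ck : continuous (fun t => K * wt1 t).
 cts.
have k0 t : 0 <= K * wt1 t by rewrite mulr_ge0.
pose M : R := 1 + e ^- 2.
have sK (g : R -> R) : (forall t, `|g t| <= K * wt1 t) -> forall t, `|g (e * t)| <= K * M * wt1 t.
 move=> gK t; letr (gK _); rewrite -mulrA ler_wpM2l // /wt1.
 have p1 : 0 < 1 + t ^+ 2 by rewrite ltr_wpDr // sqr_ge0.
 have p2 : 0 < 1 + (e * t) ^+ 2 by rewrite ltr_wpDr // sqr_ge0.
 rewrite ler_pdivlMr // ler_pdivrMl //.
 have E : e ^+ 2 * e ^- 2 = 1 by rewrite divff // expf_neq0 // gt_eqF.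
 have i0 : 0 < e ^- 2 by rewrite invr_gt0 exprn_gt0.
 have -> : (1 + (e * t) ^+ 2) * M = 1 + e ^- 2 + e ^+ 2 * t ^+ 2 + (e ^+ 2 * e ^- 2) * t ^+ 2.
  by rewrite /M exprMn; ring.
 rewrite E mul1r; have := sqr_ge0 t; have := sqr_ge0 e; nra.
pose h t := f t + K * wt1 t.
have ch : continuous h by exact: cts_add.
have h0 t : 0 <= h t.
 by rewrite /h -lerBlDr sub0r; have := fK t; rewrite ler_norml => /andP[].
have nk t : `|K * wt1 t| <= K * wt1 t by rewrite ger0_norm.
have S (g : R -> R) : continuous g -> (forall t, 0 <= g t) -> mu.-integrable setT (EFin \o (fun t => g (e * t))) ->
  \int[mu]_t g (e * t) = e^-1 * \int[mu]_t g t.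
 move=> cg g0 ig; rewrite [X in _ = _ * X]/Rintegral (Integral_scale e0 cg g0) -/(Rintegral _ _ _).
 by rewrite RintegralZl // mulKf // gt_eqF.
have i1 := itbl cf fK.
have i2 : mu.-integrable setT (EFin \o (fun t => K * wt1 t)) by exact: itble_wt1Z.
have j1 := itbl (cS _ cf) (sK _ fK).
have j2 := itbl (cS _ ck) (sK _ nk).
have jh : mu.-integrable setT (EFin \o (fun t => h (e * t))).
 exact: (@integrableD _ _ _ mu setT measurableT _ _ j1 j2).
have := S _ ch h0 jh; rewrite /h RintegralD // RintegralD // (S _ ck k0 j2) mulrDr.
exact: addIr.
Qed.

Lemma cint_scale (f : R -> C) (e K : R) : 0 < e -> continuous f ->
 (forall t, rnorm (f t) <= K * wt1 t) ->
 cint (fun t => f (e * t)) = (e^-1)%:C * cint f.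
move=> e0 /ccontP[c1 c2] fK; rewrite /cint.
rewrite (Rint_scale e0 c1 (fun t => le_trans (nRe _) (fK t))).
rewrite (Rint_scale e0 c2 (fun t => le_trans (nIm _) (fK t))).
by apply/eqP; rewrite eq_complex /= !mul0r subr0 addr0 !eqxx.
Qed.

Definition gaussT (y : R) : C := cint (fun t => (gauss_fun t)%:C * expi (y * t)).

Lemma cts_gauss_I (y : R) : continuous (fun t => (gauss_fun t)%:C * expi (y * t)).
apply: ccontM; first by apply: ctsC; exact: continuous_gauss_fun.
cts.
Qed.

(** Integration by parts in [t] gives the equation [G' = -(y / 2) G], so [G] times [exp(y^2 / 4)] is
    constant, and at 0 it is the Gauss integral. *)
Lemma gaussTE (y : R) : gaussT y = (Num.sqrt pi * gauss_fun (y / 2))%:C.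
pose F (y t : R) : C := (gauss_fun t)%:C * expi (y * t).
pose dF (y t : R) : C := 'i * (t * gauss_fun t)%:C * expi (y * t).
have FK z t : rnorm (F z t) <= 2 * wt1 t.
 by rewrite rnM rne mulr1 rnr ger0_norm ?gauss_fun_ge0 //; have [] := gauss_wt1 t.
have dFK z t : rnorm (dF z t) <= 2 * wt1 t.
 rewrite !rnM rne mulr1 rni mul1r rnr normrM (ger0_norm (gauss_fun_ge0 t)).
 by have [] := gauss_wt1 t.
have cid : continuous (fun t : R => t) by cts.
have cdF z : continuous (dF z).
 apply: ccontM.
  apply: ccontM; first cts.
  by apply: ctsC; apply: cts_mul => //; exact: continuous_gauss_fun.
 cts.
have dG z : cder (1 : R) gaussT z (cint (dF z)).
 apply: (@cder_cint R R F dF z 1 2).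
 - exact: cts_gauss_I.
 - by move=> q; exists 2; exact: FK.
 - move=> q t; have h : is_derive q (1 : R) (fun y : R => y * t) t.
  by apply: der_affine => s; rewrite /GRing.scale /= mulr1; ring.
  apply: cder_eq (cderZ _ (cder_expi h)) _.
  by rewrite /dF rmorphM /=; ring.
 - by apply: near_all => q t; exact: dFK.
have dgauss (t : R) : is_derive t (1 : R) gauss_fun (- (2 * t) * gauss_fun t).
 apply: (der_chain (phi := expR) (g := fun t => - t ^+ 2)).
 have h : is_derive t (1 : R) (fun s : R => s ^+ 2) (2 * t).
  have E : (fun s : R => s ^+ 2) = id ^+ 2 by ext s; rewrite !expr2.
  by rewrite E; apply: is_derive_eq; rewrite /GRing.scale /= expr1 mulr1.
 exact: is_deriveN.
have r2 : rnorm ((- 2 : R)%:C) = 2 by rewrite rnr normrN ger0_norm.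
have parts z : cint (dF z) = (- (z / 2))%:C * gaussT z.
 have h : cint (fun t => (- 2)%:C * (- 'i * dF z t) + ('i * z%:C) * F z t) = 0.
  apply: (@cint_der (F z) _ (4 + `|z| * 2)).
  - apply: ccontD; first by do 2!(apply: ccontM; first exact: cts_cst).
  by apply: ccontM; [cts|exact: cts_gauss_I].
  - move=> t; have hz : is_derive t (1 : R) (fun t : R => z * t) z.
  by apply: der_affine => s; rewrite /GRing.scale /= mulr1; ring.
  apply: cder_eq (cderM (cder_real (dgauss t)) (cder_expi hz)) _.
  rewrite /dF /F !rmorphM !rmorphN !rmorphM /=.
  have := @sqrCi C; rewrite expr2 => ii.
  have E (a b c : C) : - 2%:C * (- 'i * ('i * (a * b) * c)) = 2%:C * ('i * 'i) * (a * b) * c by ring.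
  by rewrite E ii; ring.
  - move=> t; letr (FK z t); monor; have := normr_ge0 z; lra.
  - move=> t; letr (rnD _ _).
  have -> : (4 + `|z| * 2) * wt1 t = 4 * wt1 t + `|z| * 2 * wt1 t by exact: mulrDl.
  apply: lerD; [rewrite rnM r2 rnM rnN rni mul1r|rewrite rnM rnM rni mul1r].
  by have := dFK z t; have := wt1_ge0 t; lra.
  by rewrite rnr -mulrA ler_wpM2l.
 have c1 : continuous (fun t => (- 2)%:C * (- 'i * dF z t)) by do 2!(apply: ccontM; first exact: cts_cst).
 have b2 t : rnorm ((- 2)%:C * (- 'i * dF z t)) <= (4 + `|z| * 2) * wt1 t.
  rewrite rnM r2 rnM rnN rni mul1r.
  have := dFK z t; have := wt1_ge0 t; have := mulr_ge0 (normr_ge0 z) (wt1_ge0 t); lra.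
 have c3 : continuous (fun t => ('i * z%:C) * F z t).
  by apply: ccontM; [cts|exact: cts_gauss_I].
 have b3 t : rnorm (('i * z%:C) * F z t) <= (4 + `|z| * 2) * wt1 t.
  rewrite rnM rnM rni mul1r rnr.
  have := ler_wpM2l (normr_ge0 z) (FK z t); have := wt1_ge0 t; have := mulr_ge0 (normr_ge0 z) (wt1_ge0 t); lra.
 rewrite (cintD c1 c3 b2 b3) in h.
 have E1 : cint (fun t => (- 2)%:C * (- 'i * dF z t)) = (- 2)%:C * (- 'i) * cint (dF z).
  rewrite -(cintZ _ (cdF z) (dFK z)); cext t; ring.
 have E2 : cint (fun t => ('i * z%:C) * F z t) = 'i * z%:C * gaussT z by rewrite -(cintZ _ (@cts_gauss_I z) (FK z)).
 rewrite E1 E2 in h.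
 have i0 : 'i != 0 :> C by rewrite eq_complex /= oner_eq0 andbF.
 have two : (2 : C) != 0 by rewrite pnatr_eq0.
 apply: (mulfI (mulf_neq0 two i0)).
 have : 2 * 'i * cint (dF z) + 'i * z%:C * gaussT z = 0.
  by rewrite -[RHS]h !rmorphN /= rmorph_nat; ring.
 move=> /eqP; rewrite addr_eq0 => /eqP ->.
 by rewrite rmorphN rmorphM fmorphV /= rmorph_nat; field.
have dk (z : R) : is_derive z (1 : R) (fun y => expR (y ^+ 2 / 4)) (z / 2 * expR (z ^+ 2 / 4)).
 have hq : is_derive z (1 : R) (fun t : R => t ^+ 2 / 4) (z / 2); last first.
  exact: (der_chain (is_derive_expR _) hq).
 have E : (fun s : R => s ^+ 2 / 4) = 4^-1 \*: (id ^+ 2).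
  by ext s; rewrite /= mulrC expr2.
 by rewrite E; apply: is_derive_eq; rewrite /GRing.scale /= expr1 mulr1; field.
have dh z : cder (1 : R) (fun y => gaussT y * (expR (y ^+ 2 / 4))%:C) z 0.
 apply: cder_eq (cderM (dG z) (cder_real (dk z))) _.
 rewrite parts !rmorphM rmorphN !rmorphM /=; ring.
have hc : gaussT y * (expR (y ^+ 2 / 4))%:C = gaussT 0 * (expR (0 ^+ 2 / 4))%:C.
 have d1 (x : R) : is_derive x (1 : R) (fun y => Re (gaussT y * (expR (y ^+ 2 / 4))%:C)) 0.
  by have /cderE[] := dh x.
 have d2 (x : R) : is_derive x (1 : R) (fun y => Im (gaussT y * (expR (y ^+ 2 / 4))%:C)) 0.
  by have /cderE[] := dh x.
 have := @is_derive_0_is_cst _ _ y 0 d1; have := @is_derive_0_is_cst _ _ y 0 d2.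
 by case: (_ * _) => ? ?; case: (_ * _) => ? ? /= -> ->.
have G0 : gaussT 0 = (Num.sqrt pi)%:C.
 rewrite /gaussT /cint; apply/eqP; rewrite eq_complex /=; apply/andP; split; apply/eqP.
  have E : (fun t => gauss_fun t * cos (0 * t) - 0 * sin (0 * t)) = @gauss_fun R.
  by ext t; rewrite !mul0r cos0 mulr1 subr0.
  by rewrite E /Rintegral integralT_gauss.
 have E : (fun t => gauss_fun t * sin (0 * t) + 0 * cos (0 * t)) = (fun _ : R => 0 : R).
  by ext t; rewrite !mul0r sin0 mulr0 addr0.
 by rewrite E /Rintegral integral0.
rewrite expr0n mul0r expR0 mulr1 G0 in hc.
have ek : expR (y ^+ 2 / 4) != 0 by rewrite gt_eqF // expR_gt0.
have ekC : (expR (y ^+ 2 / 4))%:C != 0 by rewrite (inj_eq (@complexI R) _ 0).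
apply: (mulIf ekC); rewrite hc -rmorphM /=; congr (_%:C).
rewrite -mulrA /gauss_fun -expRD (_ : - _ + _ = 0) ?expR0 ?mulr1 //.
by field.
Qed.

Lemma cts_gaussT : continuous gaussT.
have -> : gaussT = fun y => (Num.sqrt pi * gauss_fun (y / 2))%:C.
 by ext y; rewrite gaussTE.
apply: ctsC; apply: cts_mul; first cts.
apply: (ctsc (@continuous_gauss_fun R)).
cts.
Qed.

Lemma gaussT_dom : exists K, forall y, rnorm (gaussT y) <= K * wt1 y.
exists (Num.sqrt pi * 8) => y; rewrite gaussTE rnr ger0_norm; last first.
 by rewrite mulr_ge0 ?sqrtr_ge0 ?gauss_fun_ge0.
rewrite -mulrA ler_wpM2l ?sqrtr_ge0 //; have [h _] := gauss_wt1 (y / 2).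
letr h; rewrite /wt1.
have p1 : 0 < 1 + y ^+ 2 by rewrite ltr_wpDr // sqr_ge0.
have p2 : 0 < 1 + (y / 2) ^+ 2 by rewrite ltr_wpDr // sqr_ge0.
rewrite ler_pdivlMr // mulrAC ler_pdivrMr // expr_div_n.
have := sqr_ge0 y; lra.
Qed.

Lemma cint_gaussT : cint gaussT = (2 * pi)%:C.
have -> : gaussT = fun y => (Num.sqrt pi)%:C * (gauss_fun (2^-1 * y))%:C.
 by ext y; rewrite gaussTE rmorphM /= [y / 2]mulrC.
have i2 : (0 : R) < 2^-1 by rewrite invr_gt0.
have cg := ctsC (@continuous_gauss_fun R).
have gK (t : R) : rnorm (gauss_fun t)%:C <= 2 * wt1 t.
 by rewrite rnr ger0_norm ?gauss_fun_ge0 //; have [] := gauss_wt1 t.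
have [K hK] := gaussT_dom.
have gK' (t : R) : rnorm (gauss_fun (2^-1 * t))%:C <= K / Num.sqrt pi * wt1 t.
 have := hK t; rewrite gaussTE rmorphM rnM [t / 2]mulrC (rnr (Num.sqrt pi)) (ger0_norm (sqrtr_ge0 _)).
 by move=> h; rewrite mulrAC ler_pdivlMr ?sqrtr_gt0 ?pi_gt0 // [X in X <= _]mulrC; exact: h.
have cg' : continuous (fun t : R => (gauss_fun (2^-1 * t))%:C).
 apply: (ctsc cg); cts.
rewrite (cintZ _ cg' gK') (cint_scale i2 cg gK) invrK.
have -> : cint (fun t : R => (gauss_fun t)%:C) = (Num.sqrt pi)%:C.
 rewrite /cint /= /Rintegral integralT_gauss /=.
 by rewrite integral0.
rewrite -!rmorphM /=; congr (_%:C).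
by rewrite mulrCA -expr2 sqr_sqrtr ?pi_ge0.
Qed.

(** The factor [exp(-(e z)^2)] makes the double integral absolutely convergent, and Fubini moves the
    transform onto the Gaussian: [A e = B e] for [e > 0]. Both sides are continuous at [e = 0],
    where [B 0] is [f 0] times the integral of the transformed Gaussian. The sign [sg] covers the
    transform and its inverse. *)
Lemma inversion1 (sg : R) (f : R -> C) K K' : sg ^+ 2 = 1 -> continuous f ->
 (forall t, rnorm (f t) <= K * wt1 t) ->
 (forall z, rnorm (cint (fun t => expi (sg * (t * z)) * f t)) <= K' * wt1 z) ->
 cint (fun z => cint (fun t => expi (sg * (t * z)) * f t)) = (2 * pi)%:C * f 0.
move=> sg2 cf fK fhK.
pose fh z := cint (fun t => expi (sg * (t * z)) * f t).
have cid : continuous (fun t : R => t) by cts.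
have K0 : 0 <= K := coef_ge0 (fK 0) (wt1_gt0 _).
have K0' : 0 <= K' := coef_ge0 (fhK 0) (wt1_gt0 _).
have ccfst (A B : topologicalType) : continuous (fun z : A * B => z.1) by cts.
have ccsnd (A B : topologicalType) : continuous (fun z : A * B => z.2) by cts.
have cfh : continuous fh.
 apply: (@cint_cts R R (fun z t => expi (sg * (t * z)) * f t)).
  apply: ccontM; last by apply: (ctsc cf); exact: ccsnd.
  cts.
 by move=> z; exists K; apply: near_all => q t; rewrite rnM rne mul1r.
pose A e := cint (fun z => (gauss_fun (e * z))%:C * fh z).
pose B e := cint (fun u => f (e * u) * gaussT (sg * u)).
have cA : continuous A.
 apply: (@cint_cts R R (fun e z => (gauss_fun (e * z))%:C * fh z)).
  apply: ccontM; last by apply: (ctsc cfh); exact: ccsnd.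
  by apply: ctsC; apply: (ctsc (@continuous_gauss_fun R)); cts.
 move=> e; exists K'; apply: near_all => q z; rewrite rnM rnr ger0_norm ?gauss_fun_ge0 //.
 by apply: le_trans (fhK z); rewrite ler_piMl ?rn_ge0 ?gauss_fun_le1.
have [KG hKG] := gaussT_dom.
have wsg u : wt1 (sg * u) = wt1 u by rewrite /wt1 exprMn sg2 mul1r.
have cB : continuous B.
 apply: (@cint_cts R R (fun e u => f (e * u) * gaussT (sg * u))).
  apply: ccontM; first by apply: (ctsc cf); cts.
  by apply: (ctsc cts_gaussT); cts.
 move=> e; exists (K * KG); apply: near_all => q z; rewrite rnM -mulrA; apply: ler_pM => //.
  by letr (fK _); rewrite ler_piMr ?wt1_le1.
 by rewrite -(wsg z).
have AB e : 0 < e -> A e = B e.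
 move=> e0; rewrite /A /fh.
 have ge z : rnorm (gauss_fun (e * z))%:C <= 2 * (1 + e ^- 2) * wt1 z.
  rewrite rnr ger0_norm ?gauss_fun_ge0 //.
  have [h _] := gauss_wt1 (e * z); letr h; rewrite -mulrA ler_wpM2l // /wt1.
  have p1 : 0 < 1 + z ^+ 2 by rewrite ltr_wpDr // sqr_ge0.
  have p2 : 0 < 1 + (e * z) ^+ 2 by rewrite ltr_wpDr // sqr_ge0.
  rewrite ler_pdivlMr // ler_pdivrMl //.
  have E : e ^+ 2 * e ^- 2 = 1 by rewrite divff // expf_neq0 // gt_eqF.
  have i0 : 0 < e ^- 2 by rewrite invr_gt0 exprn_gt0.
  have -> : (1 + (e * z) ^+ 2) * (1 + e ^- 2) = 1 + e ^- 2 + e ^+ 2 * z ^+ 2 + (e ^+ 2 * e ^- 2) * z ^+ 2.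
  by rewrite exprMn; ring.
  rewrite E mul1r; have := sqr_ge0 z; have := sqr_ge0 e; nra.
 have cE (z : R) : continuous (fun t : R => expi (sg * (t * z)) * f t).
  apply: ccontM; last exact: cf.
  cts.
 have bE z t : rnorm (expi (sg * (t * z)) * f t) <= K * wt1 t by rewrite rnM rne mul1r.
 have -> : cint (fun z => (gauss_fun (e * z))%:C * cint (fun t => expi (sg * (t * z)) * f t)) =
  cint (fun z => cint (fun t => (gauss_fun (e * z))%:C * (expi (sg * (t * z)) * f t))).
  by cext z; rewrite (cintZ _ (cE z) (bE z)).
 rewrite (@cint_swap R _ (2 * (1 + e ^- 2) * K)); first last.
 - move=> z t; rewrite rnM; letr (ler_pM _ _ (ge z) (bE z t)) => //.
  by rewrite mulrACA -!mulrA.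
 - apply: ccontM.
  apply: ctsC; apply: (ctsc (@continuous_gauss_fun R)).
  cts.
  apply: ccontM; last by apply: (ctsc cf); exact: ccsnd.
  cts.
 have inner t : cint (fun z => (gauss_fun (e * z))%:C * (expi (sg * (t * z)) * f t)) =
  (e^-1)%:C * (f t * gaussT (sg * (e^-1 * t))).
  have cg y := @cts_gauss_I y.
  have bg (y z : R) : rnorm ((gauss_fun z)%:C * expi (y * z)) <= 2 * wt1 z.
  by rewrite rnM rne mulr1 rnr ger0_norm ?gauss_fun_ge0 //; have [] := gauss_wt1 z.
  have cgf (y : R) : continuous (fun z : R => f t * ((gauss_fun z)%:C * expi (y * z))).
  by apply: ccontM; [cts|exact: cg].
  have bgf (y z : R) : rnorm (f t * ((gauss_fun z)%:C * expi (y * z))) <= rnorm (f t) * 2 * wt1 z by rewrite rnM -mulrA ler_wpM2l.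
  rewrite -(cintZ _ (cg _) (bg _)) -(cint_scale e0 (cgf _) (bgf _)).
  cext z.
  rewrite [RHS]mulrC -[RHS]mulrA; congr (_ * _); congr (expi _ * _).
  by field; rewrite gt_eqF.
 rewrite /B; have -> : cint (fun t => cint (fun z => (gauss_fun (e * z))%:C * (expi (sg * (t * z)) * f t))) =
  cint (fun t => (e^-1)%:C * (f t * gaussT (sg * (e^-1 * t)))).
  by cext t; exact: inner.
 have cq : continuous (fun t : R => f t * gaussT (sg * (e^-1 * t))).
  apply: ccontM; first exact: cf.
  apply: (ctsc cts_gaussT).
  cts.
 have bq t : rnorm (f t * gaussT (sg * (e^-1 * t))) <= K * KG * wt1 t.
  rewrite rnM mulrAC; apply: ler_pM => //.
  letr (hKG _); rewrite ler_piMr ?wt1_le1 //.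
  exact: coef_ge0 (hKG 0) (wt1_gt0 _).
 rewrite (cintZ _ cq bq) -(cint_scale e0 cq bq).
 cext t; rewrite (_ : e^-1 * (e * t) = t) //.
 by rewrite mulKf // gt_eqF.
have A0 : A 0 = cint fh.
 by cext z; rewrite mul0r /gauss_fun expr0n oppr0 expR0 mul1r.
have B0 : B 0 = (2 * pi)%:C * f 0.
 have cgs : continuous (fun u : R => gaussT (sg * u)).
  by apply: (ctsc cts_gaussT); cts.
 have bgs u : rnorm (gaussT (sg * u)) <= KG * wt1 u by rewrite -(wsg u).
 have -> : B 0 = f 0 * cint (fun u => gaussT (sg * u)).
  by rewrite -(cintZ _ cgs bgs); cext u; rewrite mul0r.
 rewrite mulrC; congr (_ * _); rewrite -cint_gaussT; congr cint.
 by ext u; rewrite !gaussTE /gauss_fun !expr_div_n exprMn sg2 mul1r.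
rewrite -/fh -A0 -B0.
have cvA : A e @[e --> 0^'+] --> A 0 by apply: cvg_at_right_filter; exact: cA.
have cvB : A e @[e --> 0^'+] --> B 0.
 have : B e @[e --> 0^'+] --> B 0 by apply: cvg_at_right_filter; exact: cB.
 apply: cvg_trans; apply: near_eq_cvg.
 by near=> e; rewrite AB.
exact: (cvg_unique _ cvA cvB).
Unshelve. all: by end_near. Qed.

End gaussian.

(** * Fourier transform and inversion on [R^n] *)

Section bes_words.
Variable R : realType.
Notation C := R[i].

(* The operator [prod_(j <- s) (1 - d_j^2)] as a list of coefficients and words. *)
Definition bes_words (T : Type) (s : seq T) : seq (R * seq T) :=
 foldr (fun j L => L ++ [seq (- cW.1, j :: j :: cW.2) | cW <- L]) [:: (1, [::])] s.

(** Where each [d_j] acts as multiplication by [u j], as it does after a Fourier transform, the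
    operator becomes multiplication by the product of the [1 - u_j^2]. *)
Lemma bes_sym (T : Type) (s : seq T) (u : T -> C) :
 \sum_(cW <- bes_words s) cW.1%:C * \prod_(j <- cW.2) u j = \prod_(j <- s) (1 - u j ^+ 2).
elim: s => [|j s IH] /=; first by rewrite big_seq1 !big_nil mulr1.
rewrite big_cat big_map big_cons mulrBl mul1r IH /=; congr (_ + _).
rewrite -IH mulr_sumr -sumrN; apply: eq_bigr => -[c W] _ /=.
by rewrite !big_cons rmorphN /=; ring.
Qed.

End bes_words.

Section fourier_transform.
Variable R : realType.
Notation C := R[i].

Definition ud n (W : seq 'I_n) : seq 'rV[R]_n := [seq delta_mx 0 j | j <- W].

(** The constants are indexed by words and kept explicit, because the bounds drawn from them must
    later be uniform over families of symbols. *)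
Definition wclass n (K : seq 'I_n -> R) (F : 'rV[R]_n -> C) : Prop :=
 csm F /\ forall W x, rnorm (cDs (ud W) F x) <= K W * wt x.

Definition ft n (sg : R) (F : 'rV[R]_n -> C) (z : 'rV[R]_n) : C :=
 iRn (fun y => expi (sg * dot y z) * F y).

Lemma wclass_bd n K (F : 'rV[R]_n -> C) x : wclass K F -> rnorm (F x) <= K [::] * wt x.
by move=> [_ /(_ [::] x)]. Qed.

Lemma wclass_ge0 n K (F : 'rV[R]_n -> C) W : wclass K F -> 0 <= K W.
by move=> [_ /(_ W 0)] h; exact: coef_ge0 h (wt_gt0 _). Qed.

Lemma wclass_cDs n K (F : 'rV[R]_n -> C) U : wclass K F ->
 wclass (fun W => K (W ++ U)) (cDs (ud U) F).
move=> [sF hF]; split; first exact: csm_cDs.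
by move=> W x; have := hF (W ++ U) x; rewrite /ud map_cat cDs_cat.
Qed.

Lemma ftI_bd n sg K (F : 'rV[R]_n -> C) z y : wclass K F ->
 rnorm (expi (sg * dot y z) * F y) <= K [::] * wt y.
by move=> hF; rewrite rnM rne mul1r; exact: wclass_bd. Qed.

Lemma ftI_cts n sg K (F : 'rV[R]_n -> C) z : wclass K F ->
 continuous (fun y => expi (sg * dot y z) * F y).
move=> [sF _]; apply: (ccontM _ (csmc sF)); apply: cts_expi.
cts.
Qed.

Lemma ft_bd n sg K (F : 'rV[R]_n -> C) z : wclass K F ->
 rnorm (ft sg F z) <= K [::] * (2 * pi) ^+ n.
move=> hF; apply: iRn_bd; first exact: ftI_cts hF.
by move=> y; exact: ftI_bd.
Qed.

(** Integration by parts: the integral of the [j]-th derivative of the exponential times [F]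
    vanishes. *)
Lemma ft_der n sg K (F : 'rV[R]_n -> C) z j : wclass K F ->
 ft sg (cD (delta_mx 0 j) F) z = - 'i * (sg * z 0 j)%:C * ft sg F z.
move=> hF; have hF1 := wclass_cDs [:: j] hF.
have E1 : cDs (ud [:: j]) F = cD (delta_mx 0 j) F by rewrite /ud [map _ _]/= cDsc cDsn.
rewrite E1 in hF1; have [sF _] := hF.
set dF := cD _ F in hF1 *.
pose c : C := 'i * (sg * z 0 j)%:C.
pose f y := expi (sg * dot y z) * F y.
pose K' : R := K [::] * (1 + rnorm c) + K [:: j].
have k0 : 0 <= K [::] by exact: wclass_ge0 hF.
have k1 : 0 <= K [:: j] by exact: wclass_ge0 hF.
have c1 : continuous (fun y => c * f y).
 by apply: ccontM; [cts|exact: ftI_cts hF].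
have c2 := @ftI_cts _ sg _ dF z hF1.
have b0 y : rnorm (f y) <= K' * wt y.
 letr (ftI_bd sg z y hF); monor.
 rewrite /K' mulrDr mulr1 -addrA lerDl addr_ge0 // mulr_ge0 //.

have b1 y : rnorm (c * f y) <= K' * wt y.
 rewrite rnM; letr (ler_wpM2l (rn_ge0 _) (ftI_bd sg z y hF)).
 rewrite mulrA ler_wpM2r // mulrC /K' mulrDr mulr1 addrAC lerDr addr_ge0 //.
have b2 y : rnorm (expi (sg * dot y z) * dF y) <= K' * wt y.
 letr (ftI_bd sg z y hF1); monor.
 by rewrite /K' lerDr mulr_ge0 // addr_ge0 // rn_ge0.
have D0 : iRn (fun y => c * f y + expi (sg * dot y z) * dF y) = 0.
 apply: (@iRn_der R n f _ j (K' + K')).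
 - exact: ftI_cts hF.
 - exact: (ccontD c1 c2).
 - move=> x; have h1 := cder_expi_dot sg z x (delta_mx 0 j).
  have h2 := csm_cder (delta_mx 0 j) x sF.
  apply: cder_eq (cderM h1 h2) _.
  by rewrite dot_delta /c /f /dF; ring.
 - move=> x; letr (b0 x); monor; rewrite lerDl.
  exact: coef_ge0 (b0 0) (wt_gt0 _).
 - by move=> x; letr (rnD _ _); rewrite mulrDl lerD.
rewrite (iRnD c1 c2 b1 b2) in D0.
have E : iRn (fun y => c * f y) = c * ft sg F z.
 exact: (iRnZ c (@ftI_cts _ sg _ F z hF) (fun y => ftI_bd sg z y hF)).
suff -> : ft sg dF z = - (c * ft sg F z) by rewrite /c; ring.
by apply/eqP; rewrite -addr_eq0 addrC -E; apply/eqP; exact: D0.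
Qed.

Lemma ft_cDs n sg K (F : 'rV[R]_n -> C) z W : wclass K F ->
 ft sg (cDs (ud W) F) z = (\prod_(j <- W) (- 'i * (sg * z 0 j)%:C)) * ft sg F z.
move=> hF; elim: W => [|j W IH]; first by rewrite big_nil mul1r.
rewrite big_cons /ud [map _ _]/= cDsc -/(ud W) (ft_der sg z j (wclass_cDs W hF)) IH; ring.
Qed.

Lemma bes_wt n sg (z : 'rV[R]_n) : sg ^+ 2 = 1 ->
 \prod_(j <- index_enum 'I_n) (1 - (- 'i * (sg * z 0 j)%:C) ^+ 2) = ((wt z)^-1)%:C :> C.
move=> sg2; rewrite /wt -prodfV rmorph_prod; apply: eq_bigr => j _.
rewrite /wt1 invrK rmorphD rmorph1 exprMn sqrrN sqrCi mulN1r opprK.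
by rewrite -rmorphXn /= exprMn sg2 mul1r.
Qed.

Definition bes_norm n (K : seq 'I_n -> R) : R :=
 \sum_(cW <- bes_words R (index_enum 'I_n)) `|cW.1| * K cW.2.

(** On transforms, the product of the [1 - d_j^2] acts as multiplication by [1 / wt z], so uniform
    bounds on the transforms of derivatives of [F] yield decay like [wt]. *)
Lemma ft_decay n sg K (F : 'rV[R]_n -> C) z : sg ^+ 2 = 1 -> wclass K F ->
 rnorm (ft sg F z) <= bes_norm K * (2 * pi) ^+ n * wt z.
move=> sg2 hF; rewrite mulrC -ler_pdivrMl ?wt_gt0 //.
have -> : (wt z)^-1 * rnorm (ft sg F z) = rnorm (((wt z)^-1)%:C * ft sg F z) by rewrite rnM rnr ger0_norm // invr_ge0 wt_ge0.
rewrite -(bes_wt z sg2) -bes_sym mulr_suml /bes_norm mulr_suml.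
letr (rn_sum _ _ _); apply: ler_sum => -[c W] _ /=.
rewrite -mulrA -(ft_cDs sg z W hF) rnM rnr -mulrA ler_wpM2l //.
by have := ft_bd sg z (wclass_cDs W hF).
Qed.

Lemma ft_cts n sg K (F : 'rV[R]_n -> C) : wclass K F -> continuous (ft sg F).
move=> hF; have [sF _] := hF.
apply: (@iRn_cts R 'rV[R]_n n (fun z y => expi (sg * dot y z) * F y)).
 apply: ccontM; last by apply: (ctsc (csmc sF)); cts.
 apply: cts_expi; apply: cts_mul; first cts.
 by apply: cts_dot; move=> ?; [exact: cvg_snd|exact: cvg_fst].
by move=> z; exists (K [::]); apply: near_all => q y; exact: ftI_bd hF.
Qed.

Lemma wclass_slice n K (F : 'rV[R]_n.+1 -> C) (t : R) : wclass K F ->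
 wclass (fun W => K [seq rshift 1 j | j <- W] * wt1 t) (fun y => F (row_mx t%:M y : 'rV_(1 + n))).
move=> [sF hF].
have ch : continuous (fun y : 'rV[R]_n => row_mx t%:M y : 'rV_(1 + n)).
 cts.
have hE (y w : 'rV[R]_n) (s : R) : (row_mx t%:M (y + s *: w) : 'rV_(1 + n)) =
  row_mx t%:M y + s *: (row_mx 0 w : 'rV_(1 + n)).
 by rewrite scale_row_mx add_row_mx scaler0 addr0.
have [sS dS] := csm_aff ch hE sF.
split=> // W y; rewrite dS.
have -> : [seq (row_mx 0 w : 'rV_(1 + n)) | w <- ud W] = ud [seq rshift 1 j | j <- W].
 rewrite /ud -!map_comp; apply: eq_map => j /=.
 apply/rowP => k; case: (split_ordP k) => l ->.
  by rewrite row_mxEl !mxE eqxx /= eq_lrshift.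
 by rewrite row_mxEr !mxE eqxx /= eq_rshift.
by letr (hF _ _); rewrite wt_row_mx mulrA.
Qed.

Lemma ft_row_mx n sg (F : 'rV[R]_n.+1 -> C) (s : R) (z : 'rV[R]_n) :
 ft sg F (row_mx s%:M z : 'rV_(1 + n)) =
 cint (fun t => iRn (fun y => expi (sg * (t * s)) * (expi (sg * dot y z) * F (row_mx t%:M y : 'rV_(1 + n))))).
rewrite /ft /=; cext t; iext y.
by rewrite dot_row_mx mulrDr expiD -mulrA.
Qed.

(** Induction on the dimension: the inner variables are inverted by the hypothesis, the first one by
    [inversion1], whose decay condition on the transform comes from [ft_decay]. The value at 0 is
    enough; other points follow by translation. *)
Lemma ft_inversion n sg K (F : 'rV[R]_n -> C) : sg ^+ 2 = 1 -> wclass K F ->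
 iRn (ft sg F) = ((2 * pi) ^+ n)%:C * F 0.
move=> sg2; elim: n K F => [|n IH] K F hF.
 by rewrite expr0 mul1r /ft /= /dot big_ord0 mulr0 expi0 mul1r.
have [sF _] := hF; have cF := csmc sF.
pose Ft (t : R) (y : 'rV[R]_n) := F (row_mx t%:M y : 'rV_(1 + n)).
have hFt t : wclass _ (Ft t) := wclass_slice t hF.
have k0 W : 0 <= K W by exact: wclass_ge0 hF.
have sliceZ s z t : iRn (fun y => expi (sg * (t * s)) * (expi (sg * dot y z) * Ft t y)) =
  expi (sg * (t * s)) * ft sg (Ft t) z.
 by apply: iRnZ => [|y]; [exact: ftI_cts (hFt t)|exact: ftI_bd (hFt t)].
have ftE s z : ft sg F (row_mx s%:M z : 'rV_(1 + n)) = cint (fun t => expi (sg * (t * s)) * ft sg (Ft t) z).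
 by rewrite ft_row_mx; cext t; exact: sliceZ.
pose B : R := bes_norm (fun W => K [seq rshift 1 j | j <- W]) * (2 * pi) ^+ n.
have ftB t z : rnorm (ft sg (Ft t) z) <= B * wt1 t * wt z.
 letr (ft_decay z sg2 (hFt t)); monor.
 rewrite /B mulrAC ler_wpM2r ?exprn_ge0 ?mulr_ge0 ?pi_ge0 // /bes_norm mulr_suml.
 by apply: ler_sum => cW _; rewrite mulrA.
have ccft : ccont (fun (t : R) z => ft sg (Ft t) z).
 apply: (@iRn_cts R (R * 'rV[R]_n)%type n (fun q y => expi (sg * dot y q.2) * Ft q.1 y)).
  have c11 : continuous (fun x : (R * 'rV[R]_n) * 'rV[R]_n => x.1.1).
  by move=> x; apply: continuous_comp; exact: cvg_fst.
  have c12 : continuous (fun x : (R * 'rV[R]_n) * 'rV[R]_n => x.1.2).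
  by move=> x; apply: continuous_comp; [exact: cvg_fst|exact: cvg_snd].
  have c2 : continuous (fun x : (R * 'rV[R]_n) * 'rV[R]_n => x.2) by cts.
  apply: ccontM; last by apply: (ctsc cF); exact: cts_row_mx.
  apply: cts_expi; apply: cts_mul; first cts.
  exact: cts_dot.
 move=> q; exists (K [::]); apply: near_all => -[t z] y /=.
 letr (ftI_bd sg z y (hFt t)); rewrite ler_wpM2r //=.
 by rewrite ler_piMr ?wt1_le1.
have swap s : iRn (fun z => ft sg F (row_mx s%:M z : 'rV_(1 + n))) =
  cint (fun t => expi (sg * (t * s)) * (((2 * pi) ^+ n)%:C * Ft t 0)).
 have -> : iRn (fun z => ft sg F (row_mx s%:M z : 'rV_(1 + n))) =
  iRn (fun z => cint (fun t => expi (sg * (t * s)) * ft sg (Ft t) z)).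
  by iext z; exact: ftE.
 rewrite -(@cint_iRn_swap R n (fun t z => expi (sg * (t * s)) * ft sg (Ft t) z) B).
 - cext t.
  rewrite -(IH _ (Ft t) (hFt t)).
  by apply: iRnZ => [|z]; [exact: ft_cts (hFt t)|exact: ftB].
 - apply: ccontM; last exact: ccft.
  cts.
 - by move=> t z; rewrite rnM rne mul1r.
have cFt0 : continuous (fun t => ((2 * pi) ^+ n)%:C * Ft t 0).
 apply: ccontM; first cts.
 apply: (ctsc cF); cts.
have bFt0 t : rnorm (((2 * pi) ^+ n)%:C * Ft t 0) <= (2 * pi) ^+ n * K [::] * wt1 t.
 rewrite rnM rnr ger0_norm ?exprn_ge0 ?mulr_ge0 ?pi_ge0 // -mulrA ler_wpM2l ?exprn_ge0 ?mulr_ge0 ?pi_ge0 //.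
 letr (wclass_bd 0 (hFt t)); rewrite /= ler_piMr ?wt_le1 // mulr_ge0 //.
have fhB s : rnorm (cint (fun t => expi (sg * (t * s)) * (((2 * pi) ^+ n)%:C * Ft t 0))) <=
  bes_norm K * (2 * pi) ^+ n.+1 * (2 * pi) ^+ n * wt1 s.
 rewrite -swap mulrAC; apply: iRn_bd.
  have cft := @ft_cts _ sg _ F hF.
  by apply: (ctsc cft); cts.
 move=> z; rewrite -mulrA -wt_row_mx; exact: ft_decay.
have -> : iRn (ft sg F) = cint (fun s => iRn (fun z => ft sg F (row_mx s%:M z : 'rV_(1 + n)))).
 by [].
have -> : cint (fun s => iRn (fun z => ft sg F (row_mx s%:M z : 'rV_(1 + n)))) =
 cint (fun s => cint (fun t => expi (sg * (t * s)) * (((2 * pi) ^+ n)%:C * Ft t 0))).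
 by cext s; exact: swap.
rewrite (inversion1 sg2 cFt0 bFt0 fhB) mulrA -rmorphM /= -exprS; congr (_ * F _).
have -> : (0 : R)%:M = 0 :> 'rV_1 by exact: raddf0.
exact: (@row_mx0 R 1 1 n).
Qed.

End fourier_transform.

(** * Linearity of derivatives in the direction *)

Section directional_linearity.
Variables (R : realType) (V : normedModType R).
Notation C := R[i].

Lemma mean_value_line (g : V -> R) (x v : V) (h : R) : (forall y, derivable g y v) ->
 exists2 s : R, `|s| <= `|h| & g (x + h *: v) - g x = h * 'D_v g (x + s *: v).
move=> dg; pose G (t : R) := g (x + t *: v).
have GdG (t : R) : is_derive t (1 : R) G ('D_v g (x + t *: v)).
 exact: (der_line g x v _ t).1 (derivableP (dg _)).
have cG : continuous G by exact: dble_cts_line.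
have [h0|h0|->] := ltgtP h 0.
- have [s] := MVT h0 (fun t _ => GdG t) (continuous_subspaceT cG).
 rewrite in_itv /= => /andP[hs s0] /eqP; rewrite {1}/G scale0r addr0 sub0r mulrN => Es; exists s.
  by rewrite !ltr0_norm // lerN2 ltW.
 move/eqP: Es => Es; rewrite -[LHS]opprB Es opprK mulrC //.
- have [s] := MVT h0 (fun t _ => GdG t) (continuous_subspaceT cG).
 rewrite in_itv /= => /andP[s0 sh]; rewrite /G scale0r addr0 subr0 => Es; exists s.
  by rewrite !gtr0_norm // ltW.
 by rewrite Es mulrC.
- by exists 0; rewrite // scale0r addr0 subrr mul0r.
Qed.

(** The increment along [u + v] is split at [x + h u]. Its second part is a mean value of ['D_v g]
    at a point tending to [x], which is why continuity is asked of this derivative. *)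
Lemma der_addv (g : V -> R) (x u v : V) :
 derivable g x u -> (forall y, derivable g y v) -> {for x, continuous ('D_v g)} ->
 is_derive x (u + v) g ('D_u g x + 'D_v g x).
move=> du dv cv.
suff H : h^-1 *: (g (h *: (u + v) + x) - g x) @[h --> 0^'] --> 'D_u g x + 'D_v g x.
 by split; [apply/cvg_ex; exists ('D_u g x + 'D_v g x)|exact/cvg_lim].
have /choice[s hs] : forall h : R, exists s : R, `|s| <= `|h| /\
  g (x + h *: u + h *: v) - g (x + h *: u) = h * 'D_v g (x + h *: u + s *: v).
 by move=> h; have [s h1 h2] := mean_value_line (x + h *: u) h dv; exists s.
have E : {near (0 : R)^', (fun h => h^-1 *: (g (h *: u + x) - g x) + 'D_v g (x + h *: u + s h *: v)) =1
  (fun h => h^-1 *: (g (h *: (u + v) + x) - g x))}.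
 near=> h; have h0 : h != 0 by near: h; exact: nbhs_dnbhs_neq.
 have [_ Eh] := hs h; rewrite -[X in _ + X](mulKf h0) -Eh /GRing.scale /= -mulrDr; congr (_ * _).
 rewrite -![GRing.Nmodule_isLSemiModule.scale _ _ _]/(_ *: _) scalerDr !(addrC _ x) [x + (_ + _)]addrA.
 by ring.
apply: cvg_trans (near_eq_cvg E) _.
apply: cvgD; first exact: du.
suff H : x + h *: u + s h *: v @[h --> 0^'] --> x by exact: cvg_comp H cv.
rewrite -[X in _ --> X](addr0 x) -[X in _ --> X + _](addr0 x).
apply: cvgD; first apply: cvgD.
- exact: cvg_cst.
- rewrite -[X in _ --> X](scale0r u).
 by apply: cvgZr_tmp; apply: cvg_within.
- rewrite -[X in _ --> X](scale0r v).
 apply: cvgZr_tmp; apply/cvgr0Pnorm_lt => e e0.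
 near=> h; apply: le_lt_trans (hs h).1 _; near: h.
 have : (id h : R) @[h --> (0 : R)^'] --> (0 : R) by exact: cvg_within.
 by move/cvgr0Pnorm_lt; exact.
Unshelve. all: by end_near. Qed.

Lemma cD_addv (f : V -> C) (u v : V) : csm f -> cD (u + v) f = fun x => cD u f x + cD v f x.
move=> sf; ext x; apply: cder_val; apply/cderE; rewrite !raddfD.
have h1 := @der_addv (fun y => Re (f y)) x u v (@csm_dble_Re _ _ f x u sf)
 (fun y => @csm_dble_Re _ _ f y v sf).
have h2 := @der_addv (fun y => Im (f y)) x u v (@csm_dble_Im _ _ f x u sf)
 (fun y => @csm_dble_Im _ _ f y v sf).
have cv := csmc (csm_cD v sf).
move: h1 h2; rewrite -!cD_Re -!cD_Im => h1 h2.
have [c1 c2] := (ccontP _).1 cv.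
by split; [apply: h1; exact: c1|apply: h2; exact: c2].
Qed.

Lemma cD_scalev (f : V -> C) (v : V) (c : R) : csm f -> cD (c *: v) f = fun x => c%:C * cD v f x.
move=> sf; ext x; apply: cder_val.
have := cder_line f x (c *: v) (c%:C * cD v f x) 0; rewrite scale0r addr0 => ->.
have [h1 h2] := (cderE _ _ _ _).1 (csm_cder v x sf).
have c0 : x + (c * 0) *: v = x by rewrite mulr0 scale0r addr0.
rewrite -{1}c0 in h1; rewrite -{1}c0 in h2.
have E1 := (der_line (fun y => Re (f y)) x v _ (c * 0)).1 h1.
have E2 := (der_line (fun y => Im (f y)) x v _ (c * 0)).1 h2.
have hc : is_derive (0 : R) (1 : R) (fun s : R => c * s) c.
 by have := is_deriveZ (f := id) c (is_derive_id (0 : R) 1); rewrite /GRing.scale /= mulr1.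
apply/cderE; split.
- have := @der_chain R _ (fun s : R => c * s) 0 _ _ E1 hc; rewrite cReM /= mul0r subr0.
 rewrite (_ : (fun s => _) = fun s : R => Re (f (x + s *: (c *: v)))) //.
 by ext s; rewrite scalerA mulrC.
- have := @der_chain R _ (fun s : R => c * s) 0 _ _ E2 hc; rewrite cImM /= mul0r addr0.
 rewrite (_ : (fun s => _) = fun s : R => Im (f (x + s *: (c *: v)))) //.
 by ext s; rewrite scalerA mulrC.
Qed.

Lemma cD_sumv (f : V -> C) (I : Type) (s : seq I) (c : I -> R) (e : I -> V) : csm f ->
 cD (\sum_(j <- s) c j *: e j) f = fun x => \sum_(j <- s) (c j)%:C * cD (e j) f x.
move=> sf; elim: s => [|j s IH].
 have -> : \sum_(j <- [::]) c j *: e j = (0 : R) *: (0 : V) by rewrite big_nil scale0r.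
 by rewrite cD_scalev //; ext x; rewrite big_nil mul0r.
rewrite big_cons cD_addv // IH cD_scalev //; ext x; by rewrite big_cons.
Qed.

End directional_linearity.

(** * Taylor's formula *)

Section taylor.
Variable R : realType.
Notation C := R[i].

Lemma der_powfact (k : nat) (t : R) :
 is_derive t (1 : R) (fun s : R => s ^+ k.+1 / k.+1`!%:R) (t ^+ k / k`!%:R).
have h := is_deriveZ (k.+1`!%:R^-1) (is_deriveX k.+1 (is_derive_id t (1 : R))).
rewrite (_ : (fun s => _) = k.+1`!%:R^-1 *: (id ^+ k.+1)); last first.
 by ext s; rewrite scalrfctE exprfctE [LHS]mulrC.
apply: is_derive_eq h _.
rewrite /GRing.scale /= factS natrM -mulr_natl invfM.
have h1 : k.+1%:R != 0 :> R by rewrite pnatr_eq0.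
have h2 : k`!%:R != 0 :> R by rewrite pnatr_eq0 -lt0n fact_gt0.
have E (a b c : R) : a != 0 -> b != 0 -> a^-1 / b * (a * c) = c / b.
 by move=> a0 b0; field; rewrite a0 b0.
by rewrite !mulr1 (E _ _ _ h1 h2).
Qed.

(** Induction on [N]: the derivative of the remainder is the remainder of one order less for [g 1],
    and the mean value theorem on [[0, t]] with [t <= 1] keeps the bound [K]. The factor [1 / N!] is
    given up. *)
Lemma taylor_real (g : nat -> R -> R) (K : R) (N : nat) (t : R) : 0 <= t <= 1 ->
 (forall k s, is_derive s (1 : R) (g k) (g k.+1 s)) ->
 (forall s, 0 <= s <= 1 -> `|g N s| <= K) ->
 `|g 0 t - \sum_(k < N) t ^+ k / k`!%:R * g k 0| <= K.
move=> t01 dg; elim: N g dg t t01 => [|N IH] g dg t t01 gK.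
 by rewrite big_ord0 subr0; exact: gK.
pose phi (s : R) := g 0 s - \sum_(k < N.+1) s ^+ k / k`!%:R * g k 0.
pose dphi (s : R) := g 1 s - \sum_(k < N) s ^+ k / k`!%:R * g k.+1 0.
have dphiE (s : R) : is_derive s (1 : R) phi (dphi s).
 rewrite /phi /dphi.
 have h2 : is_derive s (1 : R) (fun s => \sum_(k < N.+1) s ^+ k / k`!%:R * g k 0) (\sum_(k < N) s ^+ k / k`!%:R * g k.+1 0).
  rewrite (_ : (fun s => _) = (cst (g 0 0) : R -> R) + \sum_(k < N) (g k.+1 0 *: (fun s : R => s ^+ k.+1 / k.+1`!%:R))).
  rewrite -[X in is_derive _ _ _ X]add0r; apply: is_deriveD.
  have -> : \sum_(k < N) s ^+ k / k`!%:R * g k.+1 0 = \sum_(k < N) g k.+1 0 *: (s ^+ k / k`!%:R).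
  by apply: eq_bigr => k _; rewrite mulrC.
  by apply: is_derive_sum => k; apply: is_deriveZ; exact: der_powfact.
  ext u; rewrite big_ord_recl expr0 fact0 divr1 mul1r /= fctE fct_sumE; congr (_ + _).
  by apply: eq_bigr => k _; rewrite /= mulrC.
 exact: is_deriveB (dg 0%N s) h2.
have cphi : continuous phi.
 by move=> s; apply: differentiable_continuous; apply/derivable1_diffP; have [] := dphiE s.
have bd s : 0 <= s <= 1 -> `|dphi s| <= K.
 by move=> s01; apply: (IH (fun k => g k.+1)).
have phi0 : phi 0 = 0.
 rewrite /phi big_ord_recl expr0 fact0 divr1 mul1r big1 ?addr0 ?subrr // => k _.
 by rewrite lift0 expr0n mul0r mul0r.
have [t0|t0] := eqVneq t 0.
 by rewrite -/(phi t) t0 phi0 normr0; apply: le_trans (bd 0 _); rewrite ?normr_ge0 // lexx ler01.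
have tp : 0 < t by rewrite lt_neqAle eq_sym t0; case/andP: t01.
have [s] := MVT tp (fun s _ => dphiE s) (continuous_subspaceT cphi).
rewrite in_itv /= phi0 => /andP[s0 st]; rewrite subr0 => Es; rewrite -/(phi t) Es normrM subr0 (gtr0_norm tp).
have t1 : t <= 1 by case/andP: t01.
have K0 : `|dphi s| <= K by apply: bd; rewrite (ltW s0) (le_trans (ltW st)).
by apply: le_trans _ K0; rewrite ler_piMr.
Qed.

(** The factor 2 comes from treating real and imaginary parts separately. *)
Lemma taylor_line (V : normedModType R) (f : V -> C) (x v : V) (N : nat) (K : R) : csm f ->
 (forall s, 0 <= s <= 1 -> rnorm (cDs (nseq N v) f (x + s *: v)) <= K) ->
 rnorm (f (x + v) - \sum_(k < N) (k`!%:R^-1)%:C * cDs (nseq k v) f x) <= 2 * K.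
move=> sf fK.
have H (g : nat -> R -> C) (r : C -> R) :
  (forall k s, is_derive s (1 : R) (fun t => r (g k t)) (r (g k.+1 s))) ->
  (forall s, 0 <= s <= 1 -> `|r (g N s)| <= K) ->
  (forall c (z : C), r (c%:C * z) = c * r z) -> (forall z z', r (z - z') = r z - r z') ->
  (forall z z', r (z + z') = r z + r z') -> r 0 = 0 ->
  `|r (g 0 1 - \sum_(k < N) (k`!%:R^-1)%:C * g k 0)| <= K.
 move=> dg gK rZ rB rD r0.
 have := @taylor_real (fun k t => r (g k t)) K N 1.
 rewrite ler01 lexx => /(_ isT dg gK); rewrite rB (big_morph r rD r0).
 rewrite (eq_bigr (fun k : 'I_N => k`!%:R^-1 * r (g k 0))); last by move=> k _; rewrite expr1n mul1r.
 suff -> : \sum_(k < N) r ((k`!%:R^-1)%:C * g k 0) = \sum_(k < N) k`!%:R^-1 * r (g k 0) by [].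
 by apply: eq_bigr => k _; rewrite rZ.
pose g (k : nat) (t : R) : C := cDs (nseq k v) f (x + t *: v).
have dg k (s : R) : cder (1 : R) (g k) s (g k.+1 s).
 by apply/cder_line; rewrite /g [nseq k.+1 v]/= cDsc; apply: csm_cder; exact: csm_cDs.
have dgR k s := ((cderE _ _ _ _).1 (dg k s)).1.
have dgI k s := ((cderE _ _ _ _).1 (dg k s)).2.
have ReB : `|Re (g 0 1 - \sum_(k < N) (k`!%:R^-1)%:C * g k 0)| <= K.
 apply: H dgR _ _ _ _ _ => //.
 - by move=> s s01; apply: le_trans (nRe _) (fK s s01).
 - by move=> c z; rewrite cReM /= mul0r subr0.
 - by move=> z z'; rewrite raddfB.
 - by move=> z z'; rewrite raddfD.
have ImB : `|Im (g 0 1 - \sum_(k < N) (k`!%:R^-1)%:C * g k 0)| <= K.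
 apply: H dgI _ _ _ _ _ => //.
 - by move=> s s01; apply: le_trans (nIm _) (fK s s01).
 - by move=> c z; rewrite cImM /= mul0r addr0.
 - by move=> z z'; rewrite raddfB.
 - by move=> z z'; rewrite raddfD.
have gE : g 0 1 - \sum_(k < N) (k`!%:R^-1)%:C * g k 0 =
  f (x + v) - \sum_(k < N) (k`!%:R^-1)%:C * cDs (nseq k v) f x.
 rewrite /g [nseq 0 v]/= cDsn scale1r; congr (_ - _); apply: eq_bigr => k _.
 by rewrite scale0r addr0.
rewrite -gE; letr (rn_le _).
by have := lerD ReB ImB; lra.
Qed.

End taylor.

(** * Japanese bracket and Peetre-type inequalities *)

Section japanese_bracket.
Variables (R : realType) (n : nat).
Implicit Types x y z : 'rV[R]_n.

(** An l1 form of the bracket, larger than [jap]. It measures the shift of a frequency; [jap_mul] is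
    the version of Peetre's inequality in use. *)
Definition hnorm x : R := 1 + \sum_j `|x 0 j|.

Lemma hnorm_ge1 x : 1 <= hnorm x.
by rewrite lerDl sumr_ge0. Qed.

Lemma hnorm_gt0 x : 0 < hnorm x. Proof. exact: lt_le_trans ltr01 (hnorm_ge1 x). Qed.

Lemma jap_sqr x : jap x ^+ 2 = 1 + \sum_j x 0 j ^+ 2.
rewrite /jap sqr_sqrtr; last by rewrite addr_ge0 // sqr_ge0.
rewrite /enorm sqr_sqrtr; last by apply: sumr_ge0 => j _; rewrite -expr2 sqr_ge0.
by congr (_ + _); apply: eq_bigr => j _; rewrite expr2.
Qed.

Lemma jap_ge0 x : 0 <= jap x. Proof. exact: sqrtr_ge0. Qed.

Lemma jap_ge1 x : 1 <= jap x.
rewrite -(@ler_pXn2r _ 2) ?nnegrE ?jap_ge0 // jap_sqr expr1n lerDl.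
by apply: sumr_ge0 => j _.
Qed.

Lemma jap_gt0 x : 0 < jap x. Proof. exact: lt_le_trans ltr01 (jap_ge1 x). Qed.

Lemma coord_le_jap x j : `|x 0 j| <= jap x.
rewrite -(@ler_pXn2r _ 2) ?nnegrE ?jap_ge0 // jap_sqr real_normK ?num_real // (bigD1 j) //=.
by rewrite addrCA lerDl addr_ge0 // sumr_ge0 // => i _.
Qed.

Lemma sum_sqr_le (I : Type) (s : seq I) (c : I -> R) :
 \sum_(j <- s) c j ^+ 2 <= (\sum_(j <- s) `|c j|) ^+ 2.
elim: s => [|j s IH]; first by rewrite !big_nil expr0n.
rewrite !big_cons sqrrD real_normK ?num_real // -addrA lerD2l; letr IH.
by rewrite lerDr mulrn_wge0 // mulr_ge0 // sumr_ge0.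
Qed.

Lemma jap_add x y : jap (x + y) <= jap x + \sum_j `|y 0 j|.
have s0 : 0 <= \sum_j `|y 0 j| by exact: sumr_ge0.
rewrite -(@ler_pXn2r _ 2) ?nnegrE ?jap_ge0 ?addr_ge0 ?jap_ge0 // sqrrD !jap_sqr.
letr (_ : _ <= 1 + \sum_j x 0 j ^+ 2 + jap x * (\sum_j `|y 0 j|) *+ 2 + \sum_j y 0 j ^+ 2); last first.
 by rewrite lerD2l; exact: sum_sqr_le.
have -> : jap x * (\sum_j `|y 0 j|) *+ 2 = \sum_j (jap x * `|y 0 j|) *+ 2 by rewrite sumrMnl mulr_sumr.
rewrite -!addrA lerD2l -big_split -big_split /=; apply: ler_sum => j _.
have -> : (x + y) 0 j = x 0 j + y 0 j by rewrite mxE.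
have h : x 0 j * y 0 j <= jap x * `|y 0 j|.
 by letr (ler_norm _); rewrite normrM ler_wpM2r // coord_le_jap.
by rewrite sqrrD; lra.
Qed.

Lemma jap_sub x y : jap x - \sum_j `|y 0 j| <= jap (x + y).
rewrite lerBlDr; have := jap_add (x + y) (- y); rewrite addrK.
by rewrite (eq_bigr (fun j => `|y 0 j|)) // => j _; rewrite mxE normrN.
Qed.

Lemma jap_mul x y : jap (x + y) <= jap x * hnorm y.
letr (jap_add x y); rewrite mulrDr mulr1 lerD2l ler_peMl ?jap_ge1 //.
exact: sumr_ge0.
Qed.

Lemma jap0 : jap (0 : 'rV[R]_n) = 1.
apply/eqP; rewrite -(@eqrXn2 _ 2) ?jap_ge0 // jap_sqr expr1n big1 ?addr0 // => j _.
by rewrite mxE expr0n.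
Qed.

Lemma jap_le_hnorm x : jap x <= hnorm x.
by have := jap_mul 0 x; rewrite add0r jap0 mul1r. Qed.

Lemma coord_le_hnorm x j : `|x 0 j| <= hnorm x.
exact: le_trans (coord_le_jap x j) (jap_le_hnorm x). Qed.

Lemma wtV_le_jap x : (wt x)^-1 <= jap x ^+ (2 * n).
rewrite /wt -prodfV exprM -[X in _ ^+ X](card_ord n) -prodr_const.
apply: ler_prod => j _; rewrite /wt1 invrK addr_ge0 //= jap_sqr lerD2l.
by rewrite (bigD1 j) //= lerDl sumr_ge0 // => i _.
Qed.

Lemma wtV_le x : (wt x)^-1 <= hnorm x ^+ (2 * n).
letr (wtV_le_jap x); rewrite lerXn2r ?nnegrE ?jap_ge0 ?(ltW (hnorm_gt0 x)) //.
exact: jap_le_hnorm.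
Qed.

(** [hnorm x] is at most [n + 1] times the larger of 1 and the largest coordinate, so a power of it
    is controlled by powers of single coordinates. *)
Lemma hnorm_power_bd x M (A X : R) : 0 <= X -> X <= A ->
 (forall j, `|x 0 j| ^+ M * X <= A) -> hnorm x ^+ M * X <= n.+1%:R ^+ M * A.
move=> X0 XA hA.
have H (t : R) : 0 <= t -> (forall j, `|x 0 j| <= t) -> 1 <= t -> hnorm x <= n.+1%:R * t.
 move=> t0 ht t1; rewrite /hnorm -[n.+1%:R]natr1 addrC mulrDl mul1r lerD //.
 letr (ler_sum _ (fun j _ => ht j)).
 by rewrite sumr_const card_ord mulr_natl.
have h0 := ltW (hnorm_gt0 x).
have [hs|/existsNP[j0 /negP]] := pselect (forall j, `|x 0 j| <= 1).
 have h1 := H 1 ler01 hs (lexx _); rewrite mulr1 in h1.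
 by apply: ler_pM; rewrite ?exprn_ge0 // lerXn2r ?nnegrE ?ler0n.
rewrite -ltNge => j01.
have [j _ hj] := @Order.TotalTheory.arg_maxP _ _ _ j0 xpredT (fun j => `|x 0 j|) isT.
have hj1 : 1 <= `|x 0 j| by letr (ltW j01); exact: hj.
have h1 := H _ (normr_ge0 _) (fun i => hj i isT) hj1.
letr (_ : _ <= (n.+1%:R * `|x 0 j|) ^+ M * X).
 by monor; rewrite lerXn2r ?nnegrE ?mulr_ge0 ?ler0n.
by rewrite exprMn -mulrA ler_wpM2l ?exprn_ge0 ?ler0n.
Qed.

End japanese_bracket.
#[local] Hint Extern 0 (is_true (@Order.le _ _ _ (@jap _ _ _))) => exact: jap_ge0 : core.

(** * Polynomial decay of Fourier transforms *)

Section fourier_decay.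
Variable R : realType.
Notation C := R[i].

Definition hnorm_bd n M (K : seq 'I_n -> R) : R :=
 n.+1%:R ^+ M * ((K [::] + \sum_j K (nseq M j)) * (2 * pi) ^+ n).

(** The power of a single coordinate comes from [M]-fold differentiation in that coordinate, so only
    the words [nseq M j] and the empty word enter the constant. *)
Lemma ft_decay_hnorm n sg K (F : 'rV[R]_n -> C) z M : sg ^+ 2 = 1 -> wclass K F ->
 hnorm z ^+ M * rnorm (ft sg F z) <= hnorm_bd M K.
move=> sg2 hF; have p0 : 0 <= (2 * pi : R) ^+ n by rewrite exprn_ge0 // mulr_ge0 // pi_ge0.
have k0 W : 0 <= K W by exact: wclass_ge0 hF.
apply: hnorm_power_bd; first by [].
 letr (ft_bd sg z hF); monor; rewrite lerDl.
 by apply: sumr_ge0 => j _.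
move=> j; have -> : `|z 0 j| ^+ M * rnorm (ft sg F z) = rnorm (ft sg (cDs (ud R (nseq M j)) F) z).
 rewrite (ft_cDs sg z _ hF) rnM big_nseq iter_mulr_1 rnX rnM rnN.
 rewrite rni mul1r rnr normrM.
 have -> : `|sg| = 1 by apply/eqP; rewrite -(@eqrXn2 _ 2) // ?expr1n ?real_normK ?num_real // sg2.
 by rewrite mul1r.
letr (ft_bd sg z (wclass_cDs (nseq M j) hF)).
rewrite ler_wpM2r //= (bigD1 j) //= addrCA lerDl addr_ge0 // sumr_ge0 //.
Qed.

End fourier_decay.

(** * Words of derivatives and tame symbols *)

Lemma spl_map (S T : Type) (f : S -> T) (s : seq S) :
 spl (map f s) = [seq (map f p.1, map f p.2) | p <- spl s].
elim: s => [//|x s IH]; rewrite [spl (map f (x :: s))]/= IH [spl (x :: s)]/= map_cat -!map_comp.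
by [].
Qed.

Lemma size_spl (T : eqType) (s : seq T) p : p \in spl s -> (size p.1 + size p.2)%N = size s.
elim: s p => [|x s IH] p; first by rewrite inE => /eqP ->.
rewrite [spl _]/= mem_cat => /orP[] /mapP[q /IH hq ->] /=; by rewrite ?addSn ?addnS hq.
Qed.

(** Words of bounded length over a finite alphabet are finitely many; the sum of their bounds serves
    all of them. *)
Lemma words_bdd (R : realType) (T : finType) (F : seq T -> R) M : (forall W, 0 <= F W) ->
 exists2 K, 0 <= K & forall W, (size W <= M)%N -> F W <= K.
move=> F0; exists (\sum_(k < M.+1) \sum_(t : k.-tuple T) F t).
 by apply: sumr_ge0 => k _; apply: sumr_ge0.
move=> W WM; rewrite (bigD1 (inord (size W))) //= -[X in X <= _]addr0; apply: lerD; last first.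
 by apply: sumr_ge0 => k _; apply: sumr_ge0.
have E : size W == (inord (size W) : 'I_M.+1) by rewrite inordK.
by rewrite (bigD1 (Tuple E)) //= lerDl; apply: sumr_ge0.
Qed.

Section symbol_calculus.
Variables (R : realType) (n : nat).
Notation C := R[i].
Notation rV := 'rV[R]_n.
Notation V := ('rV[R]_n * 'rV[R]_n)%type.

Lemma wclass_mul (k A : seq 'I_n -> R) (th g : rV -> C) : wclass k th -> csm g ->
 (forall W y, rnorm (cDs (ud R W) g y) <= A W) ->
 wclass (fun W => \sum_(p <- spl W) k p.1 * A p.2) (fun y => th y * g y).
move=> [sth hth] sg hg; split; first exact: csmM.
move=> W y; rewrite cDs_M // /ud spl_map big_map mulr_suml.
letr (rn_sum _ _ _); apply: ler_sum => p _; rewrite rnM mulrAC.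
by apply: ler_pM; [by []|by []|exact: hth|exact: hg].
Qed.

Definition lett := (bool * 'I_n)%type.
Definition ldir (l : lett) : V := if l.1 then dirxi R l.2 else dirx R l.2.
Definition wD (W : seq lett) (f : V -> C) : V -> C := cDs (map ldir W) f.
Definition xw (W : seq 'I_n) : seq lett := map (pair false) W.
Definition xiw (W : seq 'I_n) : seq lett := map (pair true) W.

Lemma wD_cat W1 W2 f : wD (W1 ++ W2) f = wD W1 (wD W2 f).
by rewrite /wD map_cat cDs_cat. Qed.

Lemma wD_nil f : wD [::] f = f. Proof. exact: cDsn. Qed.

Lemma wD_cons l W f : wD (l :: W) f = cD (ldir l) (wD W f).
by rewrite /wD [map _ _]/= cDsc. Qed.

Lemma csm_wD W f : csm f -> csm (wD W f).
exact: csm_cDs. Qed.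

Lemma wD_comm W1 W2 f : csm f -> wD W1 (wD W2 f) = wD W2 (wD W1 f).
exact: cDs_comm. Qed.

Lemma wD_M W f g : csm f -> csm g ->
 wD W (fun z => f z * g z) = fun z => \sum_(p <- spl W) wD p.1 f z * wD p.2 g z.
by move=> sf sg; rewrite /wD cDs_M // spl_map; ext z; rewrite big_map. Qed.

Lemma wD_Z W c f : csm f -> wD W (fun z => c * f z) = fun z => c * wD W f z.
exact: cDs_Z. Qed.

Lemma wD_sum W (I : Type) (s : seq I) (F : I -> V -> C) : (forall i, csm (F i)) ->
 wD W (fun z => \sum_(i <- s) F i z) = fun z => \sum_(i <- s) wD W (F i) z.
exact: cDs_sum. Qed.

Definition letter_coord (l : lett) (v : V) : R := if l.1 then v.2 0 l.2 else v.1 0 l.2.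

Lemma letter_sum (v : V) : v = \sum_l letter_coord l v *: ldir l.
transitivity (\sum_(b : bool) \sum_(j < n) letter_coord (b, j) v *: ldir (b, j)); last first.
 by rewrite pair_bigA; apply: eq_bigr => -[b j].
rewrite big_bool /= /letter_coord /ldir /dirxi /dirx /=.
have E1 : \sum_j v.2 0 j *: ((0, delta_mx 0 j) : V) = (0, v.2).
 rewrite [X in (0, X)](row_sum_delta v.2).
 rewrite (big_morph (fun y => ((0, y) : V)) (id1 := 0) (op1 := +%R)) //.
  by apply: eq_bigr => j _; congr (_, _); rewrite /= scaler0.
 by move=> x y; congr (_, _); rewrite /= addr0.
have E2 : \sum_j v.1 0 j *: ((delta_mx 0 j, 0) : V) = (v.1, 0).
 rewrite [X in (X, 0)](row_sum_delta v.1).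
 rewrite (big_morph (fun y => ((y, 0) : V)) (id1 := 0) (op1 := +%R)) //.
  by apply: eq_bigr => j _; congr (_, _); rewrite /= scaler0.
 by move=> x y; congr (_, _); rewrite /= addr0.
rewrite E1 E2; case: v {E1 E2} => x y; congr (_, _) => /=; by rewrite ?addr0 ?add0r.
Qed.

(** A coarse symbol class in which every derivative, in [x] or in [xi], may cost [d] powers of the
    bracket. It suffices for convergence, smoothness and the composition formula; the exact orders
    are tracked separately. *)
Definition tame (m d : R) (f : V -> C) : Prop := csm f /\
 forall W, exists K, forall z, rnorm (wD W f z) <= K * jap z.2 `^ (m + d * (size W)%:R).

Lemma japR_gt0 (x : rV) (s : R) : 0 < jap x `^ s.
by rewrite powR_gt0 // jap_gt0. Qed.

Lemma japR_ge0 (x : rV) (s : R) : 0 <= jap x `^ s.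
by []. Qed.

Lemma japRD (x : rV) (s t : R) : jap x `^ (s + t) = jap x `^ s * jap x `^ t.
by rewrite powRD //; apply/implyP => _; rewrite gt_eqF // jap_gt0. Qed.

Lemma japR_le (x : rV) (s t : R) : s <= t -> jap x `^ s <= jap x `^ t.
by apply: ler_powR; exact: jap_ge1. Qed.

Lemma bd_ge0 (f : V -> C) (K s : R) : (forall z, rnorm (f z) <= K * jap z.2 `^ s) -> 0 <= K.
by move=> /(_ 0) h; exact: coef_ge0 h (japR_gt0 _ _). Qed.

Lemma tame_weaken m m' d f : m <= m' -> tame m d f -> tame m' d f.
move=> mm' [sf hf]; split=> // W; have [K hK] := hf W; exists K => z.
letr (hK z); rewrite ler_wpM2l ?japR_le ?lerD2r //; exact: bd_ge0 hK.
Qed.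

Lemma tame_wD m d U f : tame m d f -> tame (m + d * (size U)%:R) d (wD U f).
move=> [sf hf]; split; first exact: csm_wD.
move=> W; have [K hK] := hf (W ++ U); exists K => z; rewrite -wD_cat.
by letr (hK z); rewrite size_cat natrD mulrDr addrA addrAC.
Qed.

Lemma tameZ m d c f : tame m d f -> tame m d (fun z => c * f z).
move=> [sf hf]; split; first exact: csmZ.
move=> W; have [K hK] := hf W; exists (rnorm c * K) => z.
by rewrite wD_Z // rnM -mulrA ler_wpM2l.
Qed.

Lemma tame_cst c : tame 0 0 (fun _ => c).
split; first exact: csm_cst.
case=> [|l W]; [exists (rnorm c)|exists 0] => z; rewrite !mul0r.
 by rewrite addr0 powRr0 mulr1 wD_nil.
by rewrite /wD [map _ _]/= cDs_cst rn0.
Qed.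

Lemma tame_sum m d (I : Type) (s : seq I) (F : I -> V -> C) :
 (forall i, tame m d (F i)) -> tame m d (fun z => \sum_(i <- s) F i z).
move=> tF; have sF i := (tF i).1; split; first exact: csm_sum.
move=> W; have /choice[K hK] : forall i, exists K, forall z, rnorm (wD W (F i) z) <= K * jap z.2 `^ (m + d * (size W)%:R).
 by move=> i; exact: (tF i).2.
exists (\sum_(i <- s) K i) => z; rewrite wD_sum // mulr_suml.
by letr (rn_sum _ _ _); apply: ler_sum.
Qed.

Lemma tameM m1 m2 d f g : tame m1 d f -> tame m2 d g -> tame (m1 + m2) d (fun z => f z * g z).
move=> [sf hf] [sg hg]; split; first exact: csmM.
have /choice[K hK] := hf; have /choice[L hL] := hg.
move=> W; exists (\sum_(p <- spl W) K p.1 * L p.2) => z; rewrite wD_M // mulr_suml.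
letr (rn_sum _ _ _); rewrite !big_seq; apply: ler_sum => p /size_spl <-.
rewrite rnM natrD mulrDr addrACA japRD mulrACA.
by apply: ler_pM; [by []|by []|exact: hK|exact: hL].
Qed.

Lemma tame_cD m d v f : 0 <= d -> tame m d f -> tame (m + d) d (cD v f).
move=> d0 tf; have [sf _] := tf; rewrite [v]letter_sum cD_sumv //.
apply: tame_sum => l; apply: tameZ; have := tame_wD [:: l] tf.
by rewrite wD_cons wD_nil /= mulr1.
Qed.

Lemma tame_unif m d f M : 0 <= d -> tame m d f ->
 exists2 K, 0 <= K & forall W z, (size W <= M)%N -> rnorm (wD W f z) <= K * jap z.2 `^ (m + d * M%:R).
move=> d0 [sf /choice[K hK]].
have K0 W : 0 <= K W by exact: bd_ge0 (hK W).
have [L L0 hL] := words_bdd M K0; exists L => // W z WM; letr (hK W z).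
apply: ler_pM => //; first exact: hL.
by apply: japR_le; rewrite lerD2l ler_wpM2l // ler_nat.
Qed.

Lemma japR_natle (x : rV) (s : R) : exists N : nat, forall x : rV, jap x `^ s <= jap x ^+ N.
exists (Num.truncn `|s|).+1 => y; rewrite -powR_mulrn //; apply: japR_le.
by letr (ler_norm _); apply/ltW/truncnS_gt.
Qed.

Lemma tame_poly m d f : 0 <= d -> tame m d f -> exists (N : nat) (K : R), 0 <= K /\
 forall z, rnorm (f z) <= K * jap z.2 ^+ N.
move=> d0 tf; have [K K0 hK] := tame_unif 0 d0 tf; have [N hN] := japR_natle 0 (m + d * 0%:R).
exists N, K; split=> // z; have := hK [::] z (leqnn _); rewrite wD_nil => h.
by letr h; rewrite ler_wpM2l.
Qed.

Lemma shift_x (a : V -> C) (z : V) : csm a -> csm (fun y => a (z.1 + y, z.2)) /\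
 forall W, cDs (ud R W) (fun y => a (z.1 + y, z.2)) = fun y => wD (xw W) a (z.1 + y, z.2).
move=> sa; have ch : continuous (fun y : rV => ((z.1 + y, z.2) : V)).
 cts.
have hE (y w : rV) (t : R) : ((z.1 + (y + t *: w), z.2) : V) = (z.1 + y, z.2) + t *: ((w, 0) : V).
 by congr (_, _); rewrite /= ?addrA // scaler0 addr0.
have [h1 h2] := csm_aff ch hE sa; split=> // W.
rewrite h2; ext y; congr (cDs _ _ _).
by rewrite /ud /xw -!map_comp; apply: eq_map.
Qed.

Lemma wt_cst_ex : exists k : seq 'I_n -> R, wclass k (fun x : rV => (wt x)%:C).
have [sw hw] := wt_sm R n.
have /choice[k hk] : forall W, exists K, forall x, rnorm (cDs (ud R W) (fun x : rV => (wt x)%:C) x) <= K * wt x.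
 by move=> W; exact: hw.
by exists k; split.
Qed.

Definition wcst : seq 'I_n -> R := projT1 (cid wt_cst_ex).

Lemma wcstP : wclass wcst (fun x : rV => (wt x)%:C).
exact: projT2 (cid wt_cst_ex). Qed.

(** The [y]-integral of the composition formula after integration by parts: [exp(-i y.ze)] equals
    [wt y] times the product of the [1 - d^2 / d ze_j^2] applied to it, and the derivatives have
    moved onto the other symbol as [bes_xi]. *)
Definition ghat (a : V -> C) (z : V) : rV -> C :=
 ft (-1) (fun y => (wt y)%:C * a (z.1 + y, z.2)).

Definition split_cst (W : seq 'I_n) : R := \sum_(p <- spl W) wcst p.1.

Lemma wclass_ghat (A : seq 'I_n -> R) a z : csm a ->
 (forall U x, rnorm (wD (xw U) a (x, z.2)) <= A U) ->
 wclass (fun W => \sum_(p <- spl W) wcst p.1 * A p.2) (fun y => (wt y)%:C * a (z.1 + y, z.2)).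
move=> sa hA; have [s1 s2] := shift_x z sa; apply: wclass_mul => //; first exact: wcstP.
by move=> W y; rewrite s2.
Qed.

Lemma tame_wclass (a : V -> C) (z : V) m d : tame m d a ->
 exists A : seq 'I_n -> R, forall U x, rnorm (wD (xw U) a (x, z.2)) <= A U.
move=> [_ /choice[K hK]]; exists (fun U => K (xw U) * jap z.2 `^ (m + d * (size (xw U))%:R)) => U x.
exact: hK.
Qed.

Definition ghat_cst M : R := hnorm_bd M split_cst.

Lemma ghat_bd a z ze m d M (al : R) : tame m d a ->
 (forall U x, (size U <= M)%N -> rnorm (wD (xw U) a (x, z.2)) <= al) ->
 hnorm ze ^+ M * rnorm (ghat a z ze) <= ghat_cst M * al.
move=> ta hal; have [A0 hA0] := tame_wclass z ta.
(* [hnorm_bd] reads derivatives of length at most [M] only; longer words just need some finite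
   constant to satisfy [wclass]. *)
pose A U := if (size U <= M)%N then al else A0 U.
have hA U x : rnorm (wD (xw U) a (x, z.2)) <= A U.
 by rewrite /A; case: ifP => [/hal|_].
have m1 : (-1) ^+ 2 = 1 :> R by rewrite sqrrN expr1n.
letr (ft_decay_hnorm ze M m1 (wclass_ghat ta.1 hA)).
rewrite /ghat_cst /hnorm_bd -!mulrA ler_wpM2l ?exprn_ge0 ?ler0n // [_ * al]mulrC mulrA.
rewrite ler_wpM2r ?exprn_ge0 ?mulr_ge0 ?pi_ge0 // mulrDl mulr_suml.
have H W : (size W <= M)%N -> \sum_(p <- spl W) wcst p.1 * A p.2 <= split_cst W * al.
 move=> WM; rewrite /split_cst mulr_suml !big_seq; apply: ler_sum => p /size_spl sp.
 by rewrite /A ifT // (leq_trans _ WM) // -sp leq_addl.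
apply: lerD; first by rewrite -mulr_suml; exact: H.
by rewrite mulr_suml; apply: ler_sum => j _; apply: H; rewrite size_nseq.
Qed.

Lemma size_bes_words (T : Type) (s : seq T) :
 all (fun cW => (size cW.2 <= 2 * size s)%N) (bes_words R s).
elim: s => [//|j s IH]; rewrite [bes_words _ _]/= all_cat all_map.
by apply/andP; split; apply: sub_all IH => -[c W] /= h; rewrite mulnS; [exact: leq_trans h (leq_addl _ _)|rewrite !addSn !ltnS].
Qed.

Definition bwords := bes_words R (index_enum 'I_n).

Lemma size_bwords cW : cW \in bwords -> (size cW.2 <= 2 * n)%N.
move=> h; have := allP (size_bes_words (index_enum 'I_n)) _ h.
have -> : size (index_enum 'I_n) = n by rewrite -[RHS]card_ord cardT enumT.
by [].
Qed.

Definition bes_xi (b : V -> C) (z : V) : C :=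
 \sum_(cW <- bwords) cW.1%:C * wD (xiw cW.2) b z.

Lemma csm_bes b : csm b -> csm (bes_xi b).
by move=> sb; apply: csm_sum => cW; apply: csmZ; exact: csm_wD. Qed.

Lemma bes_cD v (b : V -> C) : csm b -> bes_xi (cD v b) = cD v (bes_xi b).
move=> sb; have := @cDs_sum R V _ bwords (fun cW z => cW.1%:C * wD (xiw cW.2) b z) [:: v].
rewrite cDsc cDsn => ->; last by move=> cW; apply: csmZ; exact: csm_wD.
ext z; apply: eq_bigr => cW _.
rewrite cDsc cDsn cD_Z; last exact: csm_wD.
by rewrite /wD cDs_cD_comm.
Qed.

Lemma tame_bes m d (b : V -> C) : 0 <= d -> tame m d b -> tame (m + d * (2 * n)%:R) d (bes_xi b).
move=> d0 tb; have -> : bes_xi b = fun z => \sum_(cW <- bwords)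
  (if (size cW.2 <= 2 * n)%N then cW.1%:C else 0) * wD (if (size cW.2 <= 2 * n)%N then xiw cW.2 else [::]) b z.
 by ext z; apply: eq_big_seq => cW /size_bwords ->.
apply: tame_sum => cW; apply: tameZ; set W := (X in wD X).
apply: tame_weaken (tame_wD W tb); rewrite lerD2l ler_wpM2l // ler_nat /W.
by case: ifP => // h; rewrite size_map.
Qed.

Lemma cts_jap : continuous (@jap R n).
have -> : @jap R n = fun x : rV => Num.sqrt (1 + \sum_j x 0 j ^+ 2).
 by ext x; rewrite -jap_sqr sqrtr_sqr ger0_norm ?jap_ge0.
apply: (ctsc (@sqrt_continuous R)).
apply: cts_add; first cts.
elim: (index_enum _) => [|j s IH].
 by under eq_fun do rewrite big_nil; cts.
under eq_fun do rewrite big_cons; apply: cts_add => //.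
under eq_fun do rewrite expr2.
by apply: cts_mul; exact: coord_continuous.
Qed.

Lemma near_jap (z0 : V) : \forall z \near z0, jap z.2 <= jap z0.2 + 1.
have c : continuous (fun z : V => jap z.2).
 by apply: (ctsc cts_jap) => ?; exact: cvg_snd.
have h := (@cvgrPdist_le _ _ _ (nbhs z0) _ (fun z : V => jap z.2) (jap z0.2)).1 (c z0) 1 ltr01.
apply: filterS (h _) => z; rewrite distrC => /(le_trans (ler_norm _)).
by rewrite lerBlDl.
Qed.

Lemma near_jap_pow (z0 : V) (K : R) N : 0 <= K -> exists K', forall p : rV -> R, (forall x, 0 <= p x) ->
 \forall z \near z0, forall x, K * jap z.2 ^+ N * p x <= K' * p x.
move=> K0; exists (K * (jap z0.2 + 1) ^+ N) => p p0; have := near_jap z0; apply: filterS => z hz x.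
by monor; rewrite ler_wpM2l // lerXn2r ?nnegrE // addr_ge0.
Qed.

Definition ghatI (a : V -> C) (z : V) (ze y : rV) : C :=
 expi (-1 * dot y ze) * ((wt y)%:C * a (z.1 + y, z.2)).

Lemma ghatE a z ze : ghat a z ze = iRn (ghatI a z ze).
by []. Qed.

Lemma ghatI_cts (T : topologicalType) (a : V -> C) (f : T -> V) (g h : T -> rV) :
 csm a -> continuous f -> continuous g -> continuous h ->
 continuous (fun t => ghatI a (f t) (g t) (h t)).
move=> sa cf cg ch; apply: ccontM.
 apply: cts_expi; apply: cts_mul; first cts.
 exact: cts_dot.
apply: ccontM.
 by apply: ctsC; apply: (ctsc (@cts_wt R n)).
apply: (ctsc (csmc sa)); apply: cts_pair.
 apply: cts_addv => //; exact: (ctsc (fun z => cvg_fst) cf).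
exact: (ctsc (fun z => cvg_snd) cf).
Qed.

Lemma ghatI_bd m d (a : V -> C) : 0 <= d -> tame m d a ->
 exists (N : nat) (K : R), 0 <= K /\
 forall z ze y, rnorm (ghatI a z ze y) <= K * jap z.2 ^+ N * wt y.
move=> d0 ta; have [N [K [K0 hK]]] := tame_poly d0 ta; exists N, K; split=> // z ze y.
rewrite rnM rne mul1r rnM rnr ger0_norm // mulrC.
by monor; exact: (hK (_, _)).
Qed.

Lemma ghat_ccont m d (a : V -> C) : 0 <= d -> tame m d a -> ccont (ghat a).
move=> d0 ta; have [sa _] := ta; have [N [K [K0 hK]]] := ghatI_bd d0 ta.
apply: (@iRn_cts R (V * rV)%type n (fun q y => ghatI a q.1 q.2 y)).
 apply: ghatI_cts => //.
 - by move=> q; apply: continuous_comp; exact: cvg_fst.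
 - by move=> q; apply: continuous_comp; [exact: cvg_fst|exact: cvg_snd].
 - by cts.
move=> q; have [K' hK'] := near_jap_pow q.1 N K0; exists K'.
have cq : nbhs q.1 `<=` nbhs q.1 by [].
have h : \forall r \near q, forall y : rV, K * jap r.1.2 ^+ N * wt y <= K' * wt y.
 exact: (@cvg_fst _ _ (nbhs q.1) (nbhs q.2) _ _ (hK' _ (@wt_ge0 R n))).
apply: filterS h => r hr y; exact: le_trans (hK _ _ _) (hr y).
Qed.

Lemma cder_translate (a : V -> C) (y : V) (z v : V) : csm a ->
 cder v (fun z => a (z + y)) z (cD v a (z + y)).
move=> sa; apply: (@cder_comp R V V a (fun z => z + y) z v v).
 by move=> t; rewrite addrAC.
exact: csm_cder.
Qed.

Lemma cder_ghat m d (a : V -> C) (z v : V) (ze : rV) : 0 <= d -> tame m d a ->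
 cder v (fun z => ghat a z ze) z (ghat (cD v a) z ze).
move=> d0 ta; have [sa _] := ta; have ta' := tame_cD v d0 ta.
have cc a' : csm a' -> ccont (fun z => ghatI a' z ze).
 move=> sa'; apply: ghatI_cts => //; cts.
have ll a' m' : tame m' d a' -> ldom (fun z => ghatI a' z ze).
 move=> ta1 q; have [N [K [K0 hK]]] := ghatI_bd d0 ta1.
 have [K' hK'] := near_jap_pow q N K0; exists K'.
 apply: filterS (hK' _ (@wt_ge0 R n)) => r hr y; exact: le_trans (hK _ _ _) (hr y).
apply: (@cder_iRn R V n (fun z => ghatI a z ze) (fun z => ghatI (cD v a) z ze)).
- exact: cc.
- exact: cc (csm_cD v sa).
- exact: ll ta.
- exact: ll ta'.
move=> q y; apply: cderZ; apply: cderZ.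
have E (b : V -> C) (z' : V) : b (z'.1 + y, z'.2) = b (z' + ((y, 0) : V)).
 by congr b; congr (_, _); rewrite /= addr0.
rewrite E (_ : (fun z' : V => _) = fun z' : V => a (z' + ((y, 0) : V))); last by ext z'; rewrite E.
exact: cder_translate.
Qed.

(* The symbol of [op b] composed with [op a] is the oscillatory integral
 [(2 pi)^-n int int e^(-i y.ze) b (x, xi + ze) a (x + y, xi)]; integration
 by parts in [ze] makes it absolutely convergent. *)
Definition compI (b a : V -> C) (z : V) (ze : rV) : C :=
 bes_xi b (z.1, z.2 + ze) * ghat a z ze.

Definition comp_sym (b a : V -> C) (z : V) : C :=
 ((2 * pi) ^- n)%:C * iRn (compI b a z).

Lemma ghat_poly m d (a : V -> C) M : 0 <= d -> tame m d a -> exists (N : nat) (K : R), 0 <= K /\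
 forall z ze, hnorm ze ^+ M * rnorm (ghat a z ze) <= K * jap z.2 ^+ N.
move=> d0 ta; have [K K0 hK] := tame_unif M d0 ta.
have [N hN] := japR_natle (0 : rV) (m + d * M%:R).
exists N, `|ghat_cst M * K|; split=> // z ze.
letr (@ghat_bd a z ze m d M (K * jap z.2 `^ (m + d * M%:R)) ta _).
 by move=> U x UM; apply: (hK _ (x, z.2)); rewrite size_map.
rewrite mulrA; letr (ler_wpM2r (japR_ge0 _ _) (ler_norm _)).
by rewrite ler_wpM2l.
Qed.

Lemma hnorm_wt (ze : rV) (X A : R) : 0 <= X -> hnorm ze ^+ (2 * n) * X <= A -> X <= A * wt ze.
move=> X0 h; rewrite mulrC -ler_pdivrMl ?wt_gt0 //; apply: le_trans h.
by monor; rewrite wtV_le.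
Qed.

Lemma compI_bd mb ma d (b a : V -> C) : 0 <= d -> tame mb d b -> tame ma d a ->
 exists (N : nat) (K : R), 0 <= K /\
 forall z ze, rnorm (compI b a z ze) <= K * jap z.2 ^+ N * wt ze.
move=> d0 tb ta.
have [Nb [Kb [Kb0 hKb]]] := tame_poly d0 (tame_bes d0 tb).
(* Decay of order [2 n] makes the integrand integrable; [Nb] more powers absorb the growth of [b] at
   [xi + ze]. *)
have [Na [Ka [Ka0 hKa]]] := ghat_poly (2 * n + Nb) d0 ta.
exists (Nb + Na)%N, (Kb * Ka); split; first exact: mulr_ge0.
move=> z ze; apply: hnorm_wt; first by [].
have H0 := ltW (hnorm_gt0 ze).
rewrite /compI rnM.
letr (_ : _ <= hnorm ze ^+ (2 * n) * (Kb * (jap z.2 * hnorm ze) ^+ Nb * rnorm (ghat a z ze))).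
 monol; monor; letr (hKb _).
 monol; rewrite lerXn2r ?nnegrE ?mulr_ge0 //; exact: jap_mul.
have := ler_wpM2l (mulr_ge0 Kb0 (exprn_ge0 Nb (jap_ge0 z.2))) (hKa z ze).
by rewrite exprMn !exprD; congr (_ <= _); ring.
Qed.

Lemma compI_ccont mb ma d (b a : V -> C) : 0 <= d -> tame mb d b -> tame ma d a -> ccont (compI b a).
move=> d0 tb ta; apply: ccontM; last exact: (ghat_ccont d0 ta).
have [sb _] := tb; apply: (ctsc (csmc (csm_bes sb))).
have c11 : continuous (fun x : V * rV => x.1.1).
 by move=> x; apply: continuous_comp; exact: cvg_fst.
have c12 : continuous (fun x : V * rV => x.1.2).
 by move=> x; apply: continuous_comp; [exact: cvg_fst|exact: cvg_snd].
apply: cts_pair => //; apply: cts_addv => //.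
cts.
Qed.

Lemma compI_ldom mb ma d (b a : V -> C) : 0 <= d -> tame mb d b -> tame ma d a -> ldom (compI b a).
move=> d0 tb ta q; have [N [K [K0 hK]]] := compI_bd d0 tb ta.
have [K' hK'] := near_jap_pow q N K0; exists K'.
apply: filterS (hK' _ (@wt_ge0 R n)) => r hr y; exact: le_trans (hK _ _) (hr y).
Qed.

Lemma cts_comp_sym mb ma d (b a : V -> C) : 0 <= d -> tame mb d b -> tame ma d a -> continuous (comp_sym b a).
move=> d0 tb ta; apply: ccontM; first cts.
by apply: iRn_cts; [exact: compI_ccont tb ta|exact: compI_ldom tb ta].
Qed.

Lemma cder_comp_sym mb ma d (b a : V -> C) (v z : V) : 0 <= d -> tame mb d b -> tame ma d a ->
 cder v (comp_sym b a) z (comp_sym (cD v b) a z + comp_sym b (cD v a) z).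
move=> d0 tb ta; have tb' := tame_cD v d0 tb; have ta' := tame_cD v d0 ta.
have [N1 [K1 [K10 h1]]] := compI_bd d0 tb' ta.
have [N2 [K2 [K20 h2]]] := compI_bd d0 tb ta'.
have cc1 := compI_ccont d0 tb' ta; have cc2 := compI_ccont d0 tb ta'.
have cs F : ccont F -> continuous (F z : rV -> C).
 by move=> cF; apply: (ccomp cF); cts.
rewrite /comp_sym -mulrDr; apply: cderZ.
pose dF (z : V) ze := compI (cD v b) a z ze + compI b (cD v a) z ze.
have -> : iRn (compI (cD v b) a z) + iRn (compI b (cD v a) z) = iRn (dF z).
 pose K := K1 * jap z.2 ^+ N1 + K2 * jap z.2 ^+ N2.
 rewrite -(@iRnD _ _ (compI (cD v b) a z) (compI b (cD v a) z) K) //; [exact: cs|exact: cs| |].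
 - move=> x; letr (h1 z x); monor; rewrite lerDl; apply: mulr_ge0 => //; exact: exprn_ge0 (jap_ge0 _).
 - move=> x; letr (h2 z x); monor; rewrite lerDr; apply: mulr_ge0 => //; exact: exprn_ge0 (jap_ge0 _).
apply: (@cder_iRn R V n (compI b a) dF).
- exact: compI_ccont tb ta.
- exact: (ccontD cc1 cc2).
- exact: compI_ldom tb ta.
- move=> q; have [K1' hK1'] := compI_ldom d0 tb' ta q.
 have [K2' hK2'] := compI_ldom d0 tb ta' q.
 exists (K1' + K2'); apply: filterS2 hK1' hK2' => r hr1 hr2 x.
 by rewrite mulrDl; letr (rnD _ _); rewrite lerD.
move=> q x; apply: cderM; last exact: cder_ghat ta.
have E (f : V -> C) (z' : V) : f (z'.1, z'.2 + x) = f (z' + ((0, x) : V)).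
 by congr f; congr (_, _); rewrite /= addr0.
have [sb _] := tb.
rewrite E bes_cD // (_ : (fun z' : V => _) = fun z' : V => bes_xi b (z' + ((0, x) : V))); last by ext z'; rewrite E.
by apply: cder_translate; exact: csm_bes.
Qed.

(** The class for the coinduction: finite sums of compositions of tame symbols. The derivative of
    one composition is a sum of two, each with one order raised by [d]. *)
Lemma csm_comp mb ma d (b a : V -> C) : 0 <= d -> tame mb d b -> tame ma d a -> csm (comp_sym b a).
move=> d0 tb ta.
pose Q (F : V -> C) := exists s : seq ((V -> C) * (V -> C)),
 (forall p, List.In p s -> exists mb ma, tame mb d p.1 /\ tame ma d p.2) /\
 F = fun z => \sum_(p <- s) comp_sym p.1 p.2 z.
apply: (csm_coind (Q := Q)); last first.
- exists [:: (b, a)]; split=> [p [<-|//]|]; first by exists mb, ma.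
 by ext z; rewrite big_seq1.
- move=> _ v [s [hs ->]]; elim: s hs => [|p s IH] hs.
  exists (fun _ => 0); first by exists [::]; split=> //; ext z; rewrite big_nil.
  by move=> x; under eq_fun do rewrite big_nil; exact: cder_cst.
 have [G [s' [hs' ->]] hG] := IH (fun q hq => hs q (or_intror hq)).
 have [mb' [ma' [t1 t2]]] := hs p (or_introl erefl).
 exists (fun z => comp_sym (cD v p.1) p.2 z + comp_sym p.1 (cD v p.2) z + \sum_(p <- s') comp_sym p.1 p.2 z).
  exists ((cD v p.1, p.2) :: (p.1, cD v p.2) :: s'); split.
  move=> q [<-|[<-|/hs' //]]; last by exists mb', (ma' + d); split=> //; exact: tame_cD.
  by exists (mb' + d), ma'; split=> //; exact: tame_cD.
  by ext z; rewrite !big_cons addrA.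
 move=> x; under eq_fun do rewrite big_cons.
 by apply: cderD; [exact: cder_comp_sym t1 t2|exact: hG].
move=> _ [s [hs ->]]; elim: s hs => [|p s IH] hs.
 by under eq_fun do rewrite big_nil; cts.
under eq_fun do rewrite big_cons.
have [mb' [ma' [t1 t2]]] := hs p (or_introl erefl).
exact: (ccontD (cts_comp_sym d0 t1 t2) (IH (fun q hq => hs q (or_intror hq)))).
Qed.

Lemma wD_comp W mb ma d (b a : V -> C) : 0 <= d -> tame mb d b -> tame ma d a ->
 wD W (comp_sym b a) = fun z => \sum_(p <- spl W) comp_sym (wD p.1 b) (wD p.2 a) z.
move=> d0 tb ta; elim: W => [|l W IH].
 by ext z; rewrite [spl _]/= big_seq1 !wD_nil.
have sc p : csm (comp_sym (wD p.1 b) (wD p.2 a)).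
 exact: csm_comp (tame_wD p.1 tb) (tame_wD p.2 ta).
have E := cDs_sum (spl W) [:: ldir l] sc.
rewrite wD_cons IH -[cD _ _]cDsn -[cDs [::] (cD _ _)]/(cDs [:: ldir l] _) E.
ext x; rewrite [spl (l :: W)]/= big_cat !big_map /= -big_split; apply: eq_bigr => p _ /=.
rewrite !wD_cons; apply: cder_val.
exact: cder_comp_sym (tame_wD p.1 tb) (tame_wD p.2 ta).
Qed.

(** * Expansion of the symbol of a composition *)

Lemma iRn_sum (I : Type) (s : seq I) (F : I -> rV -> C) :
 (forall i, continuous (F i)) -> (forall i, exists K, forall x, rnorm (F i x) <= K * wt x) ->
 iRn (fun x => \sum_(i <- s) F i x) = \sum_(i <- s) iRn (F i).
move=> cF /choice[K hK].
have c s' : continuous (fun x => \sum_(i <- s') F i x).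
 elim: s' => [|i s' IH]; first by under eq_fun do rewrite big_nil; cts.
 under eq_fun do rewrite big_cons; exact: (ccontD (cF i) IH).
have K0 i : 0 <= K i := coef_ge0 (hK i 0) (wt_gt0 _).
have bd s' x : rnorm (\sum_(i <- s') F i x) <= (\sum_(i <- s') K i) * wt x.
 by rewrite mulr_suml; letr (rn_sum _ _ _); apply: ler_sum.
elim: s => [|i s IH].
 under eq_fun do rewrite big_nil; rewrite big_nil.
 have := @iRnZ R n (fun _ => 0) 0 0 (@cts_cst _ _ _).
 under eq_fun do rewrite mul0r; rewrite mul0r; apply=> x.
 by rewrite rn0 mul0r.
rewrite big_cons -IH; under eq_fun do rewrite big_cons.
apply: (@iRnD _ _ _ _ (K i + \sum_(j <- s) K j)); [exact: cF|exact: c| |] => x.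
 by letr (hK i x); monor; rewrite lerDl; exact: sumr_ge0.
by letr (bd s x); monor; rewrite lerDr.
Qed.

Fixpoint twords (k : nat) : seq (seq 'I_n) :=
 if k is k'.+1 then [seq j :: W | j <- index_enum 'I_n, W <- twords k'] else [:: [::]].

Lemma size_twords k W : W \in twords k -> size W = k.
elim: k W => [|k IH] W; first by rewrite inE => /eqP ->.
by move=> /allpairsP[[j U] [_ /IH hU ->]] /=; rewrite hU.
Qed.

Lemma ldir_xi (ze : rV) : ((0, ze) : V) = \sum_(j <- index_enum 'I_n) ze 0 j *: ldir (true, j).
rewrite (letter_sum (0, ze)).
transitivity (\sum_(b : bool) \sum_(j < n) letter_coord (b, j) ((0, ze) : V) *: ldir (b, j)).
 by rewrite pair_bigA; apply: eq_bigr => -[b j].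
rewrite big_bool /= [X in _ + X]big1 ?addr0 // => j _.
by rewrite /letter_coord /= mxE scale0r.
Qed.

Lemma cDs_nseq k (ze : rV) (f : V -> C) : csm f ->
 cDs (nseq k ((0, ze) : V)) f = fun z => \sum_(W <- twords k) (\prod_(j <- W) ze 0 j)%:C * wD (xiw W) f z.
move=> sf; elim: k => [|k IH].
 by ext z; rewrite [nseq 0 _]/= cDsn big_seq1 big_nil mul1r wD_nil.
rewrite [nseq k.+1 _]/= cDsc IH ldir_xi cD_sumv; last first.
 by apply: csm_sum => W; apply: csmZ; exact: csm_wD.
ext z; rewrite [twords k.+1]/= big_allpairs_dep; apply: eq_bigr => j _.
have E := @cDs_sum R V _ (twords k) (fun W z => (\prod_(j <- W) ze 0 j)%:C * wD (xiw W) f z) [:: ldir (true, j)].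
rewrite cDsc cDsn in E; rewrite E; last by move=> W; apply: csmZ; exact: csm_wD.
rewrite mulr_sumr; apply: eq_bigr => W _; rewrite cDsc cDsn cD_Z; last exact: csm_wD.
by rewrite big_cons rmorphM -mulrA [xiw (j :: W)]/= wD_cons.
Qed.

Definition allwords N : seq (seq 'I_n) := flatten [seq twords k | k <- iota 0 N].

(** All orderings of a word are listed separately, so the factorial of the length takes the place of
    the multi-index factorial. *)
Definition tcoef (W : seq 'I_n) : C := ((size W)`!%:R^-1)%:C.

Lemma taylor_words N (f : V -> C) (z : V) (ze : rV) (K : R) : csm f ->
 (forall s : R, 0 <= s <= 1 -> rnorm (cDs (nseq N ((0, ze) : V)) f (z.1, z.2 + s *: ze)) <= K) ->
 rnorm (f (z.1, z.2 + ze) -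
  \sum_(W <- allwords N) tcoef W * (\prod_(j <- W) ze 0 j)%:C * wD (xiw W) f z) <= 2 * K.
move=> sf hK.
have E (s : R) (y : rV) : ((z.1, z.2 + s *: y) : V) = z + s *: ((0, y) : V).
 by case: z {hK} => z1 z2; congr (_, _) => /=; rewrite ?scaler0 ?addr0.
have := @taylor_line R V f z (0, ze) N K sf.
have -> : z + ((0, ze) : V) = (z.1, z.2 + ze) by have := E 1 ze; rewrite !scale1r.
have -> : \sum_(W <- allwords N) tcoef W * (\prod_(j <- W) ze 0 j)%:C * wD (xiw W) f z =
  \sum_(k < N) (k`!%:R^-1)%:C * cDs (nseq k ((0, ze) : V)) f z.
 rewrite /allwords big_flatten big_map -[in RHS](big_mkord xpredT (fun k => (k`!%:R^-1)%:C * cDs (nseq k ((0, ze) : V)) f z)).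
 rewrite /index_iota subn0; apply: eq_bigr => k _.
 rewrite cDs_nseq // mulr_sumr; apply: eq_big_seq => W /size_twords hW.
 by rewrite /tcoef hW mulrA.
by apply=> s s01; rewrite -E; exact: hK.
Qed.

Definition bes_size : R := \sum_(cW <- bwords) `|cW.1|.

Lemma bes_size_ge0 : 0 <= bes_size. Proof. exact: sumr_ge0. Qed.

Lemma wD_bes_bd (b : V -> C) W (z : V) (K : R) : csm b ->
 (forall Q, (size Q <= 2 * n)%N -> rnorm (wD (xiw (W ++ Q)) b z) <= K) ->
 rnorm (wD (xiw W) (bes_xi b) z) <= bes_size * K.
move=> sb hK; rewrite wD_sum; last by move=> cQ; apply: csmZ; exact: csm_wD.
letr (rn_sum _ _ _); rewrite /bes_size mulr_suml !big_seq.
apply: ler_sum => cQ /size_bwords hQ; rewrite (wD_Z _ _ (csm_wD (xiw cQ.2) sb)) rnM rnr.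
by monol; rewrite -wD_cat /xiw -map_cat; exact: hK.
Qed.

Lemma prod_coord_bd (ze : rV) (W : seq 'I_n) : rnorm ((\prod_(j <- W) ze 0 j)%:C : C) <= hnorm ze ^+ size W.
elim: W => [|j W IH]; first by rewrite big_nil expr0 rn1.
rewrite big_cons rmorphM rnM rnr exprS.
by apply: ler_pM => //; exact: coord_le_hnorm.
Qed.

(* For [|zeta| <= J/2] the bracket [J] of [xi + s zeta] is comparable to the one
 of [xi]; otherwise [hnorm ze >= J/2] and any power of [J] can be bought
 with the rapid decrease in [ze]. *)
Lemma jap_peetre (xi ze : rV) (s e : R) L : 0 <= s <= 1 -> 0 <= e ->
 jap (xi + s *: ze) `^ (- e) <= 2 `^ e * jap xi `^ (- e) + 2 ^+ L * hnorm ze ^+ L * jap xi `^ (- L%:R).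
move=> /andP[s0 s1] e0; have J0 := jap_gt0 xi.
have H0 := hnorm_gt0 ze.
have S0 : \sum_j `|(s *: ze) 0 j| <= \sum_j `|ze 0 j|.
 by apply: ler_sum => j _; rewrite mxE normrM ger0_norm // ler_piMl.
have t2 : 0 <= 2 ^+ L * hnorm ze ^+ L * jap xi `^ (- L%:R) by rewrite !mulr_ge0 ?exprn_ge0 // ltW.
have t1 : 0 <= 2 `^ e * jap xi `^ (- e) by rewrite mulr_ge0.
have [h|h] := lerP (\sum_j `|ze 0 j|) (jap xi / 2).
 have h1 : jap xi / 2 <= jap (xi + s *: ze).
  by apply: le_trans (jap_sub xi (s *: ze)); rewrite [X in X - _](splitr (jap xi)); lra.
 rewrite -[X in X <= _]addr0; apply: lerD => //.
 rewrite !powRN -{1}[2 `^ e]invrK -invfM lef_pV2 ?posrE ?powR_gt0 ?mulr_gt0 ?invr_gt0 ?powR_gt0 ?jap_gt0 //.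
 have -> : (2 `^ e)^-1 = (2^-1 : R) `^ e by rewrite -powRN -[in RHS]powR_inv1 // -powRrM mulN1r.
 rewrite -powRM ?invr_ge0 ?(ltW J0) //; apply: ge0_ler_powR => //; rewrite ?nnegrE ?mulr_ge0 ?invr_ge0 ?(ltW J0) //.
 by rewrite mulrC.
rewrite -[X in X <= _]add0r; apply: lerD => //.
letr (_ : _ <= 1).
 by rewrite -(powRr0 (jap (xi + s *: ze))); apply: japR_le; rewrite oppr_le0.
rewrite powRN powR_mulrn ?(ltW J0) // -exprMn ler_pdivlMr ?exprn_gt0 // mul1r.
rewrite lerXn2r ?nnegrE ?mulr_ge0 ?(ltW J0) ?(ltW H0) //.
by rewrite /hnorm; lra.
Qed.

Definition twords_size N : R := (size (twords N))%:R.

(** The remainder holds a bracket at [xi + s ze]. [jap_peetre] trades it for the one at [xi], at the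
    price of a summand with [L] further powers of [hnorm ze]. *)
Lemma taylor_bes_rem (b : V -> C) (z : V) (ze : rV) (be e : R) N L : csm b -> 0 <= e -> 0 <= be ->
 (forall W z', (N <= size W <= N + 2 * n)%N -> rnorm (wD (xiw W) b z') <= be * jap z'.2 `^ (- e)) ->
 rnorm (bes_xi b (z.1, z.2 + ze) -
  \sum_(W <- allwords N) tcoef W * (\prod_(j <- W) ze 0 j)%:C * wD (xiw W) (bes_xi b) z)
 <= 2 * (twords_size N * bes_size * be) * (hnorm ze ^+ N *
  (2 `^ e * jap z.2 `^ (- e) + 2 ^+ L * hnorm ze ^+ L * jap z.2 `^ (- L%:R))).
move=> sb e0 be0 hb; rewrite -mulrA; apply: taylor_words; first exact: csm_bes.
move=> s s01; set P := (X in hnorm ze ^+ N * X).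
rewrite cDs_nseq; last exact: csm_bes.
letr (rn_sum _ _ _).
letr (_ : _ <= \sum_(W <- twords N) hnorm ze ^+ N * (bes_size * (be * P))); last first.
 rewrite big_const_seq count_predT iter_addr_0 /twords_size -mulr_natl.
 by apply: eq_ler; ring.
rewrite !big_seq; apply: ler_sum => W /size_twords hW; rewrite rnM.
apply: ler_pM; rewrite //; first by rewrite -hW; exact: prod_coord_bd.
apply: (wD_bes_bd sb) => Q hQ; letr (hb _ _ _).
 by rewrite size_cat hW leq_addr leq_add2l.
by monol; exact: jap_peetre.
Qed.

Lemma wt_at0 : wt (0 : rV) = 1.
by rewrite /wt big1 // => j _; rewrite mxE /wt1 expr0n /= addr0 invr1. Qed.

Lemma bwords_head : exists s, bwords = (1, [::]) :: s /\ all (fun cW => 0 < size cW.2)%N s.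
rewrite /bwords; elim: (index_enum _) => [|j t [s [E hs]]]; first by exists [::].
rewrite [bes_words _ _]/= E; exists (s ++ [seq (- cW.1, j :: j :: cW.2) | cW <- (1, [::]) :: s]).
by split=> //; rewrite all_cat hs all_map; apply/allP.
Qed.

Lemma allwords_head N : exists s, allwords N.+1 = [::] :: s /\
 forall W, W \in s -> (0 < size W <= N)%N.
exists (flatten [seq twords k | k <- iota 1 N]); split=> // W /flattenP[_ /mapP[k hk ->] /size_twords ->].
by move: hk; rewrite mem_iota add1n ltnS.
Qed.

Definition main_cst N : R := bes_size +
 \sum_(W <- behead (allwords N.+1)) bes_size * split_cst W.

(** The empty word with the leading coefficient of [bes_xi] contributes [b * a]. Every other term
    carries at least one [xi]-derivative of [b] and no more [x]-derivatives of [a] than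
    [xi]-derivatives of [b], the situation covered by [gam]. The weight enters only through its
    derivatives at 0. *)
Lemma main_term_bd m d (b a : V -> C) (z : V) (gam : R) N : csm b -> tame m d a -> 0 <= gam ->
 (forall W U, (0 < size W <= N + 2 * n)%N -> (size U <= size W)%N ->
  rnorm (wD (xiw W) b z) * rnorm (wD (xw U) a z) <= gam) ->
 rnorm (\sum_(W <- allwords N.+1) tcoef W * (- 'i) ^+ size W * wD (xiw W) (bes_xi b) z *
  cDs (ud R W) (fun y => (wt y)%:C * a (z.1 + y, z.2)) 0 - b z * a z) <= main_cst N * gam.
move=> sb ta g0 hg; have [sa _] := ta.
have [s [Es hs]] := allwords_head N; have [t [Et ht]] := bwords_head.
have z0 : (z.1 + 0, z.2) = z by rewrite addr0; case: z {hg}.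
rewrite /main_cst Es big_cons [behead _]/=.
have E0 : tcoef [::] * (- 'i) ^+ size (@nil 'I_n) * wD (xiw [::]) (bes_xi b) z *
  cDs (ud R [::]) (fun y => (wt y)%:C * a (z.1 + y, z.2)) 0 =
  b z * a z + \sum_(cW <- t) cW.1%:C * (wD (xiw cW.2) b z * a z).
 rewrite /tcoef [size _]/= expr0 fact0 invr1 !mul1r wD_nil [ud _ _]/= cDsn wt_at0 mul1r z0.
 rewrite /bes_xi Et big_cons mul1r wD_nil mulrDl mulr_suml; congr (_ + _).
 by apply: eq_bigr => cW _; rewrite mulrA.
rewrite E0 addrAC -addrA -addrA [X in rnorm X](_ : _ = \sum_(cW <- t) cW.1%:C * (wD (xiw cW.2) b z * a z) +
 \sum_(W <- s) tcoef W * (- 'i) ^+ size W * wD (xiw W) (bes_xi b) z *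
  cDs (ud R W) (fun y => (wt y)%:C * a (z.1 + y, z.2)) 0); last by ring.
rewrite mulrDl; letr (rnD _ _); apply: lerD.
 rewrite /bes_size mulr_suml Et big_cons -[X in X <= _]add0r; apply: lerD; first by rewrite mulr_ge0.
 letr (rn_sum _ _ _); rewrite !big_seq; apply: ler_sum => cQ hcQ.
 rewrite rnM rnr ler_wpM2l // rnM.
 have hin : cQ \in bwords by rewrite Et inE hcQ orbT.
 have := hg cQ.2 [::]; rewrite (allP ht _ hcQ) (leq_trans (size_bwords hin)) ?leq_addl // => /(_ isT isT).
 by rewrite wD_nil.
letr (rn_sum _ _ _); rewrite mulr_suml !big_seq; apply: ler_sum => W hW.
have /andP[W0 WN] := hs W hW.
have [s1 s2] := shift_x z sa.
rewrite cDs_M //; last exact: (wcstP).1.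
rewrite /ud spl_map big_map rnM !rnM rnX rnN rni expr1n mulr1 rnr.
have c1 : `|(size W)`!%:R^-1 : R| <= 1 by rewrite ger0_norm ?invr_ge0 ?ler0n // invf_le1 ?ltr0n ?fact_gt0 // ler1n fact_gt0.
rewrite -mulrA; letr (ler_piMl _ c1); first by rewrite mulr_ge0 // rn_ge0.
letr (ler_wpM2l (rn_ge0 _) (rn_sum _ _ _)).
rewrite mulr_sumr /split_cst mulr_sumr mulr_suml !big_seq; apply: ler_sum => p /size_spl hp.
rewrite rnM -/(ud R p.1) -/(ud R p.2) s2 z0 mulrCA [_ * wcst _]mulrC -mulrA.
apply: ler_pM; rewrite ?mulr_ge0 //.
 by have := (wcstP).2 p.1 0; rewrite wt_at0 mulr1.
have [->|a0] := eqVneq (rnorm (wD (xw p.2) a z)) 0.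
 by rewrite mulr0 mulr_ge0 // bes_size_ge0.
have ap : 0 < rnorm (wD (xw p.2) a z) by rewrite lt_neqAle eq_sym a0 rn_ge0.
rewrite -ler_pdivlMr // -mulrA; apply: (wD_bes_bd sb) => Q hQ.
rewrite ler_pdivlMr //; apply: hg; rewrite size_cat.
 by rewrite addn_gt0 W0 leq_add.
by apply: leq_trans (leq_addr _ _); rewrite -hp leq_addl.
Qed.

Lemma ft_coord_prod K (F : rV -> C) (ze : rV) (W : seq 'I_n) : wclass K F ->
 (\prod_(j <- W) ze 0 j)%:C * ft (-1) F ze = (- 'i) ^+ size W * ft (-1) (cDs (ud R W) F) ze.
move=> hF; rewrite (ft_cDs (-1) ze W hF) mulrA; congr (_ * _).
elim: W => [|j W IH]; first by rewrite !big_nil mul1r.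
rewrite !big_cons [(_ * _)%:C]rmorphM /= IH exprS mulN1r rmorphN /=.
have i2 : 'i * 'i = -1 :> C by rewrite -expr2 sqrCi.
set x := 'i in i2 *; set A := _ ^+ size W; set P := \prod_(j0 <- W) _; set t := (ze 0 j)%:C.
transitivity (- (x * x) * t * A * P); last by ring.
by rewrite i2 opprK; ring.
Qed.

(** A monomial in [ze] times [ghat] is the transform of a derivative, and Fourier inversion
    evaluates its integral as that derivative at [y = 0]. The Taylor part of the composition is thus
    computed exactly. *)
Lemma taylor_int m d (a f : V -> C) (z : V) N : tame m d a ->
 let T (ze : rV) := \sum_(W <- allwords N) tcoef W * (\prod_(j <- W) ze 0 j)%:C * wD (xiw W) f z in
 [/\ continuous (fun ze => T ze * ghat a z ze),
  exists K, forall ze, rnorm (T ze * ghat a z ze) <= K * wt ze &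
  ((2 * pi) ^- n)%:C * iRn (fun ze => T ze * ghat a z ze) =
  \sum_(W <- allwords N) tcoef W * (- 'i) ^+ size W * wD (xiw W) f z *
  cDs (ud R W) (fun y => (wt y)%:C * a (z.1 + y, z.2)) 0].
move=> ta T; have [A hA] := tame_wclass z ta; have hF := wclass_ghat ta.1 hA.
set K := (fun W => _) in hF; set F := (fun y => _) in hF *.
pose G (W : seq 'I_n) (ze : rV) := (tcoef W * (- 'i) ^+ size W * wD (xiw W) f z) * ft (-1) (cDs (ud R W) F) ze.
have m1 : (-1) ^+ 2 = 1 :> R by rewrite sqrrN expr1n.
have TE : (fun ze => T ze * ghat a z ze) = (fun ze => \sum_(W <- allwords N) G W ze).
 ext ze; rewrite mulr_suml; apply: eq_bigr => W _.
 rewrite /G -!mulrA [_ * (_ * ft _ _ _)]mulrCA -(ft_coord_prod ze W hF) /ghat -/F; ring.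
have cG W : continuous (G W).
 by apply: ccontM; [cts|exact: (ft_cts (wclass_cDs W hF))].
have bG W : exists K', forall ze, rnorm (G W ze) <= K' * wt ze.
 exists (rnorm (tcoef W * (- 'i) ^+ size W * wD (xiw W) f z) * (bes_norm (fun U => K (U ++ W)) * (2 * pi) ^+ n)) => ze.
 rewrite {1}/G rnM -[leRHS]mulrA ler_wpM2l //.
 exact: ft_decay m1 (wclass_cDs W hF).
have sG s : continuous (fun ze => \sum_(W <- s) G W ze).
 elim: s => [|W s IH]; first by under eq_fun do rewrite big_nil; cts.
 under eq_fun do rewrite big_cons; exact: (ccontD (cG W) IH).
rewrite TE; split; first exact: sG.
 have /choice[K' hK'] := bG; exists (\sum_(W <- allwords N) K' W) => ze.
 rewrite (congr1 (@^~ ze) TE) mulr_suml.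
 by letr (rn_sum _ _ _); apply: ler_sum.
rewrite iRn_sum // mulr_sumr; apply: eq_bigr => W _.
have hW := wclass_cDs W hF.
rewrite (@iRnZ _ _ _ _ (bes_norm (fun U => K (U ++ W)) * (2 * pi) ^+ n)).
- rewrite (ft_inversion m1 hW) mulrCA; congr (_ * _); rewrite mulrA -rmorphM /= mulVf ?mul1r //.
 by rewrite expf_neq0 // mulf_neq0 // gt_eqF // pi_gt0.
- exact: (ft_cts hW).
- by move=> ze; exact: ft_decay m1 hW.
Qed.

Definition rem_cst N : R := 2 * (twords_size N * bes_size).

(** The Taylor part is treated by [main_term_bd], the remainder by pointwise domination. [al0] pays
    for the [N + 1] powers of [ze] in the remainder and for the [2 n] of integrability; [al1] pays
    for [L] more, needed where [ze] is large compared with [xi]. *)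
Lemma comp_rem mb ma d (b a : V -> C) (z : V) (gam be e al0 al1 : R) N L :
 0 <= d -> tame mb d b -> tame ma d a -> 0 <= e -> 0 <= be -> 0 <= gam ->
 (forall W z', (N.+1 <= size W <= N.+1 + 2 * n)%N -> rnorm (wD (xiw W) b z') <= be * jap z'.2 `^ (- e)) ->
 (forall U x, (size U <= N.+1 + 2 * n)%N -> rnorm (wD (xw U) a (x, z.2)) <= al0) ->
 (forall U x, (size U <= N.+1 + L + 2 * n)%N -> rnorm (wD (xw U) a (x, z.2)) <= al1) ->
 (forall W U, (0 < size W <= N + 2 * n)%N -> (size U <= size W)%N ->
  rnorm (wD (xiw W) b z) * rnorm (wD (xw U) a z) <= gam) ->
 rnorm (comp_sym b a z - b z * a z) <= main_cst N * gam +
  rem_cst N.+1 * be * (2 `^ e * jap z.2 `^ (- e) * (ghat_cst (N.+1 + 2 * n) * al0)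
  + 2 ^+ L * jap z.2 `^ (- L%:R) * (ghat_cst (N.+1 + L + 2 * n) * al1)).
move=> d0 tb ta e0 be0 g0 hb ha0 ha1 hg; have [sb _] := tb.
have [cT [KT bT] ET] := taylor_int (bes_xi b) z N.+1 ta.
set T := (fun ze => _) in cT bT ET; rewrite -/T in bT ET.
have main := main_term_bd sb ta g0 hg.
rewrite -ET in main.
set bound := rem_cst N.+1 * be * _.
pose Rm (ze : rV) := compI b a z ze - T ze.
have cI : continuous (compI b a z).
 by apply: (ccomp (compI_ccont d0 tb ta)); cts.
have cR : continuous Rm.
 have -> : Rm = fun ze => compI b a z ze + (-1) * T ze by ext ze; rewrite mulN1r.
 by apply: (ccontD cI); apply: ccontM; [cts|exact: cT].
have bR ze : rnorm (Rm ze) <= bound * wt ze.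
 apply: hnorm_wt; first by [].
 have H0 := hnorm_gt0 ze; have J0 := jap_ge0 z.2.
 have h := taylor_bes_rem z ze L sb e0 be0 hb.
 rewrite /Rm /T /compI -mulrBl rnM.
 letr (ler_wpM2l (exprn_ge0 _ (ltW H0)) (ler_wpM2r (rn_ge0 _) h)).
 have g0' := ghat_bd ze ta ha0; have g1' := ghat_bd ze ta ha1.
 have p0 : 0 <= 2 `^ e * jap z.2 `^ (- e) by rewrite mulr_ge0.
 have p1 : 0 <= 2 ^+ L * jap z.2 `^ (- L%:R) by rewrite mulr_ge0 ?exprn_ge0.
 have c0 : 0 <= rem_cst N.+1 * be by rewrite !mulr_ge0 ?ler0n ?bes_size_ge0.
 have := ler_wpM2l c0 (lerD (ler_wpM2l p0 g0') (ler_wpM2l p1 g1')); rewrite -/bound.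
 by apply: le_trans; rewrite /rem_cst !exprD; apply: eq_ler; ring.
have E : iRn (compI b a z) = iRn T + iRn Rm.
 have [Nc [Kc [_ hKc]]] := compI_bd d0 tb ta.
 have b1 x : rnorm (T x) <= (`|KT| + `|bound|) * wt x.
  letr (bT x); monor.
  by letr (ler_norm _); rewrite lerDl.
 have b2 x : rnorm (Rm x) <= (`|KT| + `|bound|) * wt x.
  letr (bR x); monor.
  by letr (ler_norm _); rewrite lerDr.
 rewrite -(iRnD cT cR b1 b2); iext ze.
 by rewrite /Rm addrC subrK.
have hR := iRn_bd cR bR.
rewrite /comp_sym E mulrDr addrAC; letr (rnD _ _); apply: lerD => //.
rewrite rnM rnr ger0_norm ?invr_ge0 ?exprn_ge0 ?mulr_ge0 ?pi_ge0 //.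
rewrite ler_pdivrMl; first by rewrite mulrC.
by rewrite exprn_gt0 // mulr_gt0 // pi_gt0.
Qed.

Lemma nat_large (c t : R) : 0 < c -> exists N : nat, t <= c * N%:R.
move=> c0; exists (Num.truncn `|t / c|).+1; rewrite mulrC -ler_pdivrMr //.
by letr (ler_norm _); apply/ltW/truncnS_gt.
Qed.

(** The number of Taylor terms is chosen so that the gain in [xi] exceeds the cost of the extra
    [x]-derivatives of [a]. [M] and [K] depend on the orders only, and the constants of [a] and [b]
    enter through the factor [al * be] and through [gam]: this makes the estimate uniform over
    families of symbols. *)
Lemma comp_estimate (rho dl k1 k2 s : R) : 0 <= dl -> dl < rho -> rho <= 1 ->
 exists (M : nat) (K : R), 0 <= K /\
 forall mb ma d (b a : V -> C) (z : V) (al be gam : R), 0 <= d -> tame mb d b -> tame ma d a ->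
 0 <= al -> 0 <= be -> 0 <= gam ->
 (forall W z', (size W <= M)%N -> rnorm (wD (xiw W) b z') <= be * jap z'.2 `^ (k1 - rho * (size W)%:R)) ->
 (forall U x, (size U <= M)%N -> rnorm (wD (xw U) a (x, z.2)) <= al * jap z.2 `^ (k2 + dl * (size U)%:R)) ->
 (forall W U, (0 < size W <= M)%N -> (size U <= size W)%N ->
  rnorm (wD (xiw W) b z) * rnorm (wD (xw U) a z) <= gam) ->
 rnorm (comp_sym b a z - b z * a z) <= K * (gam + al * be * jap z.2 `^ (- s)).
move=> dl0 dr r1.
have r0 : 0 < rho by exact: le_lt_trans dr.
have d1 : 0 < 1 - dl by rewrite subr_gt0 (lt_le_trans dr).
have rd : 0 < rho - dl by rewrite subr_gt0.
(* [N1] makes the exponent [e] nonnegative. [N2] uses [dl < rho]: each further term gains [rho] and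
   costs [dl]. *)
have [N1 hN1] := nat_large k1 r0.
have [N2 hN2] := nat_large (k1 + k2 + dl * (2 * n)%:R + s) rd.
pose N := (N1 + N2)%N; pose e := rho * N.+1%:R - k1.
have e0 : 0 <= e.
 rewrite subr_ge0; letr hN1; rewrite ler_wpM2l ?(ltW r0) // ler_nat.
 by rewrite (leq_trans (leq_addr _ _) (leqnSn _)).
have eN : k2 + dl * (N.+1 + 2 * n)%:R - e <= - s.
 have : (rho - dl) * N2%:R <= (rho - dl) * N.+1%:R.
  by rewrite ler_wpM2l ?(ltW rd) // ler_nat (leq_trans (leq_addl _ _) (leqnSn _)).
 by rewrite /e natrD mulrDr; move: hN2; set q := (2 * n)%:R; lra.
(* Here [dl < 1] enters: [L] more derivatives of [a] cost [dl * L] powers and gain [L]. *)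
have [L hL] := nat_large (k2 + dl * (N.+1 + 2 * n)%:R + s) d1.
have eL : k2 + dl * (N.+1 + L + 2 * n)%:R - L%:R <= - s.
 by move: hL; rewrite addnAC [in X in _ -> X]natrD mulrDr; set q := (N.+1 + 2 * n)%:R; lra.
pose K0 := main_cst N; pose K1 := rem_cst N.+1 * (2 `^ e * `|ghat_cst (N.+1 + 2 * n)| +
 2 ^+ L * `|ghat_cst (N.+1 + L + 2 * n)|).
have K10 : 0 <= K1 by rewrite !mulr_ge0 ?ler0n ?bes_size_ge0 // addr_ge0 // mulr_ge0 ?exprn_ge0.
exists (N.+1 + L + 2 * n)%N, (`|K0| + K1); split; first by rewrite addr_ge0.
move=> mb ma d b a z al be gam d0 tb ta al0 be0 g0 hb ha hg.
pose a0 := al * jap z.2 `^ (k2 + dl * (N.+1 + 2 * n)%:R).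
pose a1 := al * jap z.2 `^ (k2 + dl * (N.+1 + L + 2 * n)%:R).
have le1 : (N.+1 + 2 * n <= N.+1 + L + 2 * n)%N by rewrite leq_add2r leq_addr.
letr (@comp_rem mb ma d b a z gam be e a0 a1 N L d0 tb ta e0 be0 g0 _ _ _ _).
- move=> W z' /andP[W1 W2]; letr (hb W z' (leq_trans W2 le1)).
 monol; apply: japR_le; rewrite /e opprB lerD2l lerN2 ler_wpM2l ?(ltW r0) // ler_nat //.
- move=> U x hU; letr (ha U x (leq_trans hU le1)); monol.
 by apply: japR_le; rewrite lerD2l ler_wpM2l // ler_nat.
- move=> U x hU; letr (ha U x hU); monol.
 by apply: japR_le; rewrite lerD2l ler_wpM2l // ler_nat.
- move=> W U /andP[W1 W2] hU; apply: hg => //; rewrite W1 (leq_trans W2) //.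
 by rewrite leq_add2r (leq_trans (leqnSn _) (leq_addr _ _)).
have ab0 : 0 <= al * be * jap z.2 `^ (- s) by rewrite !mulr_ge0.
rewrite [leRHS]mulrDr; apply: lerD.
 by monor; rewrite -[X in X <= _]addr0; apply: lerD => //; exact: ler_norm.
have q0 : jap z.2 `^ (- e) * a0 <= al * jap z.2 `^ (- s).
 by rewrite /a0 mulrCA ler_wpM2l // -japRD; apply: japR_le; rewrite addrC.
have q1 : jap z.2 `^ (- L%:R) * a1 <= al * jap z.2 `^ (- s).
 by rewrite /a1 mulrCA ler_wpM2l // -japRD; apply: japR_le; rewrite addrC.
letr (_ : _ <= K1 * (al * be * jap z.2 `^ (- s))); last first.
 by monor; rewrite lerDr.
have c0 : 0 <= rem_cst N.+1 by rewrite !mulr_ge0 ?ler0n ?bes_size_ge0.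
have E (c j g t : R) : 0 <= c -> 0 <= j * t -> j * t <= al * jap z.2 `^ (- s) ->
  be * (c * j * (g * t)) <= c * `|g| * (al * be * jap z.2 `^ (- s)).
 move=> h1 h2 h3.
 have -> : be * (c * j * (g * t)) = c * be * (g * (j * t)) by ring.
 have -> : c * `|g| * (al * be * jap z.2 `^ (- s)) = c * be * (`|g| * (al * jap z.2 `^ (- s))) by ring.
 rewrite ler_wpM2l ?mulr_ge0 //; letr (ler_wpM2r h2 (ler_norm _)).
 by rewrite ler_wpM2l.
rewrite /K1 -!(mulrA (rem_cst _)) ler_wpM2l // mulrDr [leRHS]mulrDl; apply: lerD.
 by apply: E q0; rewrite ?mulr_ge0 ?powR_ge0.
by apply: E q1; rewrite ?mulr_ge0 ?exprn_ge0 ?powR_ge0.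
Qed.

(** * Schwartz functions, amplitudes and multipliers *)

Definition schw (th : rV -> C) : Prop := csm th /\
 forall W N, exists K, forall x, jap x ^+ N * rnorm (cDs (ud R W) th x) <= K.

(** Amplitudes: rapidly decreasing in the first variable, tame in the second. The multipliers [mult]
    grow at most polynomially in the first variable and so preserve amplitudes. *)
Definition amp (m d : R) (f : V -> C) : Prop := csm f /\
 forall W N, exists K, forall z, jap z.1 ^+ N * rnorm (wD W f z) <= K * jap z.2 `^ (m + d * (size W)%:R).

Definition mult (m d : R) (p : V -> C) : Prop := csm p /\
 forall W, exists (K : R) (N : nat), 0 <= K /\
  forall z, rnorm (wD W p z) <= K * jap z.1 ^+ N * jap z.2 `^ (m + d * (size W)%:R).

Lemma japR_ge1 (x : rV) (s : R) : 0 <= s -> 1 <= jap x `^ s.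
by move=> s0; rewrite -[X in X <= _](powRr0 (jap x)); exact: japR_le. Qed.

Lemma schwZ c th : schw th -> schw (fun x => c * th x).
move=> [sth hth]; split; first exact: csmZ.
move=> W N; have [K hK] := hth W N; exists (rnorm c * K) => x.
by rewrite cDs_Z // rnM mulrCA ler_wpM2l.
Qed.

Lemma schw_sum (I : Type) (s : seq I) (F : I -> rV -> C) :
 (forall i, schw (F i)) -> schw (fun x => \sum_(i <- s) F i x).
move=> tF; have sF i := (tF i).1; split; first exact: csm_sum.
move=> W N; have /choice[K hK] : forall i, exists K, forall x, jap x ^+ N * rnorm (cDs (ud R W) (F i) x) <= K.
 by move=> i; exact: (tF i).2.
exists (\sum_(i <- s) K i) => x; rewrite cDs_sum //.
letr (ler_wpM2l (exprn_ge0 _ (jap_ge0 _)) (rn_sum _ _ _)).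
by rewrite mulr_sumr; apply: ler_sum.
Qed.

Lemma schwD (f g : rV -> C) : schw f -> schw g -> schw (fun x => f x + g x).
move=> hf hg; have := @schw_sum bool [:: true; false] (fun b : bool => if b then f else g).
rewrite (_ : (fun x => \sum_(i <- _) _) = fun x => f x + g x); first by apply; case.
by ext z; rewrite !big_cons big_nil addr0.
Qed.

Lemma schw_cD v th : schw th -> schw (cD v th).
move=> hth; have [sth bth] := hth; rewrite [v]row_sum_delta cD_sumv //.
apply: schw_sum => j; apply: schwZ; split; first exact: csm_cD.
move=> W N; have [K hK] := bth (W ++ [:: j]) N; exists K => x.
by have := hK x; rewrite /ud map_cat cDs_cat [map _ [:: j]]/= cDsc cDsn.
Qed.

Lemma schw_cDs vs th : schw th -> schw (cDs vs th).
by move=> h; elim: vs => [|v vs IH]; [rewrite cDsn|rewrite cDsc; exact: schw_cD]. Qed.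

Lemma schw_bd th N : schw th -> exists2 K, 0 <= K & forall x, jap x ^+ N * rnorm (th x) <= K.
move=> [_ /(_ [::] N)[K hK]]; rewrite /ud [map _ _]/= cDsn in hK; exists K => //.
by apply: le_trans (hK 0); rewrite mulr_ge0 ?exprn_ge0 ?jap_ge0 ?rn_ge0.
Qed.

Lemma jap_wt (x : rV) (X A : R) : 0 <= X -> jap x ^+ (2 * n) * X <= A -> X <= A * wt x.
move=> X0 h; rewrite mulrC -ler_pdivrMl ?wt_gt0 //; apply: le_trans h.
by monor; rewrite wtV_le_jap.
Qed.

Lemma schw_wt th : schw th -> exists2 K, 0 <= K & forall x, rnorm (th x) <= K * wt x.
by move=> /(schw_bd (2 * n))[K K0 hK]; exists K => // x; apply: jap_wt (hK x).
Qed.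

Lemma ampZ m d c f : amp m d f -> amp m d (fun z => c * f z).
move=> [sf hf]; split; first exact: csmZ.
move=> W N; have [K hK] := hf W N; exists (rnorm c * K) => z.
by rewrite wD_Z // rnM mulrCA -mulrA ler_wpM2l.
Qed.

Lemma amp_weaken m m' d f : m <= m' -> amp m d f -> amp m' d f.
move=> mm' [sf hf]; split=> // W N; have [K hK] := hf W N; exists K => z.
have K0 : 0 <= K.
 have := le_trans (mulr_ge0 (exprn_ge0 N (jap_ge0 _)) (rn_ge0 _)) (hK 0).
 by rewrite pmulr_lge0 // japR_gt0.
by letr (hK z); rewrite ler_wpM2l ?japR_le ?lerD2r.
Qed.

Lemma amp_sum m d (I : Type) (s : seq I) (F : I -> V -> C) :
 (forall i, amp m d (F i)) -> amp m d (fun z => \sum_(i <- s) F i z).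
move=> tF; have sF i := (tF i).1; split; first exact: csm_sum.
move=> W N; have /choice[K hK] : forall i, exists K, forall z, jap z.1 ^+ N * rnorm (wD W (F i) z) <= K * jap z.2 `^ (m + d * (size W)%:R).
 by move=> i; exact: (tF i).2.
exists (\sum_(i <- s) K i) => z; rewrite wD_sum //.
letr (ler_wpM2l (exprn_ge0 _ (jap_ge0 _)) (rn_sum _ _ _)).
by rewrite mulr_sumr mulr_suml; apply: ler_sum.
Qed.

Lemma ampD m d f g : amp m d f -> amp m d g -> amp m d (fun z => f z + g z).
move=> af ag; have := @amp_sum m d bool [:: true; false] (fun b : bool => if b then f else g).
rewrite (_ : (fun z => _) = fun z => f z + g z); first by apply; case.
by ext z; rewrite !big_cons big_nil addr0.
Qed.

Lemma amp_wD m d U f : amp m d f -> amp (m + d * (size U)%:R) d (wD U f).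
move=> [sf hf]; split; first exact: csm_wD.
move=> W N; have [K hK] := hf (W ++ U) N; exists K => z; rewrite -wD_cat.
by letr (hK z); rewrite size_cat natrD mulrDr addrA addrAC.
Qed.

Lemma amp_cD m d v f : 0 <= d -> amp m d f -> amp (m + d) d (cD v f).
move=> d0 tf; have [sf _] := tf; rewrite [v]letter_sum cD_sumv //.
apply: amp_sum => l; apply: ampZ; have := amp_wD [:: l] tf.
by rewrite wD_cons wD_nil /= mulr1.
Qed.

Lemma amp_mult m1 m2 d p f : mult m1 d p -> amp m2 d f -> amp (m1 + m2) d (fun z => p z * f z).
move=> [sp hp] [sf hf]; split; first exact: csmM.
have /choice[K /choice[M hK]] := hp.
have /choice[L0 hL0] : forall q : seq (lett) * nat, exists L, forall z, jap z.1 ^+ q.2 * rnorm (wD q.1 f z) <= L * jap z.2 `^ (m2 + d * (size q.1)%:R).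
 by move=> q; exact: hf.
move=> W N; exists (\sum_(q <- spl W) K q.1 * L0 (q.2, (N + M q.1)%N)) => z; rewrite wD_M // mulr_suml.
letr (ler_wpM2l (exprn_ge0 _ (jap_ge0 _)) (rn_sum _ _ _)); rewrite mulr_sumr !big_seq.
apply: ler_sum => q /size_spl <-; rewrite rnM natrD mulrDr addrACA japRD.
have [K0 h1] := hK q.1; have h2 := hL0 (q.2, (N + M q.1)%N) z.
letr (ler_wpM2l (exprn_ge0 _ (jap_ge0 _)) (ler_wpM2r (rn_ge0 _) (h1 z))).
have := ler_wpM2l (mulr_ge0 K0 (japR_ge0 z.2 (m1 + d * (size q.1)%:R))) h2.
move=> /= h3; letr (le_trans _ h3).
 by rewrite exprD; apply: eq_ler; ring.
by apply: eq_ler; ring.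
Qed.

Lemma mult_tame m d b : tame m d b -> mult m d b.
move=> [sb hb]; split=> // W; have [K hK] := hb W; exists K, 0%N; split; first exact: bd_ge0 hK.
by move=> z; rewrite expr0 mulr1.
Qed.

Lemma csm_fst (th : rV -> C) : csm th -> csm (fun z : V => th z.1) /\
 forall vs, cDs vs (fun z : V => th z.1) = fun z => cDs (map fst vs) th z.1.
move=> sth; apply: (@csm_aff R V rV th fst fst) => //.
cts.
Qed.

Lemma amp_schw d th : 0 <= d -> schw th -> amp 0 d (fun z => th z.1).
move=> d0 hth; have [s1 s2] := csm_fst hth.1; split=> // W N.
have [K K0 hK] := schw_bd N (schw_cDs [seq v.1 | v <- map (@ldir) W] hth).
exists K => z; rewrite /wD s2; letr (hK _); rewrite ler_peMr // add0r.
by apply: japR_ge1; rewrite mulr_ge0.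
Qed.

Lemma cder_dot (u : rV) (z v : V) :
 cder v (fun z : V => (dot z.1 u)%:C) z (dot v.1 u)%:C.
apply: cder_real; apply: der_affine => t.
by rewrite /= dotDl dotZl.
Qed.

Lemma mult_dot d u : 0 <= d -> mult 0 d (fun z => (dot z.1 u)%:C).
move=> d0.
have cdot v : cD v (fun z : V => (dot z.1 u)%:C) = fun _ => (dot v.1 u)%:C.
 by ext z; apply: cder_val; exact: cder_dot.
split.
 apply: (csm_coind (Q := fun F => F = (fun z : V => (dot z.1 u)%:C) \/ exists c, F = fun _ => c)); last by left.
 - move=> _ [->|[c ->]]; last cts.
  cts.
 - move=> _ v [->|[c ->]].
  by exists (fun _ => (dot v.1 u)%:C); [right; exists (dot v.1 u)%:C|move=> z; exact: cder_dot].
  by exists (fun _ => 0); [right; exists 0|move=> z; exact: cder_cst].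
have J1 (z : V) (s : R) : 0 <= s -> 1 <= jap z.2 `^ (0 + s).
 by move=> s0; rewrite add0r; exact: japR_ge1.
case/lastP => [|W l].
 exists (\sum_j `|u 0 j|), 1%N; split; first exact: sumr_ge0.
 move=> z; rewrite wD_nil rnr /dot expr1; letr (ler_norm_sum _ _ _).
 letr (_ : _ <= (\sum_j `|u 0 j|) * jap z.1).
  by rewrite mulr_suml; apply: ler_sum => j _; rewrite normrM mulrC ler_wpM2l // coord_le_jap.
 by rewrite ler_peMr ?mulr_ge0 ?sumr_ge0 // J1 // mulr_ge0.
exists `|dot (ldir l).1 u|, 0%N; split=> // z; rewrite expr0 mulr1.
rewrite -cats1 wD_cat wD_cons wD_nil cdot.
case: W => [|l' W].
 by rewrite wD_nil rnr ler_peMr // J1 // mulr_ge0.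
by rewrite /wD [map _ _]/= cDs_cst rn0 mulr_ge0 // japR_ge0.
Qed.

Lemma mult_wt d (x : rV) : 0 <= d -> mult 0 d (fun z => (wt (x - z.1))%:C).
move=> d0; have [sw hw] := wt_sm R n.
have ch : continuous (fun z : V => x - z.1).
 apply: cts_addv; first cts.
 move=> z; apply: cvgN; exact: cvg_fst.
have hE (y w : V) (t : R) : x - (y + t *: w).1 = (x - y.1) + t *: (- w.1) by rewrite /= opprD addrA scalerN.
have [s1 s2] := csm_aff ch hE sw; split=> // W.
have [K hK] := hw [seq - v.1 | v <- map (@ldir) W].
have K0 : 0 <= K := coef_ge0 (hK 0) (wt_gt0 _).
exists K, 0%N; split=> // z; rewrite expr0 mulr1 /wD s2; letr (hK _).
monol; rewrite add0r; letr (wt_le1 _).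
by apply: japR_ge1; rewrite mulr_ge0.
Qed.

Implicit Types (f g : V -> C) (th : rV -> C) (m d sg : R).

Lemma amp_unif m d f M N : 0 <= d -> amp m d f -> exists2 K, 0 <= K &
 forall W z, (size W <= M)%N -> jap z.1 ^+ N * rnorm (wD W f z) <= K * jap z.2 `^ (m + d * M%:R).
move=> d0 [sf hf].
have /choice[K hK] : forall W, exists K, forall z, jap z.1 ^+ N * rnorm (wD W f z) <= K * jap z.2 `^ (m + d * (size W)%:R).
 by move=> W; exact: hf.
have K0 W : 0 <= K W.
 have := le_trans (mulr_ge0 (exprn_ge0 N (jap_ge0 _)) (rn_ge0 _)) (hK W 0).
 by rewrite pmulr_lge0 // japR_gt0.
have [L L0 hL] := words_bdd M K0; exists L => // W z WM; letr (hK W z).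
apply: ler_pM => //; first exact: hL.
by apply: japR_le; rewrite lerD2l ler_wpM2l // ler_nat.
Qed.

Lemma amp_wt m d f : 0 <= d -> amp m d f -> exists (N : nat) (K : R), 0 <= K /\
 forall z, rnorm (f z) <= K * jap z.2 ^+ N * wt z.1.
move=> d0 af; have [K K0 hK] := amp_unif 0 (2 * n) d0 af.
have [N hN] := japR_natle (0 : rV) (m + d * 0%:R).
exists N, K; split=> // z; apply: jap_wt => //.
by have := hK [::] z (leqnn _); rewrite wD_nil => /le_trans; apply; rewrite ler_wpM2l.
Qed.

(** * Oscillatory integrals and their regularization *)

Lemma slice_xi f eta : csm f -> csm (fun y => f (y, eta)) /\
 forall W, cDs (ud R W) (fun y => f (y, eta)) = fun y => wD (xw W) f (y, eta).
move=> sf; have [s1 s2] := shift_x (0, eta) sf.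
have E g : (fun y => g (((0, eta) : V).1 + y, ((0, eta) : V).2)) = (fun y => g (y, eta)) :> (rV -> C).
 by ext y; rewrite /= add0r.
by rewrite E in s1; split=> // W; have := s2 W; rewrite !E.
Qed.

(** The frequency of the transform is the second variable of the amplitude itself, so a derivative
    in [eta] falls on the exponential and on the amplitude. *)
Definition bft sg f (eta : rV) : C := ft sg (fun z => f (z, eta)) eta.

Definition bftI sg f (eta z : rV) : C := expi (sg * dot z eta) * f (z, eta).

Lemma bftE sg f eta : bft sg f eta = iRn (bftI sg f eta).
by []. Qed.

Definition bft_cst M : R := n.+1%:R ^+ M * (n.+1%:R * (2 * pi) ^+ n).

Lemma bft_cst_ge0 M : 0 <= bft_cst M.
by rewrite !mulr_ge0 ?exprn_ge0 ?ler0n ?mulr_ge0 ?pi_ge0. Qed.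

Lemma amp_wclass m d f eta : amp m d f -> exists A : seq 'I_n -> R,
 forall U x, rnorm (wD (xw U) f (x, eta)) <= A U * wt x.
move=> [_ hf]; have /choice[K hK] : forall U, exists K, forall z, jap z.1 ^+ (2 * n) * rnorm (wD (xw U) f z) <= K * jap z.2 `^ (m + d * (size (xw U))%:R).
 by move=> U; exact: hf.
exists (fun U => K U * jap eta `^ (m + d * (size (xw U))%:R)) => U x.
by apply: jap_wt (hK U (x, eta)).
Qed.

Lemma bft_bd sg m d f eta M (k : R) : sg ^+ 2 = 1 -> amp m d f ->
 (forall U x, (size U <= M)%N -> rnorm (wD (xw U) f (x, eta)) <= k * wt x) ->
 hnorm eta ^+ M * rnorm (bft sg f eta) <= bft_cst M * k.
move=> sg2 af hk; have [A0 hA0] := amp_wclass eta af; have [s1 s2] := slice_xi eta af.1.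
pose A U := if (size U <= M)%N then k else A0 U.
have hA : wclass A (fun y => f (y, eta)).
 by split=> // W y; rewrite s2 /A; case: ifP => [/hk|_].
letr (ft_decay_hnorm eta M sg2 hA).
rewrite /hnorm_bd /bft_cst -!mulrA ler_wpM2l ?exprn_ge0 ?ler0n // [_ * k]mulrC mulrA.
rewrite ler_wpM2r ?exprn_ge0 ?mulr_ge0 ?pi_ge0 //.
rewrite (eq_bigr (fun=> k)); last by move=> j _; rewrite /A size_nseq leqnn.
by rewrite /A /= sumr_const card_ord -natr1 mulrDl mul1r mulr_natl addrC.
Qed.

(** [M] derivatives in [z] gain [M] powers of [eta] and cost [d * M], so any order of decay is
    reached because [d < 1]. *)
Lemma bft_decay sg m d f N : sg ^+ 2 = 1 -> 0 <= d -> d < 1 -> amp m d f ->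
 exists K, forall eta, jap eta ^+ N * rnorm (bft sg f eta) <= K.
move=> sg2 d0 d1 af.
have d1' : 0 < 1 - d by rewrite subr_gt0.
have [M hM] := nat_large (N%:R + m) d1'.
have [K K0 hK] := amp_unif M (2 * n) d0 af.
exists (bft_cst M * K) => eta.
have h := @bft_bd sg m d f eta M (K * jap eta `^ (m + d * M%:R)) sg2 af _.
have {h} : hnorm eta ^+ M * rnorm (bft sg f eta) <= bft_cst M * (K * jap eta `^ (m + d * M%:R)).
 apply: h => U x UM; apply: jap_wt => //.
 by apply: (hK _ (x, eta)); rewrite size_map.
have J0 := jap_ge0 eta.
move=> h0; have h : jap eta ^+ M * rnorm (bft sg f eta) <= bft_cst M * (K * jap eta `^ (m + d * M%:R)).
 apply: le_trans h0; monor; rewrite lerXn2r ?nnegrE ?jap_le_hnorm //.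
 exact: ltW (hnorm_gt0 _).
have c0 := mulr_ge0 (bft_cst_ge0 M) K0.
have -> : jap eta ^+ N * rnorm (bft sg f eta) =
  jap eta `^ (N%:R - M%:R) * (jap eta ^+ M * rnorm (bft sg f eta)).
 by rewrite mulrA -[jap eta ^+ M]powR_mulrn // -japRD subrK powR_mulrn.
letr (ler_wpM2l (japR_ge0 _ _) h).
rewrite [leLHS](_ : _ = bft_cst M * K * (jap eta `^ (N%:R - M%:R) * jap eta `^ (m + d * M%:R))); last by ring.
rewrite -japRD.
rewrite ler_piMr // -[X in _ <= X](powRr0 (jap eta)); apply: japR_le.
by move: hM; lra.
Qed.

Lemma bftI_cts (T : topologicalType) sg f (g h : T -> rV) :
 csm f -> continuous g -> continuous h -> continuous (fun t => bftI sg f (g t) (h t)).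
move=> sf cg ch; apply: ccontM.
 apply: cts_expi; apply: cts_mul; first cts.
 exact: cts_dot.
by apply: (ctsc (csmc sf)); exact: cts_pair.
Qed.

Lemma bftI_ccont sg f : csm f -> ccont (bftI sg f).
by move=> sf; apply: bftI_cts => //; move=> ?; [exact: cvg_fst|exact: cvg_snd].
Qed.

Lemma near_jap1 (x0 : rV) : \forall x \near x0, jap x <= jap x0 + 1.
have h := (@cvgrPdist_le _ _ _ (nbhs x0) _ (@jap R n) (jap x0)).1 (@cts_jap x0) 1 ltr01.
by apply: filterS (h _) => x; rewrite distrC => /(le_trans (ler_norm _)); rewrite lerBlDl.
Qed.

Lemma bftI_bd sg m d f : 0 <= d -> amp m d f -> exists (N : nat) (K : R), 0 <= K /\
 forall eta z, rnorm (bftI sg f eta z) <= K * jap eta ^+ N * wt z.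
move=> d0 af; have [N [K [K0 hK]]] := amp_wt d0 af; exists N, K; split=> // eta z.
by rewrite rnM rne mul1r; exact: (hK (z, eta)).
Qed.

Lemma bftI_ldom sg m d f : 0 <= d -> amp m d f -> ldom (bftI sg f).
move=> d0 af eta0; have [N [K [K0 hK]]] := bftI_bd sg d0 af.
exists (K * (jap eta0 + 1) ^+ N); apply: filterS (near_jap1 eta0) => eta h z.
letr (hK eta z); monor; monol.
by rewrite lerXn2r ?nnegrE // addr_ge0.
Qed.

Lemma bft_cts sg m d f : 0 <= d -> amp m d f -> continuous (bft sg f).
move=> d0 af; apply: iRn_cts; first exact: bftI_ccont af.1.
exact: bftI_ldom af.
Qed.

Lemma bftI_slice sg m d f eta : 0 <= d -> amp m d f ->
 continuous (bftI sg f eta) /\ exists K, forall z, rnorm (bftI sg f eta z) <= K * wt z.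
move=> d0 af; split.
 apply: bftI_cts; [exact: af.1|cts|cts].
have [N [K [_ hK]]] := bftI_bd sg d0 af.
by exists (K * jap eta ^+ N) => z; exact: hK.
Qed.

Lemma bftD sg m m' d f g : 0 <= d -> amp m d f -> amp m' d g ->
 bft sg (fun z => f z + g z) = fun eta => bft sg f eta + bft sg g eta.
move=> d0 af ag; ext eta.
have [cf [K hK]] := bftI_slice sg eta d0 af.
have [cg [L hL]] := bftI_slice sg eta d0 ag.
have b1 x : rnorm (bftI sg f eta x) <= (`|K| + `|L|) * wt x.
 letr (hK x); monor.
 by letr (ler_norm _); rewrite lerDl.
have b2 x : rnorm (bftI sg g eta x) <= (`|K| + `|L|) * wt x.
 letr (hL x); monor.
 by letr (ler_norm _); rewrite lerDr.
rewrite !bftE -(iRnD cf cg b1 b2); iext x.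
by rewrite /bftI mulrDr.
Qed.

Lemma bftZ sg m d c f : 0 <= d -> amp m d f ->
 bft sg (fun z => c * f z) = fun eta => c * bft sg f eta.
move=> d0 af; ext eta; have [cf [K hK]] := bftI_slice sg eta d0 af.
rewrite !bftE -(iRnZ c cf hK); iext x.
by rewrite /bftI mulrCA.
Qed.

Definition bft_der sg v f : V -> C :=
 fun z => (dot z.1 v)%:C * (('i * sg%:C) * f z) + cD ((0, v) : V) f z.

Lemma amp_bft_der sg m d v f : 0 <= d -> amp m d f -> amp (m + d) d (bft_der sg v f).
move=> d0 af; apply: ampD; last exact: amp_cD.
apply: (@amp_weaken (0 + m)); first by rewrite add0r lerDl.
apply: amp_mult; [exact: mult_dot|exact: ampZ].
Qed.

Lemma cder_bft sg m d v f eta : 0 <= d -> amp m d f ->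
 cder v (bft sg f) eta (bft sg (bft_der sg v f) eta).
move=> d0 af; have af' := amp_bft_der sg v d0 af; have [sf _] := af.
apply: (@cder_iRn R rV n (bftI sg f) (bftI sg (bft_der sg v f))).
- exact: bftI_ccont.
- exact: bftI_ccont af'.1.
- exact: bftI_ldom af.
- exact: bftI_ldom af'.
move=> q z; rewrite /bftI /bft_der /=.
have h1 : cder v (fun eta : rV => expi (sg * dot z eta)) q ('i * (sg * dot v z)%:C * expi (sg * dot z q)).
 have := cder_expi_dot sg z q v; rewrite [dot q z]dotC.
 by under eq_fun do rewrite dotC.
have h2 : cder v (fun eta : rV => f (z, eta)) q (cD ((0, v) : V) f (z, q)).
 apply: (@cder_comp R rV V f (fun eta => (z, eta)) q v (0, v)).
  by move=> t; congr (_, _); rewrite /= scaler0 addr0.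
 exact: csm_cder.
apply: cder_eq (cderM h1 h2) _.
by rewrite (dotC v z) rmorphM /=; ring.
Qed.

Lemma csm_bft sg m d f : 0 <= d -> amp m d f -> csm (bft sg f).
move=> d0 af; apply: (csm_coind (Q := fun F => exists m g, amp m d g /\ F = bft sg g)); last by exists m, f.
 by move=> _ [m' [g [ag ->]]]; exact: bft_cts ag.
move=> _ v [m' [g [ag ->]]]; exists (bft sg (bft_der sg v g)).
 by exists (m' + d), (bft_der sg v g); split=> //; exact: amp_bft_der.
by move=> x; exact: cder_bft ag.
Qed.

Lemma schw_bft sg m d f : sg ^+ 2 = 1 -> 0 <= d -> d < 1 -> amp m d f -> schw (bft sg f).
move=> sg2 d0 d1 af; split; first exact: csm_bft af.
move=> W N; suff [m' [g [ag ->]]] : exists m' g, amp m' d g /\ cDs (ud R W) (bft sg f) = bft sg g.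
 exact: bft_decay ag.
elim: W => [|j W [m' [g [ag E]]]].
 by exists m, f; split=> //; rewrite /ud [map _ _]/= cDsn.
exists (m' + d), (bft_der sg (delta_mx 0 j) g); split; first exact: amp_bft_der.
rewrite /ud [map _ _]/= cDsc -/(ud R W) E; ext x.
by apply: cder_val; exact: cder_bft ag.
Qed.

Lemma schw_ft sg th : sg ^+ 2 = 1 -> schw th -> schw (ft sg th).
move=> sg2 hth; have := schw_bft sg2 (lexx 0) ltr01 (amp_schw (lexx 0) hth).
by rewrite (_ : bft sg _ = ft sg th) //; ext x.
Qed.

Lemma schwI sg th (x : rV) : schw th ->
 continuous (fun y => expi (sg * dot y x) * th y) /\
 exists K, forall y, rnorm (expi (sg * dot y x) * th y) <= K * wt y.
move=> hth; have [K K0 hK] := schw_wt hth; split; last first.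
 by exists K => y; rewrite rnM rne mul1r.
apply: (ccontM _ (csmc hth.1)); apply: cts_expi.
cts.
Qed.

Lemma ftD sg th (th' : rV -> C) x : schw th -> schw th' -> ft sg (fun y => th y + th' y) x = ft sg th x + ft sg th' x.
move=> h1 h2; have [c1 [K hK]] := schwI sg x h1; have [c2 [L hL]] := schwI sg x h2.
rewrite /ft -(@iRnD _ _ _ _ (`|K| + `|L|) c1 c2).
- by iext y; rewrite mulrDr.
- move=> y; letr (hK y); monor.
 by letr (ler_norm _); rewrite lerDl.
- move=> y; letr (hL y); monor.
 by letr (ler_norm _); rewrite lerDr.
Qed.

Lemma ftZ sg c th x : schw th -> ft sg (fun y => c * th y) x = c * ft sg th x.
move=> h1; have [c1 [K hK]] := schwI sg x h1.
by rewrite /ft -(iRnZ c c1 hK); iext y; rewrite mulrCA.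
Qed.

Lemma m1sqr : (-1) ^+ 2 = 1 :> R. Proof. by rewrite sqrrN expr1n. Qed.
Lemma onesqr : 1 ^+ 2 = 1 :> R. Proof. by rewrite expr1n. Qed.

Definition off (x : rV) (j : 'I_n) (z : V) : C := (x 0 j)%:C - (dot z.1 (delta_mx 0 j))%:C.

Lemma offE x j z : off x j z = (x 0 j - z.1 0 j)%:C.
by rewrite /off dotC dot_delta rmorphB. Qed.

Lemma off_mulE x j f : (fun z => off x j z * f z) =
 fun z => (x 0 j)%:C * f z + (-1) * ((dot z.1 (delta_mx 0 j))%:C * f z).
by ext z; rewrite /off; ring. Qed.

Lemma amp_coord m d j f : 0 <= d -> amp m d f -> amp m d (fun z => (dot z.1 (delta_mx 0 j))%:C * f z).
move=> d0 af; rewrite -[m]add0r; apply: amp_mult => //; exact: mult_dot.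
Qed.

Lemma amp_off m d x j f : 0 <= d -> amp m d f -> amp m d (fun z => off x j z * f z).
move=> d0 af; rewrite off_mulE; apply: ampD; apply: ampZ => //; exact: amp_coord.
Qed.

(* [x |-> int int e^(-i (x - z).eta) f (z, eta) dz deta] *)
Definition osc f (x : rV) : C := ft (-1) (bft 1 f) x.

Lemma oscD m m' d f g x : 0 <= d -> d < 1 -> amp m d f -> amp m' d g ->
 osc (fun z => f z + g z) x = osc f x + osc g x.
move=> d0 d1 af ag; rewrite /osc (bftD 1 d0 af ag).
by apply: ftD; [exact: schw_bft onesqr d0 d1 af|exact: schw_bft onesqr d0 d1 ag].
Qed.

Lemma oscZ m d c f x : 0 <= d -> d < 1 -> amp m d f ->
 osc (fun z => c * f z) x = c * osc f x.
by move=> d0 d1 af; rewrite /osc (bftZ 1 c d0 af); apply: ftZ; exact: schw_bft onesqr d0 d1 af.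
Qed.

(** Integration by parts in [eta]: on the phase [exp(-i (x - z).eta)] a derivative in [eta_j] is
    multiplication by [-i (x_j - z_j)]. *)
Lemma osc_off m d x j f : 0 <= d -> d < 1 -> amp m d f ->
 osc (cD (dirxi R j) f) x = 'i * osc (fun z => off x j z * f z) x.
move=> d0 d1 af; set e := delta_mx 0 j : rV.
have sB := schw_bft onesqr d0 d1 af.
have aD := amp_cD (dirxi R j) d0 af; have aO := amp_off x j d0 af.
have aD' := amp_bft_der 1 e d0 af.
have sD := schw_bft onesqr d0 d1 aD'.
pose h y := expi (-1 * dot y x) * bft 1 f y.
have sc : schw (fun y => (- 'i * (x 0 j)%:C) * bft 1 f y + bft 1 (bft_der 1 e f) y).
 by apply: schwD => //; exact: schwZ.
have [ch [K hK]] := schwI (-1) x sB.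
have [cdh [L hL]] := schwI (-1) x sc.
have I0 : iRn (fun y => expi (-1 * dot y x) * ((- 'i * (x 0 j)%:C) * bft 1 f y + bft 1 (bft_der 1 e f) y)) = 0.
 apply: (@iRn_der R n h _ j (`|K| + `|L|)).
 - exact: ch.
 - exact: cdh.
 - move=> y; have h1 := cder_expi_dot (-1) x y e.
  have h2 := cder_bft 1 e y d0 af.
  apply: cder_eq (cderM h1 h2) _.
  have -> : (-1 * dot e x)%:C = - (x 0 j)%:C :> C by rewrite dot_delta mulN1r rmorphN.
  by ring.
 - move=> y; letr (hK y); monor.
  by letr (ler_norm _); rewrite lerDl.
 - move=> y; letr (hL y); monor.
  by letr (ler_norm _); rewrite lerDr.
have E : (fun y => (- 'i * (x 0 j)%:C) * bft 1 f y + bft 1 (bft_der 1 e f) y) =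
 bft 1 (fun z => (- 'i) * (off x j z * f z) + cD (dirxi R j) f z).
 have aZ := ampZ (- 'i * (x 0 j)%:C) af.
 ext y.
 transitivity (bft 1 (fun z => - 'i * (x 0 j)%:C * f z + bft_der 1 e f z) y).
  by rewrite (bftD 1 d0 aZ aD') (bftZ 1 _ d0 af).
 congr (bft 1 _ y); ext z.
 by rewrite /bft_der /off -/e; ring.
have : osc (fun z => (- 'i) * (off x j z * f z) + cD (dirxi R j) f z) x = 0.
 by rewrite /osc -E; exact: I0.
rewrite (oscD x d0 d1 (ampZ (- 'i) aO) aD) (oscZ _ x d0 d1 aO) mulNr => /eqP.
by rewrite addrC subr_eq0 => /eqP.
Qed.

Lemma cD_fst_mul (th : rV -> C) g (v : rV) : csm th -> csm g ->
 cD ((0, v) : V) (fun z => th z.1 * g z) = fun z => th z.1 * cD ((0, v) : V) g z.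
move=> sth sg; have [s1 s2] := csm_fst sth; rewrite cD_M //.
ext z; have := s2 [:: (0, v)]; rewrite [map _ _]/= !cDsc !cDsn => ->.
have := cD_scalev 0 0 sth; rewrite scaler0 => ->.
by rewrite mul0r mul0r add0r.
Qed.

Lemma wD_fst_mul (th : rV -> C) g W : csm th -> csm g ->
 wD (xiw W) (fun z => th z.1 * g z) = fun z => th z.1 * wD (xiw W) g z.
move=> sth sg; elim: W => [|j W IH]; first by rewrite !wD_nil.
by rewrite [xiw _]/= wD_cons IH cD_fst_mul ?wD_cons //; exact: csm_wD.
Qed.

Lemma cD_off_mul x j i f : csm f ->
 cD (dirxi R j) (fun z => off x i z * f z) = fun z => off x i z * cD (dirxi R j) f z.
move=> sf; have [sd _] := @mult_dot 0 (delta_mx 0 i) (lexx 0).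
have so : csm (off x i).
 have -> : off x i = fun z => (x 0 i)%:C + (-1) * (dot z.1 (delta_mx 0 i))%:C.
  by ext z; rewrite mulN1r.
 by apply: csmD; [exact: csm_cst|exact: csmZ].
rewrite cD_M //; ext z.
have -> : off x i = fun z => (x 0 i)%:C + (-1) * (dot z.1 (delta_mx 0 i))%:C.
 by ext z'; rewrite mulN1r.
rewrite cD_D; [|exact: csm_cst|exact: csmZ].
rewrite cD_cst cD_Z // (cder_val (cder_dot _ _ _)) /=.
by rewrite /dot big1 ?mulr0 ?addr0 ?mul0r ?add0r // => l _; rewrite mxE mul0r.
Qed.

(** Multiplication by the product of the [1 + (x_j - z_j)^2], one factor at a time, in step with the
    recursion of [bes_words]. *)
Fixpoint off_mul (x : rV) (s : seq 'I_n) f : V -> C :=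
 if s is j :: s' then let g := off_mul x s' f in
  fun z => g z + off x j z * (off x j z * g z) else f.

Lemma amp_off_mul m d x s f : 0 <= d -> amp m d f -> amp m d (off_mul x s f).
move=> d0 af; elim: s => [//|j s IH] /=; apply: ampD => //.
by apply: amp_off => //; exact: amp_off.
Qed.

Lemma cD_off_mul_all m d x j s f : 0 <= d -> amp m d f ->
 cD (dirxi R j) (off_mul x s f) = off_mul x s (cD (dirxi R j) f).
move=> d0 af; elim: s => [//|i s IH] /=.
have a1 := amp_off_mul x s d0 af; have a2 := amp_off x i d0 a1; have a3 := amp_off x i d0 a2.
rewrite cD_D; [|exact: a1.1|exact: a3.1].
by rewrite (cD_off_mul x j i a2.1) (cD_off_mul x j i a1.1) IH.
Qed.

Lemma osc_bes m d x s f : 0 <= d -> d < 1 -> amp m d f ->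
 osc (off_mul x s f) x =
 \sum_(cW <- bes_words R s) cW.1%:C * osc (wD (xiw cW.2) f) x.
move=> d0 d1; elim: s m f => [|j s IH] m f af; first by rewrite big_seq1 mul1r wD_nil.
rewrite [off_mul _ _ _]/= [bes_words _ _]/= big_cat big_map /=.
set g := off_mul x s f.
have ag : amp m d g := amp_off_mul x s d0 af.
have ag1 := amp_off x j d0 ag; have ag2 := amp_off x j d0 ag1.
rewrite (oscD x d0 d1 ag ag2) (IH _ _ af); congr (_ + _).
have aDf := amp_cD (dirxi R j) d0 af; have aDDf := amp_cD (dirxi R j) d0 aDf.
have aDg := amp_cD (dirxi R j) d0 ag.
have E1 : 'i * osc (fun z => off x j z * (off x j z * g z)) x =
  osc (fun z => off x j z * cD (dirxi R j) g z) x.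
 by rewrite -(osc_off x j d0 d1 ag1) cD_off_mul //; exact: ag.1.
have E2 := osc_off x j d0 d1 aDg.
have -> : osc (fun z => off x j z * (off x j z * g z)) x =
  - osc (cD (dirxi R j) (cD (dirxi R j) g)) x.
 by rewrite E2 -E1 mulrA -expr2 sqrCi mulN1r opprK.
rewrite /g (cD_off_mul_all x j s d0 af) (cD_off_mul_all x j s d0 aDf) (IH _ _ aDDf).
rewrite -sumrN; apply: eq_bigr => -[c W] _ /=; rewrite rmorphN mulNr.
have E : wD (xiw W) (cD (dirxi R j) (cD (dirxi R j) f)) = wD (xiw (j :: j :: W)) f.
 have := wD_comm (xiw W) [:: (true, j); (true, j)] af.1.
 by rewrite !wD_cons !wD_nil.
by rewrite E.
Qed.

Lemma osc_words m d x f (L : seq (R * seq 'I_n)) : 0 <= d -> d < 1 -> amp m d f ->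
 (exists m', amp m' d (fun z => \sum_(cW <- L) cW.1%:C * wD (xiw cW.2) f z)) /\
 osc (fun z => \sum_(cW <- L) cW.1%:C * wD (xiw cW.2) f z) x =
 \sum_(cW <- L) cW.1%:C * osc (wD (xiw cW.2) f) x.
move=> d0 d1 af; elim: L => [|cW L [[m' a'] IH]].
 have E : (fun z => \sum_(cW <- [::]) cW.1%:C * wD (xiw cW.2) f z) = fun z => 0 * f z.
  by ext z; rewrite big_nil mul0r.
 rewrite E (oscZ _ x d0 d1 af) mul0r big_nil; split=> //.
 by exists m; exact: ampZ.
have E : (fun z => \sum_(cW <- cW :: L) cW.1%:C * wD (xiw cW.2) f z) =
  fun z => cW.1%:C * wD (xiw cW.2) f z + \sum_(cW <- L) cW.1%:C * wD (xiw cW.2) f z.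
 by ext z; rewrite big_cons.
have a1 := amp_wD (xiw cW.2) af; have a2 := ampZ cW.1%:C a1.
rewrite E (oscD x d0 d1 a2 a') (oscZ _ x d0 d1 a1) IH big_cons; split=> //.
set m1 := m + _ in a2; exists (Num.max m1 m').
by apply: ampD; [apply: amp_weaken a2|apply: amp_weaken a']; rewrite le_max lexx ?orbT.
Qed.

Lemma off_mul_prod (x : rV) (s : seq 'I_n) f z :
 off_mul x s f z = (\prod_(j <- s) (1 + (x 0 j - z.1 0 j) ^+ 2))%:C * f z.
elim: s => [|j s IH] /=; first by rewrite big_nil mul1r.
have E (t : R) : (1 + t ^+ 2)%:C = 1 + t%:C * t%:C :> C by rewrite expr2 rmorphD rmorphM rmorph1.
by rewrite big_cons rmorphM /= -mulrA -IH E !offE; ring.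
Qed.

Definition kamp (x : rV) (th : rV -> C) (g : V -> C) (z : V) : C :=
 (wt (x - z.1))%:C * th z.1 * g z.

Lemma csm_wt_sub (x : rV) : csm (fun y => (wt (x - y))%:C : C) /\
 forall ws, cDs ws (fun y => (wt (x - y))%:C) =
  fun y => cDs (map -%R ws) (fun y => (wt y)%:C : C) (x - y).
apply: (@csm_aff R rV rV _ (fun y => x - y) -%R); last exact: (wt_sm R n).1.
 cts.
by move=> y w t; rewrite opprD addrA scalerN.
Qed.

(** Multiply and divide by the product of the [1 + (x_j - z_j)^2] and trade the product for
    derivatives in [eta]. The new amplitude [kamp] decays in [x] as well as in [z], which allows
    integration in [x] to be interchanged with the other integrals. *)
Lemma osc_regularized m d x (th : rV -> C) b : 0 <= d -> d < 1 -> schw th -> tame m d b ->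
 osc (fun z => th z.1 * b z) x = osc (kamp x th (bes_xi b)) x.
move=> d0 d1 hth tb; have [sth _] := hth; have [sb _] := tb.
have ag : amp m d (fun z => b z * th z.1).
 rewrite -[m]addr0; apply: amp_mult; [exact: mult_tame|exact: amp_schw].
have agw : amp (0 + m) d (fun z => (wt (x - z.1))%:C * (b z * th z.1)).
 by apply: amp_mult => //; exact: mult_wt.
have sw : csm (fun y => (wt (x - y))%:C * th y) by apply: csmM => //; exact: (csm_wt_sub x).1.
have E0 : (fun z => th z.1 * b z) = off_mul x (index_enum 'I_n) (fun z => (wt (x - z.1))%:C * (b z * th z.1)).
 ext z; rewrite off_mul_prod mulrA -rmorphM /wt -big_split /= big1 ?mul1r 1?mulrC // => j _.
 by rewrite !mxE /wt1 divff // gt_eqF // ltr_wpDr // sqr_ge0.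
rewrite E0 (osc_bes x _ d0 d1 agw).
have [_ <-] := osc_words x (bes_words R (index_enum 'I_n)) d0 d1 agw.
congr (osc _ x); ext z; rewrite /kamp /bes_xi mulr_sumr.
apply: eq_bigr => cW _; rewrite (_ : (fun z => _) = fun z => ((wt (x - z.1))%:C * th z.1) * b z); last first.
 by ext z'; ring.
have := @wD_fst_mul (fun y => (wt (x - y))%:C * th y) b cW.2 sw sb.
by move=> /= ->; ring.
Qed.

(** Peetre's inequality for the product weight, with a factor 2 per coordinate. *)
Lemma wt_sub (x z : rV) : wt (x - z) * wt z <= 2 ^+ n * wt x.
rewrite /wt -big_split /= -[X in 2 ^+ X](card_ord n) -prodr_const -big_split /=.
apply: ler_prod => j _; rewrite mulr_ge0 //= !mxE.
have h := wt1_translate (x 0 j) (- z 0 j); rewrite sqrrN in h.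
letr (ler_wpM2r (wt1_ge0 _) h).
have E : (1 + z 0 j ^+ 2) * wt1 (z 0 j) = 1 by rewrite /wt1 mulfV // gt_eqF // ltr_wpDr // sqr_ge0.
rewrite [leLHS](_ : _ = 2 * wt1 (x 0 j) * ((1 + z 0 j ^+ 2) * wt1 (z 0 j))); last by ring.
by rewrite E mulr1.
Qed.

Lemma wD_wt_sub : exists K : seq (lett) -> R, forall W, 0 <= K W /\
 forall (x : rV) (z : V), rnorm (wD W (fun z => (wt (x - z.1))%:C : C) z) <= K W * wt (x - z.1).
have [sw hw] := wt_sm R n.
have /choice[K hK] : forall W : seq (lett), exists K : R, 0 <= K /\
  forall (x : rV) (z : V), rnorm (wD W (fun z => (wt (x - z.1))%:C : C) z) <= K * wt (x - z.1).
 move=> W; have [K hK] := hw (map -%R (map fst (map (@ldir) W))).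
 have K0 : 0 <= K := coef_ge0 (hK 0) (wt_gt0 _).
 exists K; split=> // x z; have [s1 s2] := csm_wt_sub x.
 have [_ s3] := csm_fst s1; rewrite /wD s3 s2; exact: hK.
by exists K.
Qed.

(** Rapid decrease of [th] supplies [wt z] twice: one factor turns [wt (x - z)] into [wt x] by
    [wt_sub], the other remains for the integration in [z]. Hence [4 * n] powers of the bracket. *)
Lemma ker_bd m d (th : rV -> C) (g : V -> C) M : 0 <= d -> schw th -> tame m d g ->
 exists2 K, 0 <= K & forall x z U, (size U <= M)%N ->
  rnorm (wD U (kamp x th g) z) <= K * jap z.2 `^ (m + d * M%:R) * wt x * wt z.1.
move=> d0 hth tg; have [Kw hKw] := wD_wt_sub.
have ag : amp (m + 0) d (fun z => g z * th z.1).
 apply: amp_mult; [exact: mult_tame|exact: amp_schw].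
rewrite addr0 in ag; have [K K0 hK] := amp_unif M (4 * n) d0 ag.
have KM0 W : 0 <= Kw W by have [] := hKw W.
pose S U := \sum_(p <- spl U) Kw p.1.
have S0 U : 0 <= S U by exact: sumr_ge0.
have [SM SM0 hS] := words_bdd M S0.
exists (SM * K * 2 ^+ n); first by rewrite !mulr_ge0 ?exprn_ge0.
move=> x z U UM; have -> : kamp x th g = fun z => (wt (x - z.1))%:C * (g z * th z.1).
 by ext z'; rewrite /kamp; ring.
have sw := (mult_wt x (lexx 0)).1.
rewrite wD_M //; last exact: ag.1.
letr (rn_sum _ _ _).
set J := jap z.2 `^ _; have J0 : 0 <= J by exact: japR_ge0.
letr (_ : _ <= S U * (K * J * (2 ^+ n * wt x * wt z.1))); last first.
 rewrite (_ : SM * _ * _ * _ * _ * _ = SM * (K * J * (2 ^+ n * wt x * wt z.1))); last by ring.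
 by rewrite ler_wpM2r ?hS // !mulr_ge0 ?exprn_ge0.
rewrite /S mulr_suml !big_seq; apply: ler_sum => p /size_spl hp.
have p2M : (size p.2 <= M)%N by rewrite (leq_trans _ UM) // -hp leq_addl.
rewrite rnM; have [_ h1] := hKw p.1.
have h2 : rnorm (wD p.2 (fun z => g z * th z.1) z) <= K * J * wt z.1 * wt z.1.
 apply: jap_wt => //.
 rewrite -ler_pdivrMr ?wt_gt0 //; apply: le_trans (hK p.2 z p2M).
 rewrite mulrC mulrA ler_wpM2r // (_ : (4 * n)%N = (2 * n + 2 * n)%N); last by rewrite -mulnDl.
 by rewrite exprD ler_wpM2r // wtV_le_jap.
letr (ler_rnM (h1 x z) h2).
have hw := wt_sub x z.1.
rewrite -[leLHS]mulrA ler_wpM2l //.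
have -> : wt (x - z.1) * (K * J * wt z.1 * wt z.1) = K * J * (wt (x - z.1) * wt z.1 * wt z.1) by ring.
by rewrite ler_wpM2l ?mulr_ge0 // ler_wpM2r.
Qed.

Lemma amp_ker m d x (th : rV -> C) (g : V -> C) : 0 <= d -> schw th -> tame m d g ->
 amp m d (kamp x th g).
move=> d0 hth tg; have -> : kamp x th g = fun z => (wt (x - z.1))%:C * (g z * th z.1).
 by ext z'; rewrite /kamp; ring.
rewrite -[m]add0r; apply: amp_mult; first exact: mult_wt.
rewrite -[m]addr0; apply: amp_mult; [exact: mult_tame|exact: amp_schw].
Qed.

Lemma bft_ker_bd m d (th : rV -> C) (g : V -> C) : 0 <= d -> d < 1 -> schw th -> tame m d g ->
 exists2 K, 0 <= K & forall x eta, rnorm (bft 1 (kamp x th g) eta) <= K * wt x * wt eta.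
move=> d0 d1 hth tg; have d1' : 0 < 1 - d by rewrite subr_gt0.
have [M hM] := nat_large ((2 * n)%:R + m) d1'.
have [K K0 hK] := ker_bd M d0 hth tg.
exists (bft_cst M * K); first by rewrite mulr_ge0 ?bft_cst_ge0.
move=> x eta; have ak := amp_ker x d0 hth tg.
have h := @bft_bd 1 m d _ eta M (K * jap eta `^ (m + d * M%:R) * wt x) (onesqr) ak _.
have {}h := h (fun U y hU => hK x (y, eta) (xw U) (leq_trans (eq_leq (size_map _ _)) hU)).
apply: jap_wt => //.
have JM : jap eta `^ (M%:R) <= hnorm eta ^+ M.
 rewrite powR_mulrn // lerXn2r ?nnegrE ?jap_le_hnorm //.
 exact: ltW (hnorm_gt0 _).
have {}h := le_trans (ler_wpM2r (rn_ge0 _) JM) h.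
have -> : jap eta ^+ (2 * n) * rnorm (bft 1 (kamp x th g) eta) =
  jap eta `^ ((2 * n)%:R - M%:R) * (jap eta `^ M%:R * rnorm (bft 1 (kamp x th g) eta)).
 by rewrite mulrA -japRD subrK powR_mulrn.
letr (ler_wpM2l (japR_ge0 _ _) h).
rewrite [leLHS](_ : _ = bft_cst M * K * wt x * (jap eta `^ ((2 * n)%:R - M%:R) * jap eta `^ (m + d * M%:R))); last by ring.
rewrite -japRD ler_piMr //; first exact: mulr_ge0 (mulr_ge0 (bft_cst_ge0 _) K0) (wt_ge0 _).
rewrite -[X in _ <= X](powRr0 (jap eta)); apply: japR_le.
by move: hM; set q := (2 * n)%:R; lra.
Qed.

Lemma ker_amp_cts (T : topologicalType) (th : rV -> C) (g : V -> C) (f1 f2 f3 : T -> rV) :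
 csm th -> csm g -> continuous f1 -> continuous f2 -> continuous f3 ->
 continuous (fun t => kamp (f1 t) th g (f2 t, f3 t)).
move=> sth sg c1 c2 c3; apply: ccontM.
 apply: ccontM; last exact: (ctsc (csmc sth) c2).
 apply: ctsC; apply: (ctsc (@cts_wt R n)).
 by apply: cts_addv => //; apply: (ctsc _ c2); exact: opp_continuous.
by apply: (ctsc (csmc sg)); exact: cts_pair.
Qed.

Lemma expi_dotc (T : topologicalType) (sg : R) (f1 f2 : T -> rV) :
 continuous f1 -> continuous f2 -> continuous (fun t => expi (sg * dot (f1 t) (f2 t))).
move=> c1 c2; apply: cts_expi; apply: cts_mul; first cts.
exact: cts_dot.
Qed.

Lemma bft_ker_ccont m d (th : rV -> C) (g : V -> C) : 0 <= d -> schw th -> tame m d g ->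
 ccont (fun x eta => bft 1 (kamp x th g) eta).
move=> d0 hth tg; have [sth _] := hth; have [sg _] := tg.
apply: (@iRn_cts R (rV * rV)%type n (fun q z => bftI 1 (kamp q.1 th g) q.2 z)).
 have c11 : continuous (fun x : (rV * rV) * rV => x.1.1) by move=> x; apply: continuous_comp; exact: cvg_fst.
 have c12 : continuous (fun x : (rV * rV) * rV => x.1.2).
  by move=> x; apply: continuous_comp; [exact: cvg_fst|exact: cvg_snd].
 have c2 : continuous (fun x : (rV * rV) * rV => x.2) by cts.
 apply: ccontM; first exact: (expi_dotc (sg := 1) c2 c12).
 exact: (ker_amp_cts sth sg c11 c2 c12).
move=> q; have [N [K [K0 hK]]] := tame_poly d0 tg; have [L L0 hL] := schw_wt hth.
exists (L * (K * (jap q.2 + 1) ^+ N)).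
have h : \forall r \near q, jap r.2 <= jap q.2 + 1.
 exact: (@cvg_snd _ _ (nbhs q.1) (nbhs q.2) _ _ (near_jap1 q.2)).
apply: filterS h => r hr z; rewrite /bftI /kamp /= rnM rne mul1r !rnM rnr.
rewrite ger0_norm // -mulrA; letr (ler_piMl _ (wt_le1 _)).
 by rewrite mulr_ge0 // rn_ge0.
letr (ler_rnM (hL z) (hK (z, r.2))) => /=.
rewrite mulrAC ler_wpM2r // ler_wpM2l // ler_wpM2l // lerXn2r ?nnegrE //.
by rewrite addr_ge0.
Qed.

(** * The transposed operator and the composition formula *)

Definition qtr (b : V -> C) (th : rV -> C) (x : rV) : C :=
 ((2 * pi) ^- n)%:C * osc (fun z => th z.1 * b z) x.

Lemma amp_prd m d (th : rV -> C) (b : V -> C) : 0 <= d -> schw th -> tame m d b ->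
 amp m d (fun z => th z.1 * b z).
move=> d0 hth tb; rewrite (_ : (fun z => _) = fun z => b z * th z.1); last by ext z; rewrite mulrC.
rewrite -[m]addr0; apply: amp_mult; [exact: mult_tame|exact: amp_schw].
Qed.

Lemma schw_qtr m d b th : 0 <= d -> d < 1 -> tame m d b -> schw th ->
 schw (qtr b th).
move=> d0 d1 tb hth; apply: schwZ; apply: (schw_ft (m1sqr)).
exact: (schw_bft (onesqr) d0 d1 (amp_prd d0 hth tb)).
Qed.

(** The left side is regularized by [osc_regularized]. For fixed [eta] the variables [x] and [z] are
    exchanged and [x] becomes [z + y], which produces [ghat] at the frequency [ze = eta - xi].
    Translating [eta] by [xi] and exchanging [z] with [ze] leaves the transform of [th] times the
    composed symbol. *)
Lemma composition_fourier mb ma d (b a : V -> C) (th : rV -> C) (xi : rV) : 0 <= d -> d < 1 ->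
 tame mb d b -> tame ma d a -> schw th ->
 bft 1 (fun z => qtr b th z.1 * a z) xi = bft 1 (fun z => th z.1 * comp_sym b a z) xi.
move=> d0 d1 tb ta hth; set ka := ((2 * pi) ^- n)%:C : C.
have [sth _] := hth; have [sa _] := ta; have tP := tame_bes d0 tb; have [sP _] := tP.
set P := bes_xi b in tP sP.
have [Ka [Ka0 hKa]] : exists Ka, 0 <= Ka /\ forall x, rnorm (a (x, xi)) <= Ka.
 have [N [K [K0 hK]]] := tame_poly d0 ta; exists (K * jap xi ^+ N).
 by split=> [|x]; [rewrite mulr_ge0 ?exprn_ge0 ?jap_ge0|exact: (hK (x, xi))].
have idc : continuous (fun x : rV => x) by cts.
have cst (U : topologicalType) (x : rV) : continuous (fun _ : U => x) by cts.
have ca : continuous (fun x => a (x, xi)).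
 by apply: (ctsc (csmc sa)); exact: cts_pair.
pose A x := expi (1 * dot x xi) * a (x, xi).
have cA : continuous A by apply: ccontM; [apply: expi_dotc; [exact: idc|exact: cst]|exact: ca].
have bA x : rnorm (A x) <= Ka by rewrite rnM rne mul1r.
have c1 : continuous (fun z : rV * rV => z.1) by cts.
have c2 : continuous (fun z : rV * rV => z.2) by move=> ?; exact: cvg_snd.
pose k eta x z := expi (-1 * dot eta x) * bftI 1 (kamp x th P) eta z.
have ck eta : ccont (k eta).
 apply: ccontM; first exact: (expi_dotc (sg := -1) (cst _ eta) c1).
 apply: ccontM; first exact: (expi_dotc (sg := 1) c2 (cst _ eta)).
 exact: (ker_amp_cts sth sP c1 c2 (cst _ eta)).
have [N [KP [KP0 hP]]] := tame_poly d0 tP.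
have [Lt Lt0 hLt] := schw_wt hth.
have [K4 K40 hK4] := schw_bd (4 * n) hth.
have bk eta x z : rnorm (k eta x z) <= K4 * (KP * jap eta ^+ N) * 2 ^+ n * wt x * wt z.
 rewrite rnM rne mul1r rnM rne mul1r !rnM rnr ger0_norm //.
 have ht : rnorm (th z) <= K4 * wt z * wt z.
  apply: jap_wt => //.
  rewrite -ler_pdivrMr ?wt_gt0 //; apply: le_trans (hK4 z).
  rewrite mulrC mulrA ler_wpM2r // (_ : (4 * n)%N = (2 * n + 2 * n)%N); last by rewrite -mulnDl.
  by rewrite exprD ler_wpM2r // wtV_le_jap.
 letr (ler_pM (mulr_ge0 (wt_ge0 _) (rn_ge0 _)) (rn_ge0 _) (ler_wpM2l (wt_ge0 _) ht) (hP (z, eta))).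
 rewrite [leLHS](_ : _ = (K4 * (KP * jap eta ^+ N)) * wt z * (wt (x - z) * wt z)); last by rewrite /=; ring.
 rewrite [leRHS](_ : _ = (K4 * (KP * jap eta ^+ N)) * wt z * (2 ^+ n * wt x)); last by ring.
 by rewrite ler_wpM2l ?wt_sub // !mulr_ge0 ?exprn_ge0.
pose g x eta := expi (-1 * dot eta x) * bft 1 (kamp x th P) eta.
have kE eta x : g x eta = iRn (k eta x).
 have [cf [K hK]] := bftI_slice 1 eta d0 (amp_ker x d0 hth tP).
 by rewrite /g bftE -(iRnZ _ cf hK).
have [KB KB0 hKB] := bft_ker_bd d0 d1 hth tP.
have step1 : bft 1 (fun z => qtr b th z.1 * a z) xi =
  iRn (fun x => ka * iRn (fun eta => A x * g x eta)).
 rewrite bftE; iext x.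
 have cx : continuous (fun eta => g x eta).
  by apply: ccontM; [exact: expi_dotc|exact: (bft_cts d0 (amp_ker x d0 hth tP))].
 have bx eta : rnorm (g x eta) <= KB * wt x * wt eta by rewrite rnM rne mul1r.
 rewrite (iRnZ (A x) cx bx) /bftI /qtr /= (osc_regularized x d0 d1 hth tb).
 by rewrite /osc /ft /A /g -/ka -/P; ring.
have cF1 : ccont (fun x eta => A x * g x eta).
 apply: ccontM; first exact: (ctsc cA c1).
 apply: ccontM; last exact: (bft_ker_ccont d0 hth tP).
 exact: (expi_dotc (sg := -1) c2 c1).
have bF1 x eta : rnorm (A x * g x eta) <= Ka * KB * wt x * wt eta.
 by rewrite rnM -!mulrA; apply: ler_pM => //; rewrite rnM rne mul1r mulrA; exact: hKB.
have cin x : continuous (fun eta => A x * g x eta) by apply: (ccomp cF1).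
have inner_c : continuous (fun x => iRn (fun eta => A x * g x eta)).
 apply: (@iRn_cts R rV n) => // q; exists (Ka * KB); apply: near_all => x eta.
 letr (bF1 x eta); monor; rewrite ler_piMr ?wt_le1 ?mulr_ge0 //.
have inner_b x : rnorm (iRn (fun eta => A x * g x eta)) <=
  Ka * KB * (2 * pi) ^+ n * wt x.
 by rewrite mulrAC; apply: iRn_bd; [exact: cin|exact: bF1].
pose E0 z := expi (1 * dot z xi) * th z.
pose T ze := iRn (fun z => E0 z * compI b a (z, xi) ze).
have step2 eta : iRn (fun x => A x * g x eta) = T (eta - xi).
 have -> : (fun x => A x * g x eta) =
  (fun x => iRn (fun z => A x * k eta x z)).
  ext x; have ckx : continuous (k eta x).
  exact: (ccomp (ck eta) (cst _ x) idc).
  by rewrite kE (iRnZ (A x) ckx (bk eta x)).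
 have cc : ccont (fun x z => A x * k eta x z).
  by apply: ccontM; [exact: (ctsc cA c1)|exact: ck].
 have bb x z : rnorm (A x * k eta x z) <= Ka * (K4 * (KP * jap eta ^+ N) * 2 ^+ n) * wt x * wt z.
  rewrite rnM -!mulrA; apply: ler_pM => //.
  by letr (bk eta x z); rewrite !mulrA.
 rewrite (iRn_swap cc bb) /T; iext z.
 have cz : continuous (fun x => A x * k eta x z) by apply: (ccomp cc).
 have bz x : rnorm (A x * k eta x z) <= Ka * (K4 * (KP * jap eta ^+ N) * 2 ^+ n) * wt x.
  letr (bb x z); rewrite ler_piMr ?wt_le1 // !mulr_ge0 //.
 rewrite -(iRn_shift z cz bz).
 have [Ng [Kg [Kg0 hg]]] := ghatI_bd d0 ta.
 have cg : continuous (ghatI a (z, xi) (eta - xi))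
  by exact: (@ghatI_cts _ a (fun=> (z, xi)) (fun=> eta - xi) id sa (@cts_cst _ _ _) (cst _ _) idc).
 rewrite /compI -/P /= (_ : xi + (eta - xi) = eta); last by rewrite addrC subrK.
 rewrite ghatE mulrA -(iRnZ _ cg (hg (z, xi) (eta - xi))); iext y.
 rewrite /A /k /bftI /kamp /ghatI /E0 /= addrK (addrC y z).
 rewrite [LHS](_ : _ = (expi (1 * dot (z + y) xi) * (expi (-1 * dot eta (z + y)) * expi (1 * dot z eta))) *
  ((wt y)%:C * th z * P (z, eta) * a (z + y, xi))); last by ring.
 rewrite [RHS](_ : _ = (expi (1 * dot z xi) * expi (-1 * dot y (eta - xi))) *
  ((wt y)%:C * th z * P (z, eta) * a (z + y, xi))); last by ring.
 congr (_ * _); rewrite -!expiD; congr expi.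
 have dB : dot y (eta - xi) = dot y eta - dot y xi by rewrite dotC dotDl -scaleN1r dotZl mulN1r !(dotC _ y).
 by rewrite dB (dotC eta) !dotDl; ring.
have [Nc [Kc [Kc0 hc]]] := compI_bd d0 tb ta.
have cE0 : continuous E0 by apply: ccontM; [exact: expi_dotc|exact: csmc].
have cG : ccont (fun ze z => E0 z * compI b a (z, xi) ze).
 apply: ccontM; first exact: (ctsc cE0 c2).
 by apply: (ccomp (compI_ccont d0 tb ta)) => //; exact: cts_pair.
have bG ze z : rnorm (E0 z * compI b a (z, xi) ze) <= Lt * (Kc * jap xi ^+ Nc) * wt ze * wt z.
 rewrite rnM rnM rne mul1r.
 letr (ler_rnM (hLt z) (hc (z, xi) ze)) => /=.
 by apply: eq_ler; ring.
have Tc : continuous T.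
 apply: (@iRn_cts R rV n) => // q; exists (Lt * (Kc * jap xi ^+ Nc)); apply: near_all => ze z.
 letr (bG ze z); monor; rewrite ler_piMr ?wt_le1 // !mulr_ge0 //.
have Tb ze : rnorm (T ze) <= Lt * (Kc * jap xi ^+ Nc) * (2 * pi) ^+ n * wt ze.
 rewrite mulrAC; apply: iRn_bd; last exact: bG.
 by apply: (ccomp cG).
rewrite step1 (iRnZ ka inner_c inner_b) (iRn_swap cF1 bF1).
have -> : (fun eta => iRn (fun x => A x * g x eta)) =
  (fun eta => T (eta + - xi)) by ext eta; exact: step2.
rewrite (iRn_shift (- xi) Tc Tb) /T (iRn_swap cG bG).
have bG' z ze : rnorm (compI b a (z, xi) ze) <= Kc * jap xi ^+ Nc * wt ze.
 exact: (hc (z, xi) ze).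
have cI z : continuous (compI b a (z, xi)).
 exact: (ccomp (compI_ccont d0 tb ta) (@cts_cst _ _ (z, xi)) idc).
have cG2 : ccont (fun z ze => E0 z * compI b a (z, xi) ze).
 exact: (ccomp cG c2 c1).
have bG2 z ze : rnorm (E0 z * compI b a (z, xi) ze) <= Lt * (Kc * jap xi ^+ Nc) * wt z * wt ze.
 by letr (bG ze z); rewrite mulrAC.
have c3 : continuous (fun z => iRn (fun ze => E0 z * compI b a (z, xi) ze)).
 apply: (@iRn_cts R rV n) => // q; exists (Lt * (Kc * jap xi ^+ Nc)); apply: near_all => z ze.
 letr (bG2 z ze); monor; rewrite ler_piMr ?wt_le1 // !mulr_ge0 //.
have b3 z : rnorm (iRn (fun ze => E0 z * compI b a (z, xi) ze)) <= Lt * (Kc * jap xi ^+ Nc) * (2 * pi) ^+ n * wt z.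
 rewrite mulrAC; apply: iRn_bd; last exact: bG2.
 by apply: (ccomp cG2).
rewrite -(iRnZ ka c3 b3) bftE; iext z.
rewrite (iRnZ (E0 z) (cI z) (bG' z)) /bftI /comp_sym /E0 /= -/ka; ring.
Qed.

End symbol_calculus.

(** * Maximum norms of matrices, entries and multi-indices *)

Section matrix_norm.
Variable R : realType.
Notation C := R[i].

Lemma rn_mx_le p q (M : 'M[C]_(p, q)) (k : R) : 0 <= k ->
 (forall i j, rnorm (M i j) <= k) -> rnorm M <= k.
move=> k0 hk; rewrite -lecR -rnE.
have E : `|M| = mx_norm M by [].
rewrite E; have [->|/mx_norm_neq0[[i j] ->]] := eqVneq (mx_norm M) 0; first by rewrite ler0c.
by rewrite /= rnE lecR.
Qed.

Lemma rn_ent p q (M : 'M[C]_(p, q)) i j : rnorm (M i j) <= rnorm M.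
rewrite -lecR -!rnE; have E : `|M| = mx_norm M by [].
rewrite E mx_normE.
set B := (\big[_/_]_i _); have : (B <= B)%O by exact: lexx.
by rewrite {1}/B => /bigmax_leP[_ /(_ (i, j) isT)]; rewrite -num_le.
Qed.

Lemma rn_mulmx p q r (A : 'M[C]_(p, q)) (B : 'M[C]_(q, r)) :
 rnorm (A *m B) <= q%:R * rnorm A * rnorm B.
apply: rn_mx_le; first by rewrite !mulr_ge0 ?ler0n.
move=> i j; rewrite mxE; letr (rn_sum _ _ _).
letr (_ : _ <= \sum_(l < q) rnorm A * rnorm B).
 by apply: ler_sum => l _; rewrite rnM; apply: ler_pM; rewrite ?rn_ge0 ?rn_ent.
by rewrite sumr_const card_ord -[leLHS]mulr_natl mulrA.
Qed.

End matrix_norm.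

Section entries.
Variables (R : realType) (V : normedModType R) (p q : nat).
Notation C := R[i].
Implicit Types F : V -> 'M[C]_(p, q).

Definition ent F i j (x : V) : C := F x i j.

Lemma derC_ent v F i j : ent (derC v F) i j = cD v (ent F i j).
ext x; rewrite /ent mxE; apply/eqP; rewrite eq_complex /=.
by apply/andP; split; apply/eqP.
Qed.

Lemma derC_ents vs F i j : ent (foldr (@derC R V p q) F vs) i j = cDs vs (ent F i j).
by elim: vs => [|v vs IH]; [rewrite cDsn|rewrite cDsc -IH -derC_ent].
Qed.

Lemma smP F : smooth F <-> forall i j, csm (ent F i j).
split=> [sF i j|sF vs].
 apply/csmE => vs; rewrite -derC_ents; have [cF dF] := sF vs; split.
  exact: ((cts_mxP _).1 cF i j).
 by move=> x v; exact: (dF x v i j).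
split.
 apply/cts_mxP => i j; have := (csmE _).1 (sF i j) vs.
 by rewrite -derC_ents => -[].
move=> x v i j; have := (csmE _).1 (sF i j) vs.
by rewrite -derC_ents => -[_]; apply.
Qed.

End entries.

Section multi_indices.
Variable n : nat.

(** The seminorms are indexed by multi-indices, the calculus by words. A multi-index becomes its
    sorted word and a word its letter counts; since derivatives commute, nothing is lost. *)
Definition mword (al : multi_index n) : seq 'I_n := flatten [seq nseq (al i) i | i <- enum 'I_n].

Definition widx (W : seq 'I_n) : multi_index n := [ffun i => count_mem i W].

Lemma size_mword al : size (mword al) = mabs al.
rewrite /mword size_flatten /shape -map_comp sumnE big_map /mabs big_enum.
by apply: eq_bigr => i _; rewrite /= size_nseq.
Qed.

Lemma perm_mword W : perm_eq (mword (widx W)) W.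
apply/allP => x _ /=; apply/eqP; rewrite count_flatten -map_comp sumnE big_map big_enum (bigD1 x) //=.
rewrite count_nseq /= eqxx mul1n ffunE big1 ?addn0 // => i /negPf ix.
by rewrite /= count_nseq /= ix mul0n.
Qed.

Lemma mabs_widx W : mabs (widx W) = size W.
by rewrite -size_mword; exact/perm_size/perm_mword. Qed.

Lemma pderivE (R : realType) (V : normedModType R) p q (e : 'I_n -> V) al (F : V -> 'M[R[i]]_(p, q)) :
 pderiv e al F = foldr (@derC R V p q) F (map e (mword al)).
rewrite /pderiv /mword; elim: (enum 'I_n) => [//|i s IH] /=.
rewrite IH map_cat foldr_cat; set G := foldr _ F _; elim: (al i) => [//|l IHl] /=.
by rewrite IHl.
Qed.

Lemma pderiv_ent (R : realType) (V : normedModType R) p q (e : 'I_n -> V) al (F : V -> 'M[R[i]]_(p, q)) i j :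
 ent (pderiv e al F) i j = cDs (map e (mword al)) (ent F i j).
by rewrite pderivE derC_ents. Qed.

End multi_indices.

(** * Schwartz functions and symbols through their entries *)

Section suprema.
Variable R : realType.

Lemma sup_leP (T : Type) (f : T -> R) (k : R) :
 (ereal_sup [set (f x)%:E | x in [set: T]] <= k%:E)%E <-> forall x, f x <= k.
split=> [h x|h].
 by rewrite -lee_fin; apply: le_trans h; apply: ereal_sup_ubound; exists x.
by apply: ub_ereal_sup => _ [x _ <-]; rewrite lee_fin.
Qed.

Lemma sup_finP (T : Type) (x0 : T) (f : T -> R) :
 (ereal_sup [set (f x)%:E | x in [set: T]] < +oo)%E <-> exists k, forall x, f x <= k.
split=> [h|[k hk]]; last first.
 by apply: le_lt_trans ((sup_leP _ _).2 hk) _; exact: ltry.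
have ge : ((f x0)%:E <= ereal_sup [set (f x)%:E | x in [set: T]])%E.
 by apply: ereal_sup_ubound; exists x0.
have fin : ereal_sup [set (f x)%:E | x in [set: T]] \is a fin_num.
 by rewrite fin_numElt h andbT; apply: lt_le_trans ge; exact: ltNyr.
by exists (fine (ereal_sup [set (f x)%:E | x in [set: T]])); apply/sup_leP; rewrite fineK.
Qed.

End suprema.

Section schwartz_entries.
Variables (R : realType) (n k : nat).
Notation C := R[i].

Lemma schwP (phi : vfun R n k) : schwartz phi <-> forall j, schw (fun x => phi x j 0).
split=> [[sp hp] j|h].
 have sj := (smP phi).1 sp j 0; split=> // W N.
 have [K hK] := (sup_finP 0 _).1 (hp N (widx W)); exists K => x; apply: le_trans (hK x).
 monol; apply: le_trans (rn_ent _ j 0).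
 have := congr1 (@^~ x) (pderiv_ent (fun i => delta_mx 0 i : 'rV[R]_n) (widx W) phi j 0).
 rewrite /ent /= => ->; rewrite (cDs_perm (fun i => delta_mx 0 i : 'rV[R]_n) sj (perm_mword W)).
 exact: lexx.
split.
 by apply/smP => i j; rewrite (ord1 j); exact: (h i).1.
move=> N al; apply/(sup_finP 0).
have /choice[K hK] : forall j, exists K, forall x, jap x ^+ N * rnorm (cDs (ud R (mword al)) (fun x => phi x j 0) x) <= K.
 by move=> j; exact: (h j).2.
exists (\sum_j `|K j|) => x.
have J0 := exprn_gt0 N (jap_gt0 x).
rewrite -ler_pdivlMl //; apply: rn_mx_le.
 by rewrite mulr_ge0 ?invr_ge0 ?(ltW J0) ?sumr_ge0.
move=> i j; rewrite (ord1 j) ler_pdivlMl //.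
have := congr1 (@^~ x) (pderiv_ent (fun i => delta_mx 0 i : 'rV[R]_n) al phi i 0).
rewrite /ent /= => ->; letr (hK i x); letr (ler_norm _).
by rewrite (bigD1 i) //= lerDl sumr_ge0.
Qed.

End schwartz_entries.

Section symbol_entries.
Variables (R : realType) (n k : nat).
Notation C := R[i].
Notation V := ('rV[R]_n * 'rV[R]_n)%type.
Implicit Types (a : symbol R n k) (W : seq (lett n)).

Definition nxi W : nat := count (fun l => l.1) W.
Definition nx W : nat := count (fun l => ~~ l.1) W.
(** The exponent of the bracket that a word of derivatives costs in type [(rho, dl)]. It is additive
    under concatenation and under Leibniz splittings. *)
Definition word_o (rho dl : R) W : R := - rho * (nxi W)%:R + dl * (nx W)%:R.

Lemma word_o_cat rho dl W1 W2 :
 word_o rho dl (W1 ++ W2) = word_o rho dl W1 + word_o rho dl W2.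
by rewrite /word_o /nxi /nx !count_cat !natrD; ring. Qed.

Lemma word_o_xi rho dl (U : seq 'I_n) : word_o rho dl (xiw U) = - (rho * (size U)%:R).
by rewrite /word_o /nxi /nx !count_map /= count_predT count_pred0 mulr0 addr0 mulNr.
Qed.

Lemma word_o_x rho dl (U : seq 'I_n) : word_o rho dl (xw U) = dl * (size U)%:R.
by rewrite /word_o /nxi /nx !count_map /= count_predT count_pred0 mulr0 add0r.
Qed.

Lemma word_o_le rho dl W : 0 <= rho -> 0 <= dl -> word_o rho dl W <= dl * (size W)%:R.
move=> r0 d0; rewrite /word_o mulNr; apply: le_trans (_ : dl * (nx W)%:R <= _).
 by rewrite gerDr oppr_le0 mulr_ge0.
by monol; rewrite ler_nat count_size.
Qed.

Definition sword (al be : multi_index n) : seq (lett n) := xiw (mword al) ++ xw (mword be).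

Lemma dsym_ent al be a i j : ent (dsym al be a) i j = wD (sword al be) (ent a i j).
by rewrite /dsym pderiv_ent pderiv_ent /sword wD_cat /wD /xiw /xw -!map_comp. Qed.

Lemma word_o_sorted rho dl al be :
 word_o rho dl (sword al be) = - rho * (mabs al)%:R + dl * (mabs be)%:R.
by rewrite word_o_cat word_o_xi word_o_x !size_mword mulNr. Qed.

Definition idx_xi W : multi_index n := widx [seq l.2 | l <- W & l.1].
Definition idx_x W : multi_index n := widx [seq l.2 | l <- W & ~~ l.1].

Lemma perm_sorted_word W : perm_eq W (sword (idx_xi W) (idx_x W)).
rewrite perm_sym; apply: perm_trans (_ : perm_eq _ (xiw [seq l.2 | l <- W & l.1] ++ xw [seq l.2 | l <- W & ~~ l.1])) _.
 by apply: perm_cat; apply: perm_map; exact: perm_mword.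
have E1 : xiw [seq l.2 | l <- W & l.1] = [seq l <- W | l.1].
 rewrite /xiw -map_comp -[RHS]map_id; apply/eq_in_map => -[b i]; rewrite mem_filter => /andP[/= -> _].
 by [].
have E2 : xw [seq l.2 | l <- W & ~~ l.1] = [seq l <- W | ~~ l.1].
 rewrite /xw -map_comp -[RHS]map_id; apply/eq_in_map => -[b i]; rewrite mem_filter => /andP[/= /negPf-> _].
 by [].
by rewrite E1 E2; have /permPl := perm_filterC (fun l : lett n => l.1) W; apply.
Qed.

Lemma word_o_perm rho dl W : word_o rho dl W =
 - rho * (mabs (idx_xi W))%:R + dl * (mabs (idx_x W))%:R.
by rewrite /idx_xi /idx_x !mabs_widx !size_map !size_filter. Qed.

Lemma wD_dsym W a i j : csm (ent a i j) ->
 wD W (ent a i j) = ent (dsym (idx_xi W) (idx_x W) a) i j.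
by move=> sa; rewrite dsym_ent /wD; exact: (cDs_perm _ sa (perm_sorted_word W)).
Qed.

Lemma seminorm_exp m rho dl (al be : multi_index n) :
 - m + rho * (mabs al)%:R - dl * (mabs be)%:R = - (m + word_o rho dl (sword al be)).
by rewrite word_o_sorted; ring. Qed.

Lemma sym_seminorm_leP m rho dl al be a (K : R) : 0 <= K ->
 (symbol_seminorm m rho dl al be a <= K%:E)%E <->
 forall i j z, rnorm (wD (sword al be) (ent a i j) z) <= K * jap z.2 `^ (m + word_o rho dl (sword al be)).
move=> K0; rewrite /symbol_seminorm.
split=> [/sup_leP h i j z|h].
 have := h z; rewrite seminorm_exp powRN ler_pdivrMr ?japR_gt0 //; apply: le_trans.
 by rewrite -dsym_ent; exact: rn_ent.
apply/sup_leP => z; rewrite seminorm_exp powRN ler_pdivrMr ?japR_gt0 //.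
apply: rn_mx_le => [|i j]; first by rewrite mulr_ge0 // japR_ge0.
by have := h i j z; rewrite -dsym_ent.
Qed.

Lemma symcP m rho dl a : symbol_class m rho dl a <->
 (forall i j, csm (ent a i j)) /\
 forall W, exists K, 0 <= K /\ forall i j z, rnorm (wD W (ent a i j) z) <= K * jap z.2 `^ (m + word_o rho dl W).
split=> [[sa ha]|[sa ha]].
 have sa' := (smP a).1 sa; split=> // W.
 have [K hK] := (sup_finP (0 : V) _).1 (ha (idx_xi W) (idx_x W)).
 have K0 : 0 <= K.
  by apply: le_trans (hK 0); rewrite mulr_ge0 ?rn_ge0 ?japR_ge0.
 exists K; split=> // i j z.
 have := (@sym_seminorm_leP m rho dl (idx_xi W) (idx_x W) a K K0).1 ((sup_leP _ _).2 hK) i j z.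
 by rewrite -dsym_ent -wD_dsym // word_o_sorted -word_o_perm.
split; first exact/smP.
move=> al be; have [K [K0 hK]] := ha (sword al be).
apply: le_lt_trans ((sym_seminorm_leP m rho dl al be a K0).2 hK) _; exact: ltry.
Qed.

Lemma symc_tame m rho dl a i j : 0 <= rho -> 0 <= dl -> symbol_class m rho dl a ->
 tame m dl (ent a i j).
move=> r0 d0 /symcP[sa ha]; split=> // W; have [K [K0 hK]] := ha W; exists K => z.
letr (hK i j z); monol; apply: japR_le.
by rewrite lerD2l word_o_le.
Qed.

End symbol_entries.

(** * Scalar operators, pairings and composition *)

Section scalar_operators.
Variables (R : realType) (n : nat).
Notation C := R[i].
Notation rV := 'rV[R]_n.
Notation V := ('rV[R]_n * 'rV[R]_n)%type.
Implicit Types (a b : V -> C) (th phi psi : rV -> C).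

(** Inversion at 0, applied to the translate of [th] by [y]. *)
Lemma ft_involution th (y : rV) : schw th -> ((2 * pi) ^- n)%:C * ft (-1) (ft 1 th) y = th y.
move=> hth; have [sth _] := hth.
have ch : continuous (fun x : rV => x + y) by cts.
have hE (x w : rV) (t : R) : (x + t *: w) + y = (x + y) + t *: w by rewrite addrAC.
have [s1 s2] := csm_aff ch hE sth.
have J (x : rV) : jap x <= jap (x + y) * hnorm y.
 have := jap_mul (x + y) (- y); rewrite addrK (_ : hnorm (- y) = hnorm y) //.
 by rewrite /hnorm; congr (_ + _); apply: eq_bigr => j _; rewrite mxE normrN.
have /choice[K hK] : forall W, exists K, forall x, rnorm (cDs (ud R W) (fun x => th (x + y)) x) <= K * wt x.
 move=> W; have [K hK] := hth.2 W (2 * n)%N; exists (hnorm y ^+ (2 * n) * K) => x.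
 apply: jap_wt => //.
 rewrite s2 map_id; apply: le_trans (ler_wpM2l (exprn_ge0 _ (ltW (hnorm_gt0 y))) (hK (x + y))).
 rewrite mulrA -exprMn ler_wpM2r // lerXn2r ?nnegrE ?mulr_ge0 ?(ltW (hnorm_gt0 y)) //.
 by rewrite mulrC.
have hF : wclass K (fun x => th (x + y)) by split.
have [c0 [L hL]] := schwI 1 0 hth.
have E : ft (-1) (ft 1 th) y = iRn (ft 1 (fun x => th (x + y))).
 iext xi.
 have [c1 [L1 hL1]] := schwI 1 xi hth.
 have [Lt _ hLt] := schw_wt hth.
 rewrite /ft -(@iRnZ _ _ _ _ L1 c1 hL1) -(@iRn_shift _ _ _ y L1); first last.
 - by move=> x; rewrite rnM rne mul1r.
 - by apply: ccontM; [cts|exact: c1].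
 iext x; rewrite mulrA -expiD; congr (expi _ * _).
 by rewrite dotDl (dotC xi y); ring.
rewrite E (ft_inversion (onesqr R) hF) add0r mulrA -rmorphM /= mulVf ?mul1r //.
by rewrite expf_neq0 // mulf_neq0 // gt_eqF // pi_gt0.
Qed.

Definition quant (a : V -> C) (phi : rV -> C) (x : rV) : C :=
 ((2 * pi) ^- n)%:C * iRn (fun xi => expi (1 * dot x xi) * (a (x, xi) * ft (-1) phi xi)).

Definition quant_I a phi (x xi : rV) : C := expi (1 * dot x xi) * (a (x, xi) * ft (-1) phi xi).

Lemma quant_I_bd m d a phi : 0 <= d -> tame m d a -> schw phi ->
 exists2 K, 0 <= K & forall x xi, rnorm (quant_I a phi x xi) <= K * wt xi.
move=> d0 ta hp; have [N [K [K0 hK]]] := tame_poly d0 ta.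
have [L L0 hL] := schw_bd (2 * n + N) (schw_ft (m1sqr R) hp).
exists (K * L); first exact: mulr_ge0.
move=> x xi; rewrite rnM rne mul1r rnM; apply: jap_wt; first by rewrite mulr_ge0 // rn_ge0.
have := ler_wpM2l K0 (hL xi); apply: le_trans.
letr (ler_wpM2l (exprn_ge0 _ (jap_ge0 _)) (ler_wpM2r (rn_ge0 _) (hK (x, xi)))).
by rewrite exprD; apply: eq_ler => /=; ring.
Qed.

Lemma quant_I_ccont m d a phi : 0 <= d -> tame m d a -> schw phi -> ccont (quant_I a phi).
move=> d0 [sa _] hp; have cf := csmc (schw_ft (m1sqr R) hp).1.
have c1 : continuous (fun z : rV * rV => z.1) by cts.
have c2 : continuous (fun z : rV * rV => z.2) by move=> ?; exact: cvg_snd.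
apply: ccontM; first exact: (expi_dotc (sg := 1) c1 c2).
apply: ccontM; last exact: (ctsc cf c2).
by apply: (ctsc (csmc sa)); exact: cts_pair.
Qed.

Lemma quant_bd m d a phi : 0 <= d -> tame m d a -> schw phi ->
 exists K, forall x, rnorm (quant a phi x) <= K.
move=> d0 ta hp; have [K K0 hK] := quant_I_bd d0 ta hp.
exists (rnorm (((2 * pi) ^- n)%:C : C) * (K * (2 * pi) ^+ n)) => x; rewrite rnM ler_wpM2l //.
apply: iRn_bd; last exact: hK.
exact: (ccomp (quant_I_ccont d0 ta hp) (@cts_cst _ _ x) (fun=> cvg_id)).
Qed.

Lemma quant_cts m d a phi : 0 <= d -> tame m d a -> schw phi -> continuous (quant a phi).
move=> d0 ta hp; have [K K0 hK] := quant_I_bd d0 ta hp.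
apply: ccontM; first cts.
apply: (@iRn_cts R rV n); first exact: (quant_I_ccont d0 ta hp).
by move=> q; exists K; apply: near_all => x xi; exact: hK.
Qed.

Lemma int_cst_bd_swap (F : rV -> rV -> C) (ka : C) (K : R) : ccont F ->
 (forall x y, rnorm (F x y) <= K * wt x * wt y) ->
 iRn (fun x => ka * iRn (F x)) = ka * iRn (fun y => iRn (F ^~ y)).
move=> cF bF; have K0 : 0 <= K.
 by have := le_trans (rn_ge0 _) (bF 0 0); rewrite -mulrA pmulr_lge0 // mulr_gt0 ?wt_gt0.
have ci : continuous (fun x => iRn (F x)).
 apply: (@iRn_cts R rV n) => // q; exists K; apply: near_all => x y.
 by letr (bF x y); monor; rewrite ler_piMr ?wt_le1.
have bi x : rnorm (iRn (F x)) <= K * (2 * pi) ^+ n * wt x.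
 rewrite mulrAC; apply: iRn_bd; last exact: bF.
 exact: (ccomp cF (@cts_cst _ _ x) (fun=> cvg_id)).
by rewrite (iRnZ ka ci bi) (iRn_swap cF bF).
Qed.

Lemma quant_pairing m d a phi th : 0 <= d -> d < 1 -> tame m d a -> schw phi -> schw th ->
 iRn (fun x => quant a phi x * th x) =
 ((2 * pi) ^- n)%:C * iRn (fun xi => ft (-1) phi xi * bft 1 (fun z => th z.1 * a z) xi).
move=> d0 d1 ta hp hth; set ka := ((2 * pi) ^- n)%:C : C.
have [K K0 hK] := quant_I_bd d0 ta hp.
have [L L0 hL] := schw_wt hth.
pose F x xi := th x * quant_I a phi x xi.
have c1 : continuous (fun z : rV * rV => z.1) by cts.
have cF : ccont F.
 apply: ccontM; first exact: (ctsc (csmc hth.1) c1).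
 exact: (quant_I_ccont d0 ta hp).
have bF x xi : rnorm (F x xi) <= L * K * wt x * wt xi.
 rewrite rnM; letr (ler_rnM (hL x) (hK x xi)).
 by apply: eq_ler; ring.
have E1 : (fun x => quant a phi x * th x) = fun x => ka * iRn (F x).
 ext x.
 have cx : continuous (quant_I a phi x).
  exact: (ccomp (quant_I_ccont d0 ta hp) (@cts_cst _ _ x) (fun=> cvg_id)).
 by rewrite /F (iRnZ (th x) cx (hK x)) /quant -/ka -mulrA; congr (_ * _); rewrite mulrC.
rewrite E1 (int_cst_bd_swap ka cF bF); congr (_ * iRn _); ext xi.
have [cb [Kb hb]] := bftI_slice 1 xi d0 (amp_prd d0 hth ta).
rewrite bftE -(iRnZ _ cb hb); iext x.
by rewrite /F /quant_I /bftI /=; ring.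
Qed.

Lemma osc_pairing m d f phi : 0 <= d -> d < 1 -> amp m d f -> schw phi ->
 iRn (fun y => phi y * (((2 * pi) ^- n)%:C * osc f y)) =
 ((2 * pi) ^- n)%:C * iRn (fun xi => ft (-1) phi xi * bft 1 f xi).
move=> d0 d1 af hp; set ka := ((2 * pi) ^- n)%:C : C.
have sB := schw_bft (onesqr R) d0 d1 af.
have [K K0 hK] := schw_wt hp; have [L L0 hL] := schw_wt sB.
pose F y xi := phi y * (expi (-1 * dot xi y) * bft 1 f xi).
have c1 : continuous (fun z : rV * rV => z.1) by cts.
have c2 : continuous (fun z : rV * rV => z.2) by move=> ?; exact: cvg_snd.
have cF : ccont F.
 apply: ccontM; first exact: (ctsc (csmc hp.1) c1).
 apply: ccontM; first exact: (expi_dotc (sg := -1) c2 c1).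
 exact: (ctsc (csmc sB.1) c2).
have bF y xi : rnorm (F y xi) <= K * L * wt y * wt xi.
 rewrite rnM rnM rne mul1r.
 letr (ler_rnM (hK y) (hL xi)).
 by apply: eq_ler; ring.
have E1 : (fun y => phi y * (ka * osc f y)) = fun y => ka * iRn (F y).
 ext y; have [cb [Kb hb]] := schwI (-1) y sB.
 by rewrite /F (iRnZ (phi y) cb hb) /osc /ft mulrCA.
rewrite E1 (int_cst_bd_swap ka cF bF); congr (_ * iRn _); ext xi.
have [cp [Kp hp']] := schwI (-1) xi hp.
rewrite mulrC /ft -(iRnZ _ cp hp'); iext y.
by rewrite /F (dotC xi y); ring.
Qed.

(** On the Fourier side both pairings integrate [ft (-1) phi] against a transform, and
    [composition_fourier] makes the two transforms equal at each frequency. *)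
Lemma scalar_composition mb ma mc d a b phi psi : 0 <= d -> d < 1 ->
 tame mb d b -> tame ma d a -> tame mc d (comp_sym b a) -> schw phi -> schw psi ->
 iRn (fun x => quant a phi x * qtr b psi x) =
 iRn (fun y => phi y * qtr (comp_sym b a) psi y).
move=> d0 d1 tb ta tc hphi hpsi.
rewrite (quant_pairing d0 d1 ta hphi (schw_qtr d0 d1 tb hpsi)).
rewrite (osc_pairing d0 d1 (amp_prd d0 hpsi tc) hphi).
congr (_ * iRn _); ext xi; congr (_ * _).
exact: (composition_fourier xi d0 d1 tb ta hpsi).
Qed.

Lemma qtr_sum m d (I : Type) (s : seq I) (b : I -> V -> C) psi y : 0 <= d -> d < 1 ->
 (forall i, tame m d (b i)) -> schw psi ->
 qtr (fun z => \sum_(i <- s) b i z) psi y = \sum_(i <- s) qtr (b i) psi y.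
move=> d0 d1 tb hp; rewrite /qtr -mulr_sumr; congr (_ * _).
elim: s => [|i s IH].
 have a0 := amp_prd d0 hp (tame_sum [::] tb).
 rewrite big_nil -[RHS](mul0r (osc (fun z => psi z.1 * \sum_(i <- [::]) b i z) y)).
 rewrite -(oscZ 0 y d0 d1 a0).
 by congr (osc _ y); ext z; rewrite big_nil !mulr0.
rewrite big_cons -IH -(oscD y d0 d1 (amp_prd d0 hp (tb i)) (amp_prd d0 hp (tame_sum s tb))).
by congr (osc _ y); ext z; rewrite big_cons mulrDr.
Qed.

Lemma qtrD m m' d b b' psi y : 0 <= d -> d < 1 -> tame m d b -> tame m' d b' -> schw psi ->
 qtr (fun z => b z + b' z) psi y = qtr b psi y + qtr b' psi y.
move=> d0 d1 tb tb' hp; rewrite /qtr -mulrDr; congr (_ * _).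
rewrite -(oscD y d0 d1 (amp_prd d0 hp tb) (amp_prd d0 hp tb')).
by congr (osc _ y); ext z; rewrite mulrDr.
Qed.

Lemma qtrZ m d b c psi y : 0 <= d -> d < 1 -> tame m d b -> schw psi ->
 qtr (fun z => c * b z) psi y = c * qtr b psi y.
move=> d0 d1 tb hp; rewrite /qtr mulrCA; congr (_ * _).
rewrite -(oscZ _ y d0 d1 (amp_prd d0 hp tb)).
by congr (osc _ y); ext z; rewrite mulrCA.
Qed.

Lemma qtr_cst c psi y : schw psi -> qtr (fun _ => c) psi y = c * psi y.
move=> hp; have t1 : tame 0 0 (fun _ : V => 1 : C) by exact: tame_cst.
have -> : qtr (fun _ => c) psi y = c * qtr (fun _ => 1) psi y.
 rewrite -(qtrZ c y (lexx 0) ltr01 t1 hp); congr (qtr _ _ y).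
 by ext z; rewrite mulr1.
congr (_ * _); rewrite -[RHS](ft_involution y hp) /qtr /osc.
congr (_ * ft _ _ _); ext eta; rewrite /bft; congr (ft _ _ _).
by ext z; rewrite mulr1.
Qed.

End scalar_operators.

(** * Matrix-valued operators *)

Section matrix_operators.
Variables (R : realType) (n k : nat).
Notation C := R[i].
Notation rV := 'rV[R]_n.
Notation V := ('rV[R]_n * 'rV[R]_n)%type.
Implicit Types (a b : symbol R n k) (phi psi : vfun R n k).

Definition comp_of phi (j : 'I_k) : rV -> C := fun x => phi x j 0.

Definition wint (f : rV -> C) : Prop := continuous f /\ exists K, forall x, rnorm (f x) <= K * wt x.

Lemma wint_sum (I : Type) (s : seq I) (F : I -> rV -> C) : (forall i, wint (F i)) ->
 wint (fun x => \sum_(i <- s) F i x).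
move=> hF; have cF i := (hF i).1; have /choice[K hK] : forall i, exists K, forall x, rnorm (F i x) <= K * wt x.
 by move=> i; exact: (hF i).2.
split.
 elim: s => [|i s' IH]; first by under eq_fun do rewrite big_nil; cts.
 under eq_fun do rewrite big_cons; exact: (ccontD (cF i) IH).
exists (\sum_(i <- s) K i) => x.
by rewrite mulr_suml; letr (rn_sum _ _ _); apply: ler_sum.
Qed.

Lemma wint_s (I : Type) (s : seq I) (F : I -> rV -> C) : (forall i, wint (F i)) ->
 iRn (fun x => \sum_(i <- s) F i x) = \sum_(i <- s) iRn (F i).
by move=> hF; apply: iRn_sum => i; [exact: (hF i).1|exact: (hF i).2]. Qed.

Lemma osc_sum m d (I : Type) (s : seq I) (f : I -> V -> C) y : 0 <= d -> d < 1 ->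
 (forall i, amp m d (f i)) ->
 osc (fun z => \sum_(i <- s) f i z) y = \sum_(i <- s) osc (f i) y.
move=> d0 d1 af; elim: s => [|i s IH].
 have a0 := amp_sum [::] af.
 rewrite big_nil -[RHS](mul0r (osc (fun z => \sum_(i <- [::]) f i z) y)).
 rewrite -(oscZ 0 y d0 d1 a0).
 by congr (osc _ y); ext z; rewrite big_nil mulr0.
rewrite big_cons -IH -(oscD y d0 d1 (af i) (amp_sum s af)).
by congr (osc _ y); ext z; rewrite big_cons.
Qed.

Lemma opT_ent m d b psi y i : 0 <= d -> d < 1 -> (forall i j, tame m d (ent b i j)) -> schwartz psi ->
 opT b psi y i 0 = \sum_l qtr (ent b l i) (comp_of psi l) y.
move=> d0 d1 tb /schwP hp; rewrite /qtr -mulr_sumr.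
rewrite -(osc_sum _ y d0 d1 (fun l => amp_prd d0 (hp l) (tb l i))).
rewrite /opT mxE; congr (_ * _); rewrite mxE; iext xi.
rewrite mxE (dotC y xi); congr (_ * _); first by rewrite mulN1r.
rewrite /integralMx mxE.
iext x.
rewrite mxE mul1r; congr (_ * _); rewrite mxE; apply: eq_bigr => l _.
by rewrite mxE mulrC.
Qed.

Lemma schw_opT m d b psi : 0 <= d -> d < 1 -> (forall i j, tame m d (ent b i j)) -> schwartz psi ->
 schwartz (opT b psi).
move=> d0 d1 tb sp; have hp := (schwP psi).1 sp; apply/schwP => i.
have -> : (fun x => opT b psi x i 0) = fun y => \sum_l qtr (ent b l i) (comp_of psi l) y.
 by ext y; exact: (opT_ent y i d0 d1 tb sp).
by apply: schw_sum => l; exact: schw_qtr d0 d1 (tb l i) (hp l).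
Qed.

Lemma op_ent m d a phi x i : 0 <= d -> (forall i j, tame m d (ent a i j)) -> schwartz phi ->
 op a phi x i 0 = \sum_l quant (ent a i l) (comp_of phi l) x.
move=> d0 ta /schwP hp; rewrite /quant -mulr_sumr /op mxE; congr (_ * _); rewrite mxE.
rewrite -(@wint_s _ (index_enum 'I_k) (fun l => quant_I (ent a i l) (comp_of phi l) x)).
 iext xi; rewrite mxE mxE mulr_sumr; apply: eq_bigr => l _.
 rewrite /quant_I mul1r; congr (_ * (_ * _)).
 rewrite mxE; iext y.
 by rewrite mxE mulN1r.
move=> l; have [K _ hK] := quant_I_bd d0 (ta i l) (hp l); split; last by exists K.
exact: (ccomp (quant_I_ccont d0 (ta i l) (hp l)) (@cts_cst _ _ x) (fun=> cvg_id)).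
Qed.

Definition comp_mx b a : symbol R n k :=
 fun z => \matrix_(i, l) \sum_j comp_sym (ent b i j) (ent a j l) z.

Lemma comp_mx_ent b a i l :
 ent (comp_mx b a) i l = fun z => \sum_j comp_sym (ent b i j) (ent a j l) z.
by ext z; rewrite /ent mxE. Qed.

Lemma op_composition mb ma mc d b a phi psi : 0 <= d -> d < 1 ->
 (forall i j, tame mb d (ent b i j)) -> (forall i j, tame ma d (ent a i j)) ->
 (forall i j l, tame mc d (comp_sym (ent b i j) (ent a j l))) ->
 schwartz phi -> schwartz psi ->
 pairing (op a phi) (opT b psi) = pairing phi (opT (comp_mx b a) psi).
move=> d0 d1 tb ta tc sphi spsi.
have hphi := (schwP phi).1 sphi; have hpsi := (schwP psi).1 spsi.
have tcm i l : tame mc d (ent (comp_mx b a) i l).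
 by rewrite comp_mx_ent; apply: tame_sum => j.
pose A i l := quant (ent a i l) (comp_of phi l).
pose B j i := qtr (ent b j i) (comp_of psi j).
pose D j i l := qtr (comp_sym (ent b j i) (ent a i l)) (comp_of psi j).
have wAB i l j : wint (fun x => A i l x * B j i x).
 have sB := schw_qtr d0 d1 (tb j i) (hpsi j).
 have [K hK] := quant_bd d0 (ta i l) (hphi l); have [L _ hL] := schw_wt sB.
 split.
  have c1 := quant_cts d0 (ta i l) (hphi l).
  by apply: ccontM; [exact: c1|exact: csmc sB.1].
 exists (`|K| * L) => x; rewrite rnM -mulrA; apply: ler_pM; rewrite //; last exact: hL.
 by letr (hK x); exact: ler_norm.
have wD l j i : wint (fun y => comp_of phi l y * D j i l y).
 have sD := schw_qtr d0 d1 (tc j i l) (hpsi j).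
 have [K K0 hK] := schw_wt (hphi l); have [L L0 hL] := schw_wt sD.
 split.
  by apply: ccontM; [exact: csmc (hphi l).1|exact: csmc sD.1].
 exists (K * L) => y; rewrite rnM.
 letr (ler_rnM (hK y) (hL y)).
 rewrite [leLHS](_ : _ = K * L * wt y * wt y); last by ring.
 by rewrite ler_piMr ?wt_le1 // !mulr_ge0.
have E (u v : 'I_k -> C) : (\sum_l u l) * (\sum_j v j) = \sum_l \sum_j u l * v j by rewrite big_distrlr.
have EL : pairing (op a phi) (opT b psi) = \sum_i \sum_l \sum_j iRn (fun x => A i l x * B j i x).
 rewrite /pairing.
 have -> : (fun x => \sum_i op a phi x i 0 * opT b psi x i 0) =
  (fun x => \sum_i \sum_l \sum_j A i l x * B j i x).
  ext x; apply: eq_bigr => i _.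
  transitivity ((\sum_l A i l x) * (\sum_j B j i x)).
  by congr (_ * _); [exact: (op_ent x i d0 ta sphi)|exact: (opT_ent x i d0 d1 tb spsi)].
  exact: (E (fun l => A i l x) (fun j => B j i x)).
 rewrite wint_s; last by move=> i; apply: wint_sum => l; apply: wint_sum => j; exact: wAB.
 apply: eq_bigr => i _; rewrite wint_s; last by move=> l; apply: wint_sum => j; exact: wAB.
 by apply: eq_bigr => l _; rewrite wint_s.
have ER : pairing phi (opT (comp_mx b a) psi) = \sum_l \sum_j \sum_i iRn (fun y => comp_of phi l y * D j i l y).
 rewrite /pairing.
 have -> : (fun x => \sum_l phi x l 0 * opT (comp_mx b a) psi x l 0) =
  (fun y => \sum_l \sum_j \sum_i comp_of phi l y * D j i l y).
  ext y; apply: eq_bigr => l _; rewrite (opT_ent y l d0 d1 tcm spsi) mulr_sumr.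
  apply: eq_bigr => j _; rewrite -mulr_sumr; congr (_ * _).
  by rewrite comp_mx_ent (qtr_sum _ y d0 d1 (fun i => tc j i l) (hpsi j)).
 rewrite wint_s; last by move=> l; apply: wint_sum => j; apply: wint_sum => i; exact: wD.
 apply: eq_bigr => l _; rewrite wint_s; last by move=> j; apply: wint_sum => i; exact: wD.
 by apply: eq_bigr => j _; rewrite wint_s.
rewrite EL ER exchange_big; apply: eq_bigr => l _; rewrite exchange_big.
apply: eq_bigr => j _; apply: eq_bigr => i _.
exact: (scalar_composition d0 d1 (tb j i) (ta i l) (tc j i l) (hphi l) (hpsi j)).
Qed.

End matrix_operators.

(** * Smooth inverses and the Leibniz rule for matrix functions *)

Section smooth_inverse.
Variables (R : realType) (V : normedModType R).
Notation C := R[i].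
Implicit Types f g : V -> C.

Lemma normsq_neq0 (z : C) : z != 0 -> Re z ^+ 2 + Im z ^+ 2 != 0.
apply: contraNneq => h; have /eqP := h; rewrite paddr_eq0 // !sqrf_eq0.
by rewrite eq_complex /=.
Qed.

Lemma inv_conj (z : C) : z^-1 = (z^*)%C * ((Re z ^+ 2 + Im z ^+ 2)^-1)%:C.
have [->|z0] := eqVneq z 0; first by rewrite invr0 conjc0 mul0r.
apply: (mulfI z0); rewrite divff // mulrA.
have -> : z * (z^*)%C = (Re z ^+ 2 + Im z ^+ 2)%:C.
 by case: z {z0} => a b; apply/eqP; rewrite eq_complex /=; apply/andP; split; apply/eqP; ring.
by rewrite -rmorphM /= mulfV // normsq_neq0.
Qed.

(** Through [1 / z = conj z / |z|^2], which reduces the rule to a real reciprocal. *)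
Lemma cderV f x v l : cder v f x l -> f x != 0 -> cder v (fun y => (f y)^-1) x (- l / f x ^+ 2).
move=> hf fx0; have [h1 h2] := (cderE _ _ _ _).1 hf.
pose N (y : V) : R := Re (f y) ^+ 2 + Im (f y) ^+ 2.
have Nx0 : N x != 0 by exact: normsq_neq0.
have hN : is_derive x v N (2 * (Re (f x) * Re l + Im (f x) * Im l)).
 rewrite /N (_ : (fun y => _) = (fun y => Re (f y)) * (fun y => Re (f y)) +
  (fun y => Im (f y)) * (fun y => Im (f y))); last first.
  by ext y; rewrite /= !expr2.
 have e1 := is_deriveM h1 h1; have e2 := is_deriveM h2 h2.
 apply: is_derive_eq (is_deriveD e1 e2) _.
 by rewrite /GRing.scale /=; ring.
have hV : is_derive x v (fun y => (N y)^-1) (- (N x) ^- 2 *: (2 * (Re (f x) * Re l + Im (f x) * Im l))).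
 have [dN eN] := hN; split; first exact: (derivableV Nx0 dN).
 by rewrite (deriveV Nx0 dN) eN.
have hc : cder v (fun y => (f y)^*%C) x (l^*)%C.
 have Rc (z : C) : Re (z^*)%C = Re z by case: z.
 have Ic (z : C) : Im (z^*)%C = - Im z by case: z.
 apply/cderE; rewrite Rc Ic; split; first by under eq_fun do rewrite Rc.
 by under eq_fun do rewrite Ic; exact: is_deriveN h2.
have := cderM hc (cder_real hV).
rewrite (_ : (fun y => _) = fun y => (f y)^-1); last first.
 by ext y; rewrite inv_conj.
move/cder_eq; apply.
rewrite /GRing.scale /=.
move: Nx0 fx0; rewrite /N; case: (f x) => a b; case: l {hf h1 h2 hN hV hc} => c d /= Nx0 fx0.
apply: (mulIf (expf_neq0 2 fx0)); rewrite divfK ?expf_neq0 //.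
apply/eqP; rewrite eq_complex /=; simpc => /=.
by apply/andP; split; apply/eqP; field; rewrite Nx0.
Qed.

Lemma ctsV f : continuous f -> (forall x, f x != 0) -> continuous (fun x => (f x)^-1).
by move=> cf f0 x; apply: cvgV; [exact: f0|exact: cf]. Qed.

Lemma csmX f p : csm f -> csm (fun x => f x ^+ p).
move=> sf; elim: p => [|p IH]; first exact: csm_cst.
have -> : (fun x => f x ^+ p.+1) = fun x => f x * f x ^+ p by ext x; rewrite exprS.
exact: csmM.
Qed.

(** The class for the coinduction: quotients [g / f^p] with [g] smooth. *)
Lemma csmV f : csm f -> (forall x, f x != 0) -> csm (fun x => (f x)^-1).
move=> sf f0; pose Q (F : V -> C) := exists g p, csm g /\ F = fun x => g x * (f x ^+ p)^-1.
apply: (csm_coind (Q := Q)); last first.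
- exists (fun=> 1), 1%N; split; first exact: csm_cst.
 by ext x; rewrite mul1r expr1.
- move=> _ v [g [p [sg ->]]].
 have sfp := csmX p sf.
 exists (fun x => (cD v g x * f x ^+ p - g x * cD v (fun x => f x ^+ p) x) * (f x ^+ (p * 2))^-1).
  exists (fun x => cD v g x * f x ^+ p - g x * cD v (fun x => f x ^+ p) x), (p * 2)%N; split=> //.
  have -> : (fun x => cD v g x * f x ^+ p - g x * cD v (fun x => f x ^+ p) x) =
  (fun x => cD v g x * f x ^+ p + (-1) * (g x * cD v (fun x => f x ^+ p) x)).
  by ext x; rewrite mulN1r.
  apply: csmD; first by apply: csmM => //; exact: csm_cD.
  by apply: csmZ; apply: csmM => //; exact: csm_cD.
 move=> x; have fp0 : f x ^+ p != 0 by rewrite expf_neq0.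
 have := cderM (csm_cder v x sg) (cderV (csm_cder v x sfp) fp0).
 move/cder_eq; apply; rewrite exprM; move: fp0; move: (f x ^+ p) => t t0.
 by field.
- move=> _ [g [p [sg ->]]]; apply: ccontM; first exact: csmc.
 apply: ctsV; first exact: csmc (csmX p sf).
 by move=> x; rewrite expf_neq0.
Qed.

Lemma csm_prod (I : Type) (s : seq I) (F : I -> V -> C) :
 (forall i, csm (F i)) -> csm (fun x => \prod_(i <- s) F i x).
move=> sF; elim: s => [|i s IH].
 by under eq_fun do rewrite big_nil; exact: csm_cst.
by under eq_fun do rewrite big_cons; exact: csmM.
Qed.

Lemma csm_det p (F : V -> 'M[C]_p) : (forall i j, csm (fun x => F x i j)) -> csm (fun x => \det (F x)).
by move=> sF; apply: csm_sum => s; apply: csmZ; exact: csm_prod.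
Qed.

Lemma csm_invmx p (F : V -> 'M[C]_p) : (forall i j, csm (fun x => F x i j)) ->
 (forall x, F x \in unitmx) -> forall i j, csm (fun x => invmx (F x) i j).
move=> sF uF i j.
have -> : (fun x => invmx (F x) i j) = fun x => (\det (F x))^-1 * ((-1) ^+ (j + i) * \det (row' j (col' i (F x)))).
 by ext x; rewrite /invmx uF !mxE.
apply: csmM; first by apply: csmV; [exact: csm_det|move=> x; have := uF x; rewrite unitmxE unitfE].
apply: csmZ; apply: csm_det => i' j'.
by under eq_fun do rewrite !mxE; exact: sF.
Qed.

End smooth_inverse.

Section matrix_words.
Variables (R : realType) (n k : nat).
Notation C := R[i].
Notation V := ('rV[R]_n * 'rV[R]_n)%type.
Implicit Types (a b : symbol R n k) (W : seq (lett n)).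

Definition wDm W a : symbol R n k := fun z => \matrix_(i, j) wD W (ent a i j) z.

Lemma wDm_nil a : wDm [::] a = a.
by ext z; apply/matrixP => i j; rewrite mxE wD_nil. Qed.

(** Isolates the Leibniz term in which all letters fall on the first factor, so that the formula can
    be solved for it. *)
Lemma spl_head (T : Type) (W : seq T) : exists s, spl W = (W, [::]) :: s /\
 all (fun p => 0 < size p.2)%N s.
elim: W => [|x W [s [E hs]]]; first by exists [::].
exists ([seq (x :: p.1, p.2) | p <- s] ++ [seq (p.1, x :: p.2) | p <- (W, [::]) :: s]); split.
 by rewrite [spl _]/= E.
by rewrite all_cat !all_map /=; apply/andP; split=> //; elim: {E hs} s => //.
Qed.

Lemma wDm_mul W a b z : (forall i j, csm (ent a i j)) -> (forall i j, csm (ent b i j)) ->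
 wDm W (fun z => a z *m b z) z = \sum_(p <- spl W) wDm p.1 a z *m wDm p.2 b z.
move=> sa sb; apply/matrixP => i j; rewrite mxE summxE.
have -> : ent (fun z => a z *m b z) i j = fun z => \sum_l ent a i l z * ent b l j z.
 by ext z'; rewrite /ent mxE.
rewrite wD_sum; last by move=> l; exact: csmM.
rewrite (eq_bigr (fun l => \sum_(p <- spl W) wD p.1 (ent a i l) z * wD p.2 (ent b l j) z)); last first.
 by move=> l _; rewrite wD_M.
rewrite exchange_big; apply: eq_bigr => p _; rewrite mxE; apply: eq_bigr => l _.
by rewrite !mxE.
Qed.

End matrix_words.

Lemma spl_count (T : eqType) (P : pred T) (W : seq T) p : p \in spl W ->
 count P W = (count P p.1 + count P p.2)%N.
elim: W p => [|x W IH] p; first by rewrite inE => /eqP ->.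
rewrite [spl _]/= mem_cat => /orP[] /mapP[q /IH hq ->] /=; first by rewrite hq addnA.
by rewrite hq addnCA.
Qed.

Lemma spl_order (R : realType) n (rho dl : R) (W : seq (lett n)) p : p \in spl W ->
 word_o rho dl W = word_o rho dl p.1 + word_o rho dl p.2.
move=> hp; rewrite /word_o /nxi /nx (spl_count (fun l => l.1) hp) (spl_count (fun l => ~~ l.1) hp).
by rewrite !natrD; ring.
Qed.

Section invertible_matrices.
Variables (R : realType) (k : nat).
Notation C := R[i].
Implicit Types (A B : 'M[C]_k) (l : C).

Lemma eigenvalue_unitmx A l : ~~ eigenvalue A l -> A - l%:M \in unitmx.
by rewrite negbK kermx_eq0 row_free_unit. Qed.

Lemma large_unitmx A l : k%:R * rnorm A < rnorm l -> A - l%:M \in unitmx.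
move=> h; apply: eigenvalue_unitmx; apply/negP => /eigenvalueP[v Ev v0].
have v1 : 0 < rnorm v by rewrite lt_neqAle eq_sym rn_eq0 v0 rn_ge0.
have := rn_mulmx v A; rewrite Ev rnZ => h'.
have : rnorm l * rnorm v <= k%:R * rnorm A * rnorm v by letr h'; rewrite mulrAC.
by rewrite ler_pM2r // leNgt h.
Qed.

Lemma rn_mx1 : rnorm (1%:M : 'M[C]_k) <= 1.
apply: rn_mx_le => // i j; rewrite mxE; case: (i == j); rewrite ?rn1 //.
by rewrite rn0.
Qed.

(** From [l (A - l)^-1 = A (A - l)^-1 - 1]. *)
Lemma invmx_bd A l : A - l%:M \in unitmx ->
 rnorm l * rnorm (invmx (A - l%:M)) <= k%:R * rnorm A * rnorm (invmx (A - l%:M)) + 1.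
move=> uA; have E : l *: invmx (A - l%:M) = A *m invmx (A - l%:M) - 1%:M.
 have h := mulmxV uA; rewrite mulmxBl mul_scalar_mx in h.
 by rewrite -h opprB addrCA subrr addr0.
rewrite -rnZ E; letr (rnD _ _); rewrite rnN.
by apply: lerD; [exact: rn_mulmx|exact: rn_mx1].
Qed.

Lemma rn_mx_mul_le p q (M : 'M[C]_(p, q)) (t c : R) : 0 <= t -> 0 <= c ->
 (forall i j, rnorm (M i j) * t <= c) -> rnorm M * t <= c.
move=> t0 c0 h; have [->|tn] := eqVneq t 0; first by rewrite mulr0.
have tp : 0 < t by rewrite lt_neqAle eq_sym tn.
rewrite -ler_pdivlMr //; apply: rn_mx_le; first by rewrite divr_ge0.
by move=> i j; rewrite ler_pdivlMr.
Qed.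

End invertible_matrices.

(** * The inverse of [a - l] as a symbol *)

Section resolvent_symbol.
Variables (R : realType) (n k : nat).
Notation C := R[i].
Notation V := ('rV[R]_n * 'rV[R]_n)%type.
Variables (m rho dl : R) (a : symbol R n k).
Hypotheses (hm : 0 <= m) (hd : 0 <= dl) (hdr : dl < rho) (hr : rho <= 1).
Hypothesis ha : symbol_class m rho dl a.
Implicit Types (l : C) (W : seq (lett n)) (z : V).
Notation ord := (word_o rho dl).

Definition rsym l : symbol R n k := fun z => invmx (a z - l%:M).

(** The hypoelliptic estimates on all of phase space, with constants that do not depend on [l]. For
    such [l] the inverse symbol exists everywhere. *)
Definition rsv (CL : R) (Cw : seq (lett n) -> R) l : Prop := forall z,
 [/\ a z - l%:M \in unitmx, rnorm l * rnorm (rsym l z) <= CL &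
  forall W i j, rnorm (wD W (ent a i j) z) * rnorm (rsym l z) <= Cw W * jap z.2 `^ ord W].

(** For large [xi] the estimates are the hypothesis. For the remaining [xi] the symbol is bounded,
    and as soon as [|l|] exceeds a multiple of that bound, [a - l] is invertible with inverse of
    size [1 / |l|]. *)
Lemma rsv_ex (Lam : set C) : hypoelliptic Lam rho dl a ->
 exists (L0 CL : R) (Cw : seq (lett n) -> R), [/\ 1 <= L0, 0 <= CL, forall W, 0 <= Cw W &
  forall l, Lam l -> L0 <= rnorm l -> rsv CL Cw l].
move=> [c [C0 [c0 C0p hspec hsym]]].
have [sa hK] := (symcP m rho dl a).1 ha.
have /choice[K hK'] := hK.
have K0 W : 0 <= K W by have [] := hK' W.
have bK W i j z : rnorm (wD W (ent a i j) z) <= K W * jap z.2 `^ (m + ord W) by have [_] := hK' W; apply.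
have /choice[cab hcab] : forall W, exists cab : R, forall l x xi, Lam l -> C0 <= enorm xi ->
  rnorm (dsym (idx_xi W) (idx_x W) a (x, xi)) * rnorm (invmx (a (x, xi) - l%:M)) <=
  cab * jap xi `^ (- rho * (mabs (idx_xi W))%:R + dl * (mabs (idx_x W))%:R).
 by move=> W; exact: hsym.
pose J0 : R := Num.sqrt (1 + C0 ^+ 2).
have J0_ge0 : 0 <= J0 by exact: sqrtr_ge0.
have hJ0 (xi : 'rV[R]_n) : enorm xi < C0 -> jap xi <= J0.
 move=> h; rewrite /jap /J0 ler_wsqrtr // lerD2l lerXn2r ?nnegrE ?(ltW h) ?(ltW C0p) //.
 exact: sqrtr_ge0.
have hJm (xi : 'rV[R]_n) : enorm xi < C0 -> jap xi `^ m <= J0 `^ m.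
 by move=> h; apply: ge0_ler_powR => //; rewrite ?nnegrE // hJ0.
have o0 : ord [::] = 0 by rewrite /word_o /nxi /nx /= !mulr0 addr0.
have big z : C0 <= enorm z.2 -> forall l, Lam l ->
  forall W i j, rnorm (wD W (ent a i j) z) * rnorm (rsym l z) <= `|cab W| * jap z.2 `^ ord W.
 case: z => x xi /= hxi l hl W i j.
 letr (_ : _ <= rnorm (dsym (idx_xi W) (idx_x W) a (x, xi)) * rnorm (rsym l (x, xi))).
  by monor; rewrite wD_dsym //; exact: rn_ent.
 letr (hcab W l x xi hl hxi); rewrite word_o_perm ler_wpM2r //.
 exact: ler_norm.
pose A0 := K [::] * J0 `^ m.
have A00 : 0 <= A0 by rewrite mulr_ge0.
have smallA z : enorm z.2 < C0 -> rnorm (a z) <= A0.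
 move=> h; apply: rn_mx_le => // i j; have := bK [::] i j z; rewrite wD_nil o0 addr0 => /le_trans; apply.
 by monol; rewrite hJm.
(* Twice [k * A0], so that the term [k |a| |(a - l)^-1|] of [invmx_bd] is absorbed into the left
   side; the summand 1 ensures [|l| >= 1]. *)
pose L0 := 1 + 2 * (k%:R * A0).
have L01 : 1 <= L0 by rewrite /L0 lerDl mulr_ge0 // mulr_ge0 ?ler0n.
(* The summand 2 results from that absorption, [k * |cab [::]|] from the hypoelliptic estimate for
   [a] itself at large [xi]. *)
pose CL := 2 + k%:R * `|cab [::]|.
have CL0 : 0 <= CL by rewrite addr_ge0 // mulr_ge0 ?ler0n.
exists L0, CL, (fun W => `|cab W| + K W * J0 `^ m * CL); split=> //.
 by move=> W; rewrite addr_ge0 // !mulr_ge0 ?powR_ge0.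
move=> l hl lL z; have l1 : 1 <= rnorm l by exact: le_trans lL.
have lA : 2 * (k%:R * A0) < rnorm l.
 by apply: lt_le_trans lL; rewrite /L0; set q := 2 * _; lra.
have [hz|hz] := lerP C0 (enorm z.2).
 have uz : a z - l%:M \in unitmx.
  apply: eigenvalue_unitmx; apply/negP => he.
  by case: z hz he => x xi hz he; have [] := hspec x xi hz l he.
 split=> //.
  letr (invmx_bd uz); rewrite /CL addrC -/(rsym l z); apply: lerD; first by lra.
  rewrite -mulrA ler_wpM2l ?ler0n //; apply: rn_mx_mul_le; rewrite // => i j.
  by have := big z hz l hl [::] i j; rewrite wD_nil o0 powRr0 mulr1.
 move=> W i j; letr (big z hz l hl W i j).
 by monor; rewrite lerDl !mulr_ge0.
have aA := smallA z hz; have r0 := rn_ge0 (rsym l z).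
have kA : k%:R * rnorm (a z) <= k%:R * A0 by rewrite ler_wpM2l ?ler0n.
have uz : a z - l%:M \in unitmx.
 apply: large_unitmx; apply: le_lt_trans kA _; apply: le_lt_trans lA.
 by rewrite ler_peMl ?ler1n // mulr_ge0 ?ler0n.
have bL : rnorm l * rnorm (rsym l z) <= CL.
 have h := invmx_bd uz; rewrite -/(rsym l z) in h.
 have h2 : 2 * (k%:R * rnorm (a z) * rnorm (rsym l z)) <= rnorm l * rnorm (rsym l z).
  rewrite mulrA ler_wpM2r // (le_trans _ (ltW lA)) // ler_wpM2l //; lra.
 have : 0 <= k%:R * `|cab [::]| by rewrite mulr_ge0 ?ler0n.
 by rewrite /CL; move: h h2; lra.
split=> // W i j.
have bC : rnorm (rsym l z) <= CL by apply: le_trans bL; rewrite ler_peMl.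
letr (ler_rnM (bK W i j z) bC).
rewrite japRD mulrDl -[X in X <= _]add0r; apply: lerD; first by rewrite mulr_ge0.
rewrite mulrA mulrAC ler_wpM2r // ler_wpM2r // ler_wpM2l //.
exact: hJm.
Qed.

Variables (CL : R) (Cw : seq (lett n) -> R).
Hypotheses (hCL : 0 <= CL) (hCw : forall W, 0 <= Cw W).

Lemma sa i j : csm (ent a i j). Proof. by have [+ _] := (symcP m rho dl a).1 ha. Qed.

Lemma csm_shifted l i j : csm (fun z => (a z - l%:M) i j).
have -> : (fun z => (a z - l%:M) i j) = fun z => ent a i j z + (- (l%:M i j)).
 by ext z; rewrite !mxE.
by apply: csmD; [exact: sa|exact: csm_cst].
Qed.

Lemma csm_rsym l i j : rsv CL Cw l -> csm (ent (rsym l) i j).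
move=> hl; apply: csm_invmx; first exact: csm_shifted.
by move=> z; have [] := hl z.
Qed.

(** Derivatives of the constant [(a - l)^-1 (a - l)] vanish; the Leibniz formula is solved for the
    term with all letters on the inverse. *)
Lemma rsym_recursion l W z : rsv CL Cw l -> (0 < size W)%N ->
 wDm W (rsym l) z = - \sum_(p <- behead (spl W)) wDm p.1 (rsym l) z *m wDm p.2 a z *m rsym l z.
move=> hl W0; have [uz _ _] := hl z; have [s [E hs]] := spl_head W.
have h := wDm_mul W z (fun i j => csm_rsym i j hl) (csm_shifted l).
have L0 : wDm W (fun z => rsym l z *m (a z - l%:M)) z = 0.
 apply/matrixP => i j; rewrite !mxE.
 have -> : ent (fun z => rsym l z *m (a z - l%:M)) i j = fun _ => (i == j)%:R.
  by ext z'; rewrite /ent mulVmx ?mxE //; have [] := hl z'.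
 by case: W W0 {h s E hs} => // l' W _; rewrite /wD [map _ _]/= cDs_cst.
rewrite L0 E big_cons wDm_nil in h.
have h2 : wDm W (rsym l) z *m (a z - l%:M) = - \sum_(p <- s) wDm p.1 (rsym l) z *m wDm p.2 (fun z => a z - l%:M) z.
 by apply/eqP; rewrite -addr_eq0 -h.
rewrite E [behead _]/= -[LHS]mulmx1 -(mulmxV uz) mulmxA h2 mulNmx mulmx_suml; congr (- _).
rewrite !big_seq; apply: eq_bigr => p /(allP hs) p2; congr (_ *m _ *m _).
apply/matrixP => i j; rewrite !mxE.
have -> : ent (fun z => a z - l%:M) i j = fun z => ent a i j z + (- (l%:M i j)).
 by ext z'; rewrite /ent !mxE.
rewrite /wD cDs_D; [|exact: sa|exact: csm_cst].
by case: p.2 p2 => // l' W' _; rewrite [map _ _]/= cDs_cst addr0.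
Qed.

(** Induction on the length through [rsym_recursion]: in each term a derivative of [a] is paired
    with one factor of the inverse, where the hypoelliptic bound cancels the growth of [a], and one
    factor of the inverse survives. *)
Lemma rsym_words : exists Cb : seq (lett n) -> R, forall W, 0 <= Cb W /\
 forall l z, rsv CL Cw l -> rnorm (wDm W (rsym l) z) <= Cb W * rnorm (rsym l z) * jap z.2 `^ ord W.
suff H N : forall W, (size W <= N)%N -> exists K, 0 <= K /\ forall l z, rsv CL Cw l ->
  rnorm (wDm W (rsym l) z) <= K * rnorm (rsym l z) * jap z.2 `^ ord W.
 have /choice[Cb hCb] : forall W, exists K, 0 <= K /\ forall l z, rsv CL Cw l ->
  rnorm (wDm W (rsym l) z) <= K * rnorm (rsym l z) * jap z.2 `^ ord W.
  by move=> W; exact: (H (size W)).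
 by exists Cb.
have nilcase : exists K, 0 <= K /\ forall l z, rsv CL Cw l ->
  rnorm (wDm [::] (rsym l) z) <= K * rnorm (rsym l z) * jap z.2 `^ ord [::].
 exists 1; split=> // l z _; rewrite wDm_nil mul1r /word_o /nxi /nx /= !mulr0 addr0 powRr0.
 by rewrite mulr1.
elim: N => [|N IH] W WN; first by move: WN; rewrite leqn0 size_eq0 => /eqP ->.
have [W0|W0] := posnP (size W); first by move/eqP: W0; rewrite size_eq0 => /eqP ->.
have [s [E hs]] := spl_head W.
have sp p : p \in s -> (size p.1 <= N)%N /\ (size p.1 + size p.2)%N = size W.
 move=> hp; have hp' : p \in spl W by rewrite E inE hp orbT.
 have e := size_spl hp'; split=> //; rewrite -ltnS; apply: leq_trans WN.
 by rewrite -e -addn1 leq_add2l; exact: (allP hs _ hp).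
have /choice[K hK] : forall p : seq (lett n) * seq (lett n), exists K, 0 <= K /\
  (p \in s -> forall l z, rsv CL Cw l -> rnorm (wDm p.1 (rsym l) z) <= K * rnorm (rsym l z) * jap z.2 `^ ord p.1).
 move=> p; have [hp|hp] := boolP (p \in s); last by exists 0.
 by have [K [K0 hK]] := IH p.1 (sp p hp).1; exists K.
have K0 p : 0 <= K p by have [] := hK p.
exists (\sum_(p <- s) k%:R * k%:R * K p * Cw p.2); split.
 by apply: sumr_ge0 => p _; rewrite !mulr_ge0 ?ler0n.
move=> l z hl; rewrite (rsym_recursion z hl W0) E [behead _]/= rnN.
letr (rn_sum _ _ _); rewrite !mulr_suml !big_seq; apply: ler_sum => p hp.
have [_ hKp] := hK p; have h1 := hKp hp l z hl; have [_ _ h2] := hl z.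
have h3 : rnorm (wDm p.2 a z) * rnorm (rsym l z) <= Cw p.2 * jap z.2 `^ ord p.2.
 apply: rn_mx_mul_le; rewrite ?mulr_ge0 // => i j.
 by rewrite mxE; exact: h2.
letr (rn_mulmx _ _).
letr (ler_wpM2r (rn_ge0 _) (ler_wpM2l (ler0n _ _) (rn_mulmx _ _))).
have hp' : p \in spl W by rewrite E inE hp orbT.
rewrite (spl_order rho dl hp') japRD.
have := ler_pM (rn_ge0 _) (mulr_ge0 (rn_ge0 _) (rn_ge0 _)) h1 h3.
move/(ler_wpM2l (mulr_ge0 (ler0n R k) (ler0n R k))) => h4.
letr (le_trans _ h4); first by apply: eq_ler; ring.
by apply: eq_ler; ring.
Qed.

End resolvent_symbol.

(** Put [e = sg / (m + 1)]. If [J^(m + 1) >= L], the factor [J^-sg] is already at most [L^-e].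
    Otherwise [J^m / L <= J^(m + 1) / L < 1], and the [e]-th power of the latter, which is larger,
    times [J^-sg] equals [L^-e]. Surplus decay in [xi] thus becomes decay in [l]; [m + 1] in place
    of [m] includes order 0. *)
Lemma interpolation (R : realType) (J L m sg X c1 c2 : R) : 1 <= J -> 1 <= L -> 0 <= m -> 0 < sg -> sg <= 1 ->
 0 <= X -> 0 <= c1 -> 0 <= c2 -> X <= c1 -> X <= c2 * (J `^ m / L) ->
 X * J `^ (- sg) <= (c1 + c2) * L `^ (- (sg / (m + 1))).
move=> J1 L1 m0 s0 s1 X0 c10 c20 h1 h2.
have J0 : 0 < J by exact: lt_le_trans J1.
have L0 : 0 < L by exact: lt_le_trans L1.
have m1 : 0 < m + 1 by rewrite ltr_wpDl.
pose e := sg / (m + 1); have e0 : 0 < e by rewrite divr_gt0.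
have e1 : e <= 1 by rewrite ler_pdivrMr // mul1r; letr s1; rewrite lerDr.
have Le0 : 0 < L `^ (- e) by rewrite powR_gt0.
have JE : J `^ (- sg) = (J `^ (m + 1)) `^ (- e) by rewrite -powRrM mulrN /e mulrCA divff ?mulr1 // gt_eqF.
have K0 : 0 < J `^ (m + 1) by rewrite powR_gt0.
rewrite -/e mulrDl; have [h|h] := lerP L (J `^ (m + 1)).
 rewrite -[X in X <= _]addr0; apply: lerD; last by rewrite mulr_ge0 // ltW.
 apply: ler_pM => //.
 rewrite JE !powRN lef_pV2 ?posrE ?powR_gt0 //.
 by apply: ge0_ler_powR; rewrite ?nnegrE ?(ltW e0) ?(ltW L0) ?(ltW K0).
rewrite -[X in X <= _]add0r; apply: lerD; first by rewrite mulr_ge0 // ltW.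
letr (ler_wpM2r (powR_ge0 _ _) h2); rewrite -mulrA ler_wpM2l //.
have q1 : J `^ m / L <= J `^ (m + 1) / L.
 by rewrite ler_wpM2r ?invr_ge0 ?(ltW L0) //; apply: ler_powR => //; rewrite lerDl.
have q2 : J `^ (m + 1) / L <= (J `^ (m + 1) / L) `^ e.
 have q0 : 0 < J `^ (m + 1) / L by rewrite divr_gt0.
 rewrite -{1}[J `^ (m + 1) / L]powRr1 ?(ltW q0) //; apply: ger_powR => //.
 by rewrite q0 ler_pdivrMr // mul1r ltW.
letr (ler_wpM2r (powR_ge0 _ _) (le_trans q1 q2)).
rewrite powRM ?invr_ge0 ?(ltW L0) ?(ltW K0) // JE powRN mulrAC mulfV ?gt_eqF ?powR_gt0 // mul1r.
by rewrite -powR_inv1 ?(ltW L0) // -powRrM mulN1r.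
Qed.

Lemma tameD (R : realType) n (m d : R) (f g : 'rV[R]_n * 'rV[R]_n -> R[i]) :
 tame m d f -> tame m d g -> tame m d (fun z => f z + g z).
move=> tf tg; have := @tame_sum R n m d bool [:: true; false] (fun b : bool => if b then f else g).
rewrite (_ : (fun z => \sum_(i <- _) _) = fun z => f z + g z); first by apply; case.
by ext z; rewrite !big_cons big_nil addr0.
Qed.

(** * The remainder symbol and its decay in [l] *)

Section remainder_symbol.
Variables (R : realType) (n k : nat).
Notation C := R[i].
Notation V := ('rV[R]_n * 'rV[R]_n)%type.
Variables (m rho dl : R) (a : symbol R n k).
Hypotheses (hm : 0 <= m) (hd : 0 <= dl) (hdr : dl < rho) (hr : rho <= 1).
Hypothesis ha : symbol_class m rho dl a.
Variables (CL : R) (Cw : seq (lett n) -> R).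
Hypotheses (hCL : 0 <= CL) (hCw : forall W, 0 <= Cw W).
Implicit Types (l : C) (W : seq (lett n)) (z : V).
Notation ord := (word_o rho dl).
Notation rsv := (rsv rho dl a CL Cw).

Definition dexp : R := (rho - dl) / (m + 1).

Let sa i j : csm (ent a i j). Proof. exact: (sa ha). Qed.

Let rho0 : 0 <= rho. Proof. exact: le_trans (ltW hdr). Qed.

Lemma rsym_word_bd : exists Cb : seq (lett n) -> R, forall W, 0 <= Cb W /\
 forall l i j z, rsv l -> 1 <= rnorm l ->
 rnorm (wD W (ent (rsym a l) i j) z) <= Cb W * rnorm (rsym a l z) * jap z.2 `^ ord W /\
 rnorm (wD W (ent (rsym a l) i j) z) <= Cb W * CL / rnorm l * jap z.2 `^ ord W.
have [Cb hCb] := rsym_words ha CL hCw; exists Cb => W; have [C0 hC] := hCb W; split=> // l i j z hl l1.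
have l0 : 0 < rnorm l by exact: lt_le_trans l1.
have h := hC l z hl; have h1 := rn_ent (wDm W (rsym a l) z) i j; rewrite mxE in h1.
have h2 := le_trans h1 h; split=> //; letr h2; monor.
by rewrite -mulrA ler_wpM2l // ler_pdivlMr // mulrC; have [_] := hl z.
Qed.

Lemma rsym_tame l i j : rsv l -> 1 <= rnorm l -> tame 0 dl (ent (rsym a l) i j).
move=> hl l1; split; first exact: (csm_rsym ha i j hl).
have [Cb hCb] := rsym_word_bd => W; have [C0 hC] := hCb W.
exists (Cb W * CL / rnorm l) => z; have [_ h] := hC l i j z hl l1; letr h.
rewrite ler_wpM2l ?divr_ge0 ?mulr_ge0 //; apply: japR_le.
by rewrite add0r word_o_le.
Qed.

Definition srem l i j q : V -> C :=
 fun z => comp_sym (ent (rsym a l) i j) (ent a j q) z + (-1) * (ent (rsym a l) i j z * ent a j q z).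

(** Leibniz terms are treated one by one by [comp_estimate]. In its main part a product of
    derivatives of the inverse and of [a] has two bounds, one from hypoellipticity and one from
    [|(a - l)^-1| <= CL / |l|]; at least one [xi]-derivative gains [rho - dl] powers, which
    [interpolation] converts into decay in [|l|]. *)
Lemma rem_words W : exists K, 0 <= K /\ forall l i j q z, rsv l -> 1 <= rnorm l ->
 rnorm (wD W (srem l i j q) z) <= K * rnorm l `^ (- dexp) * jap z.2 `^ ord W.
have [Cb hCb] := rsym_word_bd.
have Cb0 U : 0 <= Cb U by have [] := hCb U.
have [_ /choice[Ka hKa]] := (symcP m rho dl a).1 ha.
have Ka0 U : 0 <= Ka U by have [] := hKa U.
have sg0 : 0 < rho - dl by rewrite subr_gt0.
have sg1 : rho - dl <= 1 by apply: le_trans hr; rewrite gerBl.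
have ta j q : tame m dl (ent a j q) by exact: symc_tame ha.
have m1 : 0 < m + 1 by rewrite ltr_wpDl.
have H (p : seq (lett n) * seq (lett n)) : exists K, 0 <= K /\ (p \in spl W ->
  forall l i j q z, rsv l -> 1 <= rnorm l ->
  rnorm (comp_sym (wD p.1 (ent (rsym a l) i j)) (wD p.2 (ent a j q)) z -
  wD p.1 (ent (rsym a l) i j) z * wD p.2 (ent a j q) z) <=
  K * rnorm l `^ (- dexp) * jap z.2 `^ ord W).
 (* The orders of the two differentiated factors; the last argument asks for a remainder of order
    [ord W]. *)
 have [M [K0 [K00 hest]]] := @comp_estimate R n rho dl (ord p.1) (m + ord p.2) (- ord W) hd hdr hr.
 have [B B0 hB] := @words_bdd R 'I_n (fun U => Cb (xiw U ++ p.1)) M (fun U => Cb0 _).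
 have [A A0 hA] := @words_bdd R 'I_n (fun U => Ka (xw U ++ p.2)) M (fun U => Ka0 _).
 have [A' A'0 hA'] := @words_bdd R 'I_n (fun U => Cw (xw U ++ p.2)) M (fun U => hCw _).
 exists (K0 * (B * (A' + CL * A) + A * (B * CL))); split.
  apply: mulr_ge0 => //; apply: addr_ge0; apply: mulr_ge0 => //; last exact: mulr_ge0.
  by apply: addr_ge0 => //; exact: mulr_ge0.
 move=> hp l i j q z hl l1; have l0 : 0 < rnorm l by exact: lt_le_trans l1.
 have eo := spl_order rho dl hp.
 have tb := rsym_tame i j hl l1.
 set gam := B * (A' + CL * A) * rnorm l `^ (- dexp) * jap z.2 `^ ord W.
 have gam0 : 0 <= gam by rewrite !mulr_ge0 // addr_ge0 // mulr_ge0.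
 have bl0 : 0 <= B * CL / rnorm l by rewrite divr_ge0 ?mulr_ge0 // ltW.
 have := hest _ _ dl _ _ z A (B * CL / rnorm l) gam hd (tame_wD p.1 tb) (tame_wD p.2 (ta j q)) A0 bl0 gam0.
 move=> h; letr (h _ _ _).
 - move=> U z' hU; rewrite -wD_cat.
  have [_ hb] := hCb (xiw U ++ p.1); have [_ {}hb] := hb l i j z' hl l1.
  letr hb; rewrite word_o_cat word_o_xi [- _ + _]addrC.
  monor; rewrite ler_wpM2r ?invr_ge0 ?(ltW l0) // ler_wpM2r //.
  exact: hB.
 - move=> U x hU; rewrite -wD_cat; have [_ hb] := hKa (xw U ++ p.2).
  letr (hb j q (x, z.2)); rewrite word_o_cat word_o_x /=.
  rewrite (_ : m + (dl * (size U)%:R + ord p.2) = m + ord p.2 + dl * (size U)%:R); last by ring.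
  by monor; exact: hA.
 - move=> U U' /andP[U0 UM] U'U; rewrite -!wD_cat.
  have U'M : (size U' <= M)%N by exact: leq_trans UM.
  set X := rnorm _; set Y := rnorm _.
  have [_ /(_ l i j z hl l1)[x1 x2]] := hCb (xiw U ++ p.1).
  have [_ y2] := hKa (xw U' ++ p.2); have {}y2 := y2 j q z.
  have [_ _ y1] := hl z; have {}y1 := y1 (xw U' ++ p.2) j q.
  rewrite -/X in x1 x2; rewrite -/Y in y1 y2.
  have X0 : 0 <= X := rn_ge0 _.
  have Y0 : 0 <= Y := rn_ge0 _.
  have J0 := jap_gt0 z.2.
  set o1 := ord (xiw U ++ p.1) in x1 x2; set o2 := ord (xw U' ++ p.2) in y1 y2.
  have oo : o1 + o2 <= ord W - (rho - dl).
  rewrite /o1 /o2 !word_o_cat word_o_xi word_o_x eo.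
  have e1 : dl * (size U')%:R <= dl * (size U)%:R by rewrite ler_wpM2l // ler_nat.
  have e2 : (rho - dl) * 1 <= (rho - dl) * (size U)%:R by rewrite ler_wpM2l ?(ltW sg0) // ler1n.
  by lra.
  have P0 : 0 < jap z.2 `^ (o1 + o2) by exact: japR_gt0.
  have XY1 : X * Y / jap z.2 `^ (o1 + o2) <= B * A'.
  rewrite ler_pdivrMr // japRD.
  letr (ler_wpM2r Y0 x1).
  have := ler_pM (mulr_ge0 (rn_ge0 _) (rn_ge0 _)) (mulr_ge0 (Cb0 (xiw U ++ p.1)) (japR_ge0 z.2 o1)) y1 (lexx _).
  move=> h3; letr (_ : _ <= Cb (xiw U ++ p.1) * Cw (xw U' ++ p.2) * (jap z.2 `^ o1 * jap z.2 `^ o2)).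
  have := ler_wpM2l (mulr_ge0 (Cb0 (xiw U ++ p.1)) (japR_ge0 z.2 o1)) y1 => h4.
  letr (le_trans _ h4); rewrite /Y; apply: eq_ler; ring.
  rewrite ler_wpM2r ?mulr_ge0 //; apply: ler_pM => //; [exact: hB|exact: hA'].
  have XY2 : X * Y / jap z.2 `^ (o1 + o2) <= B * CL * A * (jap z.2 `^ m / rnorm l).
  rewrite ler_pdivrMr // japRD.
  letr (ler_pM X0 Y0 x2 y2); rewrite japRD.
  rewrite [leLHS](_ : _ = (Cb (xiw U ++ p.1) * Ka (xw U' ++ p.2)) * (CL / rnorm l * jap z.2 `^ m * jap z.2 `^ o1 * jap z.2 `^ o2)); last by ring.
  rewrite [leRHS](_ : _ = (B * A) * (CL / rnorm l * jap z.2 `^ m * jap z.2 `^ o1 * jap z.2 `^ o2)); last by ring.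
  monor; first by rewrite !mulr_ge0 ?invr_ge0 // ltW.
  by apply: ler_pM => //; [exact: hB|exact: hA].
  have XY0 : 0 <= X * Y / jap z.2 `^ (o1 + o2) by rewrite divr_ge0 ?mulr_ge0 // ltW.
  have q1 : 0 <= B * A' by rewrite mulr_ge0.
  have q2 : 0 <= B * CL * A by rewrite !mulr_ge0.
  have hi := interpolation (jap_ge1 z.2) l1 hm sg0 sg1 XY0 q1 q2 XY1 XY2.
  have -> : X * Y = X * Y / jap z.2 `^ (o1 + o2) * jap z.2 `^ (o1 + o2) by rewrite divfK // gt_eqF.
  letr (ler_wpM2l XY0 (japR_le z.2 oo)).
  rewrite [ord W - _]addrC (japRD z.2 (- (rho - dl)) (ord W)) mulrA; letr (ler_wpM2r (japR_ge0 _ _) hi).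
  by rewrite /gam /dexp; apply: eq_ler; ring.
 (* The Taylor remainder carries the full factor [1 / |l|], which is more than required. *)
 have li : (rnorm l)^-1 <= rnorm l `^ (- dexp).
  rewrite -powR_inv1 ?(ltW l0) //; apply: ler_powR => //; rewrite lerN2 /dexp ler_pdivrMr // mul1r.
  by letr sg1; rewrite lerDr.
 rewrite -[leRHS]mulrA -[leRHS]mulrA ler_wpM2l // mulrDl opprK; apply: lerD; first by rewrite /gam -!mulrA.
 rewrite -!mulrA ler_wpM2l // ler_wpM2l // ler_wpM2l // ler_wpM2r //.
have /choice[K hK] := H; have K0 p : 0 <= K p by have [] := hK p.
exists (\sum_(p <- spl W) K p); split; first exact: sumr_ge0.
move=> l i j q z hl l1; have tb := rsym_tame i j hl l1.
have sb := tb.1.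
have sc : csm (comp_sym (ent (rsym a l) i j) (ent a j q)) by exact: csm_comp tb (ta j q).
rewrite /srem /wD cDs_D //; last by apply: csmZ; exact: csmM.
rewrite (@cDs_Z R V (-1) _ (map (@ldir R n) W) (csmM sb (sa j q))).
rewrite -/(wD W _) -/(wD W (fun z => ent (rsym a l) i j z * ent a j q z)) (wD_comp W hd tb (ta j q)) wD_M //.
rewrite mulN1r -sumrB !mulr_suml; letr (rn_sum _ _ _).
rewrite !big_seq; apply: ler_sum => p hp; have [_ h] := hK p; exact: h.
Qed.

Lemma csm_rem l i j q : rsv l -> 1 <= rnorm l -> csm (srem l i j q).
move=> hl l1; have tb := rsym_tame i j hl l1.
have ta : tame m dl (ent a j q) by exact: symc_tame ha.
apply: csmD; first exact: csm_comp tb ta.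
by apply: csmZ; apply: csmM => //; exact: tb.1.
Qed.

Lemma tame_rem l i j q : rsv l -> 1 <= rnorm l -> tame 0 dl (srem l i j q).
move=> hl l1; split; first exact: csm_rem.
move=> W; have [K [K0 hK]] := rem_words W; exists (K * rnorm l `^ (- dexp)) => z.
letr (hK l i j q z hl l1); rewrite ler_wpM2l ?mulr_ge0 //; apply: japR_le.
by rewrite add0r word_o_le.
Qed.

Lemma tame_comp_rsym l i j q : rsv l -> 1 <= rnorm l ->
 tame m dl (comp_sym (ent (rsym a l) i j) (ent a j q)).
move=> hl l1; have tb := rsym_tame i j hl l1.
have ta : tame m dl (ent a j q) by exact: symc_tame ha.
have tba := tameM tb ta; rewrite add0r in tba.
have tr := tame_weaken hm (tame_rem i j q hl l1).
have := tameD tr tba; congr (tame _ _ _).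
by ext z; rewrite /srem; ring.
Qed.

Definition rem_mx l : symbol R n k := fun z => \matrix_(i, q) \sum_j srem l i j q z.

Lemma rem_mx_ent l i q : ent (rem_mx l) i q = fun z => \sum_j srem l i j q z.
by ext z; rewrite /ent mxE. Qed.

Lemma rem_mxE l z : rsv l ->
 comp_mx (rsym a l) a z - l *: rsym a l z = 1%:M + rem_mx l z.
move=> hl; have [uz _ _] := hl z.
have h := mulVmx uz; rewrite mulmxBr mul_mx_scalar in h.
rewrite -h; apply/matrixP => i q; rewrite !mxE /srem.
rewrite [X in _ = _ + X](eq_bigr (fun j => comp_sym (ent (rsym a l) i j) (ent a j q) z - ent (rsym a l) i j z * ent a j q z)); last first.
 by move=> j _; rewrite mulN1r.
by rewrite sumrB /ent /rsym; ring.
Qed.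

Lemma rem_sym_bd W : exists K, 0 <= K /\ forall l i q z, rsv l -> 1 <= rnorm l ->
 rnorm (wD W (ent (rem_mx l) i q) z) <= K * rnorm l `^ (- dexp) * jap z.2 `^ ord W.
have [K [K0 hK]] := rem_words W; exists (k%:R * K); split; first by rewrite mulr_ge0 ?ler0n.
move=> l i q z hl l1; rewrite rem_mx_ent wD_sum; last by move=> j; exact: csm_rem.
letr (rn_sum _ _ _); letr (ler_sum _ (fun j _ => hK l i j q z hl l1)).
by rewrite sumr_const card_ord -[leLHS]mulr_natl !mulrA.
Qed.

End remainder_symbol.

Lemma sub_subACA (W : zmodType) (p q r s : W) : (p - q) - (r - s) = (p - r) - (q - s).
by rewrite !opprD !opprK addrACA. Qed.

(** * Bounded operators and their norm *)

Section bounded_operators.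
Variables (R : realType) (E : normedModType R[i]).
Notation C := R[i].
Implicit Types (T S : E -> E) (u v : E).

Lemma linearDop T u v : linear T -> T (u + v) = T u + T v.
by move=> hT; have := hT 1 u v; rewrite !scale1r. Qed.

Lemma linear0op T : linear T -> T 0 = 0.
move=> hT; have : T ((-1) *: 0 + 0) = (-1) *: T 0 + T 0 := hT _ _ _.
by rewrite scaler0 addr0 scaleN1r addNr.
Qed.

Lemma linearZop T c u : linear T -> T (c *: u) = c *: T u.
by move=> hT; have := hT c u 0; rewrite !addr0 (linear0op hT) addr0. Qed.

Lemma linearBop T u v : linear T -> T (u - v) = T u - T v.
by move=> hT; rewrite (linearDop _ _ hT) -scaleN1r (linearZop _ _ hT) scaleN1r. Qed.

Lemma opnorm_le T (K : R) : 0 <= K -> (forall u, rnorm (T u) <= K * rnorm u) -> opnorm T <= K.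
move=> K0 hK; apply: ge_sup.
 by exists (rnorm (T 0)); exists 0 => //=; rewrite rn0.
move=> _ [u /= u1 <-]; letr (hK u).
by rewrite -[X in _ <= X]mulr1 ler_wpM2l.
Qed.

Lemma opnorm_set_sup T : bounded_op T -> has_sup [set rnorm (T u) | u in [set u | rnorm u <= 1]].
move=> [_ [K hK]]; split; first by exists (rnorm (T 0)); exists 0 => //=; rewrite rn0.
exists `|K| => _ [u /= u1 <-]; letr (hK u).
letr (ler_wpM2r (rn_ge0 _) (ler_norm K)).
by rewrite -[X in _ <= X]mulr1 ler_wpM2l.
Qed.

Lemma opnorm_ge T u : bounded_op T -> rnorm (T u) <= opnorm T * rnorm u.
move=> bT; have [lT _] := bT; have [->|u0] := eqVneq u 0.
 by rewrite (linear0op lT) !rn0 mulr0.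
have n0 : 0 < rnorm u by rewrite lt_neqAle eq_sym rn_eq0 u0 rn_ge0.
pose v := ((rnorm u)^-1)%:C *: u.
have v1 : rnorm v = 1 by rewrite rnZ rnr ger0_norm ?invr_ge0 // mulVf // gt_eqF.
have -> : rnorm (T u) = rnorm (T v) * rnorm u.
 rewrite (linearZop _ _ lT) rnZ rnr ger0_norm ?invr_ge0 //.
 by rewrite mulrAC mulVf ?mul1r // gt_eqF.
monor; apply: sup_ubound; first by have [] := opnorm_set_sup bT.
by exists v => //=; rewrite v1.
Qed.

Lemma opnorm_ge0 T : bounded_op T -> 0 <= opnorm T.
move=> bT; letr (rn_ge0 (T 0)).
by apply: sup_ubound; [have [] := opnorm_set_sup bT|exists 0 => //=; rewrite rn0].
Qed.

Lemma bop0 : bounded_op (fun _ : E => 0 : E).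
by split; [move=> c u v; rewrite scaler0 addr0|exists 0 => u; rewrite rn0 mul0r]. Qed.

Lemma bopD T S : bounded_op T -> bounded_op S -> bounded_op (fun u => T u + S u).
move=> [lT [K hK]] [lS [L hL]]; split.
 by move=> c u v; rewrite lT lS scalerDr addrACA.
exists (K + L) => u; rewrite mulrDl; letr (rnD _ _); exact: lerD.
Qed.

Lemma bopZ c T : bounded_op T -> bounded_op (fun u => c *: T u).
move=> [lT [K hK]]; split.
 by move=> d u v; rewrite lT scalerDr !scalerA mulrC.
by exists (rnorm c * K) => u; rewrite rnZ -mulrA ler_wpM2l ?rn_ge0.
Qed.

Lemma bopB T S : bounded_op T -> bounded_op S -> bounded_op (fun u => T u - S u).
move=> bT bS; have := bopD bT (bopZ (-1) bS).
by congr bounded_op; ext u; rewrite scaleN1r.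
Qed.

Lemma bop_sum (I : Type) (s : seq I) (F : I -> E -> E) :
 (forall i, bounded_op (F i)) -> bounded_op (fun u => \sum_(i <- s) F i u).
move=> hF; elim: s => [|i s IH].
 by have := bop0; congr bounded_op; ext u; rewrite big_nil.
by have := bopD (hF i) IH; congr bounded_op; ext u; rewrite big_cons.
Qed.

Lemma opnormB_le T S : bounded_op T -> bounded_op S -> opnorm T <= opnorm S + opnorm (fun u => T u - S u).
move=> bT bS; have bB := bopB bT bS.
apply: opnorm_le; first by rewrite addr_ge0 // opnorm_ge0.
move=> u; rewrite mulrDl; apply: le_trans (lerD (opnorm_ge u bS) (opnorm_ge u bB)).
by rewrite -{1}[T u](subrK (S u)) addrC; exact: rnD.
Qed.

Lemma opnormC T S : opnorm (fun u => T u - S u) = opnorm (fun u => S u - T u).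
by rewrite /opnorm; congr sup; apply: eq_imagel => u _; rewrite rnB. Qed.

End bounded_operators.

(** * Quantization on [E] *)

Section operators_on_space.
Variables (R : realType) (n k : nat) (E : normedModType R[i]) (iota : E -> distr R n k).
Notation C := R[i].
Notation V := ('rV[R]_n * 'rV[R]_n)%type.
Variables (rho dl : R).
Hypotheses (hd : 0 <= dl) (hdr : dl < rho) (hr : rho <= 1).
Hypothesis hE : tempered_embedding iota.
Hypothesis hop : op_continuous iota rho dl.
Notation ord := (word_o rho dl).
Implicit Types (a b : symbol R n k) (T S : E -> E) (phi psi : vfun R n k).

Let d1 : dl < 1. Proof. exact: lt_le_trans hr. Qed.
Let r0 : 0 <= rho. Proof. exact: le_trans (ltW hdr). Qed.

Lemma cltame m b i j : symbol_class m rho dl b -> tame m dl (ent b i j).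
exact: symc_tame. Qed.

Lemma embedD c u v phi : schwartz phi -> iota (c *: u + v) phi = c * iota u phi + iota v phi.
by have [_ h _] := hE; exact: h. Qed.

Lemma embed0 phi : schwartz phi -> iota 0 phi = 0.
move=> sp; have := embedD (-1) 0 0 sp; rewrite scaler0 addr0 mulN1r addNr; exact.
Qed.

Lemma iota_test c u phi psi : schwartz phi -> schwartz psi ->
 iota u (fun x => c *: phi x + psi x) = c * iota u phi + iota u psi.
by have [/(_ u)[h _] _ _] := hE; exact: h. Qed.

Lemma iota_inj u v : (forall phi, schwartz phi -> iota u phi = iota v phi) -> u = v.
by have [_ _] := hE; apply. Qed.

Lemma opT_lin mb mb' c b b' phi : (forall i j, tame mb dl (ent b i j)) ->
 (forall i j, tame mb' dl (ent b' i j)) -> schwartz phi ->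
 opT (fun z => c *: b z + b' z) phi = fun y => c *: opT b phi y + opT b' phi y.
move=> tb tb' sp; have hp := (schwP phi).1 sp.
have tb1 i j : tame (Num.max mb mb') dl (ent (fun z => c *: b z + b' z) i j).
 have -> : ent (fun z => c *: b z + b' z) i j = fun z => c * ent b i j z + ent b' i j z.
  by ext z; rewrite /ent !mxE.
 apply: tameD; first by apply: tameZ; apply: tame_weaken (tb i j); rewrite le_max lexx.
 by apply: tame_weaken (tb' i j); rewrite le_max lexx orbT.
ext y; apply/matrixP => i j; rewrite (ord1 j).
have e1 := opT_ent y i hd d1 tb1 sp; have e2 := opT_ent y i hd d1 tb sp.
have e3 := opT_ent y i hd d1 tb' sp.
transitivity (c * opT b phi y i 0 + opT b' phi y i 0); last by rewrite [RHS]mxE [X in _ = X + _]mxE.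
apply: (etrans e1); apply: (etrans _ (esym (congr2 (fun p q : C => c * p + q) e2 e3))).
rewrite mulr_sumr -big_split; apply: eq_bigr => l _ /=.
rewrite -(qtrZ c y hd d1 (tb l i) (hp l)).
rewrite -(qtrD y hd d1 (tameZ c (tb l i)) (tb' l i) (hp l)).
by congr (qtr _ _ y); ext z; rewrite /ent !mxE.
Qed.

Lemma schw_opT0 b phi : symbol_class 0 rho dl b -> schwartz phi -> schwartz (opT b phi).
by move=> cb sp; apply: (schw_opT hd d1 _ sp) => i j; exact: cltame cb. Qed.

Lemma op_on_lin c b b' T S : symbol_class 0 rho dl b -> symbol_class 0 rho dl b' ->
 op_on iota b T -> op_on iota b' S -> op_on iota (fun z => c *: b z + b' z) (fun u => c *: T u + S u).
move=> cb cb' [bT hT] [bS hS]; split; first exact: bopD (bopZ c bT) bS.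
move=> u phi sp; rewrite embedD // hT // hS //.
rewrite (opT_lin c (fun i j => cltame i j cb) (fun i j => cltame i j cb') sp).
exact: esym (iota_test c u (schw_opT0 cb sp) (schw_opT0 cb' sp)).
Qed.

Lemma symc_lin m c b b' : symbol_class m rho dl b -> symbol_class m rho dl b' ->
 symbol_class m rho dl (fun z => c *: b z + b' z).
move=> /symcP[sb hb] /symcP[sb' hb']; apply/symcP.
have e i j : ent (fun z => c *: b z + b' z) i j = fun z => c * ent b i j z + ent b' i j z.
 by ext z; rewrite /ent !mxE.
split=> [i j|W]; first by rewrite e; apply: csmD => //; exact: csmZ.
have [K [K0 hK]] := hb W; have [L [L0 hL]] := hb' W; exists (rnorm c * K + L); split.
 by rewrite addr_ge0 // mulr_ge0 // rn_ge0.
move=> i j z; rewrite e /wD cDs_D //; last exact: csmZ.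
rewrite cDs_Z // mulrDl; letr (rnD _ _); apply: lerD; last exact: hL.
by rewrite rnM -mulrA ler_wpM2l //; exact: hK.
Qed.

Lemma symc_cst (M : 'M[C]_k) : symbol_class (n := n) 0 rho dl (fun _ : V => M).
apply/symcP; split=> [i j|W]; first exact: csm_cst.
case: W => [|l W].
 exists (rnorm M); split=> [|i j z]; first by [].
 by rewrite wD_nil /word_o /nxi /nx /= !mulr0 !addr0 powRr0 mulr1; exact: rn_ent.
exists 0; split=> // i j z; rewrite mul0r /wD [map _ _]/=.
by have -> : ent (fun _ : V => M) i j = fun _ => M i j by []; rewrite cDs_cst rn0.
Qed.

Lemma op_on_zero : op_on iota (fun _ => 0) (fun _ => 0).
split; first exact: bop0.
move=> u phi sp; rewrite embed0 //.
have c0 := symc_cst 0.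
have e : opT (fun _ : V => 0) phi = fun y => (-1) *: opT (fun _ : V => 0) phi y + opT (fun _ : V => 0) phi y.
 have := opT_lin (-1) (fun i j => cltame i j c0) (fun i j => cltame i j c0) sp.
 by move=> <-; congr (opT _ phi); ext z; rewrite scaler0 addr0.
have s0 := schw_opT0 c0 sp; have h := iota_test (-1) u s0 s0.
by apply: esym; rewrite [LHS](congr1 (iota u) e) [LHS]h mulN1r addNr.
Qed.

Lemma op_on_ex b : symbol_class 0 rho dl b -> exists T, op_on iota b T.
by move=> cb; have [h _] := hop; exact: h. Qed.

(** Continuity at the symbol 0 gives finitely many seminorms and a radius [d0] within which the
    operator norm is at most 1; scaling [b] by [d0 / d] turns this into a linear bound. *)
Lemma op_on_bd : exists (N : nat) (K : R), 0 <= K /\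
 forall b T d, symbol_class 0 rho dl b -> op_on iota b T -> 0 < d ->
 (forall W i j z, (size W <= N)%N -> rnorm (wD W (ent b i j) z) <= d * jap z.2 `^ ord W) ->
 forall u, rnorm (T u) <= K * d * rnorm u.
have c0 := symc_cst 0.
have [_ /(_ _ c0 1 ltr01)[N [d0 [d00 hN]]]] := hop.
exists N, d0^-1; split; first by rewrite invr_ge0 ltW.
move=> b T d cb oT dp hb u.
pose t := d0 / d; have t0 : 0 < t by rewrite divr_gt0.
have cb' := symc_lin t%:C cb c0.
have oT' := op_on_lin t%:C cb c0 oT op_on_zero.
have sb := ((symcP 0 rho dl b).1 cb).1.
have bT' := oT'.1.
have h := hN _ cb' _ (fun _ => 0) _ op_on_zero oT'.
have {h} h1 : opnorm (fun u => t%:C *: T u + 0 - 0) <= 1.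
 apply: h => al be hab; apply/sym_seminorm_leP; first exact: ltW.
 move=> i j z; have -> : ent (fun z => t%:C *: b z + 0 - 0) i j = fun z => t%:C * ent b i j z.
  by ext z'; rewrite /ent !mxE oppr0 !addr0.
 rewrite wD_Z // rnM rnr gtr0_norm // add0r.
 have sz : (size (sword al be) <= N)%N by rewrite size_cat !size_map !size_mword.
 have := ler_wpM2l (ltW t0) (hb _ i j z sz); rewrite mulrA.
 by rewrite /t divfK // gt_eqF.
have h2 := opnorm_ge u bT'.
have e : opnorm (fun u => t%:C *: T u + 0 - 0) = opnorm (fun u => t%:C *: T u + 0).
 by congr opnorm; ext v; rewrite subr0.
rewrite e in h1; have := le_trans h2 (ler_wpM2r (rn_ge0 u) h1).
rewrite mul1r addr0 rnZ rnr gtr0_norm // -ler_pdivlMl // /t invf_div.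
by rewrite [d / d0]mulrC.
Qed.

Lemma pairingD c phi phi' psi : schwartz phi -> schwartz phi' -> schwartz psi ->
 pairing psi (fun x => c *: phi x + phi' x) = c * pairing psi phi + pairing psi phi'.
move=> /schwP s1 /schwP s2 /schwP s3; rewrite /pairing.
have w (f g : 'rV[R]_n -> C) : schw f -> schw g -> wint (fun x => f x * g x).
 move=> sf sg; have [K K0 hK] := schw_wt sf; have [L L0 hL] := schw_wt sg; split.
  by apply: ccontM; [exact: csmc sf.1|exact: csmc sg.1].
 exists (K * L) => y; rewrite rnM.
 letr (ler_rnM (hK y) (hL y)).
 rewrite [leLHS](_ : _ = K * L * wt y * wt y); last by ring.
 by rewrite ler_piMr ?wt_le1 // !mulr_ge0.
rewrite (wint_s _ (fun j => w _ _ (s3 j) (s1 j))) (wint_s _ (fun j => w _ _ (s3 j) (s2 j))).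
have s4 j : schw (fun x => (c *: phi x + phi' x) j 0).
 have -> : (fun x => (c *: phi x + phi' x) j 0) = fun x => c * phi x j 0 + phi' x j 0.
  by ext x; rewrite !mxE.
 by apply: schwD => //; exact: schwZ.
rewrite (wint_s _ (fun j => w _ _ (s3 j) (s4 j))) mulr_sumr -big_split; apply: eq_bigr => j _ /=.
have [c1 [K hK]] := w _ _ (s3 j) (s1 j); have [c2 [L hL]] := w _ _ (s3 j) (s2 j).
rewrite -(iRnZ c c1 hK).
have cz : continuous (fun x => c * (psi x j 0 * phi x j 0)) by apply: ccontM; [cts|exact: c1].
rewrite -(@iRnD _ _ _ _ (rnorm c * `|K| + `|L|) cz c2).
- by iext x; rewrite !mxE; ring.
- move=> x; rewrite rnM mulrDl -[X in X <= _]addr0; apply: lerD; last by rewrite mulr_ge0.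
 rewrite -mulrA ler_wpM2l //; letr (hK x).
 by monor; rewrite ler_norm.
- move=> x; letr (hL x); monor.
 by letr (ler_norm L); rewrite lerDr mulr_ge0 ?rn_ge0.
Qed.

End operators_on_space.

(** * The parametrix and the resolvent of [A] *)

Section parametrix.
Variables (R : realType) (n k : nat) (E : normedModType R[i]) (iota : E -> distr R n k).
Notation C := R[i].
Notation V := ('rV[R]_n * 'rV[R]_n)%type.
Variables (m rho dl : R) (a : symbol R n k).
Hypotheses (hm : 0 <= m) (hd : 0 <= dl) (hdr : dl < rho) (hr : rho <= 1).
Hypothesis ha : symbol_class m rho dl a.
Variables (CL : R) (Cw : seq (lett n) -> R).
Hypotheses (hCL : 0 <= CL) (hCw : forall W, 0 <= Cw W).
Hypothesis hE : tempered_embedding iota.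
Variables (D : set E) (A : E -> E).
Hypothesis hA : closed_extension iota a D A.
Notation ord := (word_o rho dl).
Notation rem := (rem_mx a).
Implicit Types (u v : E) (l : C).

Let d1 : dl < 1. Proof. exact: lt_le_trans hr. Qed.

Lemma symc_rsym l : rsv rho dl a CL Cw l -> 1 <= rnorm l ->
 symbol_class 0 rho dl (rsym a l).
move=> hl l1; apply/symcP; split=> [i j|W]; first exact: (csm_rsym ha i j hl).
have [Cb hCb] := rsym_word_bd ha CL hCw; have [C0 hC] := hCb W.
exists (Cb W * CL / rnorm l); split; first by rewrite divr_ge0 ?mulr_ge0.
by move=> i j z; rewrite add0r; have [] := hC l i j z hl l1.
Qed.

Lemma symc_rem l : rsv rho dl a CL Cw l -> 1 <= rnorm l ->
 symbol_class 0 rho dl (rem l).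
move=> hl l1; apply/symcP; split=> [i j|W].
 rewrite rem_mx_ent; apply: csm_sum => q.
 exact: (csm_rem hd hdr ha hCL hCw i q j hl l1).
have [K [K0 hK]] := rem_sym_bd hm hd hdr hr ha hCL hCw W.
exists (K * rnorm l `^ (- dexp m rho dl)); split; first by rewrite mulr_ge0.
by move=> i j z; rewrite add0r; exact: hK.
Qed.

Lemma opT_id (phi : vfun R n k) : schwartz phi -> opT (fun _ : V => (1%:M : 'M[C]_k)) phi = phi.
move=> sp; have hp := (schwP phi).1 sp.
have t1 i j : tame 0 dl (ent (fun _ : V => (1%:M : 'M[C]_k)) i j).
 exact: (cltame hd hdr i j (symc_cst n rho dl _)).
ext y; apply/matrixP => i j; rewrite (ord1 j).
apply: (etrans (opT_ent y i hd d1 t1 sp)); rewrite (bigD1 i) //= big1 ?addr0.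
 apply: (etrans (qtr_cst _ y (hp i))).
 by rewrite mxE eqxx mul1r.
move=> l li; apply: (etrans (qtr_cst _ y (hp l))).
by rewrite mxE (negbTE li) mul0r.
Qed.

(** Tested against [psi], all operators move onto [psi] as transposes. By [rem_mxE] the composed
    symbol is [l] times the inverse symbol, plus the identity, plus [rem_mx], and the multiple of
    [l] cancels. *)
Lemma parametrix_schw l Tb Tr u v phi : rsv rho dl a CL Cw l -> 1 <= rnorm l ->
 op_on iota (rsym a l) Tb -> op_on iota (rem l) Tr ->
 schwartz phi -> represents iota u phi -> represents iota v (op a phi) ->
 Tb (v - l *: u) = u + Tr u.
move=> hl l1 [bTb hTb] [bTr hTr] sphi ru rv; apply: (iota_inj hE) => psi spsi.
have cb := symc_rsym hl l1; have cr := symc_rem hl l1.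
have c1 := symc_cst n rho dl (1%:M : 'M[C]_k).
have tb i j := cltame hd hdr i j cb; have tr i j := cltame hd hdr i j cr.
have t1 i j := cltame hd hdr i j c1.
have sb := schw_opT0 hd hdr hr cb spsi; have sr := schw_opT0 hd hdr hr cr spsi.
rewrite (hTb _ _ spsi); have -> : v - l *: u = (- l) *: u + v by rewrite scaleNr addrC.
rewrite (embedD hE (- l) u v sb) (rv _ sb) (ru _ sb) mulNr.
have -> : u + Tr u = 1 *: u + Tr u by rewrite scale1r.
rewrite (embedD hE 1 u _ spsi) mul1r (ru _ spsi) (hTr _ _ spsi) (ru _ sr).
have ta i j := cltame hd hdr i j ha.
have -> := op_composition hd d1 tb ta (fun i j q => tame_comp_rsym hm hd hdr hr ha hCL hCw i j q hl l1) sphi spsi.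
have c1r := symc_lin 1 c1 cr.
have e : comp_mx (rsym a l) a = fun z => l *: rsym a l z + (1 *: (1%:M : 'M[C]_k) + rem l z).
 by ext z; rewrite scale1r -(rem_mxE z hl) addrC subrK.
rewrite e (opT_lin hd hdr hr l tb (fun i j => cltame hd hdr i j c1r) spsi).
have e1 : opT (fun z : V => 1 *: (1%:M : 'M[C]_k) + rem l z) psi = fun x => 1 *: psi x + opT (rem l) psi x by rewrite (opT_lin hd hdr hr 1 t1 tr spsi) opT_id.
have s1r := schw_opT0 hd hdr hr c1r spsi.
apply: (etrans (congr1 (fun p => - (l * pairing phi (opT (rsym a l) psi)) + p) (pairingD l sb s1r sphi))).
rewrite addKr e1.
by apply: (etrans (pairingD 1 spsi sr sphi)); rewrite mul1r.
Qed.

(** The difference of the two sides is continuous on [E * E] and vanishes on the graph of [op a]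
    over Schwartz functions, hence on its closure, the graph of [A]. *)
Lemma parametrix l Tb Tr u : rsv rho dl a CL Cw l -> 1 <= rnorm l ->
 op_on iota (rsym a l) Tb -> op_on iota (rem l) Tr -> D u -> Tb (A u - l *: u) = u + Tr u.
move=> hl l1 oTb oTr Du; have [[lTb [K hK]] _] := oTb; have [[lTr [L hL]] _] := oTr.
apply/eqP; rewrite -subr_eq0 -rn_eq0; apply/eqP/le_anti; rewrite rn_ge0 andbT.
set F := fun w : E * E => Tb (w.2 - l *: w.1) - (w.1 + Tr w.1).
have FL w w' : rnorm (F w - F w') <= `|K| * (rnorm (w.2 - w'.2) + rnorm l * rnorm (w.1 - w'.1)) +
  (rnorm (w.1 - w'.1) + `|L| * rnorm (w.1 - w'.1)).
 have -> : F w - F w' = Tb ((w.2 - w'.2) - l *: (w.1 - w'.1)) - ((w.1 - w'.1) + Tr (w.1 - w'.1)).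
  rewrite /F [LHS]sub_subACA; congr (_ - _).
  by rewrite -(linearBop _ _ lTb) [in LHS]sub_subACA scalerBr.
  by rewrite (linearBop _ _ lTr) opprD addrACA.
 rewrite -[X in X <= _]/(rnorm (_ + - _)); letr (rnD _ _); rewrite rnN; apply: lerD.
  letr (hK _); letr (ler_wpM2r (rn_ge0 _) (ler_norm K)).
  monol; letr (rnD _ _); by rewrite rnN rnZ.
 letr (rnD _ _); rewrite lerD2l; letr (hL _).
 by monor; rewrite ler_norm.
have cl : closure [set w : E * E | exists2 phi, schwartz phi & represents iota w.1 phi /\ represents iota w.2 (op a phi)] (u, A u) by rewrite -hA.
apply/ler_addgt0Pr => e e0; rewrite add0r.
pose M := `|K| * (1 + rnorm l) + (1 + `|L|).
have M0 : 0 < M by rewrite ltr_wpDl ?mulr_ge0 ?addr_ge0 // ltr_pwDl.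
have eM : 0 < e / M by rewrite divr_gt0.
have := cl _ (nbhsx_ballx (u, A u) (e / M)%:C _); rewrite ltcR => /(_ eM).
move=> [w [[phi sphi [r1 r2]] [/= b1 b2]]].
have Fw : F w = 0 by rewrite /F (parametrix_schw hl l1 oTb oTr sphi r1 r2) subrr.
have b1' : rnorm (u - w.1) < e / M by move: b1; rewrite -ball_normE /= rnE ltcR.
have b2' : rnorm (A u - w.2) < e / M by move: b2; rewrite -ball_normE /= rnE ltcR.
have := FL (u, A u) w; rewrite Fw subr0 /= => h; letr h.
have -> : e = `|K| * (e / M + rnorm l * (e / M)) + (e / M + `|L| * (e / M)).
 by rewrite /M; field; rewrite -/M gt_eqF.
have b1'' := ltW b1'; have b2'' := ltW b2'.
apply: lerD.
 by apply: ler_wpM2l; rewrite ?normr_ge0 //; apply: lerD => //; apply: ler_wpM2l; rewrite ?rn_ge0.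
by apply: lerD => //; apply: ler_wpM2l; rewrite ?normr_ge0.
Qed.

Lemma rslv_parametrix l Tb Tr T : rsv rho dl a CL Cw l -> 1 <= rnorm l ->
 op_on iota (rsym a l) Tb -> op_on iota (rem l) Tr -> is_resolvent D A l T ->
 forall v, T v = Tb v - Tr (T v).
move=> hl l1 oTb oTr [_ hT _] v; have [DT e] := hT v.
by rewrite -[in Tb v]e (parametrix hl l1 oTb oTr DT) addrK.
Qed.

End parametrix.

(** * Mean values and primitives of complex-valued functions *)

Section primitives.
Variable R : realType.
Notation C := R[i].

Lemma cmean_value (P g : R -> C) (a b K : R) : a <= b ->
 (forall t, a <= t <= b -> cder (1 : R) P t (g t)) ->
 (forall t, a <= t <= b -> rnorm (g t) <= K) -> rnorm (P b - P a) <= 2 * K * (b - a).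
move=> ab dP hK.
have real (p q : R -> R) : (forall t, a <= t <= b -> is_derive t (1 : R) p (q t)) ->
  (forall t, a <= t <= b -> `|q t| <= K) -> `|p b - p a| <= K * (b - a).
 move=> dp hq; have [||c cab ->] := @MVT_segment R p q a b ab.
 - by move=> t; rewrite in_itv /= => /andP[t1 t2]; apply: dp; rewrite !ltW.
 - by apply: derivable_within_continuous => t; rewrite in_itv /= => /dp h; exact: ex_derive.
 - by rewrite normrM [`|b - a|]ger0_norm ?subr_ge0 // ler_wpM2r ?subr_ge0 // hq.
letr (rn_le _); rewrite !raddfB /= -mulrA mulr2n mulrDl !mul1r; apply: lerD.
 apply: (real (fun t => Re (P t)) (fun t => Re (g t))) => t ht.
  by have [] := dP t ht.
 by letr (nRe _); exact: hK.
apply: (real (fun t => Im (P t)) (fun t => Im (g t))) => t ht.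
 by have [] := dP t ht.
by letr (nIm _); exact: hK.
Qed.

Lemma cprimitive (g : R -> C) (a b : R) : a < b ->
 (forall t, a <= t <= b -> {for t, continuous (fun x => Re (g x))} /\
  {for t, continuous (fun x => Im (g x))}) ->
 exists P : R -> C, forall t, a < t < b -> cder (1 : R) P t (g t).
move=> ab cg.
have real (q : R -> R) : (forall t, a <= t <= b -> {for t, continuous q}) ->
  exists p : R -> R, forall t, a < t < b -> is_derive t (1 : R) p (q t).
 move=> cq; exists (fun x => \int[lebesgue_measure]_(t in [set` `[a, x]]) q t) => t /andP[at_ tb].
 have iq : lebesgue_measure.-integrable `[a, b] (EFin \o q).
  apply: continuous_compact_integrable; first exact: segment_compact.
  by apply: continuous_in_subspaceT => x; rewrite inE /= in_itv /= => /cq.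
 have tab : a <= t <= b by rewrite !ltW.
 have [d1 d2] := @continuous_FTC1_closed R q a t b tb iq at_ (cq t tab).
 by apply: DeriveDef d1 _; rewrite -derive1E; exact: d2.
have [p hp] := real _ (fun t ht => (cg t ht).1).
have [q hq] := real _ (fun t ht => (cg t ht).2).
by exists (fun t => p t +i* q t) => t ht; split; [exact: hp|exact: hq].
Qed.

Lemma lipschitz_cts_at (g : R -> R) (t K d : R) : 0 < d ->
 (forall x, `|x - t| < d -> `|g x - g t| <= K * `|x - t|) -> {for t, continuous g}.
move=> d0 hg; apply/cvgrPdist_le => e e0.
have k0 : 0 < `|K| + 1 by rewrite ltr_wpDl.
exists (Num.min d (e / (`|K| + 1))) => /=; first by rewrite lt_min d0 divr_gt0.
move=> x /=; rewrite lt_min distrC => /andP[xd xe].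
rewrite distrC; letr (hg x xd).
apply: le_trans (_ : (`|K| + 1) * `|x - t| <= _).
 by monor; rewrite (le_trans (ler_norm K)) // lerDl.
by rewrite mulrC -ler_pdivlMr // ltW.
Qed.

Lemma nested_intervals (x d : nat -> R) : (forall k, 0 <= d k) -> (forall k, x k <= x k.+1) ->
 (forall k, x k.+1 + d k.+1 <= x k + d k) -> exists p, forall k, x k <= p <= x k + d k.
move=> d0 hx hd.
have mx k j : x k <= x (k + j)%N.
 by elim: j => [|j IH]; rewrite ?addn0 // addnS (le_trans IH).
have md k j : x (k + j)%N + d (k + j)%N <= x k + d k.
 by elim: j => [|j IH]; rewrite ?addn0 // addnS (le_trans (hd _)).
have cross j k : x j <= x k + d k.
 letr (mx j k); rewrite addnC; apply: le_trans (md k j).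
 by rewrite lerDl.
exists (sup (range x)) => k; apply/andP; split.
 apply: sup_ubound; last by exists k.
 by exists (x 0%N + d 0%N) => _ [j _ <-]; exact: cross.
by apply: ge_sup; [exists (x k); exists k|move=> _ [j _ <-]; exact: cross].
Qed.

End primitives.

(** * Goursat's lemma for rectangles *)

Section goursat.
Variable R : realType.
Notation C := R[i].
Implicit Types (G : R -> R -> C) (u s : R).

(** Complex differentiability of [G] at [u0 + i s0], with the real and imaginary parts of the
    variable kept apart. *)
Definition cr_diff G u0 s0 := exists c : C, forall e : R, 0 < e -> exists2 d : R, 0 < d &
 forall u s, `|u - u0| < d -> `|s - s0| < d ->
  rnorm (G u s - G u0 s0 - c * ((u - u0) +i* (s - s0))) <= e * (`|u - u0| + `|s - s0|).

Lemma cr_lipschitz G u0 s0 : cr_diff G u0 s0 -> exists K d : R, 0 < d /\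
 forall u s, `|u - u0| < d -> `|s - s0| < d -> rnorm (G u s - G u0 s0) <= K * (`|u - u0| + `|s - s0|).
move=> [c /(_ 1 ltr01)[d d0 h]]; exists (1 + rnorm c), d; split=> // u s hu hs.
rewrite -[G u s - G u0 s0](subrK (c * ((u - u0) +i* (s - s0)))) mulrDl.
letr (rnD _ _); apply: lerD; first exact: h.
by rewrite rnM ler_wpM2l //; exact: rn_le.
Qed.

Lemma cr_cts_u G u0 s0 : cr_diff G u0 s0 ->
 {for u0, continuous (fun u => Re (G u s0))} /\ {for u0, continuous (fun u => Im (G u s0))}.
move=> /cr_lipschitz[K [d [d0 h]]].
have h' u : `|u - u0| < d -> rnorm (G u s0 - G u0 s0) <= K * `|u - u0|.
 by move=> hu; have := h u s0 hu; rewrite subrr normr0 addr0; apply.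
split; apply: (@lipschitz_cts_at _ _ _ K d d0) => u hu; rewrite -raddfB.
 by letr (nRe _); exact: h'.
by letr (nIm _); exact: h'.
Qed.

Lemma cr_cts_s G u0 s0 : cr_diff G u0 s0 ->
 {for s0, continuous (fun s => Re (G u0 s))} /\ {for s0, continuous (fun s => Im (G u0 s))}.
move=> /cr_lipschitz[K [d [d0 h]]].
have h' s : `|s - s0| < d -> rnorm (G u0 s - G u0 s0) <= K * `|s - s0|.
 by move=> hs; have := h u0 s; rewrite subrr normr0 add0r; apply.
split; apply: (@lipschitz_cts_at _ _ _ K d d0) => u hu; rewrite -raddfB.
 by letr (nRe _); exact: h'.
by letr (nIm _); exact: h'.
Qed.

Variables (G : R -> R -> C) (a b al be : R).
Hypothesis hG : forall u s, a <= u <= b -> al <= s <= be -> cr_diff G u s.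

(* [P s] and [Q u] are primitives of [G] along horizontal and vertical lines, so that
 [rect] is the integral of [G] over the boundary of a rectangle. *)
Variables (P Q : R -> R -> C).
Hypothesis hP : forall u s, a < u < b -> al < s < be -> cder (1 : R) (P s) u (G u s).
Hypothesis hQ : forall u s, a < u < b -> al < s < be -> cder (1 : R) (Q u) s (G u s).

Definition rect u1 u2 s1 s2 : C :=
 (P s1 u2 - P s1 u1) - (P s2 u2 - P s2 u1) + 'i * ((Q u2 s2 - Q u2 s1) - (Q u1 s2 - Q u1 s1)).

(** The affine part of [G] has the explicit primitives [A] and [B], and its boundary integral
    vanishes. After subtracting it, each side is estimated by the mean value inequality, whose
    factor 2, over two pairs of sides, gives the constant 4. *)
Lemma rect_small u1 u2 s1 s2 u0 s0 (c : C) (e : R) : a < u1 -> u2 < b -> al < s1 -> s2 < be ->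
 u1 <= u0 <= u2 -> s1 <= s0 <= s2 -> 0 <= e ->
 (forall u s, u1 <= u <= u2 -> s1 <= s <= s2 ->
  rnorm (G u s - G u0 s0 - c * ((u - u0) +i* (s - s0))) <= e * (`|u - u0| + `|s - s0|)) ->
 rnorm (rect u1 u2 s1 s2) <= 4 * e * ((u2 - u1) + (s2 - s1)) ^+ 2.
move=> h1 h2 h3 h4 hu hs e0 hG0; set L := (u2 - u1) + (s2 - s1).
have /andP[hu1 hu2] := hu; have /andP[hs1 hs2] := hs.
have u12 : u1 <= u2 := le_trans hu1 hu2; have s12 : s1 <= s2 := le_trans hs1 hs2.
have bnd u s : u1 <= u <= u2 -> s1 <= s <= s2 ->
  rnorm (G u s - G u0 s0 - c * ((u - u0) +i* (s - s0))) <= e * L.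
 move=> hu' hs'; letr (hG0 u s hu' hs'); monol.
 have /andP[? ?] := hu'; have /andP[? ?] := hs'.
 apply: lerD; rewrite ler_norml; apply/andP; split; lra.
pose A s u : C := (G u0 s0 + c * ('i * (s - s0)%:C)) * u%:C + c * (((u - u0) ^+ 2 / 2)%:C).
pose B u s : C := (G u0 s0 + c * (u - u0)%:C) * s%:C + c * ('i * ((s - s0) ^+ 2 / 2)%:C).
have split_i (x y : R) : x +i* y = x%:C + 'i * y%:C :> C.
 by apply/eqP; rewrite eq_complex /=; apply/andP; split; apply/eqP; ring.
have dsq (t0 t : R) : is_derive t (1 : R) (fun x : R => (x - t0) ^+ 2 / 2) (t - t0).
 have h : is_derive t (1 : R) (fun x : R => x - t0) 1.
  by have := is_deriveB (is_derive_id t (1 : R)) (is_derive_cst t0 t (1 : R)); rewrite subr0.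
 apply: (is_derive_eq (is_deriveM (is_deriveX 2 h) (is_derive_cst (2^-1 : R) t (1 : R)))).
 by rewrite scaler0 add0r /= /GRing.scale /= /cst; field.
have dA s u : cder (1 : R) (A s) u (G u0 s0 + c * ((u - u0) +i* (s - s0))).
 have h1' := cderZ (G u0 s0 + c * ('i * (s - s0)%:C)) (cder_real (is_derive_id u (1 : R))).
 have h2' := cderZ c (cder_real (dsq u0 u)).
 by have := cderD h1' h2'; move/cder_eq; apply; rewrite split_i; ring.
have dB u s : cder (1 : R) (B u) s (G u0 s0 + c * ((u - u0) +i* (s - s0))).
 have h1' := cderZ (G u0 s0 + c * (u - u0)%:C) (cder_real (is_derive_id s (1 : R))).
 have h2' := cderZ c (cderZ 'i (cder_real (dsq s0 s))).
 have := cderD h1' h2'; move/cder_eq; apply; rewrite split_i; ring.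
have side (F H : R -> C) (g : R -> C) t1 t2 (h : R -> C) : t1 <= t2 ->
  (forall t, t1 <= t <= t2 -> cder (1 : R) F t (g t)) ->
  (forall t, t1 <= t <= t2 -> cder (1 : R) H t (h t)) ->
  (forall t, t1 <= t <= t2 -> rnorm (g t - h t) <= e * L) ->
  t2 - t1 <= L -> rnorm ((F t2 - F t1) - (H t2 - H t1)) <= 2 * (e * L) * (t2 - t1).
 move=> t12 dF dH hb tL.
 have -> : (F t2 - F t1) - (H t2 - H t1) = (F t2 + (-1) * H t2) - (F t1 + (-1) * H t1) by ring.
 apply: (@cmean_value _ (fun t => F t + (-1) * H t) (fun t => g t + (-1) * h t)) => // t ht.
  by apply: cderD (dF t ht) (cderZ (-1) (dH t ht)).
 by rewrite mulN1r; exact: hb.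
have sP s : s1 <= s <= s2 -> rnorm ((P s u2 - P s u1) - (A s u2 - A s u1)) <= 2 * (e * L) * (u2 - u1).
 move=> hs'; have /andP[? ?] := hs'; apply: (side _ _ (fun u => G u s) _ _ (fun u => G u0 s0 + c * ((u - u0) +i* (s - s0)))) => //.
 - by move=> t /andP[? ?]; apply: hP; apply/andP; split; lra.
 - by move=> t ht; rewrite opprD addrA; exact: bnd.
 - by rewrite /L lerDl subr_ge0.
have sQ u : u1 <= u <= u2 -> rnorm ((Q u s2 - Q u s1) - (B u s2 - B u s1)) <= 2 * (e * L) * (s2 - s1).
 move=> hs'; have /andP[? ?] := hs'; apply: (side _ _ (fun s => G u s) _ _ (fun s => G u0 s0 + c * ((u - u0) +i* (s - s0)))) => //.
 - by move=> t /andP[? ?]; apply: hQ; apply/andP; split; lra.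
 - by move=> t ht; rewrite opprD addrA; exact: bnd.
 - by rewrite /L lerDr subr_ge0.
have -> : rect u1 u2 s1 s2 = ((P s1 u2 - P s1 u1) - (A s1 u2 - A s1 u1)) - ((P s2 u2 - P s2 u1) - (A s2 u2 - A s2 u1))
  + 'i * (((Q u2 s2 - Q u2 s1) - (B u2 s2 - B u2 s1)) - ((Q u1 s2 - Q u1 s1) - (B u1 s2 - B u1 s1))).
 by rewrite /rect /A /B !rmorphB /=; ring.
have r1 : s1 <= s1 <= s2 by rewrite lexx. have r2 : s1 <= s2 <= s2 by rewrite lexx s12.
have r3 : u1 <= u1 <= u2 by rewrite lexx. have r4 : u1 <= u2 <= u2 by rewrite lexx u12.
have tri (x y z w : C) : rnorm (x - y + 'i * (z - w)) <= rnorm x + rnorm y + (rnorm z + rnorm w).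
 letr (rnD _ _); rewrite rnM rni mul1r.
 by apply: lerD; letr (rnD _ _); rewrite rnN.
letr (tri _ _ _ _).
letr (lerD (lerD (sP _ r1) (sP _ r2)) (lerD (sQ _ r4) (sQ _ r3))).
by apply: eq_ler; rewrite /L; ring.
Qed.

(** Bisection: among the four quarters of a rectangle, one has a boundary integral of at least a
    fourth of the whole. The nested rectangles shrink to a point, where the quadratic bound of
    [rect_small] with small [e] beats the factor [4^k]. *)
Lemma goursat u1 u2 s1 s2 : a < u1 -> u1 <= u2 -> u2 < b -> al < s1 -> s1 <= s2 -> s2 < be ->
 rect u1 u2 s1 s2 = 0.
move=> h1 h12 h2 h3 h34 h4.
pose J (k : nat) (p : R * R) := rnorm (rect p.1 (p.1 + (u2 - u1) / 2 ^+ k) p.2 (p.2 + (s2 - s1) / 2 ^+ k)).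
have two k : 0 < 2 ^+ k :> R by rewrite exprn_gt0.
have /choice[nxt hnxt] : forall kp : nat * (R * R), exists q : bool * bool,
  J kp.1 kp.2 <= 4 * J kp.1.+1 (kp.2.1 + q.1%:R * ((u2 - u1) / 2 ^+ kp.1.+1), kp.2.2 + q.2%:R * ((s2 - s1) / 2 ^+ kp.1.+1)).
 move=> [k [x y]] /=; apply: contrapT => /forallNP hn.
 have hn' (q1 q2 : bool) : 4 * J k.+1 (x + q1%:R * ((u2 - u1) / 2 ^+ k.+1), y + q2%:R * ((s2 - s1) / 2 ^+ k.+1)) < J k (x, y).
  by rewrite ltNge; apply/negP; exact: hn (q1, q2).
 have := hn' false false; have := hn' false true; have := hn' true false; have := hn' true true.
 rewrite /J /= !mul1r !mul0r !addr0.
 set du := (u2 - u1) / _; set ds := (s2 - s1) / _.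
 have -> : (u2 - u1) / 2 ^+ k = du + du by rewrite /du exprS; field; rewrite gt_eqF.
 have -> : (s2 - s1) / 2 ^+ k = ds + ds by rewrite /ds exprS; field; rewrite gt_eqF.
 rewrite !addrA => a1 a2 a3 a4.
 have E : rect x (x + du + du) y (y + ds + ds) = rect x (x + du) y (y + ds) + rect x (x + du) (y + ds) (y + ds + ds)
  + rect (x + du) (x + du + du) y (y + ds) + rect (x + du) (x + du + du) (y + ds) (y + ds + ds).
  by rewrite /rect; ring.
 have := rnD (rect x (x + du) y (y + ds) + rect x (x + du) (y + ds) (y + ds + ds) + rect (x + du) (x + du + du) y (y + ds)) (rect (x + du) (x + du + du) (y + ds) (y + ds + ds)).
 have := rnD (rect x (x + du) y (y + ds) + rect x (x + du) (y + ds) (y + ds + ds)) (rect (x + du) (x + du + du) y (y + ds)).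
 have := rnD (rect x (x + du) y (y + ds)) (rect x (x + du) (y + ds) (y + ds + ds)).
 rewrite -E; lra.
pose p := fix p k : R * R := if k is k'.+1 then
 ((p k').1 + (nxt (k', p k')).1%:R * ((u2 - u1) / 2 ^+ k'.+1), (p k').2 + (nxt (k', p k')).2%:R * ((s2 - s1) / 2 ^+ k'.+1))
 else (u1, s1).
have Jp k : J 0%N (p 0%N) <= 4 ^+ k * J k (p k).
 elim: k => [|k IH]; first by rewrite mul1r.
 by letr IH; rewrite exprSr -mulrA ler_wpM2l //; exact: hnxt (k, p k).
have nest (x L : R) (w : nat -> R) (q : nat -> bool) : 0 <= L -> (forall k, w k.+1 = w k + (q k)%:R * (L / 2 ^+ k.+1)) ->
  exists z, forall k, w k <= z <= w k + L / 2 ^+ k.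
 move=> L0 hw; apply: nested_intervals => k; first by rewrite divr_ge0 // ltW.
  by rewrite hw lerDl mulr_ge0 ?ler0n // divr_ge0 // ltW.
 rewrite hw -addrA lerD2l.
 have -> : L / 2 ^+ k = L / 2 ^+ k.+1 + L / 2 ^+ k.+1 by rewrite exprS; field; rewrite gt_eqF.
 rewrite lerD2r; have : 0 <= L / 2 ^+ k.+1 by rewrite divr_ge0 // ltW.
 by case: (q k); rewrite ?mul1r ?mul0r.
have [u0 hu0] : exists z, forall k, (p k).1 <= z <= (p k).1 + (u2 - u1) / 2 ^+ k.
 by apply: (nest u1 _ (fun k => (p k).1) (fun k => (nxt (k, p k)).1)) => //; rewrite subr_ge0.
have [s0 hs0] : exists z, forall k, (p k).2 <= z <= (p k).2 + (s2 - s1) / 2 ^+ k.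
 by apply: (nest s1 _ (fun k => (p k).2) (fun k => (nxt (k, p k)).2)) => //; rewrite subr_ge0.
have low k : u1 <= (p k).1 /\ s1 <= (p k).2.
 elim: k => [|k [IH1 IH2]] //=; split; [letr IH1|letr IH2];
 by rewrite lerDl mulr_ge0 ?ler0n // divr_ge0 ?subr_ge0 // ltW.
have high k : (p k).1 + (u2 - u1) / 2 ^+ k <= u2 /\ (p k).2 + (s2 - s1) / 2 ^+ k <= s2.
 elim: k => [|k [IH1 IH2]]; first by rewrite /= !expr0 !divr1 !subrKC.
 have half (L : R) : L / 2 ^+ k = L / 2 ^+ k.+1 + L / 2 ^+ k.+1 by rewrite exprS; field; rewrite gt_eqF.
 split; [apply: le_trans IH1|apply: le_trans IH2]; rewrite /= -addrA lerD2l [leRHS]half lerD2r.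
  have : 0 <= (u2 - u1) / 2 ^+ k.+1 by rewrite divr_ge0 ?subr_ge0 // ltW.
  by case: (nxt _).1; rewrite ?mul1r ?mul0r.
 have : 0 <= (s2 - s1) / 2 ^+ k.+1 by rewrite divr_ge0 ?subr_ge0 // ltW.
 by case: (nxt _).2; rewrite ?mul1r ?mul0r.
have /andP[a0 a1] := hu0 0%N; have /andP[b0 b1] := hs0 0%N.
rewrite /= expr0 divr1 subrKC in a0 a1; rewrite /= expr0 divr1 subrKC in b0 b1.
have [c hc] : cr_diff G u0 s0 by apply: hG; apply/andP; split; lra.
apply/eqP; rewrite -rn_eq0; apply/eqP/le_anti; rewrite rn_ge0 andbT.
have J0 : J 0%N (p 0%N) = rnorm (rect u1 u2 s1 s2) by rewrite /J /= expr0 !divr1 !subrKC.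
rewrite -J0; set M := 4 * ((u2 - u1) + (s2 - s1)) ^+ 2.
have M0 : 0 <= M by rewrite mulr_ge0 // sqr_ge0.
apply/ler_addgt0Pr => e e0; rewrite add0r.
have e1 : 0 < e / (M + 1) by rewrite divr_gt0 // ltr_wpDl.
have [d d0 hd] := hc _ e1.
have [k hk] : exists k : nat, (u2 - u1 + (s2 - s1)) / 2 ^+ k < d.
 pose L := u2 - u1 + (s2 - s1); have L0 : 0 <= L by rewrite addr_ge0 // subr_ge0.
 exists (Num.truncn (L / d)).+1; rewrite -/L ltr_pdivrMr // mulrC -ltr_pdivrMr //.
 apply: lt_le_trans (truncnS_gt _) _; rewrite -natrX ler_nat; exact/ltnW/ltn_expl.
have /andP[? ?] := hu0 k; have /andP[? ?] := hs0 k; have [? ?] := low k; have [? ?] := high k.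
have du0 : 0 <= (u2 - u1) / 2 ^+ k by rewrite divr_ge0 ?subr_ge0 // ltW.
have ds0 : 0 <= (s2 - s1) / 2 ^+ k by rewrite divr_ge0 ?subr_ge0 // ltW.
rewrite mulrDl in hk.
letr (Jp k).
have := @rect_small (p k).1 ((p k).1 + (u2 - u1) / 2 ^+ k) (p k).2 ((p k).2 + (s2 - s1) / 2 ^+ k) u0 s0 c (e / (M + 1)).
move/(_ _ _ _ _ (hu0 k) (hs0 k) (ltW e1)) => small.
have bnd u s : (p k).1 <= u <= (p k).1 + (u2 - u1) / 2 ^+ k -> (p k).2 <= s <= (p k).2 + (s2 - s1) / 2 ^+ k ->
  rnorm (G u s - G u0 s0 - c * ((u - u0) +i* (s - s0))) <= e / (M + 1) * (`|u - u0| + `|s - s0|).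
 by move=> /andP[? ?] /andP[? ?]; apply: hd; rewrite ltr_norml; apply/andP; split; lra.
have [lo1 lo2] := low k; have [hi1 hi2] := high k.
have {small} small := small (lt_le_trans h1 lo1) (le_lt_trans hi1 h2) (lt_le_trans h3 lo2) (le_lt_trans hi2 h4) bnd.
letr (ler_wpM2l (exprn_ge0 k (ler0n R 4)) small).
rewrite [(p k).1 + _]addrC [(p k).2 + _]addrC !addrK -mulrDl.
have -> : 4 ^+ k * (4 * (e / (M + 1)) * ((u2 - u1 + (s2 - s1)) / 2 ^+ k) ^+ 2) = e * (M / (M + 1)).
 have -> : 4 ^+ k = (2 ^+ k) ^+ 2 :> R by rewrite -exprM mulnC exprM; congr (_ ^+ k); ring.
 have M2 : 4 * (u2 - u1 + (s2 - s1)) ^+ 2 + 1 != 0 by rewrite -/M gt_eqF // ltr_wpDl.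
 by move: (two k); rewrite /M; move: (2 ^+ k) => T T0; field; rewrite M2 gt_eqF.
have M1 : 0 < M + 1 by rewrite ltr_wpDl.
have h : M / (M + 1) <= 1 by rewrite ler_pdivrMr // mul1r lerDl.
by rewrite -[leRHS]mulr1 ler_wpM2l // ltW.
Qed.

End goursat.

(** * Primitives of holomorphic functions, on rectangles and in polar coordinates *)

Section holo_prim.
Variable R : realType.
Notation C := R[i].

(** Path integrals from the center [(c, g)], horizontal first, then vertical. The derivative in [s]
    is immediate. For the one in [u], [goursat] exchanges the path for the other one, vertical
    first, on which only the last piece depends on [u]. *)
Lemma holo_prim (G : R -> R -> C) (a b al be : R) : a < b -> al < be ->
 (forall u s, a <= u <= b -> al <= s <= be -> cr_diff G u s) ->
 exists Psi : R -> R -> C, forall u s, a < u < b -> al < s < be ->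
  cder (1 : R) (Psi ^~ s) u (G u s) /\ cder (1 : R) (Psi u) s ('i * G u s).
move=> ab hal hG.
have /choice[P hP] : forall s, exists p : R -> C, al < s < be -> forall u, a < u < b -> cder (1 : R) p u (G u s).
 move=> s; have [hs|hs] := pselect (al < s < be); last by exists (fun _ => 0).
 have /andP[s1 s2] := hs; have hs' : al <= s <= be by rewrite !ltW.
 have [p hp] := @cprimitive R (fun u => G u s) a b ab (fun t ht => cr_cts_u (hG t s ht hs')).
 by exists p.
have /choice[Q hQ] : forall u, exists p : R -> C, a < u < b -> forall s, al < s < be -> cder (1 : R) p s (G u s).
 move=> u; have [hu|hu] := pselect (a < u < b); last by exists (fun _ => 0).
 have /andP[u1 u2] := hu; have hu' : a <= u <= b by rewrite !ltW.
 have [p hp] := @cprimitive R (fun s => G u s) al be hal (fun t ht => cr_cts_s (hG u t hu' ht)).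
 by exists p.
have hP' u s : a < u < b -> al < s < be -> cder (1 : R) (P s) u (G u s) by move=> hu hs; exact: hP.
have hQ' u s : a < u < b -> al < s < be -> cder (1 : R) (Q u) s (G u s) by move=> hu hs; exact: hQ.
have R0 := goursat hG hP' hQ'.
pose c := (a + b) / 2; pose g := (al + be) / 2.
have hc : a < c < b by rewrite midf_lt // midf_lt.
have hg : al < g < be by rewrite midf_lt // midf_lt.
have rect0 u s : a < u < b -> al < s < be -> rect P Q c u g s = 0.
 move=> /andP[u1 u2] /andP[s1 s2]; have /andP[c1 c2] := hc; have /andP[g1 g2] := hg.
 have swu u' v' s' t' : rect P Q u' v' s' t' = - rect P Q v' u' s' t' by rewrite /rect; ring.
 have sws u' v' s' t' : rect P Q u' v' s' t' = - rect P Q u' v' t' s' by rewrite /rect; ring.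
 have [cu|/ltW uc] := leP c u; have [gs|/ltW sg] := leP g s.
 - exact: R0.
 - by rewrite sws R0 ?oppr0.
 - by rewrite swu R0 ?oppr0.
 - by rewrite swu sws R0 ?oppr0.
exists (fun u s => P g u - P g c + 'i * (Q u s - Q u g)) => u s hu hs; split; last first.
 have h := cderZ 'i (cderD (hQ' u s hu hs) (cder_cst (- Q u g) s (1 : R))).
 have := cderD (cder_cst (P g u - P g c) s (1 : R)) h.
 by move/cder_eq; apply; rewrite addr0 add0r.
have h := cderD (hP' u s hu hs) (cder_cst (- P s c + 'i * (Q c s - Q c g)) u (1 : R)).
rewrite addr0 in h.
have near_eq : \forall x \near u, P s x + (- P s c + 'i * (Q c s - Q c g)) = P g x - P g c + 'i * (Q x s - Q x g).
 have : nbhs u [set` `]a, b[] by apply: open_nbhs_nbhs; split; [exact: interval_open|rewrite /= in_itv].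
 apply: filterS => x; rewrite /= in_itv /= => hx; have := rect0 x s hx hs.
 by rewrite /rect => e; rewrite -[RHS]subr0 -{}e; ring.
have [h1 h2] := h; split.
 apply: near_eq_is_derive h1.
 by apply: filterS near_eq => x ->.
apply: near_eq_is_derive h2.
by apply: filterS near_eq => x ->.
Qed.

End holo_prim.

Section polar_primitive.
Variable R : realType.
Notation C := R[i].
Implicit Types (theta r s t : R) (f : C -> C).

Lemma dble_littleo (K : numFieldType) (f : K -> K) (x : K) : derivable (f : K^o -> K^o) x 1 ->
 forall e : K, 0 < e -> exists2 d : K, 0 < d & forall h : K, `|h| < d ->
  `|f (x + h) - f x - 'D_1 (f : K^o -> K^o) x * h| <= e * `|h|.
move=> df e e0; set l := 'D_1 _ x.
have hl : h^-1 *: ((f : K^o -> K^o) (h *: 1 + x) - f x) @[h --> 0^'] --> l by exact: df.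
have /cvgrPdist_le/(_ e e0)[d /= d0 hd] := hl; exists d => // h hhd.
have [->|h0] := eqVneq h 0; first by rewrite addr0 subrr mulr0 subr0 !normr0 mulr0.
have := hd h; rewrite /ball_ /= sub0r normrN => /(_ hhd h0).
rewrite /GRing.scale /= mulr1 [h + x]addrC => hh.
have -> : f (x + h) - f x - l * h = - ((l - h^-1 * (f (x + h) - f x)) * h) by rewrite mulrBl mulrAC mulVf // mul1r opprB.
by rewrite normrN normrM ler_wpM2r.
Qed.

Lemma real_littleo (g : R -> R) (l : R) : is_derive (0 : R) (1 : R) g l -> forall e : R, 0 < e ->
 exists2 d : R, 0 < d & forall h : R, `|h| < d -> `|g h - g 0 - l * h| <= e * `|h|.
move=> [dg <-] e e0; have [d d0 hd] := dble_littleo dg e0.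
by exists d => // h /hd; rewrite add0r.
Qed.

Lemma cexp_littleo (e : R) : 0 < e -> exists2 d : R, 0 < d & forall a b : R, `|a| < d -> `|b| < d ->
 rnorm ((expR a)%:C * expi b - 1 - (a +i* b)) <= e * (`|a| + `|b|).
move=> e0; have e8 : 0 < e / 8 by rewrite divr_gt0.
have [d1 d10 h1] := real_littleo (is_derive_expR 0) e8.
have [d2 d20 h2] := real_littleo (is_derive_cos 0) e8.
have [d3 d30 h3] := real_littleo (is_derive_sin 0) e8.
rewrite expR0 in h1; rewrite cos0 sin0 oppr0 in h2; rewrite sin0 cos0 in h3.
pose d := Num.min (Num.min d1 (Num.min d2 d3)) (Num.min 1 (e / 8)).
exists d; first by rewrite !lt_min d10 d20 d30 ltr01 e8.
move=> a b; rewrite !lt_min => /andP[/andP[a1 _] /andP[a4 a5]] /andP[/andP[_ /andP[b2 b3]] _].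
have {}h1 := h1 a a1; have {}h2 := h2 b b2; have {}h3 := h3 b b3.
have ei : expi b - 1 - 'i * b%:C = ((cos b - 1 - 0 * b) +i* (sin b - 0 - 1 * b)) :> C.
 by apply/eqP; rewrite eq_complex /=; apply/andP; split; apply/eqP; ring.
have ne : rnorm (expi b - 1 - 'i * b%:C : C) <= e / 4 * `|b|.
 by rewrite ei; letr (rn_le _) => /=; lra.
have -> : (expR a)%:C * expi b - 1 - (a +i* b) =
  (expR a - 1 - 1 * a)%:C * expi b + ((1 + a)%:C * (expi b - 1 - 'i * b%:C) + 'i * (a * b)%:C) :> C.
 have -> : a +i* b = a%:C + 'i * b%:C :> C.
  by apply/eqP; rewrite eq_complex /=; apply/andP; split; apply/eqP; ring.
 by rewrite !rmorphB !rmorphD !rmorphM !rmorph1 /=; ring.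
letr (rnD _ _); rewrite rnM rne mulr1 rnr [leRHS]mulrDr.
apply: lerD; first by letr h1; monor; lra.
letr (rnD _ _); rewrite !rnM rni mul1r !rnr normrM.
have a2 : `|1 + a| <= 2.
 by letr (ler_normD _ _); rewrite normr1; lra.
have k1 := ler_pM (normr_ge0 (1 + a)) (rn_ge0 _) a2 ne.
have k2 := ler_wpM2r (normr_ge0 b) (ltW a5).
by have := mulr_ge0 (ltW e0) (normr_ge0 b); lra.
Qed.

(** In [w = u + i s] the point [ray s (expR u)] is [exp(w)], so the composite has the complex
    derivative [f'(z0) z0]. *)
Lemma cr_polar f (u0 s0 : R) : derivable f (ray s0 (expR u0)) 1 ->
 cr_diff (fun u s => f (ray s (expR u))) u0 s0.
move=> /(@dble_littleo C)/(ex_intro (fun l : C => forall e : C, 0 < e -> exists2 d : C, 0 < d &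
 forall h : C, `|h| < d -> `|f (ray s0 (expR u0) + h) - f (ray s0 (expR u0)) - l * h| <= e * `|h|) _)[l hl].
set z0 := ray s0 (expR u0) in hl *.
exists (l * z0) => e e0.
pose M := rnorm z0 + 1; have M0 : 0 < M by rewrite ltr_wpDl.
have l0 : 0 < rnorm l + 1 by rewrite ltr_wpDl.
have e1 : 0 < e / (4 * M) by rewrite divr_gt0 // mulr_gt0.
have e1' : 0 < (e / (4 * M))%:C by rewrite ltcR.
have [d1 d10 h1] := hl _ e1'.
have d10' : 0 < Re d1 by move: d10; rewrite ltcE /= => /andP[].
have d1E : d1 = (Re d1)%:C by move: d10; rewrite ltcE /= => /andP[/eqP i0 _]; rewrite [LHS]complexE i0 mulr0 addr0.
pose e2 := Num.min 1 (e / (2 * M * (rnorm l + 1))).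
have e20 : 0 < e2 by rewrite lt_min ltr01 divr_gt0 // !mulr_gt0.
have [d2 d20 h2] := cexp_littleo e20.
pose d := Num.min d2 (Re d1 / (4 * M)).
exists d; first by rewrite lt_min d20 divr_gt0 // mulr_gt0.
move=> u s; rewrite !lt_min => /andP[u1 u2] /andP[s1 s2].
set a := u - u0 in u1 u2 *; set b := s - s0 in s1 s2 *; set q := `|a| + `|b|.
have q0 : 0 <= q by rewrite addr_ge0.
have hE := h2 a b u1 s1; rewrite -/q in hE.
set w : C := (expR a)%:C * expi b - 1 in hE *.
have zE : ray s (expR u) = z0 + z0 * w.
 rewrite /w /z0 /ray (_ : u = u0 + a); last by rewrite /a subrKC.
 rewrite (_ : s = s0 + b); last by rewrite /b subrKC.
 by rewrite expRD expiD rmorphM /=; ring.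
have wq : rnorm w <= 2 * q.
 rewrite -[w](subrK (a +i* b)); letr (rnD _ _).
 have -> : 2 * q = q + q by ring.
 apply: lerD; last exact: rn_le.
 by letr hE; rewrite ler_piMl // ge_min lexx.
have zM : rnorm z0 <= M by rewrite lerDl.
have hw : rnorm (z0 * w) <= M * (2 * q) by rewrite rnM; apply: ler_pM; rewrite ?rn_ge0.
have hd : `|z0 * w| < d1.
 rewrite d1E rnE ltcR; apply: le_lt_trans hw _.
 have -> : Re d1 = M * (2 * (Re d1 / (4 * M) + Re d1 / (4 * M))).
  by field; rewrite gt_eqF.
 by rewrite ltr_pM2l // ltr_pM2l // ltrD.
have := h1 _ hd; rewrite -zE !rnE -rmorphM lecR => hf.
have -> : f (ray s (expR u)) - f z0 - l * z0 * (a +i* b) =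
  (f (ray s (expR u)) - f z0 - l * (z0 * w)) + l * z0 * (w - (a +i* b)) by ring.
letr (rnD _ _); rewrite [X in _ + X]rnM [rnorm (l * z0)]rnM.
have -> : e * q = e / 2 * q + e / 2 * q by field.
apply: lerD; first letr hf.
 have -> : e / 2 * q = e / (4 * M) * (M * (2 * q)) by field; rewrite gt_eqF.
 by rewrite ler_pM2l.
have lM : rnorm l * rnorm z0 <= (rnorm l + 1) * M.
 by apply: ler_pM; rewrite // lerDl.
have e2q : rnorm (w - (a +i* b)) <= e / (2 * M * (rnorm l + 1)) * q.
 by letr hE; monor; rewrite ge_min lexx orbT.
have -> : e / 2 * q = (rnorm l + 1) * M * (e / (2 * M * (rnorm l + 1)) * q).
 by field; rewrite !gt_eqF.
by apply: ler_pM; rewrite ?mulr_ge0 ?rn_ge0.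
Qed.

Lemma rn_ray s r : 0 <= r -> rnorm (ray s r) = r.
by move=> r0; rewrite rnM rne mulr1 rnr ger0_norm. Qed.

(* The distance of [t e^(is)] to the ray of argument [phi] is [t |sin (phi - s)|] or [t]. *)
Lemma sector_distance theta s t om z : 0 < theta < pi -> 0 <= t -> 0 <= om -> `|s| <= theta - om ->
 sector theta z -> t * sin om <= rnorm (ray s t - z).
move=> /andP[th0 thpi] t0 om0 hs [r [phi [r0 /andP[p1 p2] ->]]].
have om_pi : om <= pi by have := normr_ge0 s; lra.
have cosle x : om <= x <= pi -> cos x <= cos om.
  move=> /andP[x1 x2]; rewrite leNgt ltr_cos ?in_itv /= ?x2 ?(le_trans om0 x1) ?om0 ?om_pi //.
  by rewrite -leNgt.
have hc : cos (phi - s) <= cos om.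
 have := hs; rewrite ler_norml => /andP[s1 s2].
 have [le_pi|gt_pi] := leP (phi - s) pi.
  by apply: cosle; apply/andP; split; lra.
 have -> : cos (phi - s) = cos (2 * pi - (phi - s)).
  by rewrite -cosN -(cosD2pi (- (phi - s))) mulr_natl [in RHS]addrC.
 by apply: cosle; apply/andP; split; lra.
have som : 0 <= sin om by apply: sin_ge0_pi; rewrite om0.
rewrite -(ler_pXn2r (_ : (0 < 2)%N)) ?nnegrE ?mulr_ge0 // rn_sqr /ray /expi /=.
rewrite !mul0r !subr0 !addr0.
have E : (t * cos s - r * cos phi) ^+ 2 + (t * sin s - r * sin phi) ^+ 2 =
  t ^+ 2 * (cos s ^+ 2 + sin s ^+ 2) + r ^+ 2 * (cos phi ^+ 2 + sin phi ^+ 2)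
  - 2 * (t * r) * (cos phi * cos s + sin phi * sin s) by ring.
rewrite E !cos2Dsin2 -cosB.
have h1 : t * r * cos (phi - s) <= t * r * cos om by rewrite ler_wpM2l // mulr_ge0.
have h2 : sin om ^+ 2 = 1 - cos om ^+ 2 by rewrite -(cos2Dsin2 om); ring.
have h3 := sqr_ge0 (r - t * cos om).
rewrite exprMn h2; rewrite sqrrB exprMn in h3; nra.
Qed.

Lemma ray_out theta s r : 0 < theta < pi -> 0 < r -> `|s| < theta -> ~ sector theta (ray s r).
move=> hth r0 hs hz.
pose om := (theta - `|s|); have om0 : 0 < om by rewrite subr_gt0.
have hs' : `|s| <= theta - om by rewrite /om opprB addrCA subrr addr0.
have := sector_distance hth (ltW r0) (ltW om0) hs' hz.
rewrite subrr rn0 leNgt mulr_gt0 // sin_gt0_pi // om0 /=.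
by have /andP[] := hth; have := normr_ge0 s; rewrite /om; lra.
Qed.

(** In [w = ln r + i s] the form [f(z) dz / z] becomes [f(exp(w)) dw], holomorphic on a strip, where
    [holo_prim] applies. *)
Lemma polar_primitive theta f (al r1 r2 : R) : 0 < theta < pi -> holomorphic_off theta f ->
 0 < al < theta -> 0 < r1 < r2 ->
 exists Phi : R -> R -> C, forall r s, r1 <= r <= r2 -> `|s| <= al ->
  cder (1 : R) (Phi ^~ s) r (f (ray s r) / r%:C) /\
  cder (1 : R) (Phi r) s ('i * f (ray s r)).
move=> hth hf /andP[al0 alt] /andP[r10 r12].
pose be := (al + theta) / 2; have be1 : al < be by rewrite midf_lt.
have be2 : be < theta by rewrite midf_lt.
have l12 : ln r1 < ln r2 by rewrite ltr_ln // posrE (lt_trans r10).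
have ab : ln r1 - 1 < ln r2 + 1 by lra.
have cr u s : ln r1 - 1 <= u <= ln r2 + 1 -> - be <= s <= be ->
  cr_diff (fun u s => f (ray s (expR u))) u s.
 move=> _ hs; apply: cr_polar; apply: hf; apply: ray_out => //; first exact: expR_gt0.
 by apply: le_lt_trans be2; rewrite ler_norml.
have bb : - be < be by lra.
have [Psi hPsi] := holo_prim ab bb cr.
exists (fun r s => Psi (ln r) s) => r s /andP[h1 h2] hs.
have r0 : 0 < r := lt_le_trans r10 h1.
have hu : ln r1 - 1 < ln r < ln r2 + 1.
 have : ln r1 <= ln r <= ln r2 by rewrite !ler_ln ?posrE // ?h1 // (lt_trans r10).
 by move=> /andP[? ?]; apply/andP; split; lra.
have hs' : - be < s < be by rewrite -ltr_norml (le_lt_trans hs).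
have [H1 H2] := hPsi _ _ hu hs'; rewrite lnK ?posrE // in H1 H2; split=> //.
have [R1 R2] := H1; have dl := is_derive1_ln r0.
have e (z : C) : (Re (z / r%:C) = Re z * r^-1) /\ (Im (z / r%:C) = Im z * r^-1).
 by rewrite -fmorphV; case: z => x y /=; split; ring.
have [e1 e2] := e (f (ray s r)).
split; rewrite ?e1 ?e2; [exact: (is_derive1_comp R1 dl)|exact: (is_derive1_comp R2 dl)].
Qed.

End polar_primitive.

(** * Samples of [f] near the contour *)

Section step_values.
Variable R : realType.
Notation C := R[i].
Implicit Types (f : C -> C) (b : bool) (i N : nat).

Definition side b : R := if b then 1 else - 1.

Lemma normr_side b (x : R) : `|side b * x| = `|x|.
by rewrite normrM /side; case: b; rewrite ?normrN normr1 mul1r. Qed.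

Variables (theta : R) (f : C -> C).
Hypotheses (hth : 0 < theta < pi) (hf : holomorphic_off theta f).

(** [v b i] is [i] times the increment of a primitive of [f(z) / z] over the cell
    [[i h, (i + 1) h]]. It is close to [f] there because [1 / t] is close to [1 / (i h)]; the error
    of this replacement is the term [rnorm c / i]. The quotients [v b i / i] telescope, and the
    difference of the rays reduces to increments along two arcs of opening less than [2 theta], each
    at most [4 theta B]. The angle [om] keeps all paths inside the domain of holomorphy. *)
Lemma step_values (B om h : R) N : (forall z, ~ sector theta z -> rnorm (f z) <= B) ->
 0 < om < theta -> 0 < h ->
 exists v : bool -> nat -> C,
 (forall b i c e, (0 < i < N)%N ->
  (forall t, i%:R * h <= t <= i.+1%:R * h -> rnorm (f (ray (side b * (theta - om)) t) - c) <= e) ->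
  rnorm (v b i - c) <= 2 * (e + rnorm c / i%:R)) /\
 (forall i0 i1, (0 < i0)%N -> (i0 <= i1)%N -> (i1 <= N)%N ->
  rnorm (dsum v i0 i1) <= 8 * theta * B).
move=> hB /andP[om0 omt] h0; have /andP[th0 _] := hth.
have al : 0 < theta - om < theta by apply/andP; split; lra.
have r12 : 0 < h < N.+2%:R * h by rewrite h0 ltr_pMl // (ltr_nat R 1).
have [Phi hPhi] := polar_primitive hth hf al r12.
have win i : (0 < i <= N.+2)%N -> h <= i%:R * h <= N.+2%:R * h.
 by move=> /andP[i0 iN]; rewrite ler_pM2r // ler_nat iN andbT ler_peMl ?ler1n // ltW.
have hside b : `|side b * (theta - om)| <= theta - om.
 by rewrite normr_side ger0_norm //; have /andP[/ltW] := al.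
have B0 : 0 <= B.
 apply: le_trans (rn_ge0 _) (hB (ray 0 1) _); apply: ray_out => //.
 by rewrite normr0.
exists (fun b i => (i%:R)%:C * (Phi (i.+1%:R * h) (side b * (theta - om)) - Phi (i%:R * h) (side b * (theta - om)))); split.
 move=> b i c e /andP[i0 iN] he; set s := side b * (theta - om) in he *.
 have i1 : 0 < i%:R :> R by rewrite ltr0n.
 have ih0 : 0 < i%:R * h by rewrite mulr_gt0.
 have /andP[w1 _] := win i (introT andP (conj i0 (leq_trans (ltnW iN) (leq_trans (leqnSn _) (leqnSn _))))).
 have /andP[_ w2] := win i.+1 (leq_trans iN (leq_trans (leqnSn _) (leqnSn _))).
 have ii : i%:R * h <= i.+1%:R * h by rewrite ler_pM2r // ler_nat.
 have dP t : i%:R * h <= t <= i.+1%:R * h ->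
  cder (1 : R) (fun t => Phi t s + (- (c / (i%:R * h)%:C)) * t%:C) t (f (ray s t) / t%:C - c / (i%:R * h)%:C).
  move=> /andP[t1 t2]; have ht : h <= t <= N.+2%:R * h by rewrite (le_trans w1) // (le_trans t2).
  have h1 := (hPhi t s ht (hside b)).1.
  have := cderD h1 (cderZ (- (c / (i%:R * h)%:C)) (cder_real (is_derive_id t (1 : R)))).
  by move/cder_eq; apply; rewrite mulr1.
 have bd t : i%:R * h <= t <= i.+1%:R * h ->
  rnorm (f (ray s t) / t%:C - c / (i%:R * h)%:C) <= (e + rnorm c / i%:R) / (i%:R * h).
  move=> ht; have /andP[t1 t2] := ht; have t0 : 0 < t := lt_le_trans ih0 t1.
  have -> : f (ray s t) / t%:C - c / (i%:R * h)%:C = (f (ray s t) - c) * (t^-1)%:C + c * (t^-1 - (i%:R * h)^-1)%:C.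
  by rewrite rmorphB /= !fmorphV /=; ring.
  letr (rnD _ _); rewrite !rnM !rnr mulrDl.
  have ti : t^-1 <= (i%:R * h)^-1 by rewrite lef_pV2.
  apply: lerD.
  rewrite gtr0_norm ?invr_gt0 //; apply: ler_pM; rewrite ?invr_ge0 ?(ltW t0) //; exact: he.
  rewrite -mulrA ler_wpM2l // ler0_norm ?subr_le0 // opprB.
  have -> : (i%:R * h)^-1 - t^-1 = (t - i%:R * h) / (i%:R * h) / t by field; rewrite !gt_eqF.
  have -> : i%:R^-1 / (i%:R * h) = h / (i%:R * h) / (i%:R * h) by field; rewrite !gt_eqF.
  apply: ler_pM => //; [by rewrite divr_ge0 ?subr_ge0 // ltW|by rewrite invr_ge0 ltW|].
  by rewrite ler_pM2r ?invr_gt0 // lerBlDl; move: t2; rewrite -natr1 mulrDl mul1r.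
 have := cmean_value ii dP bd; set P1 := Phi _ _; set P0 := Phi _ _ => hm.
 have -> : (i%:R)%:C * (P1 - P0) - c = (i%:R)%:C * (P1 + - (c / (i%:R * h)%:C) * (i.+1%:R * h)%:C - (P0 + - (c / (i%:R * h)%:C) * (i%:R * h)%:C)).
  rewrite -natr1 !rmorphM !rmorphD /= rmorph1; field.
  by rewrite fmorph_eq0 gt_eqF // pnatr_eq0 -lt0n i0.
 rewrite rnM rnr gtr0_norm //; letr (ler_wpM2l (ltW i1) hm).
 by apply: eq_ler; rewrite -natr1; field; rewrite !gt_eqF.
move=> i0 i1 i00 i01 i1N.
have arc i : (0 < i <= N.+2)%N -> rnorm (Phi (i%:R * h) (theta - om) - Phi (i%:R * h) (- (theta - om))) <= 4 * theta * B.
 move=> hi; have hw := win i hi; have /andP[hw1 _] := hw.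
 have le1 : - (theta - om) <= theta - om by lra.
 have := @cmean_value R (Phi (i%:R * h)) (fun s => 'i * f (ray s (i%:R * h))) _ _ B le1.
 move/(_ _ _) => H; letr (H _ _).
 - by move=> s hs; have [] := hPhi _ s hw; rewrite ?ler_norml.
 - move=> s hs; rewrite rnM rni mul1r; apply: hB; apply: ray_out => //; first exact: lt_le_trans hw1.
  by apply: le_lt_trans (_ : theta - om < theta); [rewrite ler_norml|have /andP[] := al].
 - have : B * om >= 0 by rewrite mulr_ge0 // ltW.
  by lra.
rewrite (@eq_big_nat _ _ _ _ _ _ (fun i => (Phi (i.+1%:R * h) (theta - om) - Phi (i.+1%:R * h) (- (theta - om))) -
 (Phi (i%:R * h) (theta - om) - Phi (i%:R * h) (- (theta - om))))); last first.
 move=> i /andP[hi _]; rewrite /side /= !mul1r !mulN1r; field.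
 by rewrite pnatr_eq0 -lt0n (leq_trans i00).
rewrite telescope_sumr //; letr (rnD _ _); rewrite rnN.
letr (lerD (arc i1 _) (arc i0 _)).
- by rewrite (leq_trans i00 i01) (leq_trans i1N) // -addn2 leq_addr.
- by rewrite i00 (leq_trans i01) // (leq_trans i1N) // -addn2 leq_addr.
- by lra.
Qed.

(** The chord has squared length [2 - 2 cos om], at most [4 sin(om)^2] when the cosine is
    nonnegative. *)
Lemma rn_expiB (s s' om : R) : s - s' = om \/ s - s' = - om -> 0 <= sin om -> 0 <= cos om ->
 rnorm (expi s - expi s' : C) <= 2 * sin om.
move=> hs s0 c0.
have cc : cos (s - s') = cos om by case: hs => ->; rewrite ?cosN.
rewrite -(ler_pXn2r (_ : (0 < 2)%N)) ?nnegrE ?mulr_ge0 // rn_sqr /expi /=.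
have -> : (cos s - cos s') ^+ 2 + (sin s - sin s') ^+ 2 = 2 - 2 * cos om.
 have := cos2Dsin2 s; have := cos2Dsin2 s'; rewrite -cc cosB => e1 e2.
 rewrite [LHS](_ : _ = (cos s ^+ 2 + sin s ^+ 2) + (cos s' ^+ 2 + sin s' ^+ 2) - 2 * (cos s * cos s' + sin s * sin s')); last by ring.
 by rewrite e1 e2; ring.
have := cos_le1 om; have := sin2cos2 om; rewrite exprMn => -> c1; nra.
Qed.

(** A point of the turned ray with [|t' - t| <= sin om] is within [(1 + 2 t) sin om] of the boundary
    point, while its distance to [Lambda] is at least [t' sin om >= (t / 2) sin om]. The quotient is
    the fixed aperture [2 (1 + 2 t) / t]. *)
Lemma stolz_limit b (t : R) (w : C) (e : R) : 0 < t -> 0 < e ->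
 (forall kappa, f @ within (stolz theta kappa (ray (side b * theta) t)) (nbhs (ray (side b * theta) t)) --> w) ->
 exists2 d : R, 0 < d & forall om t', 0 < om < theta -> om <= pi / 2 -> sin om < d -> `|t' - t| <= sin om ->
  rnorm (f (ray (side b * (theta - om)) t') - w) <= e.
move=> t0 e0 /(_ (2 * (1 + 2 * t) / t)) hl.
have eC : 0 < e%:C by rewrite ltcR.
have /cvgrPdist_le/(_ _ eC) := hl; rewrite /within /= => -[d /= d0 hd].
have d0' : 0 < Re d by move: d0; rewrite ltcE /= => /andP[].
have dE : d = (Re d)%:C by move: d0; rewrite ltcE /= => /andP[/eqP i0 _]; rewrite [LHS]complexE i0 mulr0 addr0.
exists (Num.min (t / 2) (Re d / (2 * (1 + 2 * t)))).
 by rewrite lt_min !divr_gt0 // mulr_gt0 // ltr_pwDl // mulr_ge0 // ltW.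
move=> om t' /andP[om0 omt] ompi; rewrite lt_min => /andP[so1 so2] tt'.
have /andP[_ thpi] := hth.
have sin0 : 0 < sin om by apply: sin_gt0_pi; rewrite om0 (lt_trans omt).
have cos0 : 0 <= cos om by apply: cos_ge0_pihalf; rewrite ompi andbT; have := pi_gt0 R; lra.
have t'0 : t / 2 <= t' by move: tt'; rewrite ler_norml => /andP[? _]; lra.
have dist : rnorm (ray (side b * (theta - om)) t' - ray (side b * theta) t) <= (1 + 2 * t) * sin om.
 have -> : ray (side b * (theta - om)) t' - ray (side b * theta) t =
  (t' - t)%:C * expi (side b * (theta - om)) + t%:C * (expi (side b * (theta - om)) - expi (side b * theta)).
  by rewrite /ray rmorphB /=; ring.
 letr (rnD _ _); rewrite !rnM rne mulr1 !rnr (gtr0_norm t0) mulrDl mul1r.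
 apply: lerD => //; rewrite [2 * t]mulrC -mulrA ler_pM2l //; apply: rn_expiB => //; last exact: ltW.
 by rewrite /side; case: (b); [right|left]; ring.
rewrite rnB -lecR -rnE; apply: hd => /=.
 rewrite dE rnE ltcR rnB; apply: le_lt_trans dist _.
 have T1 : 0 < 1 + 2 * t by lra.
 rewrite mulrC -ltr_pdivlMr //; apply: lt_le_trans so2 _.
 by rewrite ler_pM2l // lef_pV2 ?posrE ?mulr_gt0 //; lra.
have hs : `|side b * (theta - om)| <= theta - om by rewrite normr_side ger0_norm // subr_ge0 ltW.
have t'00 : 0 < t' by apply: lt_le_trans t'0; rewrite divr_gt0.
split; first by apply: ray_out => //; apply: le_lt_trans hs _; lra.
move=> z hz; have hsd := sector_distance hth (ltW t'00) (ltW om0) hs hz.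
have k0 : 0 <= 2 * (1 + 2 * t) / t by rewrite divr_ge0 ?mulr_ge0 ?addr_ge0 ?mulr_ge0 // ltW.
letr dist; apply: le_trans (ler_wpM2l k0 hsd).
apply: le_trans (_ : 2 * (1 + 2 * t) / t * (t / 2 * sin om) <= _); last by rewrite ler_wpM2l // ler_pM2r.
by apply: eq_ler; field; rewrite gt_eqF.
Qed.

End step_values.

Notation sd := (side _).

(** * Vector-valued simple functions *)

Section simple_functions.
Variable R : realType.
Notation C := R[i].
Notation mu := (@lebesgue_measure R).
Implicit Types (X Y : set R) (t : R).

(** The value at [t] of a simple function, accumulated cell by cell. This form supports induction on
    the list of cells with the domain split along one cell at a time; the cells may overlap. *)
Definition sfold (I W : Type) (op : W -> W -> W) (B : I -> set R) (T : I -> W) (r : seq I) (w : W) t : W :=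
 foldl (fun v i => if t \in B i then op v (T i) else v) w r.

Lemma setIDU X B : (X `&` B) `|` (X `\` B) = X.
by rewrite setUIDK. Qed.

(** The domain is split along [B i], and on each part the value accumulated so far is known; in the
    end measurability is needed only for [Phi v] with a fixed [v]. *)
Lemma mble_smp_fold (I W : Type) (op : W -> W -> W) (B : I -> set R) (T : I -> W) (Q : W -> Prop)
  (Phi : W -> R -> R) X : (forall i, measurable (B i)) -> (forall v i, Q v -> Q (op v (T i))) ->
 (forall v, Q v -> measurable_fun X (Phi v)) -> measurable X ->
 forall r Y w, measurable Y -> Y `<=` X -> Q w ->
 measurable_fun Y (fun t => Phi (sfold op B T r w t) t).
move=> mB hQ hPhi mX; elim=> [|i r IH] Y w mY YX Qw.
 by apply: measurable_funS (hPhi _ Qw).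
rewrite -(setIDU Y (B i)); apply/measurable_funU; first exact: measurableI.
 exact: measurableD.
split.
 apply: (@eq_measurable_fun _ _ _ _ _ (fun t => Phi (sfold op B T r (op w (T i)) t) t)).
  by move=> t; rewrite inE /sfold /= => -[_ /mem_set ->].
 by apply: IH => //; [exact: measurableI|move=> t [/YX]|exact: hQ].
apply: (@eq_measurable_fun _ _ _ _ _ (fun t => Phi (sfold op B T r w t) t)).
 by move=> t; rewrite inE /sfold /= => -[_ /(@memNset _ (B i) t) ->].
by apply: IH => //; [exact: measurableD|move=> t [/YX]].
Qed.

Section vector.
Variables (E : normedModType C) (I : Type) (B : I -> set R).
Hypothesis mB : forall i, measurable (B i).

Lemma smp_fold_sum (T : I -> E) r w t :
 sfold +%R B T r w t = w + \sum_(i <- r) (\1_(B i) t)%:C *: T i.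
elim: r w => [|i r IH] w; first by rewrite big_nil addr0.
rewrite /sfold /= -/(sfold _ _ _ _ _ _) IH big_cons indicE.
by case: ifP => _; rewrite /= ?rmorph1 ?rmorph0 ?scale1r ?scale0r ?addrA ?add0r ?addr0.
Qed.

Lemma mble_rn_smp (T : I -> E) r Y w : measurable Y ->
 measurable_fun Y (fun t => rnorm (sfold +%R B T r w t)).
move=> mY; apply: (@mble_smp_fold I E +%R B T (fun _ => True) (fun v _ => rnorm v) setT) => //.
Qed.

(** The triangle inequality for integrals of simple functions, by induction on the cells with [Y]
    split into its parts inside and outside [B i]. *)
Lemma rn_smp_int (T : I -> E) r Y w : measurable Y -> (mu Y < +oo)%E ->
 ((rnorm ((fine (mu Y))%:C *: w + \sum_(i <- r) (fine (mu (B i `&` Y)))%:C *: T i))%:E <=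
 \int[mu]_(t in Y) (rnorm (sfold +%R B T r w t))%:E)%E.
elim: r Y w => [|i r IH] Y w mY fY.
 rewrite big_nil addr0 /sfold /= integral_cst //.
 rewrite rnZ rnr ger0_norm ?fine_ge0 // mulrC EFinM fineK //.
 by rewrite ge0_fin_numE.
have mI : measurable (Y `&` B i) by exact: measurableI.
have mD : measurable (Y `\` B i) by exact: measurableD.
have fI : (mu (Y `&` B i) < +oo)%E by apply: le_lt_trans fY; apply: le_measure; rewrite ?inE //; exact: subIsetl.
have fD : (mu (Y `\` B i) < +oo)%E by apply: le_lt_trans fY; apply: le_measure; rewrite ?inE //; exact: subDsetl.
have fin Z : measurable Z -> (mu Z < +oo)%E -> mu Z \is a fin_num by move=> _ fZ; rewrite ge0_fin_numE.
rewrite -[X in (\int[mu]_(_ in X) _)%E](setIDU Y (B i)) ge0_integral_setU //; first last.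
- by apply/disj_setPS => t [[_ ?] [_ ?]].
- by move=> t _; rewrite lee_fin rn_ge0.
- by rewrite setIDU; apply/measurable_EFinP; exact: mble_rn_smp.
have -> : (\int[mu]_(t in Y `&` B i) (rnorm (sfold +%R B T (i :: r) w t))%:E =
  \int[mu]_(t in Y `&` B i) (rnorm (sfold +%R B T r (w + T i) t))%:E)%E.
 by apply: eq_integral => t; rewrite inE /sfold /= => -[_ /mem_set ->].
have -> : (\int[mu]_(t in Y `\` B i) (rnorm (sfold +%R B T (i :: r) w t))%:E =
  \int[mu]_(t in Y `\` B i) (rnorm (sfold +%R B T r w t))%:E)%E.
 by apply: eq_integral => t; rewrite inE /sfold /= => -[_ /(@memNset _ (B i) t) ->].
apply: le_trans (leeD (IH _ (w + T i) mI fI) (IH _ w mD fD)).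
rewrite -EFinD lee_fin; apply: le_trans (rnD _ _); apply: eq_ler; congr rnorm.
have split A : measurable A -> fine (mu (A `&` Y)) = fine (mu (A `&` (Y `&` B i))) + fine (mu (A `&` (Y `\` B i))).
 move=> mA; rewrite -fineD.
 - congr fine; rewrite -measureU //.
  + by rewrite -setIUr setIDU.
  + exact: measurableI.
  + exact: measurableI.
  + by rewrite -subset0 => t [[_ [_ ?]] [_ [_ ?]]].
 - apply: fin; first exact: measurableI.
  by apply: le_lt_trans fI; apply: le_measure; rewrite ?inE //; exact: measurableI.
 - apply: fin; first exact: measurableI.
  by apply: le_lt_trans fD; apply: le_measure; rewrite ?inE //; exact: measurableI.
have eY : fine (mu Y) = fine (mu (Y `&` B i)) + fine (mu (Y `\` B i)).
 by have := split setT measurableT; rewrite !setTI.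
rewrite big_cons setIC eY (eq_bigr (fun j => (fine (mu (B j `&` (Y `&` B i))))%:C *: T j + (fine (mu (B j `&` (Y `\` B i))))%:C *: T j)); last first.
 by move=> j _; rewrite (split _ (mB j)) rmorphD /= scalerDl.
rewrite big_split /= rmorphD /= scalerDl scalerDr -!addrA; congr (_ + _).
rewrite [in RHS]addrA [RHS]addrC -!addrA.
by congr (_ + _); rewrite [RHS]addrC -addrA.
Qed.

End vector.

(** Operator norms are suprema over uncountable sets, so measurability is drawn from a Lipschitz
    bound: the set where [phi (g t) t < y] is the union, over rational values of [c] and of the
    second argument, of the sets where the Lipschitz majorant [bd] is below [y]. *)
Lemma mble_lipschitz (phi : C -> R -> R) (g : R -> C) (K L : R) X : measurable X ->
 (X `<=` [set t | 0 < t]) -> 0 <= K -> 0 <= L ->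
 measurable_fun X (fun t => Re (g t)) -> measurable_fun X (fun t => Im (g t)) ->
 (forall c c' t t', 0 < t -> 0 < t' -> `|phi c t - phi c' t'| <= K * rnorm (c - c') + rnorm c' * L * `|t - t'|) ->
 measurable_fun X (fun t => phi (g t) t).
move=> mX X0 K0 L0 mr mi hphi; apply: (measurability _ (RGenInftyO.measurableE R)) => //.
move=> _ [_ [y ->] <-].
pose cq (q : rat * rat) : C := ratr q.1 +i* ratr q.2.
pose bd (q : (rat * rat) * rat) t := phi (cq q.1) (ratr q.2) + K * (`|Re (g t) - ratr q.1.1| + `|Im (g t) - ratr q.1.2|) + rnorm (cq q.1) * L * `|t - ratr q.2|.
pose F (q : (rat * rat) * rat) := if 0 < q.2 then X `&` [set t | bd q t < y] else set0.
have -> : X `&` (fun t => phi (g t) t) @^-1` `]-oo, y[ = \bigcup_q F q.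
 apply/seteqP; split=> t /=; last first.
  move=> [q _]; rewrite /F; case: ifP => // q0 [Xt hb]; split=> //; rewrite in_itv /=.
  apply: le_lt_trans hb; rewrite /bd -addrA -lerBlDl.
  have q0' : 0 < ratr q.2 :> R by rewrite ltr0q.
  letr (ler_norm _); letr (hphi (g t) (cq q.1) t _ (X0 _ Xt) q0').
  rewrite lerD2r ler_wpM2l //; letr (rn_le _).
  by case: (g t) => u v.
 rewrite in_itv /= => -[Xt hy]; have t0 : 0 < t := X0 _ Xt.
 pose e := y - phi (g t) t; have e0 : 0 < e by rewrite subr_gt0.
 pose M := 1 + 4 * K + (rnorm (g t) + 2) * (2 * L).
 have M0 : 0 < M.
  have a1 : 0 <= 4 * K by rewrite mulr_ge0.
  have a2 : 0 <= (rnorm (g t) + 2) * (2 * L) by rewrite !mulr_ge0 ?addr_ge0.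
  by rewrite /M; lra.
 pose d := Num.min 1 (e / (2 * M)); have d0 : 0 < d by rewrite lt_min ltr01 divr_gt0 // mulr_gt0.
 have near (x : R) : exists q : rat, x < ratr q < x + d by apply: rat_in_itvoo; rewrite ltrDl.
 have [q1 /andP[a1 b1]] := near (Re (g t)); have [q2 /andP[a2 b2]] := near (Im (g t)).
 have [q3 /andP[a3 b3]] := near t.
 exists ((q1, q2), q3) => //; rewrite /F /=.
 have q30 : 0 < ratr q3 :> R := lt_trans t0 a3.
 rewrite ltr0q in q30; rewrite q30; split=> //; rewrite /bd /=.
 have d1 : `|Re (g t) - ratr q1| <= d by rewrite ler_norml; apply/andP; split; lra.
 have d2 : `|Im (g t) - ratr q2| <= d by rewrite ler_norml; apply/andP; split; lra.
 have d3 : `|t - ratr q3| <= d by rewrite ler_norml; apply/andP; split; lra.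
 have d1' : d <= 1 by rewrite ge_min lexx.
 have dc : rnorm (cq (q1, q2) - g t) <= 2 * d.
  rewrite rnB; letr (rn_le _).
  by move: d1 d2; rewrite /cq /=; case: (g t) => u v /=; lra.
 have nc : rnorm (cq (q1, q2)) <= rnorm (g t) + 2.
  rewrite -[cq _](subrK (g t)) addrC; letr (rnD _ _); rewrite lerD2l.
  by letr dc; lra.
 have hq := hphi (cq (q1, q2)) (g t) (ratr q3) t (lt_trans t0 a3) t0.
 have k1 := ler_wpM2l K0 dc; have k2 : rnorm (g t) * L * `|ratr q3 - t| <= (rnorm (g t) + 2) * L * d.
  by apply: ler_pM; rewrite ?mulr_ge0 // ?ler_wpM2r ?lerDl // distrC.
 have k3 : rnorm (cq (q1, q2)) * L * `|t - ratr q3| <= (rnorm (g t) + 2) * L * d.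
  by apply: ler_pM; rewrite ?mulr_ge0 // ler_wpM2r.
 have k4 : K * (`|Re (g t) - ratr q1| + `|Im (g t) - ratr q2|) <= K * (2 * d).
  by monol; lra.
 have k5 : d * M <= e / 2.
  have : d <= e / (2 * M) by rewrite ge_min lexx orbT.
  by rewrite -(ler_pM2r M0) => /le_trans; apply; apply: eq_ler; field; rewrite gt_eqF.
 have k6 := ler_norm (phi (cq (q1, q2)) (ratr q3) - phi (g t) t).
 have k7 : d * M = d + 4 * (K * d) + 2 * ((rnorm (g t) + 2) * L * d) by rewrite /M; ring.
 rewrite /e in k5 e0; lra.
apply: countable_bigcupT_measurable => // q; rewrite /F; case: ifP => // q0.
have mb : measurable_fun X (bd q).
 apply: measurable_funD; last first.
  apply: measurable_funM; first exact: measurable_cst.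
  apply: measurableT_comp => //; apply: measurable_funB; [exact: measurable_id|exact: measurable_cst].
 apply: measurable_funD; first exact: measurable_cst.
 apply: measurable_funM; first exact: measurable_cst.
 by apply: measurable_funD; apply: measurableT_comp => //; apply: measurable_funB => //; exact: measurable_cst.
exact: (mb mX `]-oo, y[%classic (measurable_itv _)).
Qed.

End simple_functions.

(** * Existence of Bochner integrals *)

Section bochner.
Variables (R : realType) (E : completeNormedModType R[i]).
Notation C := R[i].
Notation mu := (@lebesgue_measure R).
Notation X := (@halfline R).
Implicit Types (j k : nat) (t : R) (u : E).
Variables (h : R -> E -> E) (B : nat -> nat -> set R) (T : nat -> nat -> E -> E) (r : nat -> seq nat) (M : nat -> R).
Hypothesis mB : forall j i, measurable (B j i).
Hypothesis hB : forall j i, i \in r j -> B j i `<=` `]0, M j].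
Hypothesis bT : forall j i, bounded_op (T j i).
Hypothesis bh : forall t, X t -> bounded_op (h t).
Let s j := [seq (B j i, T j i) | i <- r j].
Let err j t := opnorm (fun u => h t u - simple_val (s j) t u).
Hypothesis merr : forall j, measurable_fun X (err j).
Hypothesis herr : (\int[mu]_(t in X) (err j t)%:E)%E @[j --> \oo] --> 0%E.

Let S j := simple_integral X (s j).

Lemma smp_valE j t u : simple_val (s j) t u = \sum_(i <- r j) (\1_(B j i) t)%:C *: T j i u.
by rewrite /simple_val big_map. Qed.

Lemma bdd_smp_val j t : bounded_op (simple_val (s j) t).
have -> : simple_val (s j) t = fun u => \sum_(i <- r j) (\1_(B j i) t)%:C *: T j i u.
 by ext u; rewrite smp_valE.
by apply: bop_sum => i; apply: bopZ.
Qed.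

Lemma smp_intE j : S j = fun u => \sum_(i <- r j) (fine (mu (B j i `&` X)))%:C *: T j i u.
by ext u; rewrite /S /simple_integral big_map. Qed.

Lemma bdd_smp_int j : bounded_op (S j).
by rewrite smp_intE; apply: bop_sum => i; apply: bopZ. Qed.

Lemma err_ge0 j t : X t -> 0 <= err j t.
by move=> Xt; apply: opnorm_ge0; apply: bopB (bh Xt) (bdd_smp_val j t). Qed.

(** Both simple integrals are compared on a bounded interval that contains the cells of each, where
    the measure is finite. The estimate is relative to [rnorm u], hence uniform on the unit ball. *)
Lemma smp_intB j k u : ((rnorm (S j u - S k u))%:E <=
 (\int[mu]_(t in X) (err j t)%:E + \int[mu]_(t in X) (err k t)%:E) * (rnorm u)%:E)%E.
pose Y : set R := `]0, Num.max (M j) (M k)]%classic.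
have mY : measurable Y by exact: measurable_itv.
have fY : (mu Y < +oo)%E.
 by rewrite /Y lebesgue_measure_itv /=; case: ifP => _; rewrite ?ltry //= -EFinD ltry.
have YX : Y `<=` X by move=> t; rewrite /Y /halfline /= !in_itv /= andbT => /andP[].
pose B' (i : nat + nat) := match i with inl i => B j i | inr i => B k i end.
pose T' (i : nat + nat) := match i with inl i => T j i u | inr i => - T k i u end.
pose r' := map inl (r j) ++ map inr (r k) : seq (nat + nat).
have mB' i : measurable (B' i) by case: i => i; exact: mB.
have := rn_smp_int mB' T' r' 0 mY fY.
rewrite scaler0 add0r big_cat !big_map /=.
have meas jj i : i \in r jj -> M jj <= Num.max (M j) (M k) -> B jj i `&` Y = B jj i `&` X.
 move=> hi hM; apply/seteqP; split=> t [Bt Yt]; split=> //; first exact: YX.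
 have := hB hi Bt; rewrite /Y /= !in_itv /= => /andP[-> h2].
 exact: le_trans hM.
have -> : \sum_(i <- r j) (fine (mu (B j i `&` Y)))%:C *: T j i u + \sum_(i <- r k) (fine (mu (B k i `&` Y)))%:C *: - T k i u = S j u - S k u.
 rewrite !smp_intE -sumrN; congr (_ + _); apply: eq_big_seq => i hi.
  by rewrite (meas j i hi) // le_max lexx.
 by rewrite (meas k i hi) ?scalerN // le_max lexx orbT.
move/le_trans; apply.
have mX : measurable X by exact: measurable_itv.
have e0 jj t : X t -> (0 <= (err jj t)%:E)%E by move=> Xt; rewrite lee_fin err_ge0.
have me jj : measurable_fun X (EFin \o err jj) by apply/measurable_EFinP.
rewrite -ge0_integralD //; [|exact: e0|exact: (me j)|exact: e0|exact: (me k)].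
rewrite -ge0_integralZr //; last 3 first.
- by apply: emeasurable_funD; exact: me.
- by move=> t Xt; rewrite adde_ge0 // e0.
- by rewrite lee_fin rn_ge0.
have mF : measurable_fun X (fun t => ((err j t)%:E + (err k t)%:E) * (rnorm u)%:E)%E.
 by apply: emeasurable_funM; [apply: emeasurable_funD; exact: me|exact: measurable_cst].
apply: (@le_trans _ _ (\int[mu]_(t in Y) (((err j t)%:E + (err k t)%:E) * (rnorm u)%:E))%E); last first.
 by apply: ge0_subset_integral => // t Xt; rewrite mule_ge0 ?lee_fin ?rn_ge0 ?addr_ge0 ?err_ge0.
apply: ge0_le_integral => //.
- by move=> t _; rewrite lee_fin rn_ge0.
- by apply/measurable_EFinP; exact: mble_rn_smp.
- by apply: measurable_funS mF.
move=> t /YX Xt; rewrite smp_fold_sum add0r big_cat !big_map /= -EFinD -EFinM lee_fin mulrDl.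
have -> : \sum_(i <- r j) (\1_(B j i) t)%:C *: T j i u + \sum_(i <- r k) (\1_(B k i) t)%:C *: - T k i u =
  - (h t u - simple_val (s j) t u) + (h t u - simple_val (s k) t u).
 rewrite !smp_valE opprB addrA subrK -sumrN; congr (_ + _); apply: eq_bigr => i _.
 by rewrite scalerN.
letr (rnD _ _); rewrite rnN.
by apply: lerD; apply: (opnorm_ge u); apply: bopB (bh Xt) (bdd_smp_val _ t).
Qed.

Lemma smp_int_cauchy (e : R) : 0 < e ->
 exists J, forall j k u, (J <= j)%N -> (J <= k)%N -> rnorm (S j u - S k u) <= e * rnorm u.
move=> e0; have e2 : 0 < e / 2 by rewrite divr_gt0.
have : \forall j \near \oo, ((\int[mu]_(t in X) (err j t)%:E)%E < (e / 2)%:E)%E.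
 have /fine_cvgP[hfin /cvgrPdist_lt/(_ _ e2) hlt] := herr.
 apply: filterS2 hfin hlt => j fj; rewrite /= sub0r normrN => hj.
 by rewrite -(fineK fj) lte_fin (le_lt_trans (ler_norm _) hj).
move=> [J _ hJ]; exists J => j k u Jj Jk; rewrite -lee_fin; letr (smp_intB j k u).
rewrite EFinM; apply: lee_wpmul2r; first by rewrite lee_fin rn_ge0.
by rewrite [in leRHS](splitr e) EFinD; apply: leeD; apply: ltW; exact: hJ.
Qed.

Lemma smp_int_cvg (u : E) : exists v : E, forall e : R, 0 < e ->
 exists J, forall j, (J <= j)%N -> rnorm (S j u - v) <= e.
have cS : cauchy (S j u @[j --> \oo]).
 apply: cauchy_exP => e e0.
 have e0' : 0 < Re e by move: e0; rewrite ltcE /= => /andP[].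
 have eE : e = (Re e)%:C by move: e0; rewrite ltcE /= => /andP[/eqP i0 _]; rewrite [LHS]complexE i0 mulr0 addr0.
 have d0 : 0 < Re e / (rnorm u + 1) by rewrite divr_gt0 // ltr_wpDl.
 have [J hJ] := smp_int_cauchy d0; exists (S J u).
 exists J => // j /= Jj; rewrite -ball_normE /= rnE eE ltcR.
 apply: le_lt_trans (hJ J j u (leqnn _) Jj) _.
 by rewrite mulrAC ltr_pdivrMr ?ltr_pM2l ?ltrDl // ltr_wpDl.
have /cauchy_cvg/cvg_ex[v hv] := cS; exists v => e e0.
have eC : 0 < e%:C by rewrite ltcR.
have /cvgrPdist_le/(_ _ eC)[J _ hJ] := hv; exists J => j Jj.
by have := hJ j Jj; rewrite /= rnE lecR rnB.
Qed.

(** Completeness gives a limit for each [u]; the Cauchy estimate relative to [rnorm u] makes it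
    linear, bounded and a limit in operator norm. *)
Lemma bochner_limit : (forall j i, (mu (B j i) < +oo)%E) -> exists I : E -> E,
 is_bochner_integral X h I /\ opnorm (fun u => I u - S j u) @[j --> \oo] --> (0 : R).
move=> muB; have /choice[I hI] := smp_int_cvg.
have close (e : R) : 0 < e -> exists J, forall j u, (J <= j)%N -> rnorm (I u - S j u) <= e * rnorm u.
 move=> e0; have [J hJ] := smp_int_cauchy e0; exists J => j u Jj.
 apply/ler_addgt0Pr => d d0; have [J' hJ'] := hI u d d0.
 have -> : I u - S j u = (S (maxn J J') u - S j u) + (I u - S (maxn J J') u) by rewrite [RHS]addrC addrA subrK.
 letr (rnD _ _); apply: lerD; first by apply: hJ => //; rewrite leq_maxl.
 by rewrite rnB; apply: hJ'; rewrite leq_maxr.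
have linS j : linear (S j) by have [] := bdd_smp_int j.
have linI : linear I.
 move=> c u v; apply/eqP; rewrite -subr_eq0 -rn_eq0; apply/eqP/le_anti; rewrite rn_ge0 andbT.
 apply/ler_addgt0Pr => e e0; rewrite add0r.
 pose W := rnorm (c *: u + v) + (rnorm c * rnorm u + rnorm v) + 1.
 have W0 : 0 < W by rewrite ltr_wpDl // !addr_ge0 ?mulr_ge0.
 have [J hJ] := close _ (divr_gt0 e0 W0).
 have -> : I (c *: u + v) - (c *: I u + I v) =
  (I (c *: u + v) - S J (c *: u + v)) - (c *: (I u - S J u) + (I v - S J v)).
  by rewrite linS scalerBr [X in _ = _ - X]addrACA -opprD sub_subACA subrr subr0.
 letr (rnD _ _); rewrite rnN.
 letr (lerD (hJ J _ (leqnn J)) (rnD _ _)); rewrite rnZ.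
 have k1 := ler_wpM2l (rn_ge0 c) (hJ J u (leqnn J)).
 letr (lerD (lexx _) (lerD k1 (hJ J v (leqnn J)))).
 have -> : e / W * rnorm (c *: u + v) + (rnorm c * (e / W * rnorm u) + e / W * rnorm v) = e / W * (W - 1).
  by rewrite /W; ring.
 by rewrite mulrAC ler_pdivrMr // ler_pM2l // gerBl.
have bI : bounded_op I.
 split=> //; have [J hJ] := close 1 ltr01; have bS := bdd_smp_int J.
 exists (opnorm (S J) + 1) => u; rewrite -[I u](subrK (S J u)) addrC mulrDl.
 by letr (rnD _ _); apply: lerD; [exact: opnorm_ge|exact: hJ].
have cvg0 : opnorm (fun u => I u - S j u) @[j --> \oo] --> (0 : R).
 apply/cvgrPdist_le => e e0; have [J hJ] := close e e0; exists J => // j /= Jj.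
 rewrite sub0r normrN ger0_norm; first by apply: opnorm_le; [exact: ltW|move=> u; exact: hJ].
 by apply: opnorm_ge0; apply: bopB bI (bdd_smp_int j).
exists I; split=> //; split=> //; exists s; split=> //.
move=> j i; rewrite size_map => hi BT; rewrite /BT (nth_map 0%N) //=.
Qed.

End bochner.

(** * The resolvent integral along a ray *)

Section decay.
Variable R : realType.
Notation mu := (@lebesgue_measure R).

Lemma cvg_powR_infty (d : R) : 0 < d -> (1 + x) `^ (- d) @[x --> +oo] --> (0 : R).
move=> d0; apply/cvgrPdist_le => e e0.
exists (e `^ (- d^-1)); split; first exact: num_real.
move=> x hx; have x0 : 0 < x := le_lt_trans (powR_ge0 _ _) hx.
rewrite sub0r normrN ger0_norm //.
have -> : e = (e `^ (- d^-1)) `^ (- d) by rewrite -powRrM mulrNN mulVf ?gt_eqF // powRr1 // ltW.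
have p0 : 0 < e `^ (- d^-1) by rewrite powR_gt0.
move: (e `^ (- d^-1)) p0 hx => p p0 px; rewrite !powRN lef_pV2 ?posrE ?powR_gt0 ?addr_gt0 //.
by apply: ge0_ler_powR; rewrite ?nnegrE ?addr_ge0 // ltW //; lra.
Qed.

Lemma itble_decay (d : R) : 0 < d ->
 mu.-integrable `]0, +oo[ (fun t => ((1 + t) `^ (- 1 - d))%:E).
move=> d0; apply: (@integrableS _ _ _ mu `[0, +oo[) => //.
 by move=> x; rewrite /= !in_itv /= !andbT => /ltW.
have der (x : R) : 0 <= x -> is_derive x (1 : R) (fun x => - (d^-1 * (1 + x) `^ (- d))) ((1 + x) `^ (- 1 - d)).
 move=> x0; have x1 : 0 < 1 + x by rewrite ltr_pwDl.
 have h1 : is_derive x (1 : R) (fun x : R => 1 + x) 1.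
  apply: (is_derive_eq (is_deriveD (is_derive_cst (1 : R) x (1 : R)) (is_derive_id x (1 : R)))).
  by rewrite add0r.
 have h2 := is_derive1_comp (@is_derive1_powR R (- d) (1 + x) x1) h1.
 have := is_deriveN (is_deriveM (is_derive_cst (d^-1 : R) x (1 : R)) h2).
 move/is_derive_eq; apply.
 by rewrite scaler0 addr0 /GRing.scale /= /cst mulr1 (_ : - d - 1 = - 1 - d) ?[- d - 1]addrC // mulNr mulrN opprK mulrA mulVf ?mul1r // gt_eqF.
have cont (x : R) : 0 <= x -> {for x, continuous (fun t : R => (1 + t) `^ (- 1 - d))}.
 move=> x0; have x1 : 0 < 1 + x by rewrite ltr_pwDl.
 have h1 : {for x, continuous (fun t : R => 1 + t)} by apply: cvgD; [exact: cvg_cst|exact: cvg_id].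
 have h2 : {for 1 + x, continuous (fun y : R => y `^ (- 1 - d))}.
  by apply: differentiable_continuous; apply/derivable1_diffP; have [] := @is_derive1_powR R (- 1 - d) (1 + x) x1.
 exact: (continuous_comp h1 h2).
apply/integrableP; split.
 apply/measurable_EFinP; apply: subspace_continuous_measurable_fun => //.
 by apply: continuous_in_subspaceT => x; rewrite inE /= in_itv /= andbT; exact: cont.
have -> : (\int[mu]_(x in `[0%R, +oo[) `|((1 + x) `^ (- 1 - d))%:E| = \int[mu]_(x in `[0%R, +oo[) ((1 + x) `^ (- 1 - d))%:E)%E.
 by apply: eq_integral => t _; rewrite gee0_abs // lee_fin powR_ge0.
rewrite (@ge0_continuous_FTC2y R _ (fun x => - (d^-1 * (1 + x) `^ (- d))) 0 0) ?ltry //.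
- by apply: continuous_in_subspaceT => x; rewrite inE /= in_itv /= andbT; exact: cont.
- have := cvgN (cvgM (cvg_cst d^-1) (cvg_powR_infty d0)); rewrite mulr0 oppr0; exact.
- by move=> x /ltW x0; have [] := der x x0.
- have [dd _] := der 0 (lexx 0); apply: cvg_at_right_filter.
 have cd : {for (0 : R), continuous (fun x : R => - (d^-1 * (1 + x) `^ (- d)))}.
  by apply: differentiable_continuous; apply/derivable1_diffP; exact: dd.
 exact: cd.
- move=> x; rewrite in_itv /= andbT => /ltW x0; rewrite derive1E; have [_ e] := der x x0; exact: e.
Qed.

End decay.

Section ray_integral.
Variables (R : realType) (E : completeNormedModType R[i]).
Notation C := R[i].
Notation mu := (@lebesgue_measure R).
Notation X := (@halfline R).
Variables (K d c : R).
Hypotheses (K0 : 0 <= K) (d0 : 0 < d) (c0 : 0 <= c).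
Variables (Rs : R -> E -> E) (g : R -> C).
Hypothesis bRs : forall t, 0 <= t -> bounded_op (Rs t).
Hypothesis hRs : forall t u, 0 <= t -> rnorm (Rs t u) <= K / (1 + t) * rnorm u.
Hypothesis lRs : forall t t' u, 0 <= t -> 0 <= t' -> rnorm (Rs t u - Rs t' u) <= K ^+ 2 * `|t - t'| * rnorm u.
Hypotheses (mgr : measurable_fun X (fun t => Re (g t))) (mgi : measurable_fun X (fun t => Im (g t))).
Variables (h : nat -> R) (N : nat -> nat) (v : nat -> nat -> C).
Hypothesis h0 : forall j, 0 < h j <= 1.
Hypothesis hcvg : forall e : R, 0 < e -> exists J, forall j, (J <= j)%N -> h j < e.
Hypothesis hN : forall t : R, exists J, forall j, (J <= j)%N -> t < (N j)%:R * h j.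
Hypothesis hv : forall j i, (0 < i < N j)%N -> rnorm (v j i) <= c * (1 + i%:R * h j) `^ (- d).
Hypothesis hg : {ae mu, forall t, 0 < t -> rnorm (g t) <= c * (1 + t) `^ (- d) /\
 forall e : R, 0 < e -> exists J, forall j i, (J <= j)%N -> (0 < i < N j)%N ->
  i%:R * h j < t <= i.+1%:R * h j -> rnorm (v j i - g t) <= e}.

Let B j i : set R := `](i%:R * h j), (i.+1%:R * h j)]%classic.
Let T j i : E -> E := fun u => v j i *: Rs (i%:R * h j) u.
(** Index 0 is left out, since samples are provided from the radius [h] on. The omitted cell has
    length [h j] and eventually misses every fixed [t]. *)
Let r j := index_iota 1 (N j).

Lemma cell_index j (t : R) : 0 < t -> exists i, B j i t.
move=> t0; have /andP[hj _] := h0 j.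
have ex : exists n, t <= n.+1%:R * h j.
 exists (Num.truncn (t / h j)); rewrite -ler_pdivrMr //; exact: ltW (truncnS_gt _).
case: (ex_minnP ex) => i hi mini; exists i; rewrite /B /= in_itv /= hi andbT.
case: i hi mini => [|i] hi mini; first by rewrite mul0r.
by rewrite ltNge; apply/negP => /mini; rewrite ltnn.
Qed.

Lemma cell_unique j i i' (t : R) : B j i t -> B j i' t -> i = i'.
have /andP[hj _] := h0 j; rewrite /B /= !in_itv /= => /andP[a1 a2] /andP[b1 b2].
have := lt_le_trans a1 b2; rewrite ltr_pM2r // ltr_nat ltnS => l1.
have := lt_le_trans b1 a2; rewrite ltr_pM2r // ltr_nat ltnS => l2.
by apply/eqP; rewrite eqn_leq l1 l2.
Qed.

Lemma cell_sum (W : lmodType C) j i (t : R) (F : nat -> W) : B j i t ->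
 \sum_(i' <- r j) (\1_(B j i') t)%:C *: F i' = if (0 < i < N j)%N then F i else 0.
move=> Bt; have z i' : i' != i -> (\1_(B j i') t)%:C *: F i' = 0.
 move=> ii'; rewrite indicE memNset ?rmorph0 ?scale0r // => Bt'.
 by rewrite (cell_unique Bt' Bt) eqxx in ii'.
case: ifP => hi.
 rewrite (bigD1_seq i) ?mem_index_iota ?iota_uniq //= big1 ?addr0.
  by rewrite indicE mem_set // rmorph1 scale1r.
 by move=> i' /z.
rewrite big_seq big1 // => i' hi'; apply: z; apply/eqP => e.
by rewrite mem_index_iota e hi in hi'.
Qed.

Lemma bdd_cell j i : bounded_op (T j i).
by apply: bopZ; apply: bRs; rewrite mulr_ge0 //; have /andP[/ltW] := h0 j. Qed.

Lemma opnormB_dist (P Q S : E -> E) : bounded_op P -> bounded_op Q -> bounded_op S ->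
 `|opnorm (fun u => P u - S u) - opnorm (fun u => Q u - S u)| <= opnorm (fun u => P u - Q u).
move=> bP bQ bS; have bPS := bopB bP bS; have bQS := bopB bQ bS.
have h1 := opnormB_le bPS bQS; have h2 := opnormB_le bQS bPS.
have cancel (F G : E -> E) : opnorm (fun u => (F u - S u) - (G u - S u)) = opnorm (fun u => F u - G u).
 by congr opnorm; ext u; rewrite sub_subACA subrr subr0.
rewrite cancel in h1; rewrite cancel (opnormC Q P) in h2.
by rewrite ler_norml; apply/andP; split; lra.
Qed.

Lemma opnorm_scaleB (a a' : C) (t t' : R) : 0 <= t -> 0 <= t' ->
 opnorm (fun u => a *: Rs t u - a' *: Rs t' u) <= K / (1 + t) * rnorm (a - a') + rnorm a' * K ^+ 2 * `|t - t'|.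
move=> t0 t0'; apply: opnorm_le.
 by rewrite addr_ge0 ?mulr_ge0 // ?invr_ge0 addr_ge0.
move=> u; have -> : a *: Rs t u - a' *: Rs t' u = (a - a') *: Rs t u + a' *: (Rs t u - Rs t' u).
 by rewrite scalerBl scalerBr addrA subrK.
letr (rnD _ _); rewrite !rnZ mulrDl; apply: lerD.
 by rewrite mulrAC mulrC; apply: ler_wpM2r; [by []|exact: hRs].
rewrite -2!mulrA; apply: ler_wpM2l; first by [].
by have := lRs u t0 t0'; rewrite -mulrA.
Qed.

Lemma mble_err j :
 measurable_fun X (fun t => opnorm (fun u => g t *: Rs t u - simple_val [seq (B j i, T j i) | i <- r j] t u)).
have X0 : X `<=` [set t | 0 < t] by move=> t; rewrite /halfline /= in_itv /= andbT.
have mX : measurable X by exact: measurable_itv.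
pose Phi (w : E -> E) (t : R) := opnorm (fun u => g t *: Rs t u - w u).
pose add (w w' : E -> E) : E -> E := fun u => w u + w' u.
have foldE s w t u : sfold add (B j) (T j) s w t u = w u + simple_val [seq (B j i, T j i) | i <- s] t u.
 rewrite /simple_val big_map -(@smp_fold_sum R E nat (B j) (fun i => T j i u)).
 by elim: s w => [|i s IH] w //; rewrite /sfold /= -/(sfold _ _ _ _ _ _) IH; case: ifP.
have -> : (fun t => opnorm (fun u => g t *: Rs t u - simple_val [seq (B j i, T j i) | i <- r j] t u)) =
  fun t => Phi (sfold add (B j) (T j) (r j) (fun _ => 0) t) t.
 by ext t; rewrite /Phi; congr opnorm; ext u; rewrite foldE add0r.
apply: (@mble_smp_fold R nat (E -> E) add (B j) (T j) (@bounded_op R E) Phi X) => //.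
- by move=> i; exact: measurable_itv.
- by move=> w i bw; apply: bopD bw (bdd_cell j i).
- move=> w bw; apply: (@mble_lipschitz R (fun a t => opnorm (fun u => a *: Rs t u - w u)) g K (K ^+ 2) X) => //.
 move=> a a' t t' t0 t0'; have b1 := bopZ a (bRs (ltW t0)); have b2 := bopZ a' (bRs (ltW t0')).
 letr (opnormB_dist b1 b2 bw); letr (opnorm_scaleB a a' (ltW t0) (ltW t0')).
 rewrite lerD2r ler_wpM2r // ler_piMr // invf_le1 ?lerDl ?ltW //; by rewrite ltr_pwDl // ltW.
- exact: bop0.
Qed.

(** Dominated convergence for the operator norm of the error. At almost every [t] the samples
    approach [g t] while the Lipschitz bound on [Rs] controls the move of [t] to a node; the
    majorant is a multiple of [(1 + t)^(-1 - d)]. *)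
Lemma ray_integral : exists I : E -> E,
 is_bochner_integral X (fun t u => g t *: Rs t u) I /\
 opnorm (fun u => I u - \sum_(i <- r j) (h j)%:C *: (v j i *: Rs (i%:R * h j) u)) @[j --> \oo] --> (0 : R).
have X0 t : X t -> 0 < t by rewrite /halfline /= in_itv /= andbT.
have mX : measurable X by exact: measurable_itv.
have mB j i : measurable (B j i) by exact: measurable_itv.
have hB j i : i \in r j -> B j i `<=` `]0, (N j)%:R * h j]%classic.
 rewrite mem_index_iota => /andP[i1 iN] t; have /andP[hj _] := h0 j.
 rewrite /B /= !in_itv /= => /andP[a1 a2]; apply/andP; split.
  by apply: le_lt_trans a1; rewrite mulr_ge0 // ltW.
 by letr a2; rewrite ler_pM2r // ler_nat.
have bh t : X t -> bounded_op (fun u => g t *: Rs t u).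
 by move=> /X0/ltW t0; apply: bopZ; exact: bRs.
have muB j i : mu (B j i) = (h j)%:E.
 have /andP[hj _] := h0 j; rewrite lebesgue_measure_itv /= lte_fin ltr_pM2r // ltr_nat ltnSn -EFinD.
 by congr EFin; rewrite -natr1; ring.
pose err j t := opnorm (fun u => g t *: Rs t u - simple_val [seq (B j i, T j i) | i <- r j] t u).
have errE j i t : 0 < t -> B j i t -> err j t = if (0 < i < N j)%N then opnorm (fun u => g t *: Rs t u - v j i *: Rs (i%:R * h j) u)
  else opnorm (fun u => g t *: Rs t u).
 move=> t0 Bt; rewrite /err; case: ifP => hi; congr opnorm; ext u;
 by rewrite smp_valE (cell_sum (fun i => T j i u) Bt) hi ?subr0.
have gR (t : R) u : 0 < t -> rnorm (g t) <= c * (1 + t) `^ (- d) ->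
  rnorm (g t *: Rs t u) <= K * c * (1 + t) `^ (- 1 - d) * rnorm u.
 move=> t0 gt; rewrite rnZ.
 have -> : (1 + t) `^ (- 1 - d) = (1 + t) `^ (- d) / (1 + t).
  have t1 : 0 < 1 + t by rewrite ltr_pwDl // ltW.
  by rewrite [- 1 - d]addrC powRD ?(gt_eqF t1) ?implybT // powR_inv1 // ltW.
 letr (ler_rnM gt (hRs u (ltW t0))).
 by apply: eq_ler; ring.
have herr : (\int[mu]_(t in X) (err j t)%:E)%E @[j --> \oo] --> 0%E.
 (* [K * c] bounds the integrand. The other summand bounds the simple function, whose bounds hold at
    the left end [p] of the cell: [1 + t <= 2 (1 + p)] because [h <= 1], which costs the factors [2]
    and [2^d]. *)
 pose G t := (K * c + 2 * K * c * 2 `^ d) * (1 + t) `^ (- 1 - d).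
 have iG : mu.-integrable X (EFin \o G).
  rewrite [X in integrable _ _ X](_ : _ = (fun t => (K * c + 2 * K * c * 2 `^ d)%:E * ((1 + t) `^ (- 1 - d))%:E)%E) //.
  by apply: integrableZl => //; exact: itble_decay.
 have [|||||i _ H] := @dominated_convergence _ _ _ mu X mX (fun j t => (err j t)%:E) (fun _ => 0%E) (EFin \o G).
 - by move=> j; apply/measurable_EFinP; exact: mble_err.
 - exact: measurable_cst.
 - apply: (@filterS _ _ (ae_filter_ringOfSetsType mu) _ _ _ hg) => t Ht /X0 t0; have [gt lt] := Ht t0.
  apply: cvg_EFin; first exact: nearW.
  apply/cvgrPdist_le => e e0.
  have q0 : 0 < e / (2 * (K + 1)) by rewrite divr_gt0 // mulr_gt0 // ltr_wpDl.
  have [J1 hJ1] := lt _ q0; have [J2 hJ2] := hcvg t0; have [J3 hJ3] := hN t.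
  have w0 : 0 < e / (2 * ((rnorm (g t) + e / (2 * (K + 1))) * K ^+ 2 + 1)) by rewrite divr_gt0 // mulr_gt0 // ltr_wpDl // mulr_ge0 // addr_ge0 // ltW.
  have [J4 hJ4] := hcvg w0.
  exists (maxn (maxn J1 J2) (maxn J3 J4)) => // j /=; rewrite !geq_max => /andP[/andP[j1 j2] /andP[j3 j4]].
  have /andP[hj _] := h0 j; have [i Bt] := cell_index j t0.
  have /andP[b1 b2] : i%:R * h j < t <= i.+1%:R * h j by move: Bt; rewrite /B /= in_itv.
  have iN : (0 < i < N j)%N.
  apply/andP; split; first by case: i Bt b1 b2 => // _ _; rewrite mul1r leNgt hJ2.
  by have := lt_trans b1 (hJ3 j j3); rewrite ltr_pM2r // ltr_nat.
  rewrite (errE j i t t0 Bt) iN sub0r normrN ger0_norm; last first.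
  by apply: opnorm_ge0; apply: bopB (bh t _) (bdd_cell j i); rewrite /halfline /= in_itv /= t0.
  have ih0 : 0 <= i%:R * h j by rewrite mulr_ge0 // ltW.
  letr (opnorm_scaleB (g t) (v j i) (ltW t0) ih0).
  have vg := hJ1 j i j1 iN (introT andP (conj b1 b2)).
  have k1 : K / (1 + t) <= K + 1.
  rewrite ler_pdivrMr; last by rewrite ltr_pwDl // ltW.
  by have := mulr_ge0 K0 (ltW t0); lra.
  have nv : rnorm (v j i) <= rnorm (g t) + e / (2 * (K + 1)).
  by rewrite -[v j i](subrK (g t)) addrC; letr (rnD _ _); rewrite lerD2l.
  rewrite [leRHS](splitr e); apply: lerD.
  rewrite rnB; have -> : e / 2 = (K + 1) * (e / (2 * (K + 1))) by field; rewrite gt_eqF // ltr_wpDl.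
  by apply: ler_pM; rewrite // divr_ge0 // addr_ge0 // ltW.
  set W := (rnorm (g t) + e / (2 * (K + 1))) * K ^+ 2.
  have W0 : 0 <= W by rewrite /W mulr_ge0 // addr_ge0 // ltW.
  have td : `|t - i%:R * h j| <= e / (2 * (W + 1)).
  rewrite ger0_norm ?subr_ge0 ?ltW //; apply: le_lt_trans (hJ4 j j4).
  by rewrite lerBlDl; move: b2; rewrite -natr1 mulrDl mul1r.
  apply: le_trans (_ : (W + 1) * (e / (2 * (W + 1))) <= _).
  apply: ler_pM => //; first by rewrite mulr_ge0.
  by apply: le_trans (_ : W <= _); rewrite ?lerDl // ler_wpM2r ?sqr_ge0.
  by apply: eq_ler; field; rewrite gt_eqF // ltr_wpDl.
 - exact: iG.
 - apply: (@filterS _ _ (ae_filter_ringOfSetsType mu) _ _ _ hg) => t Ht j /X0 t0 /=; have [gt _] := Ht t0; rewrite lee_fin.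
  have [i Bt] := cell_index j t0; have /andP[hj hj1] := h0 j.
  have /andP[b1 b2] : i%:R * h j < t <= i.+1%:R * h j by move: Bt; rewrite /B /= in_itv.
  have Xt : X t by rewrite /halfline /= in_itv /= t0.
  have e0 : 0 <= err j t.
  by rewrite (errE j i t t0 Bt); case: ifP => _; apply: opnorm_ge0; [apply: bopB (bh t Xt) (bdd_cell j i)|exact: bh].
  rewrite (ger0_norm e0).
  rewrite (errE j i t t0 Bt) /G mulrDl.
  have P0 : 0 <= (1 + t) `^ (- 1 - d) by [].
  have Q0 : 0 <= 2 * K * c * 2 `^ d * (1 + t) `^ (- 1 - d) by rewrite !mulr_ge0.
  case: ifP => iN; apply: opnorm_le; rewrite ?addr_ge0 ?mulr_ge0 // => u; last first.
  by letr (gR t u t0 gt); monor; rewrite lerDl.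
  rewrite mulrDl; letr (rnD _ _); rewrite rnN; apply: lerD; first exact: gR.
  have ih0 : 0 <= i%:R * h j by rewrite mulr_ge0 // ltW.
  rewrite rnZ; letr (ler_rnM (hv iN) (hRs u ih0)).
  set p := i%:R * h j in ih0 b1 *; have p1 : 0 < 1 + p by rewrite ltr_pwDl.
  have t1 : 0 < 1 + t by rewrite ltr_pwDl // ltW.
  have tp : 1 + t <= 2 * (1 + p) by move: b2; rewrite -natr1 mulrDl mul1r -/p; lra.
  have e1 : (1 + p) `^ (- d) <= 2 `^ d * (1 + t) `^ (- d).
  have le : (1 + t) `^ d <= (2 * (1 + p)) `^ d.
  apply: ge0_ler_powR => //; [exact: ltW|rewrite nnegrE; exact: ltW|rewrite nnegrE mulr_ge0 //; exact: ltW].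
  rewrite powRM // in le; last exact: ltW.
  by rewrite !powRN ler_pdivlMr ?powR_gt0 // ler_pdivrMl ?powR_gt0 // [_ `^ d * _ in leRHS]mulrC.
  have e2 : (1 + p)^-1 <= 2 * (1 + t)^-1 by rewrite ler_pdivlMr // ler_pdivrMl // mulrC.
  have -> : (1 + t) `^ (- 1 - d) = (1 + t) `^ (- d) * (1 + t)^-1.
  by rewrite [- 1 - d]addrC powRD ?(gt_eqF t1) ?implybT // powR_inv1 // ltW.
  have i0 : 0 <= (1 + p)^-1 by rewrite invr_ge0 ltW.
  have e3 := ler_pM (powR_ge0 _ _) i0 e1 e2.
  have kc : 0 <= K * c * rnorm u by rewrite !mulr_ge0.
  apply: (le_trans _ (le_trans (ler_wpM2l kc e3) _)); apply: eq_ler; ring.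
 by move: H; rewrite integral0.
have [I [bI cI]] := bochner_limit mB hB (fun j i => bdd_cell j i) bh (fun j => mble_err j) herr
 (fun j i => eq_ind_r (fun x => (x < +oo)%E) (ltry _) (muB j i)).
exists I; split=> //.
have -> : (fun j => opnorm (fun u => I u - \sum_(i <- r j) (h j)%:C *: (v j i *: Rs (i%:R * h j) u))) =
  fun j => opnorm (fun u => I u - simple_integral X [seq (B j i, T j i) | i <- r j] u); last exact: cI.
ext j; congr opnorm; ext u; congr (_ - _); apply: esym.
rewrite /simple_integral big_map; apply: eq_big_seq => i; rewrite mem_index_iota => /andP[i1 iN].
have BX : B j i `&` X = B j i.
 apply/setIidPl => t; rewrite /B /halfline /= !in_itv /= andbT => /andP[a _]; apply: le_lt_trans a.
 by rewrite mulr_ge0 //; have /andP[/ltW] := h0 j.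
by rewrite BX muB.
Qed.

End ray_integral.

(** * Bounds of Riemann sums *)

Section riemann_sums.
Variable R : realType.
Implicit Types (h q d : R).

(** A Riemann sum of [q / (q + t)^2], whose integral is 1: each term is at most an increment of the
    primitive [t / (q + t)] over the cell to the left of the node. *)
Lemma sum_ker h q i0 i1 : 0 < h -> 0 < q -> (0 < i0)%N ->
 \sum_(i0 <= i < i1) h * (q / (q + i%:R * h) ^+ 2) <= 1.
move=> h0 q0 i00; have [i10|/ltnW i01] := leqP i1 i0; first by rewrite big_geq.
pose F i := (i%:R - 1) * h / (q + (i%:R - 1) * h).
have den i : (0 < i)%N -> 0 < q + (i%:R - 1) * h.
 by move=> hi; rewrite ltr_wpDr // mulr_ge0 ?subr_ge0 ?ler1n // ltW.
apply: le_trans (_ : \sum_(i0 <= i < i1) (F i.+1 - F i) <= _).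
 rewrite big_nat_cond [leRHS]big_nat_cond; apply: ler_sum => i; rewrite andbT => /andP[hi _].
 have ip : (0 < i)%N := leq_trans i00 hi.
 have d1 := den i ip; have d2 := den i.+1 isT; rewrite /F -natr1 addrK in d2 *.
 have -> : i%:R * h / (q + i%:R * h) - (i%:R - 1) * h / (q + (i%:R - 1) * h) =
  h * (q / ((q + i%:R * h) * (q + (i%:R - 1) * h))) by field; rewrite !gt_eqF.
 rewrite ler_pM2l // ler_pM2l // lef_pV2 ?posrE ?exprn_gt0 ?mulr_gt0 // expr2 ler_pM2l //.
 by rewrite lerD2l ler_pM2r // gerBl.
rewrite telescope_sumr //.
have F1 : F i1 <= 1.
 by rewrite /F ler_pdivrMr ?mul1r ?lerDr ?ltW //; apply: den; exact: leq_trans i01.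
have F0 : 0 <= F i0 by rewrite /F divr_ge0 ?mulr_ge0 ?subr_ge0 ?ler1n // ltW // den.
by lra.
Qed.

(** A Riemann sum of [t^(-1 - d)] against the primitive [-t^(-d) / d], over the cell to the left of
    the node; [2^d] arises because the shifted lower end is still at least [1/2]. *)
Lemma sum_powR h d i0 i1 : 0 < h <= 1 -> 0 < d -> 1 <= i0%:R * h -> (1 < i0)%N ->
 \sum_(i0 <= i < i1) h * (i%:R * h) `^ (- 1 - d) <= d^-1 * 2 `^ d.
move=> /andP[h0 h1] d0 i0h i02; have [i10|/ltnW i01] := leqP i1 i0.
 by rewrite big_geq // mulr_ge0 // invr_ge0 ltW.
pose F i := - (d^-1 * ((i%:R - 1) * h) `^ (- d)).
apply: le_trans (_ : \sum_(i0 <= i < i1) (F i.+1 - F i) <= _).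
 rewrite big_nat_cond [leRHS]big_nat_cond; apply: ler_sum => i; rewrite andbT => /andP[hi _].
 have ip : (1 < i)%N := leq_trans i02 hi.
 have p1 : 0 < i%:R :> R by rewrite ltr0n ltnW.
 have p2 : 0 < (i%:R - 1 : R) by rewrite subr_gt0 ltr1n.
 set x := i%:R * h; have x0 : 0 < x by rewrite mulr_gt0.
 set s := (i%:R - 1) / i%:R : R; have s0 : 0 < s by rewrite divr_gt0.
 have xE : (i%:R - 1) * h = s * x by rewrite /s /x; field; rewrite gt_eqF.
 rewrite /F -natr1 addrK -/x xE powRM ?(ltW s0) ?(ltW x0) // opprK [leRHS]addrC.
 have -> : x `^ (- 1 - d) = x `^ (- d) / x.
  by rewrite [- 1 - d]addrC powRD ?(gt_eqF x0) ?implybT // powR_inv1 // ltW.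
 have key : d / i%:R <= s `^ (- d) - 1.
  have : 1 + (- d * ln s) <= s `^ (- d).
  by rewrite /powR gt_eqF // expR_ge1Dx.
  have ls : ln s <= s - 1.
  have := expR_ge1Dx (ln s); rewrite lnK ?posrE //; lra.
  have sE : s - 1 = - (i%:R)^-1 by rewrite /s; field; rewrite gt_eqF.
  have := ler_wpM2l (ltW d0) ls; rewrite sE mulrN mulNr; lra.
 have -> : h * (x `^ (- d) / x) = d^-1 * x `^ (- d) * (d / i%:R) by rewrite /x; field; rewrite !gt_eqF.
 have dx : 0 <= d^-1 * x `^ (- d) by rewrite mulr_ge0 // invr_ge0 ltW.
 by have := ler_wpM2l dx key; lra.
rewrite telescope_sumr //; apply: le_trans (_ : - F i0 <= _).
 by rewrite gerDr; rewrite /F oppr_le0 mulr_ge0 // invr_ge0 ltW.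
rewrite /F opprK ler_pM2l ?invr_gt0 //.
have half : 2^-1 <= (i0%:R - 1) * h.
 have i2 : 2 <= i0%:R :> R by rewrite (ler_nat _ 2).
 have k : i0%:R * h * 2^-1 <= (i0%:R - 1) * h.
  by rewrite mulrAC ler_pM2r //; lra.
 by lra.
have -> : 2 `^ d = (2^-1) `^ (- d) :> R by rewrite -powR_inv1 // -powRrM mulN1r opprK.
rewrite !powRN lef_pV2 ?posrE ?powR_gt0 //; last by apply: lt_le_trans half; rewrite invr_gt0.
by apply: ge0_ler_powR => //; rewrite ?nnegrE ?invr_ge0 ?(ltW d0) //; apply: le_trans half; rewrite invr_ge0.
Qed.

End riemann_sums.

(** * Bounds of the inverse symbol along the contour *)

Section resolvent_symbol_bounds.
Variables (R : realType) (n k : nat).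
Notation C := R[i].
Notation V := ('rV[R]_n * 'rV[R]_n)%type.
Variables (m rho dl : R) (a : symbol R n k).
Hypothesis ha : symbol_class m rho dl a.
Variables (CL : R) (Cw : seq (lett n) -> R).
Hypotheses (hCL : 0 <= CL) (hCw : forall W, 0 <= Cw W).
Notation ord := (word_o rho dl).
Notation rsv := (rsv rho dl a CL Cw).
Notation q z := (1 + rnorm (a z)).

(** At one admissible [l0] the product of the sizes of [a - l0] and of its inverse is bounded below,
    so the hypoelliptic bound can be freed of the inverse at the price of a factor of the size of
    [a]. *)
Lemma sym_growth l0 W : rsv l0 -> exists2 K, 0 <= K &
 forall i j z, rnorm (wD W (ent a i j) z) <= K * q z * jap z.2 `^ ord W.
move=> hl0; exists (Cw W * (k%:R * (1 + rnorm l0))).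
 by rewrite !mulr_ge0 ?ler0n ?addr_ge0.
move=> i j z; have [uz _ hW] := hl0 z.
have one : 1 <= k%:R * (1 + rnorm l0) * q z * rnorm (rsym a l0 z).
 have := rn_ent (1%:M : 'M[C]_k) i i; rewrite mxE eqxx rn1 => h.
 letr h; rewrite -(mulmxV uz); letr (rn_mulmx _ _).
 monor; rewrite -mulrA ler_wpM2l ?ler0n //.
 letr (rnD _ _); rewrite rnN -scalemx1 rnZ.
 have := ler_wpM2l (rn_ge0 l0) (@rn_mx1 R k).
 by have := rn_ge0 (a z); have := mulr_ge0 (rn_ge0 l0) (rn_ge0 (a z)); lra.
letr (ler_peMr (rn_ge0 _) one).
have := ler_wpM2l (mulr_ge0 (mulr_ge0 (ler0n R k) (addr_ge0 ler01 (rn_ge0 l0))) (addr_ge0 ler01 (rn_ge0 (a z)))) (hW W i j).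
move=> h; letr (le_trans _ h); apply: eq_ler; ring.
Qed.

(** Each term of [rsym_recursion] holds two factors of the inverse and one derivative of [a].
    Bounding that derivative by [sym_growth] keeps both inverses, and their product decays fast
    enough to be summed along the contour uniformly in [z]. *)
Lemma rsym_quadratic l0 W : rsv l0 -> (0 < size W)%N -> exists2 K, 0 <= K &
 forall l i j z, rsv l ->
  rnorm (wD W (ent (rsym a l) i j) z) <= K * (q z * rnorm (rsym a l z) ^+ 2) * jap z.2 `^ ord W.
move=> hl0 W0; have [Cb hCb] := rsym_words ha CL hCw.
have Cb0 U : 0 <= Cb U by have [] := hCb U.
have /choice[G hG] : forall U, exists K, 0 <= K /\
  forall i j z, rnorm (wD U (ent a i j) z) <= K * q z * jap z.2 `^ ord U.
 by move=> U; have [K K0 hK] := sym_growth U hl0; exists K.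
have G0 U : 0 <= G U by have [] := hG U.
exists (\sum_(p <- behead (spl W)) k%:R * k%:R * Cb p.1 * G p.2).
 by apply: sumr_ge0 => p _; rewrite !mulr_ge0 ?ler0n.
move=> l i j z hl; have h0 := rn_ent (wDm W (rsym a l) z) i j; rewrite mxE in h0; letr h0.
rewrite (rsym_recursion ha z hl W0) rnN.
have q0 : 0 <= q z by rewrite addr_ge0.
letr (rn_sum _ _ _); rewrite !mulr_suml !big_seq; apply: ler_sum => p /mem_behead hp.
have [_ h1] := hCb p.1; have {}h1 := h1 l z hl; have [_ h2] := hG p.2.
have h3 : rnorm (wDm p.2 a z) <= G p.2 * q z * jap z.2 `^ ord p.2.
 by apply: rn_mx_le; rewrite ?mulr_ge0 // => i' j'; rewrite mxE; exact: h2.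
letr (rn_mulmx _ _).
letr (ler_wpM2r (rn_ge0 _) (ler_wpM2l (ler0n _ _) (rn_mulmx _ _))).
rewrite (spl_order rho dl hp) japRD.
have := ler_wpM2l (mulr_ge0 (mulr_ge0 (ler0n R k) (ler0n R k)) (rn_ge0 (rsym a l z))) (ler_rnM h1 h3).
move=> h4; letr (le_trans _ h4); apply: eq_ler; ring.
Qed.

Lemma rsym_size l z : rsv l -> 1 <= rnorm l ->
 rnorm (rsym a l z) <= (CL + CL + Cw [::]) / (q z + rnorm l).
move=> hl l1; have [_ h1 h2] := hl z.
have b0 := rn_ge0 (rsym a l z).
have h3 : rnorm (a z) * rnorm (rsym a l z) <= Cw [::].
 apply: rn_mx_mul_le => // i j; have := h2 [::] i j.
 by rewrite wD_nil /word_o /nxi /nx /= !mulr0 addr0 powRr0 mulr1.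
have h4 : rnorm (rsym a l z) <= CL by apply: le_trans h1; rewrite ler_peMl.
rewrite ler_pdivlMr; last by have := rn_ge0 (a z); lra.
by rewrite !mulrDr mulr1 [_ * rnorm (a z)]mulrC [_ * rnorm l]mulrC; lra.
Qed.

(** [(a - l)^-1 + 1 / l = a (a - l)^-1 / l]: beyond the size of [a], comparison with [-1 / l] gains
    a factor [|a| / |l|]. *)
Lemma rsym_main l i j z : rsv l -> l != 0 ->
 rnorm (rsym a l z i j + (i == j)%:R / l) <= k%:R * rnorm (a z) * rnorm (rsym a l z) / rnorm l.
move=> hl l0; have [uz _ _] := hl z.
have l0' : 0 < rnorm l by rewrite lt_neqAle eq_sym rn_eq0 l0 rn_ge0.
have h := mulmxV uz; rewrite mulmxBl mul_scalar_mx in h.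
have E : rsym a l z i j + (i == j)%:R / l = (a z *m rsym a l z) i j / l.
 have := congr1 (fun M : 'M[C]_k => M i j) h; rewrite !mxE => <-; rewrite /rsym; field.
 exact: l0.
by rewrite E rnM rnV ler_pM2r ?invr_gt0 //; apply: le_trans (rn_ent _ _ _) (rn_mulmx _ _).
Qed.

End resolvent_symbol_bounds.

(** * Symbols of the contour sums away from 0 *)

Section far_field.
Variables (R : realType) (n k : nat).
Notation C := R[i].
Notation V := ('rV[R]_n * 'rV[R]_n)%type.
Variables (theta m rho dl : R) (a : symbol R n k).
Hypothesis hth : 0 < theta < pi.
Hypothesis ha : symbol_class m rho dl a.
Variables (L0 CL : R) (Cw : seq (lett n) -> R).
Hypotheses (hL0 : 1 <= L0) (hCL : 0 <= CL) (hCw : forall W, 0 <= Cw W).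
Notation ord := (word_o rho dl).
Notation rsv := (rsv rho dl a CL Cw).
Hypothesis hres : forall l, sector theta l -> L0 <= rnorm l -> rsv l.
Notation q z := (1 + rnorm (a z)).

Lemma sector_ray b t : 0 <= t -> sector theta (ray (sd b * theta) t).
move=> t0; have /andP[th0 thpi] := hth; rewrite /ray /side; case: b.
 by exists t, theta; rewrite mul1r; split=> //; apply/andP; split; lra.
exists t, (2 * pi - theta); split=> //; first by apply/andP; split; lra.
congr (_ * _); rewrite mulN1r (_ : 2 * pi - theta = - theta + pi *+ 2); last by ring.
by rewrite /expi cosD2pi sinD2pi.
Qed.

(* Clipping at [L0] makes every index admissible. *)
Definition farp (h : R) b i : C := ray (sd b * theta) (Num.max (i%:R * h) L0).

Lemma rn_farp h b i : rnorm (farp h b i) = Num.max (i%:R * h) L0.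
by rewrite rn_ray // le_max (le_trans ler01 hL0) orbT. Qed.

Lemma rsv_farp h b i : rsv (farp h b i) /\ 1 <= rnorm (farp h b i).
split; last by rewrite rn_farp le_max hL0 orbT.
apply: hres; last by rewrite rn_farp le_max lexx orbT.
by apply: sector_ray; rewrite le_max (le_trans ler01 hL0) orbT.
Qed.

(** Quadrature weight of a node: the step, times the sample, times the derivative of [l = r e^(is)]
    in [r]. *)
Definition fcoef (h : R) (v : bool -> nat -> C) b i : C := h%:C * (v b i * expi (sd b * theta)).

Definition far_sum (h : R) v i0 N b : symbol R n k :=
 fun z => \sum_(i0 <= i < N) fcoef h v b i *: rsym a (farp h b i) z.

Lemma rn_far_coef h v b i : 0 < h -> rnorm (fcoef h v b i) = h * rnorm (v b i).
by move=> h0; rewrite /fcoef !rnM rne mulr1 rnr gtr0_norm. Qed.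

Lemma csm_far h b i x y : csm (ent (rsym a (farp h b i)) x y).
by have [hl _] := rsv_farp h b i; exact: (csm_rsym ha x y hl). Qed.

Lemma ent_far_sum h v i0 N b x y : ent (far_sum h v i0 N b) x y =
 fun z => \sum_(i0 <= i < N) fcoef h v b i * ent (rsym a (farp h b i)) x y z.
by ext z; rewrite /ent /far_sum summxE; apply: eq_bigr => i _; rewrite mxE. Qed.

Lemma wD_far_sum W h v i0 N b x y z : wD W (ent (far_sum h v i0 N b) x y) z =
 \sum_(i0 <= i < N) fcoef h v b i * wD W (ent (rsym a (farp h b i)) x y) z.
rewrite ent_far_sum wD_sum; last by move=> i; apply: csmZ; exact: csm_far.
by apply: eq_bigr => i _; rewrite wD_Z //; exact: csm_far.
Qed.

Lemma farp_id h i0 i : 0 < h -> L0 <= i0%:R * h -> (i0 <= i)%N -> Num.max (i%:R * h) L0 = i%:R * h.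
by move=> h0 i0h hi; apply/max_idPl; letr i0h; rewrite ler_pM2r // ler_nat.
Qed.

(** Absolute summation with [sum_ker]: terms dominated by [q / (q + t)^2] contribute a constant that
    depends neither on [z] nor on the step. *)
Lemma ker_sum_bd (h B : R) (v : bool -> nat -> C) i0 N (K w : R) b (F : nat -> C) (z : V) i1 i2 : 0 < h -> (0 < i0)%N ->
 vbd v B i0 N -> 0 <= B -> 0 <= K -> 0 <= w -> (i0 <= i1)%N -> (i2 <= N)%N ->
 (forall i, (i1 <= i < i2)%N -> rnorm (F i) <= K * (q z / (q z + i%:R * h) ^+ 2) * w) ->
 rnorm (\sum_(i1 <= i < i2) fcoef h v b i * F i) <= 2 * B * K * w.
move=> h0 i00 hv B0 K0 w0 i01 i2N hF; have qpos : 0 < q z by rewrite ltr_pwDl.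
letr (rn_sum _ _ _).
apply: le_trans (_ : \sum_(i1 <= i < i2) (2 * B * K * w) * (h * (q z / (q z + i%:R * h) ^+ 2)) <= _).
 rewrite big_nat_cond [leRHS]big_nat_cond; apply: ler_sum => i; rewrite andbT => hi; have /andP[hi1 hi2] := hi.
 rewrite rnM rn_far_coef //.
 have hvi : rnorm (v b i) <= 2 * B by apply: hv; rewrite (leq_trans i01) //= (leq_trans hi2).
 have h1 := ler_wpM2l (ltW h0) hvi.
 have := ler_pM (mulr_ge0 (ltW h0) (rn_ge0 _)) (rn_ge0 _) h1 (hF i hi).
 by move/le_trans; apply; apply: eq_ler; ring.
rewrite -mulr_sumr; have := sum_ker i2 h0 qpos (leq_trans i00 i01).
by move/(ler_wpM2l (mulr_ge0 (mulr_ge0 (mulr_ge0 (ler0n R 2) B0) K0) w0)); rewrite mulr1.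
Qed.

Lemma rsym_far h i0 b i (z : V) : 0 < h -> L0 <= i0%:R * h -> (i0 <= i)%N ->
 rnorm (rsym a (farp h b i) z) <= (CL + CL + Cw [::]) / (q z + i%:R * h).
move=> h0 i0h hi; have [hl l1] := rsv_farp h b i.
by have := rsym_size hCw z hl l1; rewrite rn_farp (farp_id h0 i0h hi).
Qed.

(** After a derivative, [rsym_quadratic] bounds each term by [q |(a - l)^-1|^2], which the kernel
    dominates, so each ray can be summed by itself. *)
Lemma far_words (W : seq (lett n)) : (0 < size W)%N -> exists2 K, 0 <= K & forall (h B : R) (v : bool -> nat -> C) i0 N,
 0 < h -> (0 < i0)%N -> L0 <= i0%:R * h -> 0 <= B ->
 vbd v B i0 N -> forall b x y z,
 rnorm (wD W (ent (far_sum h v i0 N b) x y) z) <= K * B * jap z.2 `^ ord W.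
move=> W0; have L00 : 0 <= L0 := le_trans ler01 hL0.
have hl0 : rsv (farp 1 true 0) by have [] := rsv_farp 1 true 0.
have [K K0 hK] := rsym_quadratic ha hCw hl0 W0.
pose Cs := CL + CL + Cw [::]; have Cs0 : 0 <= Cs by rewrite !addr_ge0.
exists (2 * (K * Cs ^+ 2)); first by rewrite !mulr_ge0 // sqr_ge0.
move=> h B v i0 N h0 i00 i0h B0 hv b x y z.
rewrite wD_far_sum.
have -> : 2 * (K * Cs ^+ 2) * B * jap z.2 `^ ord W = 2 * B * (K * Cs ^+ 2) * jap z.2 `^ ord W by ring.
apply: (@ker_sum_bd h B v i0 N (K * Cs ^+ 2) _ b _ z i0 N h0 i00 hv) => //; rewrite ?mulr_ge0 //.
move=> i /andP[hi _]; have [hl l1] := rsv_farp h b i.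
letr (hK _ x y z hl); monor; rewrite -mulrA ler_wpM2l //.
have hs := rsym_far b z h0 i0h hi; rewrite -/Cs in hs.
have q0 : 0 <= q z by rewrite addr_ge0.
have := ler_wpM2l q0 (ler_rnM hs hs); rewrite -!expr2.
move/le_trans; apply; rewrite expr_div_n; apply: eq_ler; ring.
Qed.

(** The sum is cut where the nodes pass [q]. Below, [1 / (q + t) <= 2 q / (q + t)^2]; above,
    comparison with [-1 / l] leaves terms with the same kernel. The remaining multiples of [1 / l]
    form [dsum], which is controlled only as a difference of the two rays. *)
Lemma far_sym_nil : exists2 K, 0 <= K & forall (h B : R) (v : bool -> nat -> C) i0 N,
 0 < h -> (0 < i0)%N -> L0 <= i0%:R * h -> 0 <= B ->
 vbd v B i0 N ->
 (forall i1, (i0 <= i1)%N -> (i1 <= N)%N -> rnorm (dsum v i1 N) <= 8 * theta * B) ->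
 forall x y z, rnorm (far_sum h v i0 N true z x y - far_sum h v i0 N false z x y) <= K * B.
pose Cs := CL + CL + Cw [::]; have Cs0 : 0 <= Cs by rewrite !addr_ge0.
have /andP[th0 _] := hth.
exists (2 * (4 * Cs + 4 * (k%:R * Cs)) + 8 * theta); first by rewrite addr_ge0 ?mulr_ge0 ?addr_ge0 ?mulr_ge0 ?ler0n // ltW.
move=> h B v i0 N h0 i00 i0h B0 hv htel x y z.
have [Ni0|i0N] := leqP N i0.
 rewrite /far_sum !big_geq // subrr rn0 mulr_ge0 // addr_ge0 ?mulr_ge0 ?addr_ge0 ?mulr_ge0 ?ler0n // ltW //.
have q0 : 0 < q z by rewrite ltr_pwDl.
have ex : exists i, (i0 <= i)%N && ((N <= i)%N || (q z <= i%:R * h)) by exists N; rewrite leqnn (ltnW i0N).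
(* [i1] is the first node with [q z <= i1 h], or [N] if there is none before. *)
case: (ex_minnP ex) => i1 /andP[i01 hi1] min1.
have i1N : (i1 <= N)%N by apply: min1; rewrite leqnn (ltnW i0N).
have lowq i : (i0 <= i < i1)%N -> i%:R * h <= q z.
 move=> /andP[a1 a2]; rewrite leNgt; apply/negP => /ltW hq.
 by have := min1 i; rewrite a1 hq orbT => /(_ isT); rewrite leqNgt a2.
have highq i : (i1 <= i < N)%N -> q z <= i%:R * h.
 move=> /andP[a1 a2]; have := hi1; rewrite leqNgt (leq_ltn_trans a1 a2) /= => /le_trans; apply.
 by rewrite ler_pM2r // ler_nat.
have sz b i : (i0 <= i)%N -> rnorm (rsym a (farp h b i) z) <= Cs / (q z + i%:R * h).
 exact: rsym_far.
pose S b := \sum_(i0 <= i < i1) fcoef h v b i * rsym a (farp h b i) z x y.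
pose T b := \sum_(i1 <= i < N) fcoef h v b i * (rsym a (farp h b i) z x y + (x == y)%:R / farp h b i).
have hS b : rnorm (S b) <= 4 * Cs * B.
 have -> : 4 * Cs * B = 2 * B * (2 * Cs) * 1 by ring.
 apply: (@ker_sum_bd h B v i0 N (2 * Cs) 1 b _ z i0 i1 h0 i00 hv) => //; first by rewrite mulr_ge0.
 move=> i hi; have /andP[hia hib] := hi; rewrite mulr1; letr (rn_ent _ _ _).
 letr (sz b i hia).
 have d0 : 0 < q z + i%:R * h by rewrite ltr_wpDr // mulr_ge0 // ltW.
 have -> : Cs / (q z + i%:R * h) = Cs * (q z + i%:R * h) / (q z + i%:R * h) ^+ 2 by field; rewrite gt_eqF.
 rewrite mulrA ler_pM2r ?invr_gt0 ?exprn_gt0 // [2 * Cs]mulrC -mulrA ler_wpM2l //.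
 by have := lowq i hi; lra.
have hT b : rnorm (T b) <= 4 * (k%:R * Cs) * B.
 have -> : 4 * (k%:R * Cs) * B = 2 * B * (2 * (k%:R * Cs)) * 1 by ring.
 apply: (@ker_sum_bd h B v i0 N (2 * (k%:R * Cs)) 1 b _ z i1 N h0 i00 hv) => //; first by rewrite !mulr_ge0 ?ler0n.
 move=> i hi; have /andP[hia hib] := hi; rewrite mulr1; have hi0 := leq_trans i01 hia.
 have [hl l1] := rsv_farp h b i.
 have ih0 : 0 < i%:R * h by apply: lt_le_trans (highq i hi).
 have l0 : farp h b i != 0 by rewrite -rn_eq0 gt_eqF // (lt_le_trans ltr01).
 letr (rsym_main x y z hl l0); rewrite rn_farp (farp_id h0 i0h hi0).
 have d0 : 0 < q z + i%:R * h by rewrite ltr_wpDr // ltW.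
 have h1 : k%:R * rnorm (a z) * rnorm (rsym a (farp h b i) z) <= k%:R * q z * (Cs / (q z + i%:R * h)).
  apply: ler_pM; rewrite ?mulr_ge0 ?ler0n //; last exact: sz.
  by rewrite ler_wpM2l ?ler0n // lerDr.
 have h2 : (i%:R * h)^-1 <= 2 / (q z + i%:R * h).
  by rewrite ler_pdivlMr // ler_pdivrMl // ; have := highq i hi; lra.
 have := ler_pM _ _ h1 h2; rewrite invr_ge0 (ltW ih0) !mulr_ge0 ?ler0n //.
 move=> /(_ isT isT) h3; letr h3.
 by apply: eq_ler; field; rewrite gt_eqF.
have split_sum b : far_sum h v i0 N b z x y = S b + T b - (x == y)%:R * \sum_(i1 <= i < N) v b i / (i%:R)%:C.
 have -> : far_sum h v i0 N b z x y = \sum_(i0 <= i < N) fcoef h v b i * rsym a (farp h b i) z x y.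
  by rewrite /far_sum summxE; apply: eq_bigr => i _; rewrite mxE.
 rewrite (@big_cat_nat _ _ _ i1) //= -addrA; congr (_ + _).
 rewrite mulr_sumr -sumrB; apply: eq_big_nat => i /andP[hi _]; have hi0 := leq_trans i01 hi.
 rewrite /farp (farp_id h0 i0h hi0) /ray /fcoef rmorphM /=; field.
 rewrite pnatr_eq0 -lt0n (leq_trans i00 hi0) /= fmorph_eq0 (gt_eqF h0) /=.
 by rewrite -rn_eq0 rne oner_neq0.
rewrite !split_sum.
have -> : S true + T true - (x == y)%:R * \sum_(i1 <= i < N) v true i / (i%:R)%:C -
 (S false + T false - (x == y)%:R * \sum_(i1 <= i < N) v false i / (i%:R)%:C) =
 (S true - S false) + (T true - T false) - (x == y)%:R * dsum v i1 N.
 have -> : dsum v i1 N =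
  \sum_(i1 <= i < N) v true i / (i%:R)%:C - \sum_(i1 <= i < N) v false i / (i%:R)%:C.
  by rewrite -sumrB; apply: eq_bigr => i _; rewrite mulrBl.
 by ring.
have nd : rnorm ((x == y)%:R * dsum v i1 N) <= 8 * theta * B.
 apply: le_trans (htel i1 i01 i1N); rewrite rnM ler_piMl //.
 by case: (x == y); rewrite ?rn1 ?rn0.
letr (rnD _ _); rewrite rnN; letr (lerD (rnD _ _) nd).
have := rnD (S true) (- S false); have := rnD (T true) (- T false); rewrite !rnN.
by have := hS true; have := hS false; have := hT true; have := hT false; lra.
Qed.

End far_field.

(** * The estimate for operator-valued Riemann sums *)

Section functional_calculus_bound.
Variables (R : realType) (n k : nat) (theta m rho dl : R).
Notation C := R[i].
Notation V := ('rV[R]_n * 'rV[R]_n)%type.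
Hypotheses (hth : 0 < theta < pi) (hm : 0 <= m) (hd : 0 <= dl) (hdr : dl < rho) (hr : rho <= 1).
Variable a : symbol R n k.
Hypothesis ha : symbol_class m rho dl a.
Hypothesis hypo : hypoelliptic (sector theta) rho dl a.
Variables (E : completeNormedModType R[i]) (iota : E -> distr R n k).
Hypotheses (hE : tempered_embedding iota) (hop : op_continuous iota rho dl).
Variables (D : set E) (A : E -> E).
Hypotheses (hA : closed_extension iota a D A) (h1 : sector theta `<=` resolvent_set D A).
Hypothesis h2 : exists K : R, forall l, sector theta l ->
 opnorm (fun u => (japC l)%:C *: resolvent D A l u) <= K.
Notation Res := (resolvent D A).
Notation ord := (word_o rho dl).

Lemma rslv_spec l : sector theta l -> is_resolvent D A l (Res l).
by move=> /h1[T hT]; exact: (xgetPex (fun _ => 0) (ex_intro _ T hT)). Qed.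

Lemma bdd_rslv l : sector theta l -> bounded_op (Res l).
by move=> /rslv_spec[]. Qed.

Lemma rslv_bd : exists2 K, 0 <= K & forall l u, sector theta l ->
 rnorm (Res l u) <= K / (1 + rnorm l) * rnorm u.
have [K hK] := h2; exists (2 * `|K|); first by rewrite mulr_ge0.
move=> l u hl; have bl := bopZ (japC l)%:C (bdd_rslv hl).
have l1 : 0 < 1 + rnorm l by rewrite ltr_pwDl.
have jl : (1 + rnorm l) / 2 <= japC l.
 have r0 := rn_ge0 l; rewrite -(ler_pXn2r (_ : (0 < 2)%N)) ?nnegrE ?sqrtr_ge0 ?divr_ge0 ?ltW //.
 rewrite sqr_sqrtr ?addr_ge0 // expr_div_n; have := sqr_ge0 (1 - rnorm l); rewrite sqrrB sqrrD; nra.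
have := opnorm_ge u bl; rewrite rnZ rnr ger0_norm ?sqrtr_ge0 // => h.
have h3 : (1 + rnorm l) / 2 * rnorm (Res l u) <= `|K| * rnorm u.
 letr (ler_wpM2r (rn_ge0 _) jl); letr h.
 by monor; rewrite (le_trans (hK l hl)) // ler_norm.
by rewrite mulrAC ler_pdivlMr // mulrC; lra.
Qed.

(** The resolvent identity, with both resolvents bounded by [K]. *)
Lemma rslv_lipschitz K : 0 <= K -> (forall l u, sector theta l -> rnorm (Res l u) <= K / (1 + rnorm l) * rnorm u) ->
 forall l l' u, sector theta l -> sector theta l' -> rnorm (Res l u - Res l' u) <= K ^+ 2 * rnorm (l - l') * rnorm u.
move=> K0 hK l l' u hl hl'; have [[lT _] _ hT] := rslv_spec hl; have [_ hT' _] := rslv_spec hl'.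
have [Dw Aw] := hT' u; set w := Res l' u in Dw Aw *.
have -> : Res l u - w = (l - l') *: Res l w.
 have := hT w Dw; have -> : A w - l *: w = u - (l - l') *: w.
  by rewrite -Aw scalerBl opprB addrA subrK.
 by rewrite (linearBop _ _ lT) (linearZop _ _ lT) => e; rewrite -[in LHS]e opprB addrCA subrr addr0.
have K1 l'' v : sector theta l'' -> rnorm (Res l'' v) <= K * rnorm v.
 move=> h; letr (hK _ _ h); monor; rewrite ler_piMr // invf_le1 ?lerDl //.
 by rewrite ltr_pwDl.
rewrite rnZ; letr (ler_wpM2l (rn_ge0 _) (K1 l w hl)).
letr (ler_wpM2l (rn_ge0 _) (ler_wpM2l K0 (K1 l' u hl'))).
by apply: eq_ler; ring.
Qed.

Lemma op_on_sum (I : Type) (r : seq I) (c : I -> C) (b : I -> symbol R n k) (T : I -> E -> E) :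
 (forall i, symbol_class 0 rho dl (b i)) -> (forall i, op_on iota (b i) (T i)) ->
 symbol_class 0 rho dl (fun z => \sum_(i <- r) c i *: b i z) /\
 op_on iota (fun z => \sum_(i <- r) c i *: b i z) (fun u => \sum_(i <- r) c i *: T i u).
move=> cb oT; elim: r => [|i r [IH1 IH2]].
 have -> : (fun z => \sum_(i <- [::]) c i *: b i z) = fun _ => 0 by ext z; rewrite big_nil.
 have -> : (fun u => \sum_(i <- [::]) c i *: T i u) = fun _ => 0 by ext z; rewrite big_nil.
 by split; [exact: (symc_cst n rho dl 0)|exact: (op_on_zero hd hdr hr hE)].
have -> : (fun z => \sum_(j <- i :: r) c j *: b j z) = fun z => c i *: b i z + \sum_(j <- r) c j *: b j z.
 by ext z; rewrite big_cons.
have -> : (fun u => \sum_(j <- i :: r) c j *: T j u) = fun u => c i *: T i u + \sum_(j <- r) c j *: T j u.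
 by ext z; rewrite big_cons.
by split; [exact: (symc_lin (c i) (cb i) IH1)|exact: (op_on_lin hd hdr hr hE (c i) (cb i) IH1 (oT i) IH2)].
Qed.

(** [M] depends neither on the step nor on the number of nodes, nor on the samples except through
    [B]; this is what survives the passage to the limit. The cancellation hypothesis on [dsum] is
    needed for every range of indices because the cut at [q] varies with the point of phase
    space. *)
Lemma smp_sum_bd : exists2 M, 0 <= M & forall (h B : R) (v : bool -> nat -> C) N,
 0 < h <= 1 -> 0 <= B -> (forall b i, (0 < i < N)%N -> rnorm (v b i) <= 2 * B) ->
 (forall i0 i1, (0 < i0)%N -> (i0 <= i1)%N -> (i1 <= N)%N ->
  rnorm (dsum v i0 i1) <= 8 * theta * B) ->
 let S b u := \sum_(1 <= i < N) fcoef theta h v b i *: Res (ray (sd b * theta) (i%:R * h)) u in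
 forall u, rnorm (S true u - S false u) <= M * B * rnorm u.
have [K K0 hK] := rslv_bd.
have [L0 [CL [Cw [hL0 hCL hCw hres]]]] := rsv_ex hm ha hypo.
have [Nop [Kop [Kop0 hKop]]] := op_on_bd hd hdr hr hE hop.
have L00 : 0 <= L0 := le_trans ler01 hL0.
have d1 : dl < 1 := lt_le_trans hdr hr.
pose eps := dexp m rho dl.
have eps0 : 0 < eps by rewrite divr_gt0 ?subr_gt0 // ltr_wpDl.
have res_pt h b i := rsv_farp hth hL0 hres h b i.
have [Kr Kr0 hKr] : exists2 Kr, 0 <= Kr & forall W l x y z, (size W <= Nop)%N -> rsv rho dl a CL Cw l -> 1 <= rnorm l ->
  rnorm (wD W (ent (rem_mx a l) x y) z) <= Kr * rnorm l `^ (- eps) * jap z.2 `^ ord W.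
 have /choice[F hF] := rem_sym_bd hm hd hdr hr ha hCL hCw.
 have [Kr Kr0 hKr] := words_bdd Nop (fun W => (hF W).1); exists Kr => // W l x y z hW hl l1.
 have [_ h] := hF W; letr (h l x y z hl l1).
 by monor; monor; exact: hKr.
have [Fm Fm0 hFm] : exists2 Fm, 0 <= Fm & forall W (h B : R) (v : bool -> nat -> C) i0 N, (size W <= Nop)%N ->
  0 < h -> (0 < i0)%N -> L0 <= i0%:R * h -> 0 <= B ->
  vbd v B i0 N ->
  (forall i1, (i0 <= i1)%N -> (i1 <= N)%N -> rnorm (dsum v i1 N) <= 8 * theta * B) ->
  forall x y z, rnorm (wD W (ent (far_sum theta a L0 h v i0 N true) x y) z - wD W (ent (far_sum theta a L0 h v i0 N false) x y) z)
  <= Fm * B * jap z.2 `^ ord W.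
 have [Kn Kn0 hKn] := far_sym_nil hth hL0 hCL hCw hres.
 have /choice[F hF] : forall W, exists K, 0 <= K /\ ((0 < size W)%N -> forall (h B : R) (v : bool -> nat -> C) i0 N,
  0 < h -> (0 < i0)%N -> L0 <= i0%:R * h -> 0 <= B ->
  vbd v B i0 N -> forall b x y z,
  rnorm (wD W (ent (far_sum theta a L0 h v i0 N b) x y) z) <= K * B * jap z.2 `^ ord W).
  move=> W; have [W0|W0] := posnP (size W); first by exists 0; split=> //; rewrite W0.
  by have [K' K0' h] := far_words hth ha hL0 hCL hCw hres W0; exists K'.
 have [Kw Kw0 hKw] := words_bdd Nop (fun W => (hF W).1).
 exists (Kn + 2 * Kw); first by rewrite addr_ge0 ?mulr_ge0.
 move=> W h B v i0 N hW h0 i00 i0h B0 hv htel x y z.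
 have [W0|W0] := posnP (size W).
  have -> : W = [::] by case: W W0 {hW}.
  rewrite !wD_nil /word_o /nxi /nx /= !mulr0 addr0 powRr0 mulr1.
  letr (hKn h B v i0 N h0 i00 i0h B0 hv htel x y z).
  by monor; rewrite lerDl mulr_ge0.
 have [_ hW'] := hF W; have hb b := hW' W0 h B v i0 N h0 i00 i0h B0 hv b x y z.
 letr (rnD _ _); rewrite rnN; letr (lerD (hb true) (hb false)).
 rewrite -!mulrDl ler_wpM2r // ler_wpM2r //.
 by have := hKw W hW; lra.
(* Contributions, from both rays, of the nodes with index below [i0], of the quantized sums, and of
   the remainders, whose last factor is the bound of [sum_powR]. *)
pose M := 4 * K * (L0 + 2) + Kop * Fm + 4 * (Kop * (Kr + 1) * K) * (eps^-1 * 2 `^ eps).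
exists M.
 by rewrite /M !addr_ge0 // !mulr_ge0 ?addr_ge0 ?invr_ge0 // ltW.
move=> h B v N /andP[h0 h1'] B0 hv htel S u.
have K1 b t w : 0 <= t -> rnorm (Res (ray (sd b * theta) t) w) <= K / (1 + t) * rnorm w.
 by move=> t0; have := hK _ w (sector_ray hth b t0); rewrite rn_ray.
(* A node just beyond [L0]; [.+2] also ensures [1 < i0], as [sum_powR] requires. *)
pose i0 := (Num.truncn (L0 / h)).+2.
have i0h : L0 <= i0%:R * h.
 rewrite -ler_pdivrMr // ltW // (lt_trans (truncnS_gt _)) // ltr_nat //.
have i0u : i0%:R * h <= L0 + 2.
 have tr : (Num.truncn (L0 / h))%:R <= L0 / h by rewrite truncn_le // divr_ge0 // ltW.
 rewrite /i0 -addn2 natrD mulrDl; apply: lerD; first by rewrite -ler_pdivlMr.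
 by rewrite ler_piMr.
have near b i2 : (i2 <= i0)%N -> (i2 <= N)%N ->
  rnorm (\sum_(1 <= i < i2) fcoef theta h v b i *: Res (ray (sd b * theta) (i%:R * h)) u) <= 2 * K * (L0 + 2) * B * rnorm u.
 move=> i2i0 i2N; letr (rn_sum _ _ _).
 apply: le_trans (_ : \sum_(1 <= i < i2) h * (2 * B) * (K * rnorm u) <= _).
  rewrite big_nat_cond [leRHS]big_nat_cond; apply: ler_sum => i; rewrite andbT => /andP[i1 i2'].
  rewrite rnZ rn_far_coef //; apply: ler_pM; rewrite ?mulr_ge0 ?(ltW h0) //.
  by rewrite ler_wpM2l ?(ltW h0) //; apply: hv; rewrite i1 (leq_trans i2').
  have t0 : 0 <= i%:R * h by rewrite mulr_ge0 // ltW.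
  letr (K1 b _ u t0); monor; rewrite ler_piMr // invf_le1 ?lerDl //.
  by rewrite ltr_pwDl.
 rewrite sumr_const_nat -mulr_natl.
 have c1 : (i2 - 1)%:R * h <= L0 + 2.
  by apply: le_trans i0u; rewrite ler_pM2r // ler_nat (leq_trans (leq_subr _ _)).
 have := ler_wpM2r (mulr_ge0 (mulr_ge0 (ler0n R 2) B0) (mulr_ge0 K0 (rn_ge0 u))) c1.
 by move=> c2; letr (le_trans _ c2); apply: eq_ler; ring.
have BK : 0 <= B * rnorm u by rewrite mulr_ge0.
have [Ni0|i0N] := leqP N i0.
 letr (rnD _ _); rewrite rnN.
 letr (lerD (near true N Ni0 (leqnn _)) (near false N Ni0 (leqnn _))).
 have -> : 2 * K * (L0 + 2) * B * rnorm u + 2 * K * (L0 + 2) * B * rnorm u = 4 * K * (L0 + 2) * (B * rnorm u) by ring.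
 by rewrite -[M * B * _]mulrA ler_wpM2r // /M -addrA lerDl addr_ge0 // !mulr_ge0 ?addr_ge0 ?invr_ge0 // ltW.
have hvf b i : (i0 <= i < N)%N -> rnorm (v b i) <= 2 * B by move=> /andP[a1 a2]; apply: hv; rewrite a2 andbT (leq_trans _ a1).
have clb b i : symbol_class 0 rho dl (rsym a (farp theta L0 h b i)).
 by have [hl l1] := res_pt h b i; exact: (symc_rsym ha hCL hCw hl l1).
have clr b i : symbol_class 0 rho dl (rem_mx a (farp theta L0 h b i)).
 by have [hl l1] := res_pt h b i; exact: (symc_rem hm hd hdr hr ha hCL hCw hl l1).
have /choice[Tb hTb] : forall bi : bool * nat, exists T, op_on iota (rsym a (farp theta L0 h bi.1 bi.2)) T.
 by move=> bi; exact: (op_on_ex hop (clb _ _)).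
have /choice[Tr hTr] : forall bi : bool * nat, exists T, op_on iota (rem_mx a (farp theta L0 h bi.1 bi.2)) T.
 by move=> bi; exact: (op_on_ex hop (clr _ _)).
pose Q b := far_sum theta a L0 h v i0 N b.
pose TQ b u := \sum_(i0 <= i < N) fcoef theta h v b i *: Tb (b, i) u.
pose P b := \sum_(i0 <= i < N) fcoef theta h v b i *: Tr (b, i) (Res (ray (sd b * theta) (i%:R * h)) u).
have pt b i : (i0 <= i)%N -> farp theta L0 h b i = ray (sd b * theta) (i%:R * h).
 by move=> hi; rewrite /farp (farp_id h0 i0h hi).
have SE b : S b u = \sum_(1 <= i < i0) fcoef theta h v b i *: Res (ray (sd b * theta) (i%:R * h)) u + (TQ b u - P b).
 have i0N' : (i0 <= N)%N := ltnW i0N.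
 rewrite /S (@big_cat_nat _ _ _ i0) //; congr (_ + _); rewrite /TQ /P -sumrB; apply: eq_big_nat => i /andP[hi _]; rewrite -scalerBr; congr (_ *: _).
 have [hl l1] := res_pt h b i; rewrite -(pt b i hi).
 have sl : sector theta (farp theta L0 h b i) by rewrite pt //; apply: sector_ray => //; rewrite mulr_ge0 // ltW.
 exact: (rslv_parametrix hm hd hdr hr ha hCL hCw hE hA hl l1 (hTb (b, i)) (hTr (b, i)) (rslv_spec sl) u).
have hP b : rnorm (P b) <= 2 * (Kop * (Kr + 1) * K) * (eps^-1 * 2 `^ eps) * B * rnorm u.
 letr (rn_sum _ _ _).
 apply: le_trans (_ : \sum_(i0 <= i < N) 2 * B * (Kop * (Kr + 1) * K) * rnorm u * (h * (i%:R * h) `^ (- 1 - eps)) <= _).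
  rewrite big_nat_cond [leRHS]big_nat_cond; apply: ler_sum => i; rewrite andbT => hi; have /andP[hi1 hi2] := hi.
  have [hl l1] := res_pt h b i.
  have lt : rnorm (farp theta L0 h b i) = i%:R * h by rewrite rn_farp // (farp_id h0 i0h hi1).
  have t0 : 0 < i%:R * h by rewrite -lt (lt_le_trans ltr01).
  (* [Kr + 1] in place of [Kr] makes the bound on the seminorms positive, as [op_on_bd] requires. *)
  have dp : 0 < (Kr + 1) * (i%:R * h) `^ (- eps) by rewrite mulr_gt0 ?powR_gt0 // ltr_wpDl.
  rewrite rnZ rn_far_coef //.
  have hTr1 w : rnorm (Tr (b, i) w) <= Kop * ((Kr + 1) * (i%:R * h) `^ (- eps)) * rnorm w.
  apply: (hKop _ _ _ (clr b i) (hTr (b, i)) dp) => W x y z hW.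
  letr (hKr W _ x y z hW hl l1); rewrite lt ler_wpM2r // ler_wpM2r //.
  by rewrite lerDl.
  have r1 : rnorm (Res (ray (sd b * theta) (i%:R * h)) u) <= K * (i%:R * h)^-1 * rnorm u.
  letr (K1 b _ u (ltW t0)); monor; monol.
  by rewrite lef_pV2 ?posrE ?lerDr // ltr_pwDl // ltW.
  have c0 : 0 <= Kop * ((Kr + 1) * (i%:R * h) `^ (- eps)) by rewrite mulr_ge0 // ltW.
  have r2 := le_trans (hTr1 _) (ler_wpM2l c0 r1).
  have hvi := ler_wpM2l (ltW h0) (hvf b i hi).
  letr (ler_pM (mulr_ge0 (ltW h0) (rn_ge0 _)) (rn_ge0 _) hvi r2).
  have -> : (i%:R * h) `^ (- 1 - eps) = (i%:R * h) `^ (- eps) * (i%:R * h)^-1.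
  by rewrite [- 1 - eps]addrC powRD ?(gt_eqF t0) ?implybT // powR_inv1 // ltW.
  by apply: eq_ler; ring.
 rewrite -mulr_sumr.
 have sp := @sum_powR R h eps i0 N (introT andP (conj h0 h1')) eps0 (le_trans hL0 i0h) isT.
 have c0 : 0 <= 2 * B * (Kop * (Kr + 1) * K) * rnorm u by rewrite !mulr_ge0 ?addr_ge0.
 by letr (ler_wpM2l c0 sp); apply: eq_ler; ring.
have hQ : rnorm (TQ true u - TQ false u) <= Kop * Fm * B * rnorm u.
 have [ct ot] := op_on_sum (index_iota i0 N) (fcoef theta h v true) (clb true) (fun i => hTb (true, i)).
 have [cf of_] := op_on_sum (index_iota i0 N) (fcoef theta h v false) (clb false) (fun i => hTb (false, i)).
 have oQ := op_on_lin hd hdr hr hE (-1) cf ct of_ ot.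
 have cQ := symc_lin (-1) cf ct.
 (* [op_on_bd] takes a positive bound on the seminorms, while [Fm * B] may vanish; [e] is removed by
    letting it tend to 0. *)
 have bound e : 0 < e -> rnorm (TQ true u - TQ false u) <= Kop * (Fm * B + e) * rnorm u.
  move=> e0; have dp : 0 < Fm * B + e by rewrite ltr_wpDl // mulr_ge0.
  have -> : TQ true u - TQ false u = (-1) *: (\sum_(i0 <= i < N) fcoef theta h v false i *: Tb (false, i) u) +
  \sum_(i0 <= i < N) fcoef theta h v true i *: Tb (true, i) u by rewrite scaleN1r addrC.
  apply: (hKop _ _ _ cQ oQ dp) => W x y z hW.
  have -> : ent (fun z => -1 *: (\sum_(i <- index_iota i0 N) fcoef theta h v false i *: rsym a (farp theta L0 h false i) z) +
  \sum_(i <- index_iota i0 N) fcoef theta h v true i *: rsym a (farp theta L0 h true i) z) x y =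
  fun z => (-1) * ent (Q false) x y z + ent (Q true) x y z.
  by ext z'; rewrite /ent /Q /far_sum !mxE.
  have smo b : csm (ent (Q b) x y).
  by rewrite /Q ent_far_sum; apply: csm_sum => i; apply: csmZ; exact: (csm_far hth ha hL0 hres).
  rewrite /wD cDs_D //; last exact: csmZ.
  rewrite cDs_Z // mulN1r addrC.
  have htel' i1 : (i0 <= i1)%N -> (i1 <= N)%N -> rnorm (dsum v i1 N) <= 8 * theta * B.
  by move=> a1 a2; apply: htel => //; exact: leq_trans a1.
  have := hFm W h B v i0 N hW h0 isT i0h B0 hvf htel' x y z.
  by move/le_trans; apply; monor; rewrite lerDl ltW.
 apply/ler_addgt0Pr => e e0.
 have w0 : 0 < Kop * rnorm u + 1 by rewrite ltr_wpDl // mulr_ge0.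
 letr (bound _ (divr_gt0 e0 w0)).
 rewrite mulrDr mulrDl mulrA lerD2l.
 have -> : Kop * (e / (Kop * rnorm u + 1)) * rnorm u = e * (Kop * rnorm u / (Kop * rnorm u + 1)) by ring.
 by rewrite -[leRHS]mulr1 ler_pM2l // ler_pdivrMr // mul1r lerDl.
rewrite !SE.
set N1 := \sum_(1 <= i < i0) _; set N2 := \sum_(1 <= i < i0) _.
have -> : N1 + (TQ true u - P true) - (N2 + (TQ false u - P false)) = (N1 - N2) + ((TQ true u - TQ false u) - (P true - P false)) by rewrite opprD addrACA sub_subACA.
have n1 : rnorm N1 <= 2 * K * (L0 + 2) * B * rnorm u by apply: near; rewrite // ltnW.
have n2 : rnorm N2 <= 2 * K * (L0 + 2) * B * rnorm u by apply: near; rewrite // ltnW.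
letr (rnD _ _); letr (lerD (rnD _ _) (rnD _ _)); rewrite !rnN.
have p1 := hP true; have p2 := hP false.
have pp : rnorm (P true - P false) <= rnorm (P true) + rnorm (P false) by rewrite -(rnN (P false)); exact: rnD.
rewrite /M; lra.
Qed.

End functional_calculus_bound.

(** * Angles, steps and numbers of nodes *)

Section step_sequences.
Variable R : realType.

Lemma sin_le_id (x : R) : 0 <= x -> sin x <= x.
move=> x0; have [|c _] := @MVT_segment R sin cos 0 x x0.
 by apply: derivable_within_continuous => t _; exact: ex_derive.
rewrite sin0 !subr0 => ->; rewrite -[leRHS]mul1r ler_wpM2r //; exact: cos_le1.
Qed.

Variable theta : R.
Hypothesis hth : 0 < theta < pi.

Definition step_angle j : R := Num.min theta 1 / j.+2%:R.
(** The radial step is the sine of the turning angle, so the cells are short enough for the Stolz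
    regions of [stolz_limit]. *)
Definition step_size j : R := sin (step_angle j).
(** About [h^-2] nodes for the step [h], so that the radius [N h] tends to infinity while [h] tends
    to 0. *)
Definition step_count j : nat := (Num.truncn ((step_size j ^+ 2)^-1)).+1.

Lemma step_angle_bd j : [/\ 0 < step_angle j < theta, step_angle j <= pi / 2 & step_angle j <= j.+1%:R^-1].
have /andP[th0 _] := hth; have m0 : 0 < Num.min theta 1 by rewrite lt_min th0 ltr01.
have j2 : 1 < j.+2%:R :> R by rewrite (ltr_nat R 1).
have j1 : 0 < j.+1%:R :> R by rewrite ltr0n.
have j0 : 0 < j.+2%:R :> R by rewrite ltr0n.
have le1 : step_angle j <= j.+1%:R^-1.
 rewrite /step_angle ler_pdivrMr //; apply: le_trans (_ : 1 <= _); first by rewrite ge_min lexx orbT.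
 by rewrite ler_pdivlMl // mulr1 ler_nat.
split=> //.
 rewrite divr_gt0 //=; apply: lt_le_trans (_ : Num.min theta 1 <= _); last by rewrite ge_min lexx.
 by rewrite ltr_pdivrMr // ltr_pMr.
letr le1; apply: le_trans (_ : 1 <= _); first by rewrite invf_le1 // ler1n.
by have := pi_ge2 R; lra.
Qed.

Lemma step_size_bd j : [/\ 0 < step_size j, step_size j <= 1 & step_size j <= step_angle j].
have [/andP[w0' _] w2' _] := step_angle_bd j; split; last by apply: sin_le_id; exact: ltW.
 by apply: sin_gt0_pi; rewrite w0' (le_lt_trans w2') // ltr_pdivrMr // ltr_pMr ?pi_gt0 ?ltr1n.
exact: sin_le1.
Qed.

Lemma step_small (e : R) : 0 < e -> exists J, forall j, (J <= j)%N -> step_size j < e.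
move=> e0; exists (Num.truncn e^-1) => j Jj; have [_ _ h] := step_size_bd j.
have [_ _ h'] := step_angle_bd j; apply: le_lt_trans (le_trans h h') _.
rewrite invf_plt ?posrE ?ltr0n //; apply: lt_le_trans (truncnS_gt _) _.
by rewrite ler_nat ltnS.
Qed.

Lemma step_count_large (t : R) : exists J, forall j, (J <= j)%N -> t < (step_count j)%:R * step_size j.
have e0 : 0 < (`|t| + 1)^-1 by rewrite invr_gt0 ltr_wpDl.
have [J hJ] := step_small e0; exists J => j Jj; have [s0 _ _] := step_size_bd j.
have h : `|t| + 1 < (step_size j)^-1.
 by rewrite -[X in X < _]invrK ltf_pV2 ?posrE ?invr_gt0 ?ltr_wpDl //; exact: hJ.
apply: lt_trans (_ : (step_size j)^-1 < _).
 by apply: le_lt_trans h; letr (ler_norm t); rewrite lerDl.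
rewrite -ltr_pdivrMr //; apply: le_lt_trans (truncnS_gt _).
by rewrite expr2 invfM.
Qed.

End step_sequences.

(** * Existence of the integrals and passage to the limit *)

Theorem theorem3p5 (R : realType) (n k : nat) (hn : (0 < n)%N) (hk : (0 < k)%N)
 (theta m rho delta : R)
 (htheta : 0 < theta < pi) (hm : 0 <= m)
 (hdelta : 0 <= delta) (hdr : delta < rho) (hrho : rho <= 1)
 (a : symbol R n k) (ha : symbol_class m rho delta a)
 (hypo : hypoelliptic (sector theta) rho delta a)
 (E : completeNormedModType R[i]) (iota : E -> distr R n k)
 (hE : tempered_embedding iota)
 (hS : contains_schwartz_densely iota)
 (hop : op_continuous iota rho delta)
 (D : set E) (A : E -> E) (hA : closed_extension iota a D A)
 (h1 : sector theta `<=` resolvent_set D A)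
 (h2 : exists K : R, forall l, sector theta l ->
  opnorm (fun u => (japC l)%:C *: resolvent D A l u) <= K) :
 exists M : R, forall f, Hdecay theta f -> forall fb, boundary_values theta f fb ->
  exists2 T : E -> E, is_functional_calculus theta D A fb T &
  bounded_op T /\ opnorm T <= M * supnorm theta f.
have [M M0 hM] := smp_sum_bd htheta hm hdelta hdr hrho ha hypo hE hop hA h1 h2.
have [K K0 hK] := rslv_bd h1 h2.
have lipR := rslv_lipschitz h1 K0 hK.
exists M => f [[hf [Bf hBf]] [c [d [c0 d0 hdec]]]] fb hfb.
have /andP[th0 thpi] := htheta.
pose B := supnorm theta f.
have hB z : ~ sector theta z -> rnorm (f z) <= B.
 move=> hz; apply: sup_ubound; last by exists z.
 by exists Bf => _ [w hw <-]; exact: hBf.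
have z1 : ~ sector theta (ray 0 1) by apply: ray_out; rewrite ?normr0.
have B0 : 0 <= B := le_trans (rn_ge0 _) (hB _ z1).
pose om := step_angle theta; pose h := step_size theta; pose N := step_count theta.
have hom j : 0 < om j < theta by have [] := step_angle_bd htheta j.
have h01 j : 0 < h j <= 1 by have [p q _] := step_size_bd htheta j; rewrite p q.
have h0 j : 0 < h j by have /andP[] := h01 j.
(* [1 / (t^d + t^-d) <= 2^d (1 + t)^-d], the form of decay that [ray_integral] takes. *)
pose c' := c * 2 `^ d; have c'0 : 0 <= c' by rewrite mulr_ge0 // ltW.
have dec b j t : 0 < t -> rnorm (f (ray (sd b * (theta - om j)) t)) <= c' * (1 + t) `^ (- d).
 move=> t0; have /andP[w0' w1'] := hom j.
 have hz : ~ sector theta (ray (sd b * (theta - om j)) t).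
  by apply: ray_out => //; rewrite normr_side ger0_norm; lra.
 letr (hdec _ hz); rewrite rn_ray ?(ltW t0) // /c' -mulrA ler_pM2l //.
 have t1 : 0 < 1 + t by rewrite ltr_pwDl // ltW.
 have p0 : 0 < t `^ d + t `^ (- d) by rewrite addr_gt0 // powR_gt0.
 rewrite [(1 + t) `^ (- d)]powRN ler_pdivlMr ?powR_gt0 // ler_pdivrMl // [leRHS]mulrC.
 have [t1'|/ltW t1'] := leP 1 t.
  apply: le_trans (_ : 2 `^ d * t `^ d <= _); last by rewrite ler_pM2l ?powR_gt0 // lerDl powR_ge0.
  rewrite -powRM ?(ltW t0) //; apply: ge0_ler_powR; rewrite ?nnegrE ?(ltW d0) ?(ltW t1) //; last lra.
  by rewrite mulr_ge0 // ltW.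
 apply: le_trans (_ : 2 `^ d * 1 <= _).
  by rewrite mulr1; apply: ge0_ler_powR; rewrite ?nnegrE ?(ltW d0) ?(ltW t1) //; lra.
 rewrite ler_pM2l ?powR_gt0 //; apply: le_trans (_ : t `^ (- d) <= _); last by rewrite lerDr powR_ge0.
 rewrite powRN -[leLHS]invr1 lef_pV2 ?posrE ?powR_gt0 //.
 have e1d : 1 `^ d = 1 :> R by rewrite powR1.
 by rewrite -[leRHS]e1d; apply: ge0_ler_powR; rewrite ?nnegrE ?(ltW d0) ?(ltW t0).
(* The samples for step [j], drawn from the rays of argument [theta - om j] and its negative, inside
   the domain of [f]. *)
have /choice[v hv] : forall j, exists v : bool -> nat -> R[i],
 (forall b i c e, (0 < i < N j)%N ->
  (forall t, i%:R * h j <= t <= i.+1%:R * h j -> rnorm (f (ray (sd b * (theta - om j)) t) - c) <= e) ->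
  rnorm (v b i - c) <= 2 * (e + rnorm c / i%:R)) /\
 (forall i0 i1, (0 < i0)%N -> (i0 <= i1)%N -> (i1 <= N j)%N ->
  rnorm (dsum v i0 i1) <= 8 * theta * B).
 by move=> j; exact: (@step_values R theta f htheta hf B (om j) (h j) (N j) hB (hom j) (h0 j)).
have cell0 j i : (0 < i)%N -> 0 < i%:R * h j by move=> i0; rewrite mulr_gt0 // ltr0n.
(* The approximation property with [c = 0] and [e = B]. *)
have vB j b i : (0 < i < N j)%N -> rnorm (v j b i) <= 2 * B.
 move=> hi; have /andP[i0 _] := hi; have [H _] := hv j; have := H b i 0 B hi; rewrite rn0 mul0r addr0 !subr0; apply.
 move=> t /andP[t1 _]; rewrite subr0; apply: hB; apply: ray_out => //.
  exact: lt_le_trans (cell0 j i i0) t1.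
 by have /andP[? ?] := hom j; rewrite normr_side ger0_norm; lra.
have vd j b i : (0 < i < N j)%N -> rnorm (v j b i) <= 2 * c' * (1 + i%:R * h j) `^ (- d).
 move=> hi; have /andP[i0 _] := hi; have [H _] := hv j.
 have := H b i 0 (c' * (1 + i%:R * h j) `^ (- d)) hi; rewrite rn0 mul0r addr0 !subr0 mulrA; apply.
 move=> t /andP[t1 _]; rewrite subr0; have t0 := lt_le_trans (cell0 j i i0) t1.
 letr (dec b j t t0); monol; rewrite !powRN lef_pV2 ?posrE ?powR_gt0 ?addr_gt0 //; last exact: cell0.
 apply: ge0_ler_powR; rewrite ?nnegrE ?addr_ge0 ?(ltW d0) ?(ltW t0) //; last by rewrite lerD2l.
 by rewrite ltW // cell0.
(* Only [f] is moved inside; the resolvents are taken on the contour itself, where they are under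
   control. *)
pose Rs b t := resolvent D A (ray (sd b * theta) t).
have sec b t : 0 <= t -> sector theta (ray (sd b * theta) t) by exact: sector_ray.
have bRs b t : 0 <= t -> bounded_op (Rs b t) by move=> t0; exact: bdd_rslv h1 _ (sec b t t0).
have hRs b t u : 0 <= t -> rnorm (Rs b t u) <= K / (1 + t) * rnorm u.
 by move=> t0; have := hK _ u (sec b t t0); rewrite rn_ray.
have lRs b t t' u : 0 <= t -> 0 <= t' -> rnorm (Rs b t u - Rs b t' u) <= K ^+ 2 * `|t - t'| * rnorm u.
 move=> t0 t0'; letr (lipR _ _ u (sec b t t0) (sec b t' t0')).
 by rewrite /ray -mulrBl -rmorphB rnM rne mulr1 rnr.
have bv b : [/\ measurable_fun (@halfline R) (fun r => Re (fb (ray (sd b * theta) r))),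
  measurable_fun (@halfline R) (fun r => Im (fb (ray (sd b * theta) r))) &
  {ae (@lebesgue_measure R), forall r, 0 < r -> forall kappa,
  f @ within (stolz theta kappa (ray (sd b * theta) r)) (nbhs (ray (sd b * theta) r))
  --> fb (ray (sd b * theta) r)}].
 by apply: hfb; rewrite /side; case: b; [left; rewrite mul1r|right; rewrite mulN1r].
(* The exponential is the derivative of the parametrization of the ray by its radius. *)
pose g b t : R[i] := fb (ray (sd b * theta) t) * expi (sd b * theta).
have e1 b : rnorm (expi (sd b * theta) : R[i]) = 1 by exact: rne.
have ray_int b : exists I : E -> E, is_bochner_integral (@halfline R) (fun t u => g b t *: Rs b t u) I /\
  opnorm (fun u => I u - \sum_(i <- index_iota 1 (N j)) (h j)%:C *: ((v j b i * expi (sd b * theta)) *: Rs b (i%:R * h j) u)) @[j --> \oo] --> (0 : R).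
 have [mre mim hae] := bv b.
 apply: (@ray_integral R E K d (2 * c') K0 d0 _ (Rs b) (g b) (bRs b) (hRs b) (lRs b) _ _ h N (fun j i => v j b i * expi (sd b * theta)) h01).
 - by rewrite mulr_ge0.
 - rewrite (_ : (fun t => Re (g b t)) = (fun t => Re (fb (ray (sd b * theta) t)) * cos (sd b * theta)
  - Im (fb (ray (sd b * theta) t)) * sin (sd b * theta))); last first.
  by ext t; rewrite /g /expi; case: (fb _).
  by apply: measurable_funB; apply: measurable_funM.
 - rewrite (_ : (fun t => Im (g b t)) = (fun t => Re (fb (ray (sd b * theta) t)) * sin (sd b * theta)
  + Im (fb (ray (sd b * theta) t)) * cos (sd b * theta))); last first.
  by ext t; rewrite /g /expi; case: (fb _).
  by apply: measurable_funD; apply: measurable_funM.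
 - exact: step_small.
 - exact: step_count_large.
 - by move=> j i hi; rewrite rnM e1 mulr1; exact: vd.
 apply: (@filterS _ _ (ae_filter_ringOfSetsType (@lebesgue_measure R)) _ _ _ hae) => t Ht t0.
 set w := fb (ray (sd b * theta) t) in Ht.
 have lim (e : R) (e0 : 0 < e) := stolz_limit htheta t0 e0 (Ht t0).
 have t1 : 0 <= (1 + t) `^ (- d) by [].
 split.
  (* A boundary value inherits the decay as a limit of values on the turned rays. *)
  rewrite /g rnM e1 mulr1 -/w; apply: le_trans (_ : c' * (1 + t) `^ (- d) <= _); last first.
  by monor; rewrite ler_peMl // ler1n.
  apply/ler_addgt0Pr => e e0; have [dl dl0 hl] := lim e e0.
  have [J hJ] := step_small htheta dl0; have [_ op2 _] := step_angle_bd htheta J.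
  have hw := hl (om J) t (hom J) op2 (hJ J (leqnn J)).
  rewrite subrr normr0 in hw; have {}hw := hw (ltW (h0 J)).
  rewrite -[w](subrK (f (ray (sd b * (theta - om J)) t))) addrC.
  by letr (rnD _ _); apply: lerD; [exact: dec|rewrite rnB].
 move=> e e0; have e4 : 0 < e / 4 by rewrite divr_gt0.
 have [dl dl0 hl] := lim _ e4; have [J1 hJ1] := step_small htheta dl0.
 have q0 : 0 < 4 * rnorm w / e + 2 by rewrite ltr_wpDl // divr_ge0 ?mulr_ge0 // ltW.
 (* A step small compared with [t <= (i + 1) h] forces [i] to be large, which makes the error term
    [rnorm w / i] small. *)
 have [J2 hJ2] := step_small htheta (divr_gt0 t0 q0).
 exists (maxn J1 J2) => j i; rewrite geq_max => /andP[j1 j2] hi /andP[it ti].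
 have /andP[i0 _] := hi; have i0' : 0 < i%:R :> R by rewrite ltr0n.
 have [_ op2 _] := step_angle_bd htheta j.
 rewrite /g -mulrBl rnM e1 mulr1 -/w; have [H _] := hv j.
 letr (H b i w (e / 4) hi _).
  move=> t' /andP[t1' t2']; apply: (hl (om j) t' (hom j) op2 (hJ1 j j1)).
  rewrite -[sin (om j)]/(h j); move: ti t2'; rewrite -natr1 mulrDl mul1r => ti t2'.
  by rewrite ler_norml; apply/andP; split; lra.
 have wi : rnorm w / i%:R <= e / 4.
  have : 4 * rnorm w / e + 2 < i%:R + 1.
  have := hJ2 j j2; rewrite ltr_pdivlMr // -/(h j) => hq.
  by rewrite natr1 -(ltr_pM2l (h0 j)) (lt_le_trans hq) // mulrC.
  move=> hi'; have : 4 * rnorm w / e <= i%:R by lra.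
  by rewrite ler_pdivrMr // ler_pdivrMr // => hh; lra.
 by lra.
have [Ip [bIp cIp]] := ray_int true; have [Iq [bIm cIm]] := ray_int false.
have [linp _ _] := bIp; have [linm _ _] := bIm.
pose T u := ('i / (2 * pi)%:C) *: (Iq u - Ip u).
have bT : bounded_op T by apply: bopZ; exact: bopB.
exists T.
 have st : side R true * theta = theta by rewrite /side mul1r.
 have sf : side R false * theta = - theta by rewrite /side mulN1r.
 exists Ip, Iq; split; [|rewrite /g /Rs sf in bIm; exact: bIm|reflexivity].
 by rewrite /g /Rs st in bIp; exact: bIp.
split; first exact: bT.
apply: opnorm_le; first by rewrite mulr_ge0.
move=> u; apply/ler_addgt0Pr => e e0.
have u1 : 0 < 2 * (rnorm u + 1) by rewrite mulr_gt0 // ltr_wpDl.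
have e2 : 0 < e / (2 * (rnorm u + 1)) by rewrite divr_gt0.
have /cvgrPdist_le/(_ _ e2) hp := cIp; have /cvgrPdist_le/(_ _ e2) hm' := cIm.
(* One index has to serve both rays, since [hM] bounds the difference of their sums. *)
have [j [jp jm]] : exists j, `|0 - opnorm (fun u => Ip u - \sum_(i <- index_iota 1 (N j)) (h j)%:C *: ((v j true i * expi (side R true * theta)) *: Rs true (i%:R * h j) u))| <= e / (2 * (rnorm u + 1)) /\
  `|0 - opnorm (fun u => Iq u - \sum_(i <- index_iota 1 (N j)) (h j)%:C *: ((v j false i * expi (side R false * theta)) *: Rs false (i%:R * h j) u))| <= e / (2 * (rnorm u + 1)).
 have [j hj] := filter_ex (filterI hp hm'); by exists j.
pose S b u := \sum_(1 <= i < N j) fcoef theta (h j) (v j) b i *: resolvent D A (ray (sd b * theta) (i%:R * h j)) u.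
have SE b w : \sum_(i <- index_iota 1 (N j)) (h j)%:C *: ((v j b i * expi (sd b * theta)) *: Rs b (i%:R * h j) w) = S b w.
 by apply: eq_bigr => i _; rewrite scalerA.
have bS b : bounded_op (S b).
 apply: bop_sum => i; apply: bopZ; apply: (bRs b); rewrite mulr_ge0 //; exact: ltW.
have cp : opnorm (fun u => Ip u - S true u) <= e / (2 * (rnorm u + 1)).
 move: jp; rewrite sub0r normrN; under eq_fun do rewrite SE.
 by rewrite ger0_norm // opnorm_ge0 //; exact: bopB.
have cm : opnorm (fun u => Iq u - S false u) <= e / (2 * (rnorm u + 1)).
 move: jm; rewrite sub0r normrN; under eq_fun do rewrite SE.
 by rewrite ger0_norm // opnorm_ge0 //; exact: bopB.
have h3 := hM (h j) B (v j) (N j) (h01 j) B0 (vB j) (hv j).2 u.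
rewrite -/(S true u) -/(S false u) in h3.
have h4 := opnorm_ge u (bopB linp (bS true)); have h5 := opnorm_ge u (bopB linm (bS false)).
have h6 : rnorm (Iq u - Ip u) <= M * B * rnorm u + e.
 have -> : Iq u - Ip u = ((Iq u - S false u) - (Ip u - S true u)) - (S true u - S false u).
  by rewrite [X in _ = X - _]sub_subACA -[in RHS](opprB (S true u)) opprK addrK.
 letr (rnD _ _); rewrite rnN addrC; apply: lerD; first exact: h3.
 letr (rnD _ _); rewrite rnN.
 letr (lerD (le_trans h5 (ler_wpM2r (rn_ge0 u) cm)) (le_trans h4 (ler_wpM2r (rn_ge0 u) cp))).
 have -> : e / (2 * (rnorm u + 1)) * rnorm u + e / (2 * (rnorm u + 1)) * rnorm u = e * (rnorm u / (rnorm u + 1)).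
  by field; rewrite gt_eqF // ltr_wpDl ?rn_ge0.
 by rewrite ler_piMr ?(ltW e0) // ler_pdivrMr ?mul1r ?lerDl // ltr_wpDl.
(* The factor [i / (2 pi)] has modulus at most 1, so the constant of the Riemann sums is kept. *)
rewrite /T rnZ; apply: le_trans h6; rewrite ler_piMl //.
rewrite rnM rni mul1r rnV rnr ger0_norm ?invf_le1 ?mulr_ge0 ?pi_ge0 //; last by rewrite mulr_gt0 // pi_gt0.
by have := pi_ge2 R; lra.
Qed.
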